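(* Let $H$ be a generalised Hénon map, let $c>0$ and let $f$ be a holomorphic automorphism of $\Omega_c$. Then there exists an affine map $L\in{\rm Aut}(\mathbb{C}^2)$ such that $L(K^+)=K^+$, $L(K^-)=K^-$ and $L(z)=f(z)$ for all $z\in\Omega_c$.
   Context: A generalised Hénon map is $H=H_m\circ\cdots\circ H_1$, $m\ge1$, with $H_i(x,y)=(y,p_i(y)-a_ix)$, $p_i$ a complex polynomial in one variable of degree $d_i\ge2$ and $a_i\ne0$. Put $d=d_m\cdots d_1$. $K^{\pm}=\{z\in\mathbb{C}^2:(H^{\pm n}(z))_{n\ge0}\text{ is bounded}\}$, $G_H^+(z)=\lim_{n\to\infty}d^{-n}\log^+\|H^n(z)\|$, and $\Omega_c=\{z\in\mathbb{C}^2:G_H^+(z)<c\}$. ${\rm Aut}(\mathbb{C}^2)$ is the group of holomorphic automorphisms of $\mathbb{C}^2$. *)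

(* Defs.v *)
From HB Require Import structures.
From mathcomp Require Import all_boot all_order all_algebra.
From mathcomp Require Import complex.
From mathcomp Require Import all_classical all_reals all_analysis.

Set Implicit Arguments.
Unset Strict Implicit.
Unset Printing Implicit Defensive.

Import Order.TTheory GRing.Theory Num.Theory.
Import numFieldNormedType.Exports.

Local Open Scope ring_scope.
Local Open Scope classical_set_scope.
Local Open Scope complex_scope.

(* The alias [^o] selects the structure of R[i] over itself (not over R), so
   that [differentiable] and [{linear _ -> _}] on C2 are complex notions. *)
Definition C2 (R : realType) : normedModType R[i] := (R[i]^o * R[i]^o)%type.

Definition norm2 (R : realType) (z : C2 R) : R :=
  Num.sqrt (ComplexField.Normc.normc z.1 ^+ 2
            + ComplexField.Normc.normc z.2 ^+ 2).

Definition logp (R : realType) (x : R) : R := Num.max 0 (ln x).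

Section Henon.
Variable R : realType.

(* The pair (p, a) encodes the map (x, y) |-> (y, p(y) - a x). *)
Definition henon_data := ({poly R[i]} * R[i])%type.

Implicit Types (h : henon_data) (hs : seq henon_data) (z : C2 R).

Definition henon_degree h : nat := (size h.1).-1.

Definition is_henon h : bool := (2 <= henon_degree h)%N && (h.2 != 0).

Definition henon h z : C2 R := (z.2, h.1.[z.2] - h.2 * z.1).

Definition henon_inv h z : C2 R := ((h.1.[z.1] - z.2) / h.2, z.1).

(* [:: h_1; ...; h_m] encodes H_m \o ... \o H_1. *)
Definition is_gen_henon hs : bool := (0 < size hs)%N && all is_henon hs.

Definition gen_henon hs z : C2 R := foldl (fun w h => henon h w) z hs.

Definition gen_henon_inv hs z : C2 R := foldr henon_inv z hs.

Definition gen_degree hs : nat := \prod_(h <- hs) henon_degree h.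

Lemma henonK h : h.2 != 0 -> cancel (henon h) (henon_inv h).
Proof. by move=> a0 [x y]; rewrite /henon_inv /henon /= subKr mulrC mulKf. Qed.

Lemma henon_invK h : h.2 != 0 -> cancel (henon_inv h) (henon h).
Proof.
by move=> a0 [x y]; rewrite /henon_inv /henon /= mulrC divfK // subKr.
Qed.

Lemma gen_henonK hs :
  is_gen_henon hs -> cancel (gen_henon hs) (gen_henon_inv hs).
Proof.
case/andP=> _; rewrite /gen_henon /gen_henon_inv.
elim: hs => [|h hs IH] //= /andP[/andP[_ a0] /IH K] z.
by rewrite K henonK.
Qed.

Lemma gen_henon_invK hs :
  is_gen_henon hs -> cancel (gen_henon_inv hs) (gen_henon hs).
Proof.
case/andP=> _; rewrite /gen_henon /gen_henon_inv.
elim: hs => [|h hs IH] //= /andP[/andP[_ a0] /IH K] z.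
by rewrite henon_invK.
Qed.

Definition Kplus hs : set (C2 R) :=
  [set z | bounded_fun (fun n : nat => iter n (gen_henon hs) z)].

Definition Kminus hs : set (C2 R) :=
  [set z | bounded_fun (fun n : nat => iter n (gen_henon_inv hs) z)].

Definition green_plus hs z : R :=
  lim ((fun n : nat => (gen_degree hs)%:R ^- n
          * logp (norm2 (iter n (gen_henon hs) z))) @ \oo).

Definition Omega hs (c : R) : set (C2 R) := [set z | green_plus hs z < c].

(* Complex Frechet differentiability at each point of U.  Differentiability is
   taken in C2, so this is a notion about the restriction of f to U only when
   U is open, as are Omega hs c and C2. *)
Definition holomorphic_on (U : set (C2 R)) (f : C2 R -> C2 R) : Prop :=
  forall z, U z -> differentiable f z.

Definition holomorphic_aut (U : set (C2 R)) (f : C2 R -> C2 R) : Prop :=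
  [/\ holomorphic_on U f, set_fun U U f &
    exists g : C2 R -> C2 R,
      [/\ holomorphic_on U g, set_fun U U g,
          {in U, cancel f g} & {in U, cancel g f}]].

Definition affine_map (L : C2 R -> C2 R) : Prop :=
  exists (A : {linear C2 R -> C2 R}) (b : C2 R), forall z, L z = A z + b.

End Henon.

(* Main.v *)
(* Write S_n for the n-th iterate (of a sequence of Henon maps), D_n for its
   degree and G for the Green function.  First, f preserves G.  For p in K+ the
   three circles theorem on complex lines through S_n(p), pulled back by S_n,
   gives G(f z) <= G(f p) + G(z); if G were a constant b > 0 on f(K+), Harnack's
   inequality would make G o f constant near K+, which is impossible.
   Next, {G > 0} is foliated by the leaves {w : S_n w - S_n z bounded}.  Each leaf
   is an entire curve, parametrised by the limit of the normalised displacements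
   of the second coordinate, and f maps leaves to leaves, hence acts on them by
   affine maps of C, with slopes bounded on compact sets.  Every point of the
   distinguished boundary of the polydisc of radius rho_n = exp(D_n c'), seen
   through S_n^-1, lies on the leaf of a point of a fixed compact set; therefore
   F_n = S_n o f o S_n^-1 is O(rho_n) on this polydisc, and by interpolation it is
   affine up to O(1 / rho_n) on bounded sets.
   Comparing coefficients in F_{n+1} o h_n = h_n o F_n shows that for an even
   period q the affine parts of F_{n+q} and F_n differ by O(1 / rho_{n-2}).  This
   error is so small that it can be pulled back by S_n near K+: the maps F_q and f
   agree near K+, hence on {G < c}.  Iterating, f is the restriction of the affine
   map F_{qk}, which commutes with S_q and therefore preserves K+ and K-. *)
Require Import Defs.
From HB Require Import structures.
From mathcomp Require Import all_boot all_order all_algebra.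
From mathcomp Require Import complex.
From mathcomp Require Import all_classical all_reals all_analysis.
From mathcomp Require Import lra ring zify.
Set Implicit Arguments.
Unset Strict Implicit.
Unset Printing Implicit Defensive.
Import Order.TTheory GRing.Theory Num.Theory.
Import numFieldNormedType.Exports.
Local Open Scope ring_scope.
Local Notation Re := complex.Re.
Local Notation Im := complex.Im.

(** * Complex analysis in one variable *)

(** All constants depend only on the bound [K] of [tame]. This is why single Hénon maps are iterated
    as a sequence: its shifts obey the same bounds. The affine estimates need c above a threshold
    depending on K. Conjugating f by an iterate S_n replaces {G < c} by {G < D_n c}, which meets the
    threshold, and commutation undoes this at the end. A recurring principle: D_n grows
    exponentially while most losses are O(n), so an estimate at time n, divided by D_n, becomes an
    exact statement about G ([le_of_Deg]). The leaf coordinate rests on one asymptotic identity. Let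
    x and e be the displacements of the two coordinates. On a leaf the next e is negligible, so a x
    is nearly p'(y) e; as the next y is nearly the leading term of p(y), the product x y is carried
    to the next step up to the factor d / a. The coefficient of y in F_{n+2} is tied to that of x in
    F_{n+1}, and this one to that of y in F_n: hence the even period. Finally O(1 / rho_n) survives
    the pull-back because orbits close to K+ grow at most like exp(eta D_n), with eta as small as
    desired. *)

Section ComplexModulus.
Variable R : realType.
Local Notation C := R[i].
Implicit Types (x y z w : C) (e r : R).

Definition nm z : R := ComplexField.Normc.normc z.

Lemma nmM x y : nm (x * y) = nm x * nm y.
Proof. exact: ComplexField.Normc.normcM. Qed.

Lemma nmV x : nm x^-1 = (nm x)^-1.
Proof. exact: ComplexField.Normc.normcV. Qed.

Lemma nm0 : nm 0 = 0. Proof. exact: ComplexField.Normc.normc0. Qed.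

Lemma nm1 : nm 1 = 1. Proof. exact: ComplexField.Normc.normc1. Qed.

Lemma nmN x : nm (- x) = nm x.
Proof. exact: normcN. Qed.

Lemma nmD x y : nm (x + y) <= nm x + nm y.
Proof. exact: le_normcD. Qed.

Lemma nmB x y : nm (x - y) <= nm x + nm y.
Proof. by rewrite -(nmN y); exact: nmD. Qed.

Lemma nm_distC x y : nm (x - y) = nm (y - x).
Proof. by rewrite -nmN opprB. Qed.

Lemma nm_ge0 x : 0 <= nm x.
Proof. by case: x => a b; exact: sqrtr_ge0. Qed.

Lemma nm_eq0 x : (nm x == 0) = (x == 0).
Proof.
apply/eqP/eqP => [|->]; last exact: nm0.
exact: ComplexField.Normc.eq0_normc.
Qed.

Lemma nm_gt0 x : (0 < nm x) = (x != 0).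
Proof. by rewrite lt_def nm_ge0 andbT nm_eq0. Qed.

Lemma nm_neq0 x : 0 < nm x -> x != 0.
Proof. by rewrite nm_gt0. Qed.

Lemma nm_le0 x : nm x <= 0 -> x = 0.
Proof. by move=> h; apply/eqP; rewrite -nm_eq0 eq_le h nm_ge0. Qed.

Lemma nmX x n : nm (x ^+ n) = nm x ^+ n.
Proof. by elim: n => [|n IH]; rewrite ?expr0 ?nm1 // !exprS nmM IH. Qed.

Lemma nmf_div x y : nm (x / y) = nm x / nm y.
Proof. by rewrite nmM nmV. Qed.

Lemma nm_real (a : R) : nm a%:C%C = `|a|.
Proof. by rewrite /nm /= expr0n /= addr0 sqrtr_sqr. Qed.

Lemma nm_nat n : nm n%:R = n%:R.
Proof. by rewrite -(rmorph_nat (real_complex R)) nm_real ger0_norm ?ler0n. Qed.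

Lemma nm_sub_ge x y : nm x - nm y <= nm (x - y).
Proof. by have := nmD (x - y) y; rewrite subrK; lra. Qed.

Lemma nm_tri x y z : nm (x - z) <= nm (x - y) + nm (y - z).
Proof. by have := nmD (x - y) (y - z); rewrite addrA subrK. Qed.

Lemma nm_Re x : `|Re x| <= nm x.
Proof.
case: x => a b; rewrite /nm /= -sqrtr_sqr ler_wsqrtr //.
by rewrite lerDl sqr_ge0.
Qed.

Lemma nm_Im x : `|Im x| <= nm x.
Proof.
case: x => a b; rewrite /nm /= -sqrtr_sqr ler_wsqrtr //.
by rewrite lerDr sqr_ge0.
Qed.

Lemma Re_le_nm x : Re x <= nm x.
Proof. exact: le_trans (ler_norm _) (nm_Re x). Qed.

Lemma nm_le_ReIm x : nm x <= `|Re x| + `|Im x|.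
Proof.
rewrite {1}[x]complexE; apply: le_trans (nmD _ _) _.
rewrite nmM !nm_real lerD2l -[leRHS]mul1r ler_wpM2r //.
by rewrite /nm /= expr0n /= add0r expr1n sqrtr1.
Qed.

Lemma ReD x y : Re (x + y) = Re x + Re y. Proof. by case: x; case: y. Qed.
Lemma ImD x y : Im (x + y) = Im x + Im y. Proof. by case: x; case: y. Qed.
Lemma ReN x : Re (- x) = - Re x. Proof. by case: x. Qed.
Lemma ImN x : Im (- x) = - Im x. Proof. by case: x. Qed.
Lemma ReB x y : Re (x - y) = Re x - Re y. Proof. by rewrite ReD ReN. Qed.
Lemma ImB x y : Im (x - y) = Im x - Im y. Proof. by rewrite ImD ImN. Qed.

End ComplexModulus.
Arguments nm : simpl never.

(** * Bisection of intervals and rectangles *)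

Section Bisection.
Variable R : realType.
Implicit Types (a b c d : R).

Lemma half_pow_small (x e : R) : 0 < e -> exists k : nat, x / 2 ^+ k < e.
Proof.
move=> e0; have [n hn] : exists n : nat, x / e < n%:R.
  by exists (Num.bound `|x / e|); exact: le_lt_trans (ler_norm _) (archi_boundP (normr_ge0 _)).
exists n; rewrite ltr_pdivrMr ?exprn_gt0 //.
move: hn; rewrite ltr_pdivrMr // => hn; apply: lt_le_trans hn _.
rewrite mulrC ler_wpM2l ?(ltW e0) // -natrX ler_nat.
exact: ltnW (ltn_expl _ _).
Qed.

(** Common engine of compactness, of the mean value inequality and of Goursat's lemma: a property of
    [a,b] x [c,d] that always passes to some quarter concentrates at a point. The exact widths are
    recorded because the applications compare the property with powers of the width. A degenerate
    second interval gives the one-dimensional version. *)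
Lemma bisection (P : R -> R -> R -> R -> Prop) a b c d :
  a <= b -> c <= d -> P a b c d ->
  (forall a b c d, P a b c d ->
     [\/ P a ((a + b) / 2) c ((c + d) / 2),
         P a ((a + b) / 2) ((c + d) / 2) d,
         P ((a + b) / 2) b c ((c + d) / 2)
       | P ((a + b) / 2) b ((c + d) / 2) d]) ->
  exists x y, forall k, exists a' b' c' d',
    [/\ [/\ a <= a', a' <= x, x <= b' & b' <= b],
        [/\ c <= c', c' <= y, y <= d' & d' <= d],
        b' - a' = (b - a) / 2 ^+ k, d' - c' = (d - c) / 2 ^+ k
      & P a' b' c' d'].
Proof.
move=> ab cd P0 Psplit.
pose box := {q : R * R * R * R | P q.1.1.1 q.1.1.2 q.1.2 q.2}.
pose half (u v : R) (s : bool) := if s then ((u + v) / 2, v) else (u, (u + v) / 2).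
have step (q : box) : {q' : box | exists s t,
    ((sval q').1.1 = half (sval q).1.1.1 (sval q).1.1.2 s) /\
    (((sval q').1.2, (sval q').2) = half (sval q).1.2 (sval q).2 t)}.
  apply: cid; case: q => [[[[u v] z] w]] /= Pq.
  by have [Pk|Pk|Pk|Pk] := Psplit _ _ _ _ Pq;
    [exists (exist _ (_, _, _, _) Pk); exists false, false
    |exists (exist _ (_, _, _, _) Pk); exists false, true
    |exists (exist _ (_, _, _, _) Pk); exists true, false
    |exists (exist _ (_, _, _, _) Pk); exists true, true].
pose q0 : box := exist _ (a, b, c, d) P0.
pose s := fix s n := if n is n'.+1 then sval (step (s n')) else q0.
pose A n := (sval (s n)).1.1.1; pose B n := (sval (s n)).1.1.2.
pose Cc n := (sval (s n)).1.2; pose D n := (sval (s n)).2.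
have stepA n : A n.+1 = A n /\ B n.+1 = (A n + B n) / 2 \/
               A n.+1 = (A n + B n) / 2 /\ B n.+1 = B n.
  have [s1 [s2 [e1 _]]] := svalP (step (s n)).
  by rewrite /A /B /= e1; case: s1 {e1}; [right|left].
have stepC n : Cc n.+1 = Cc n /\ D n.+1 = (Cc n + D n) / 2 \/
               Cc n.+1 = (Cc n + D n) / 2 /\ D n.+1 = D n.
  have [s1 [s2 [_ e2]]] := svalP (step (s n)).
  by rewrite /Cc /D /=; move: e2; rewrite /half; case: s2; case=> -> ->; [right|left].
have nested (U V : nat -> R) : U 0%N <= V 0%N ->
    (forall n, U n.+1 = U n /\ V n.+1 = (U n + V n) / 2 \/
               U n.+1 = (U n + V n) / 2 /\ V n.+1 = V n) ->
    (forall n, V n - U n = (V 0%N - U 0%N) / 2 ^+ n) /\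
    exists x, forall n, [/\ U 0%N <= U n, U n <= x, x <= V n & V n <= V 0%N].
  move=> UV0 st.
  have wid n : V n - U n = (V 0%N - U 0%N) / 2 ^+ n.
    elim: n => [|n IH]; first by rewrite expr0 divr1.
    rewrite exprS invfM mulrA -[_ / 2 / _]mulrAC -IH.
    by case: (st n) => -[-> ->]; lra.
  split=> //.
  have UV n : U n <= V n.
    by rewrite -subr_ge0 wid divr_ge0 ?subr_ge0 ?exprn_ge0.
  have mono n k : U n <= U (n + k)%N /\ V (n + k)%N <= V n.
    elim: k => [|k [IH1 IH2]]; first by rewrite addn0.
    by rewrite addnS; have := UV (n + k)%N; case: (st (n + k)%N) => -[-> ->]; lra.
  pose E := [set U n | n in [set: nat]]%classic.
  have Ub n : ubound E (V n).
    move=> _ [k _ <-]; have [h1 _] := mono k n; have [_ h2] := mono n k.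
    have := UV (k + n)%N; rewrite (addnC k) in h1 *; lra.
  have E0 : (E !=set0)%classic by exists (U 0%N); exists 0%N.
  exists (sup E) => n; split.
  - by have [] := mono 0%N n; rewrite add0n.
  - by apply: (ub_le_sup (ex_intro _ _ (Ub 0%N))); exists n.
  - exact: ge_sup E0 (Ub n).
  - by have [] := mono 0%N n; rewrite add0n.
have [wA [x hx]] := nested A B ab stepA.
have [wC [y hy]] := nested Cc D cd stepC.
exists x, y => k; exists (A k), (B k), (Cc k), (D k); split => //.
exact: (svalP (s k)).
Qed.

End Bisection.

(** * Compactness of closed discs and extreme values *)

Section Compactness.
Variable R : realType.
Local Notation C := R[i].

(** Compactness without coverings: [Bad] is upward closed and prime, so a bad square has a bad
    quarter. The instances are the sets that a sequence visits infinitely often ([cluster_seq]) and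
    the sets that carry a supremum ([evt]). *)
Lemma compact_prime (Bad : (C -> Prop) -> Prop) (r : R) :
  (forall A B : C -> Prop, (forall z, A z -> B z) -> Bad A -> Bad B) ->
  (forall A B : C -> Prop, Bad (fun z => A z \/ B z) -> Bad A \/ Bad B) ->
  0 <= r -> Bad (fun z => nm z <= r) ->
  exists z, forall e, 0 < e -> Bad (fun w => nm (w - z) < e).
Proof.
move=> Bmono Bprime r0 Br.
pose box (a b c d : R) (z : C) := [/\ a <= Re z, Re z <= b, c <= Im z & Im z <= d].
have [||||x [y hxy]] := @bisection R (fun a b c d => Bad (box a b c d)) (- r) r (- r) r.
- lra.
- lra.
- apply: Bmono Br => z hz; have := nm_Re z; have := nm_Im z.
  by rewrite !ler_norml => /andP[h1 h2] /andP[h3 h4]; split; lra.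
- move=> a b c d Bq; set m := (a + b) / 2; set n := (c + d) / 2.
  have : Bad (fun z => ((box a m c n z \/ box a m n d z) \/
                       (box m b c n z \/ box m b n d z))).
    apply: Bmono Bq => z [h1 h2 h3 h4].
    case: (leP (Re z) m) => h5; case: (leP (Im z) n) => h6.
    + by left; left.
    + by left; right; split=> //; apply: ltW.
    + by right; left; split=> //; apply: ltW.
    + by right; right; split=> //; apply: ltW.
  by case/Bprime => /Bprime[]; [constructor 1|constructor 2|constructor 3|constructor 4].
exists (x +i* y)%C => e e0.
have e4 : 0 < e / 4 by lra.
have [k hk] := half_pow_small (r - - r) e4.
have [a [b [c [d [[_ h1 h2 _] [_ h3 h4 _] w1 w2 Bq]]]]] := hxy k.
apply: Bmono Bq => z [h5 h6 h7 h8].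
apply: le_lt_trans (nm_le_ReIm _) _; rewrite ReB ImB /=.
have hn : (`|Re z - x| <= e / 4)%R by rewrite ler_norml; lra.
have hm : (`|Im z - y| <= e / 4)%R by rewrite ler_norml; lra.
lra.
Qed.

Definition closed1 (K : C -> Prop) :=
  forall z, (forall e, 0 < e -> exists2 w, K w & nm (w - z) < e) -> K z.

Lemma cluster_seq (u : nat -> C) (r : R) : (forall n, nm (u n) <= r) ->
  exists z, forall e N, 0 < e -> exists2 n, (N <= n)%N & nm (u n - z) < e.
Proof.
move=> ur; have r0 : 0 <= r by apply: le_trans (ur 0%N); exact: nm_ge0.
have [||//||z hz] := @compact_prime
   (fun A => forall N, exists2 n, (N <= n)%N & A (u n)) r.
- by move=> A B AB hA N; have [n Nn /AB] := hA N; exists n.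
- move=> A B hAB; apply: contrapT => /not_orP [/existsNP[N1 h1] /existsNP[N2 h2]].
  have [n hn [An|Bn]] := hAB (maxn N1 N2).
  + by apply: h1; exists n => //; apply: leq_trans hn; exact: leq_maxl.
  + by apply: h2; exists n => //; apply: leq_trans hn; exact: leq_maxr.
- by move=> N; exists N.
by exists z => e N e0; exact: hz.
Qed.

Lemma evt (K : C -> Prop) (phi : C -> R) (r : R) z0 :
  closed1 K -> (forall z, K z -> nm z <= r) -> K z0 ->
  (forall z e, K z -> 0 < e -> exists2 d, 0 < d &
     forall w, K w -> nm (w - z) < d -> phi w <= phi z + e) ->
  exists2 z, K z & forall w, K w -> phi w <= phi z.
Proof.
move=> Kc Kr Kz0 usc.
have r0 : 0 <= r by apply: le_trans (Kr _ Kz0); exact: nm_ge0.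
(* A set is bad if every value of [phi] on K is dominated by a value on its intersection with K.
   Were neither A nor B bad, the two undominated values would be dominated from the opposite sets,
   and comparing these two dominating values gives a contradiction. *)
have [||//||z hz] := @compact_prime
   (fun A => forall w, K w -> exists2 v, K v /\ A v & phi w <= phi v) r.
- by move=> A B AB hA w /hA[v [Kv /AB Bv] h]; exists v.
- move=> A B hAB; apply: contrapT => /not_orP[/existsNP[w1 h1] /existsNP[w2 h2]].
  move/not_implyP: h1 => [Kw1 h1]; move/not_implyP: h2 => [Kw2 h2].
  have [v1 [Kv1 Av1] le1] := hAB _ Kw1; have [v2 [Kv2 Av2] le2] := hAB _ Kw2.
  case: Av1 => [Av1|Bv1]; first by apply: h1; exists v1.
  case: Av2 => [Av2|Bv2]; last by apply: h2; exists v2.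
  case: (leP (phi v1) (phi v2)) => hv.
    by apply: h1; exists v2 => //; exact: le_trans hv.
  by apply: h2; exists v1 => //; exact: le_trans (ltW hv).
- by move=> w Kw; exists w => //; split=> //; exact: Kr.
have Kz : K z by apply: Kc => e e0; have [v [Kv hv] _] := hz _ e0 _ Kz0; exists v.
exists z => // w Kw; apply/ler_addgt0Pr => e e0.
have [d d0 hd] := usc _ _ Kz e0; have [v [Kv hv] le] := hz _ d0 _ Kw.
exact: le_trans le (hd _ Kv hv).
Qed.

End Compactness.

(** * Complex differentiability: rules of calculus *)

Section ComplexCalculus.
Variable R : realType.
Local Notation C := R[i].
Implicit Types (g h : C -> C) (z w : C).

Definition ccont g z := forall e : R, 0 < e ->
  exists2 d : R, 0 < d & forall w, nm (w - z) < d -> nm (g w - g z) < e.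

(* Caratheodory's form of complex differentiability: [q z] is the derivative. *)
Definition cdif g z := exists2 q : C -> C, ccont q z &
  forall w, g w - g z = q w * (w - z).

Lemma ccont_near g h z r : 0 < r -> (forall w, nm (w - z) < r -> g w = h w) ->
  ccont g z -> ccont h z.
Proof.
move=> r0 gh cg e e0; have [d d0 hd] := cg e e0.
exists (Num.min r d); first by rewrite lt_min r0.
move=> w; rewrite lt_min => /andP[wr wd]; rewrite -(gh w wr) -gh ?hd //.
by rewrite subrr nm0.
Qed.

Lemma ccont_cst c z : ccont (fun=> c) z.
Proof. by move=> e e0; exists 1 => // w _; rewrite subrr nm0. Qed.

Lemma ccont_id z : ccont id z.
Proof. by move=> e e0; exists e. Qed.

Lemma ccontD g h z : ccont g z -> ccont h z -> ccont (fun w => g w + h w) z.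
Proof.
move=> cg ch e e0; have e2 : 0 < e / 2 by lra.
have [d d0 hd] := cg _ e2; have [d' d0' hd'] := ch _ e2.
exists (Num.min d d'); first by rewrite lt_min d0.
move=> w; rewrite lt_min => /andP[/hd h1 /hd' h2].
rewrite opprD addrACA; apply: le_lt_trans (nmD _ _) _; lra.
Qed.

Lemma ccontN g z : ccont g z -> ccont (fun w => - g w) z.
Proof.
move=> cg e e0; have [d d0 hd] := cg _ e0.
by exists d => // w /hd; rewrite -opprD nmN.
Qed.

Lemma ccontM g h z : ccont g z -> ccont h z -> ccont (fun w => g w * h w) z.
Proof.
move=> cg ch e e0.
have A0 := nm_ge0 (g z); have B0 := nm_ge0 (h z).
set A := nm (g z) in A0; set B := nm (h z) in B0.
pose e1 := Num.min 1 (e / (A + B + 1) / 2).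
have S0 : 0 < A + B + 1 by lra.
have e10 : 0 < e1 by rewrite lt_min ltr01 !divr_gt0.
have e1e : e1 * (A + B + 1) <= e / 2.
  rewrite -ler_pdivlMr // mulrAC; by rewrite ge_min lexx orbT.
have e11 : e1 <= 1 by rewrite ge_min lexx.
have [d d0 hd] := cg _ e10; have [d' d0' hd'] := ch _ e10.
exists (Num.min d d'); first by rewrite lt_min d0.
move=> w; rewrite lt_min => /andP[/hd h1 /hd' h2].
have -> : g w * h w - g z * h z =
  (g w - g z) * (h w - h z) + ((g w - g z) * h z + g z * (h w - h z)) by ring.
apply: le_lt_trans (nmD _ _) _; rewrite nmM.
have : nm ((g w - g z) * h z + g z * (h w - h z)) <= e1 * B + A * e1.
  apply: le_trans (nmD _ _) _; rewrite !nmM.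
  by apply: lerD; [apply: ler_wpM2r|apply: ler_wpM2l]; rewrite ?(ltW h1) ?(ltW h2).
have : nm (g w - g z) * nm (h w - h z) <= e1 * 1.
  apply: ler_pM; rewrite ?nm_ge0 ?(ltW h1) //.
  exact: le_trans (ltW h2) e11.
nra.
Qed.

Lemma ccont_comp g h z : ccont g z -> ccont h (g z) -> ccont (fun w => h (g w)) z.
Proof.
move=> cg ch e e0; have [d d0 hd] := ch _ e0; have [d' d0' hd'] := cg _ d0.
by exists d' => // w /hd' /hd.
Qed.

Lemma ccont_neq0 g z : ccont g z -> g z != 0 ->
  exists2 d : R, 0 < d & forall w, nm (w - z) < d -> nm (g z) / 2 < nm (g w).
Proof.
move=> cg; rewrite -nm_gt0 => gz; have e2 : 0 < nm (g z) / 2 by lra.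
have [d d0 hd] := cg _ e2; exists d => // w /hd.
rewrite nm_distC => h; have := nm_sub_ge (g z) (g w).
lra.
Qed.

Lemma ccontV g z : g z != 0 -> ccont g z -> ccont (fun w => (g w)^-1) z.
Proof.
move=> gz cg e e0; have [d d0 hd] := ccont_neq0 cg gz.
have g0 : 0 < nm (g z) by rewrite nm_gt0.
have e1 : 0 < e * nm (g z) ^+ 2 / 2 by rewrite divr_gt0 // mulr_gt0 // exprn_gt0.
have [d' d0' hd'] := cg _ e1.
exists (Num.min d d'); first by rewrite lt_min d0.
move=> w; rewrite lt_min => /andP[/hd h1 /hd' h2].
have gw : g w != 0 by rewrite -nm_gt0; lra.
have -> : (g w)^-1 - (g z)^-1 = (g z - g w) / (g w * g z).
  by field; rewrite gw gz.
rewrite nmf_div nmM nm_distC ltr_pdivrMr ?mulr_gt0 ?nm_gt0 //.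
apply: lt_trans h2 _; rewrite -mulrA ltr_pM2l // expr2 mulrAC ltr_pM2r //.
Qed.

(** The difference quotient, completed by [l] at z, is the factor of the definition. The factor form
    makes products and compositions algebraic; the epsilon form is the one that is visibly local. *)
Lemma cdifP g z : cdif g z <-> exists l, forall e : R, 0 < e ->
  exists2 d : R, 0 < d & forall w, nm (w - z) < d ->
    nm (g w - g z - l * (w - z)) <= e * nm (w - z).
Proof.
split=> [[q cq hq]|[l hl]].
  exists (q z) => e e0; have [d d0 hd] := cq e e0; exists d => // w /hd h.
  by rewrite hq -mulrBl nmM ler_wpM2r ?nm_ge0 // ltW.
pose q w := if w == z then l else (g w - g z) / (w - z).
exists q => [e e0|w]; last first.
  rewrite /q; case: eqP => [->|/eqP wz]; first by rewrite !subrr mulr0.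
  by rewrite divfK // subr_eq0.
have e2 : 0 < e / 2 by lra.
have [d d0 hd] := hl _ e2; exists d => // w /hd.
rewrite /q eqxx; case: (eqVneq w z) => [-> _|wz]; first by rewrite subrr nm0.
have wz0 : 0 < nm (w - z) by rewrite nm_gt0 subr_eq0.
have -> : (g w - g z) / (w - z) - l = (g w - g z - l * (w - z)) / (w - z).
  by rewrite [RHS]mulrBl mulfK // subr_eq0.
rewrite nmf_div ltr_pdivrMr // => h; apply: le_lt_trans h _; nra.
Qed.

Lemma cdif_ccont g z : cdif g z -> ccont g z.
Proof.
case=> q cq hq.
have h := ccontD (ccontM cq (ccontD (ccont_id z) (ccont_cst (- z) z))) (ccont_cst (g z) z).
by move=> e /h[d d0 hd]; exists d => // w /hd; rewrite -!hq !subrK.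
Qed.

Lemma cdif_near g h z r : 0 < r -> (forall w, nm (w - z) < r -> g w = h w) ->
  cdif g z -> cdif h z.
Proof.
move=> r0 gh /cdifP[l hl]; apply/cdifP; exists l => e /hl[d d0 hd].
exists (Num.min r d); first by rewrite lt_min r0.
move=> w; rewrite lt_min => /andP[wr wd]; rewrite -(gh w wr) -gh ?hd //.
by rewrite subrr nm0.
Qed.

Lemma cdif_cst c z : cdif (fun=> c) z.
Proof. by exists (fun=> 0) => [|w]; rewrite ?subrr ?mul0r //; apply: ccont_cst. Qed.

Lemma cdif_id z : cdif id z.
Proof. by exists (fun=> 1) => [|w]; rewrite ?mul1r //; apply: ccont_cst. Qed.

Lemma cdifD g h z : cdif g z -> cdif h z -> cdif (fun w => g w + h w) z.
Proof.
move=> [q cq hq] [q' cq' hq']; exists (fun w => q w + q' w); first exact: ccontD.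
by move=> w; rewrite mulrDl -hq -hq'; ring.
Qed.

Lemma cdifN g z : cdif g z -> cdif (fun w => - g w) z.
Proof.
move=> [q cq hq]; exists (fun w => - q w); first exact: ccontN.
by move=> w; rewrite mulNr -hq; ring.
Qed.

Lemma cdifB g h z : cdif g z -> cdif h z -> cdif (fun w => g w - h w) z.
Proof. by move=> hg hh; apply: cdifD => //; apply: cdifN. Qed.

Lemma cdifM g h z : cdif g z -> cdif h z -> cdif (fun w => g w * h w) z.
Proof.
move=> dg dh; have cg := cdif_ccont dg.
move: dg dh => [q cq hq] [q' cq' hq'].
exists (fun w => q w * h z + g w * q' w).
  by apply: ccontD; apply: ccontM => //; apply: ccont_cst.
move=> w; transitivity ((g w - g z) * h z + g w * (h w - h z)); first by ring.
by rewrite hq hq'; ring.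
Qed.

Lemma cdifV g z : g z != 0 -> cdif g z -> cdif (fun w => (g w)^-1) z.
Proof.
move=> gz dg; have cg := cdif_ccont dg.
have [d d0 hd] := ccont_neq0 cg gz; case: dg => q cq hq.
pose k w := if g w == 0 then (0 : C) else (g w)^-1.
have ck : ccont (fun w => (g w)^-1) z by apply: ccontV.
apply/cdifP; exists (- q z / (g z * g z)).
have cc : ccont (fun w => - q w * (g w)^-1 * (g z)^-1) z.
  apply: ccontM; last exact: ccont_cst.
  by apply: ccontM => //; apply: ccontN.
move=> e e0; have [d1 d10 hd1] := cc e e0.
exists (Num.min d d1); first by rewrite lt_min d0.
move=> w; rewrite lt_min => /andP[/hd h1 /hd1 h2].
have gw : g w != 0 by rewrite -nm_gt0; have := nm_ge0 (g z); lra.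
have -> : (g w)^-1 - (g z)^-1 = - q w * (g w)^-1 * (g z)^-1 * (w - z).
  have -> : - q w * (g w)^-1 * (g z)^-1 * (w - z) =
            - (q w * (w - z)) * (g w)^-1 * (g z)^-1 by ring.
  by rewrite -hq; field; rewrite gw gz.
rewrite -mulrBl nmM ler_wpM2r ?nm_ge0 //; apply: ltW; apply: le_lt_trans h2.
by rewrite invfM !mulrA.
Qed.

Lemma cdif_comp g h z : cdif g z -> cdif h (g z) -> cdif (fun w => h (g w)) z.
Proof.
move=> dg; have cg := cdif_ccont dg.
move: dg => [q cq hq] [q' cq' hq']; exists (fun w => q' (g w) * q w).
  by apply: ccontM => //; apply: ccont_comp.
by move=> w; rewrite hq' hq mulrA.
Qed.

Lemma cdifZ c g z : cdif g z -> cdif (fun w => c * g w) z.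
Proof. by apply: cdifM; apply: cdif_cst. Qed.

Lemma cdifX g n z : cdif g z -> cdif (fun w => g w ^+ n) z.
Proof.
move=> dg; elim: n => [|n IH]; first exact: cdif_cst.
have h := cdifM dg IH; apply: (cdif_near (r := 1)) h => // w _.
by rewrite exprS.
Qed.

Lemma cdif_div g h z : h z != 0 -> cdif g z -> cdif h z ->
  cdif (fun w => g w / h w) z.
Proof. by move=> h0 dg dh; apply: cdifM => //; apply: cdifV. Qed.

Lemma cdif_prod n (F : nat -> C -> C) z : (forall k, (k < n)%N -> cdif (F k) z) ->
  cdif (fun w => \prod_(k < n) F k w) z.
Proof.
elim: n => [_|n IH dF].
  by apply: (cdif_near ltr01) (cdif_cst 1 z) => w _; rewrite big_ord0.
have h1 : cdif (fun w => \prod_(k < n) F k w) z.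
  by apply: IH => k kn; apply: dF; exact: ltnW.
apply: (cdif_near ltr01) (cdifM h1 (dF n (ltnSn n))) => w _.
by rewrite big_ord_recr.
Qed.

End ComplexCalculus.

(** * The complex exponential *)

Section ComplexExponential.
Variable R : realType.
Local Notation C := R[i].

Lemma is_derive_eps (f : R -> R) (x l : R) : is_derive x 1 f l ->
  forall e : R, 0 < e -> exists2 d : R, 0 < d &
    forall h, `|h| < d -> `|f (x + h) - f x - l * h| <= e * `|h|.
Proof.
move=> [df fl] e e0.
move: df; rewrite /derivable => /cvg_ex[k kl].
have kE : k = l by rewrite -fl /derive; symmetry; apply: cvg_lim.
rewrite kE in kl; move/cvgrPdist_le : kl => /(_ e e0).
move=> /nbhs_ballP[d /= d0 hd]; exists d => // h hh.
have [->|h0] := eqVneq h 0; first by rewrite addr0 subrr mulr0 subr0 normr0 mulr0.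
have := hd h; rewrite /ball /= sub0r normrN => /(_ hh h0).
rewrite /= -[(h *: 1 + x)%R]/(h * 1 + x) mulr1 -[_ *: _]/(_ * _) => H.
have -> : f (x + h) - f x - l * h = - (l - h^-1 * (f (h + x) - f x)) * h.
  by rewrite (addrC h); field.
by rewrite normrM normrN ler_wpM2r.
Qed.

Definition cexp (z : C) : C :=
  (expR (Re z) * cos (Im z) +i* (expR (Re z) * sin (Im z)))%C.

Lemma cexpD z w : cexp (z + w) = cexp z * cexp w.
Proof.
apply/eqP; rewrite eq_complex /= ReD ImD expRD cosD sinD; apply/andP; split; apply/eqP; ring.
Qed.

Lemma nm_cexp z : nm (cexp z) = expR (Re z).
Proof.
rewrite /nm /= !exprMn -mulrDr cos2Dsin2 mulr1 sqrtr_sqr ger0_norm //.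
Qed.

Lemma cexp_neq0 z : cexp z != 0.
Proof. by rewrite -nm_gt0 nm_cexp expR_gt0. Qed.

Lemma cexp_der0 (e : R) : 0 < e -> exists2 d : R, 0 < d &
  forall h : C, nm h < d -> nm (cexp h - 1 - h) <= e * nm h.
Proof.
move=> e0; pose e1 := Num.min 1 (e / 16).
have e10 : 0 < e1 by rewrite lt_min ltr01 divr_gt0.
have e11 : e1 <= 1 by rewrite ge_min lexx.
have e1e : e1 <= e / 16 by rewrite ge_min lexx orbT.
have [d1 d10 h1] := is_derive_eps (is_derive_expR (0 : R)) e10.
have [d2 d20 h2] := is_derive_eps (is_derive_cos (0 : R)) e10.
have [d3 d30 h3] := is_derive_eps (is_derive_sin (0 : R)) e10.
exists (Num.min (Num.min d1 d2) (Num.min d3 e1)).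
  by rewrite !lt_min d10 d20 d30 ltr01 divr_gt0.
move=> h; rewrite !lt_min => /andP[/andP[k1 k2] /andP[k3 k4']].
have k4 : nm h < e1 by rewrite lt_min.
have ra := nm_Re h; have rb := nm_Im h.
set a := Re h in ra; set b := Im h in rb.
have H1 := h1 a (le_lt_trans ra k1); have H2 := h2 b (le_lt_trans rb k2).
have H3 := h3 b (le_lt_trans rb k3).
rewrite !add0r expR0 cos0 sin0 mul1r in H1 H2 H3.
rewrite oppr0 mul0r subr0 in H2; rewrite subr0 mul1r in H3.
apply: le_trans (nm_le_ReIm _) _; rewrite !(ReB, ImB) /= -/a -/b subr0.
have n0 := nm_ge0 h.
set N := nm h in k1 k2 k3 k4 ra rb n0 *.
have A1 : `|expR a - 1 - a| <= e1 * N by apply: le_trans H1 _; rewrite ler_pM2l.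
have A2 : `|cos b - 1| <= e1 * N by apply: le_trans H2 _; rewrite ler_pM2l.
have A3 : `|sin b - b| <= e1 * N by apply: le_trans H3 _; rewrite ler_pM2l.
have B1 : `|cos b| <= 1 by rewrite ler_norml cos_geN1 cos_le1.
have B2 : `|sin b| <= N + e1 * N.
  by rewrite -[sin b](subrK b) (le_trans (ler_normD _ _)) // addrC lerD.
have B3 : `|expR a - 1| <= N + e1 * N.
  by rewrite -[expR a - 1](subrK a) (le_trans (ler_normD _ _)) // addrC lerD.
have C1 : `|expR a * cos b - 1 - a| <= e1 * N + (N + e1 * N) * (e1 * N) + e1 * N.
  have -> : expR a * cos b - 1 - a =
     (expR a - 1 - a) + (expR a - 1) * (cos b - 1) + (cos b - 1) by ring.
  apply: le_trans (ler_normD _ _) _; apply: lerD => //.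
  apply: le_trans (ler_normD _ _) _; apply: lerD => //.
  by rewrite normrM; apply: ler_pM.
have C2 : `|expR a * sin b - b| <= (N + e1 * N) * (N + e1 * N) + e1 * N.
  have -> : expR a * sin b - b = (expR a - 1) * sin b + (sin b - b) by ring.
  apply: le_trans (ler_normD _ _) _; apply: lerD => //.
  by rewrite normrM; apply: ler_pM.
have NE : N <= e1 by exact: ltW.
have D1 : N * N <= e1 * N by rewrite ler_wpM2r.
have D2 : e1 * N <= N by rewrite -[leRHS]mul1r ler_wpM2r.
have D3 : e1 * N <= e / 16 * N by rewrite ler_wpM2r.
have D4 : 0 <= e1 * N by rewrite mulr_ge0 // ltW.
have N1 : N <= 1 by apply: le_trans NE e11.
move: C1 C2 D1 D2 D3 D4; set u := e1 * N; set E := e * N.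
rewrite (_ : e / 16 * N = E / 16); last by rewrite /E; ring.
clear -n0 N1; nra.
Qed.

Lemma cdif_cexp z : cdif cexp z.
Proof.
apply/cdifP; exists (cexp z) => e e0.
have c0 : 0 < nm (cexp z) by rewrite nm_gt0 cexp_neq0.
have [d d0 hd] := cexp_der0 (divr_gt0 e0 c0).
exists d => // w /hd.
have -> : cexp w - cexp z - cexp z * (w - z) = cexp z * (cexp (w - z) - 1 - (w - z)).
  have -> : cexp w = cexp (w - z) * cexp z by rewrite -cexpD subrK.
  by ring.
rewrite nmM => h; apply: le_trans (ler_wpM2l (ltW c0) h) _.
by rewrite mulrA (mulrC (nm _)) divfK // gt_eqF.
Qed.

Lemma cexpi (t : R) : cexp ('i%C * t%:C%C) = (cos t +i* sin t)%C.
Proof.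
have -> : 'i%C * t%:C%C = (0 +i* t)%C :> C.
  by apply/eqP; rewrite eq_complex /=; apply/andP; split; apply/eqP; ring.
by rewrite /cexp /= expR0 !mul1r.
Qed.

Lemma cexpi0 : cexp ('i%C * 0%:C%C) = 1 :> C.
Proof. by rewrite cexpi cos0 sin0. Qed.

Lemma nm_i : nm ('i%C : C) = 1.
Proof. by rewrite /nm /= expr0n expr1n add0r sqrtr1. Qed.

End ComplexExponential.

(** * Primitives along segments and Goursat's lemma for rectangles *)

Section Goursat.
Variable R : realType.
Local Notation C := R[i].

Definition rcont (phi : R -> C) (x : R) := forall e : R, 0 < e ->
  exists2 d : R, 0 < d & forall h, `|h| < d -> nm (phi (x + h) - phi x) < e.

Definition rder (F : R -> C) (x : R) (l : C) := forall e : R, 0 < e ->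
  exists2 d : R, 0 < d & forall h, `|h| < d ->
    nm (F (x + h) - F x - l * h%:C%C) <= e * `|h|.

Lemma rprimitive (phi : R -> R) (L : R) : continuous phi ->
  exists F : R -> R, forall x, L < x -> is_derive x 1 F (phi x).
Proof.
move=> cphi.
exists (fun x => (\int[lebesgue_measure]_(t in [set` `[L, x]]) phi t)%R) => x Lx.
have xu : x < x + 1 by rewrite ltrDl.
have [|d1 d2] := @continuous_FTC1_closed R phi L x (x + 1) xu _ Lx (cphi x).
  apply: continuous_compact_integrable; first exact: segment_compact.
  exact: continuous_subspaceT.
by split; [exact: d1|rewrite -derive1E].
Qed.

Lemma rprimitive_eps (phi : R -> R) (L : R) :
  (forall x e : R, 0 < e -> exists2 d : R, 0 < d &
     forall h, `|h| < d -> `|phi (x + h) - phi x| < e) ->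
  exists F : R -> R, forall x, L < x -> forall e : R, 0 < e -> exists2 d : R, 0 < d &
    forall h, `|h| < d -> `|F (x + h) - F x - phi x * h| <= e * `|h|.
Proof.
move=> cphi; have [|F hF] := @rprimitive phi L; last first.
  by exists F => x /hF/is_derive_eps.
move=> x; apply/cvgrPdist_lt => e e0; have [d d0 hd] := cphi x e e0.
apply/nbhs_ballP; exists d => //= y; rewrite /ball /= => xy.
by rewrite distrC -(subrKC x y) hd // distrC.
Qed.

Lemma cprimitive (phi : R -> C) (L : R) : (forall x, rcont phi x) ->
  exists F, forall x, L < x -> rder F x (phi x).
Proof.
move=> cphi.
have [|F1 h1] := @rprimitive_eps (fun x => Re (phi x)) L.
  move=> x e /(cphi x)[d d0 hd]; exists d => // h /hd.
  by apply: le_lt_trans; rewrite -ReB nm_Re.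
have [|F2 h2] := @rprimitive_eps (fun x => Im (phi x)) L.
  move=> x e /(cphi x)[d d0 hd]; exists d => // h /hd.
  by apply: le_lt_trans; rewrite -ImB nm_Im.
exists (fun x => (F1 x +i* F2 x)%C) => x Lx e e0.
have e2 : 0 < e / 2 by lra.
have [d d0 hd] := h1 x Lx _ e2; have [d' d0' hd'] := h2 x Lx _ e2.
exists (Num.min d d'); first by rewrite lt_min d0.
move=> h; rewrite lt_min => /andP[/hd k1 /hd' k2].
apply: le_trans (nm_le_ReIm _) _.
rewrite !(ReB, ImB) /=; case: (phi x) k1 k2 => a b /= k1 k2.
rewrite mulr0 subr0 mulr0 add0r; lra.
Qed.

Lemma rderB F G x l m : rder F x l -> rder G x m ->
  rder (fun t => F t - G t) x (l - m).
Proof.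
move=> hF hG e e0; have e2 : 0 < e / 2 by lra.
have [d d0 hd] := hF _ e2; have [d' d0' hd'] := hG _ e2.
exists (Num.min d d'); first by rewrite lt_min d0.
move=> h; rewrite lt_min => /andP[/hd h1 /hd' h2].
have -> : F (x + h) - G (x + h) - (F x - G x) - (l - m) * h%:C%C =
  (F (x + h) - F x - l * h%:C%C) - (G (x + h) - G x - m * h%:C%C) by ring.
apply: le_trans (nmB _ _) _; lra.
Qed.

Lemma rderZ c F x l : rder F x l -> rder (fun t => c * F t) x (c * l).
Proof.
move=> hF e e0; have c1 : 0 < nm c + 1 by have := nm_ge0 c; lra.
have [d d0 hd] := hF _ (divr_gt0 e0 c1); exists d => // h /hd k.
rewrite (_ : _ - _ - _ = c * (F (x + h) - F x - l * h%:C%C)); last by ring.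
rewrite nmM; apply: le_trans (ler_wpM2l (nm_ge0 c) k) _.
rewrite mulrA ler_wpM2r // mulrA ler_pdivrMr //.
have := nm_ge0 c; nra.
Qed.

Lemma rder_line (Q : C -> C) (w u : C) (x : R) q :
  (forall e : R, 0 < e -> exists2 d : R, 0 < d & forall v, nm (v - (w + x%:C%C * u)) < d ->
      nm (Q v - Q (w + x%:C%C * u) - q * (v - (w + x%:C%C * u))) <=
        e * nm (v - (w + x%:C%C * u))) ->
  nm u = 1 -> rder (fun t => Q (w + t%:C%C * u)) x (q * u).
Proof.
move=> hQ u1 e e0; have [d d0 hd] := hQ e e0; exists d => // h hh.
have E : w + (x + h)%:C%C * u - (w + x%:C%C * u) = h%:C%C * u.
  by rewrite rmorphD; ring.
have n1 : nm (h%:C%C * u) = `|h| by rewrite nmM u1 mulr1 nm_real.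
have := hd (w + (x + h)%:C%C * u); rewrite E n1 => /(_ hh).
by rewrite mulrA (mulrAC q) .
Qed.

(** Mean value inequality by bisection: an increment above (M + e) times the length is inherited by
    one half, and contradicts differentiability at the limit point. *)
Lemma rder_bound (F phi : R -> C) (a b M : R) : a <= b ->
  (forall x, a <= x <= b -> rder F x (phi x)) ->
  (forall x, a <= x <= b -> nm (phi x) <= M) ->
  nm (F b - F a) <= M * (b - a).
Proof.
rewrite le_eqVlt => /orP[/eqP <- _ _|ab hF hM].
  by rewrite !subrr nm0 mulr0.
rewrite leNgt; apply/negP => hlt.
have ba : 0 < b - a by lra.
have M0 : 0 <= M by apply: le_trans (hM a _); rewrite ?nm_ge0 ?lexx ?(ltW ab).
set N := nm (F b - F a) in hlt.
pose e := (N - M * (b - a)) / (b - a) / 2.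
have e0 : 0 < e by rewrite !divr_gt0 ?subr_gt0.
have eN : (M + e) * (b - a) < N.
  have : e * (b - a) = (N - M * (b - a)) / 2 by rewrite /e; field; rewrite gt_eqF.
  lra.
have [||||x [y hxy]] := @bisection R (fun a b _ _ => (M + e) * (b - a) < nm (F b - F a)) a b 0 0.
- exact: ltW.
- exact: lexx.
- exact: eN.
- move=> a1 b1 _ _ h; set m := (a1 + b1) / 2.
  case: (ltP ((M + e) * (m - a1)) (nm (F m - F a1))) => h1; first by constructor 1.
  case: (ltP ((M + e) * (b1 - m)) (nm (F b1 - F m))) => h2; first by constructor 3.
  have := nm_tri (F b1) (F m) (F a1); rewrite /m in h1 h2 *; nra.
have [a0 [b0 [_ [_ [[h1 h2 h3 h4] _ _ _ _]]]]] := hxy 0%N.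
have xab : a <= x <= b by lra.
have [d d0 hd] := hF x xab e e0.
have [k hk] := half_pow_small (b - a) d0.
have [a' [b' [_ [_ [[k1 k2 k3 k4] _ w _ P]]]]] := hxy k.
have w0 : 0 < b' - a' by rewrite w divr_gt0 // exprn_gt0.
rewrite -w in hk.
have ha : `|a' - x| < d by rewrite ltr_norml; lra.
have hb : `|b' - x| < d by rewrite ltr_norml; lra.
have := hd _ ha; have := hd _ hb; rewrite !subrKC.
rewrite (ger0_norm (_ : 0 <= b' - x)) ?subr_ge0 // (ler0_norm (_ : a' - x <= 0)) ?subr_le0 //.
move=> q1 q2; have Mx := hM x xab.
have : nm (phi x * (b' - a')%:C%C) <= M * (b' - a').
  by rewrite nmM nm_real ger0_norm ?(ltW w0) // ler_wpM2r // ltW.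
have E : F b' - F a' = (F b' - F x - phi x * (b' - x)%:C%C) -
   (F a' - F x - phi x * (a' - x)%:C%C) + phi x * (b' - a')%:C%C.
  by rewrite !rmorphB; ring.
have := nmD ((F b' - F x - phi x * (b' - x)%:C%C) -
   (F a' - F x - phi x * (a' - x)%:C%C)) (phi x * (b' - a')%:C%C).
rewrite -E; have := nmB (F b' - F x - phi x * (b' - x)%:C%C) (F a' - F x - phi x * (a' - x)%:C%C).
nra.
Qed.

Local Notation pt s t := (s%:C + 'i * t%:C)%C.

(** [H t] and [V s] are primitives of G on horizontal and vertical lines, so the left side is the
    integral of G along the boundary. It is additive under quartering. A nonzero value would keep
    modulus at least [kap] times the squared width down to a point, where G is affine up to
    o(width). *)
Lemma goursat (G : C -> C) (H V : R -> R -> C) (a b c d : R) :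
  a < b -> c < d ->
  (forall s t, a <= s <= b -> c <= t <= d -> cdif G (pt s t)) ->
  (forall s t, a <= s <= b -> c <= t <= d -> rder (H t) s (G (pt s t))) ->
  (forall s t, a <= s <= b -> c <= t <= d -> rder (V s) t (G (pt s t))) ->
  (H c b - H c a) - (H d b - H d a) +
    'i%C * ((V b d - V b c) - (V a d - V a c)) = 0.
Proof.
move=> ab cd dG dH dV.
pose Phi a b c d := (H c b - H c a) - (H d b - H d a) +
    'i%C * ((V b d - V b c) - (V a d - V a c)).
rewrite -/(Phi a b c d); apply: nm_le0; rewrite leNgt; apply/negP => P0.
have ba : 0 < b - a by lra.
pose kap := nm (Phi a b c d) / (b - a) ^+ 2.
have kap0 : 0 < kap by rewrite divr_gt0 // exprn_gt0.
have [||||x [y hxy]] := @bisection R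
  (fun a b c d => kap * (b - a) ^+ 2 <= nm (Phi a b c d)) a b c d.
- exact: ltW.
- exact: ltW.
- by rewrite /kap divfK // expf_neq0 // gt_eqF.
- move=> a1 b1 c1 d1 h; set m := (a1 + b1) / 2; set n := (c1 + d1) / 2.
  have E : Phi a1 b1 c1 d1 = (Phi a1 m c1 n + Phi a1 m n d1) +
                             (Phi m b1 c1 n + Phi m b1 n d1).
    by rewrite /Phi; ring.
  have t1 := nmD (Phi a1 m c1 n + Phi a1 m n d1) (Phi m b1 c1 n + Phi m b1 n d1).
  have t2 := nmD (Phi a1 m c1 n) (Phi a1 m n d1).
  have t3 := nmD (Phi m b1 c1 n) (Phi m b1 n d1).
  rewrite -E in t1.
  have w1 : (m - a1) ^+ 2 = (b1 - a1) ^+ 2 / 4 by rewrite /m; field.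
  have w2 : (b1 - m) ^+ 2 = (b1 - a1) ^+ 2 / 4 by rewrite /m; field.
  case: (leP (kap * (m - a1) ^+ 2) (nm (Phi a1 m c1 n))) => h1; first by constructor 1.
  case: (leP (kap * (m - a1) ^+ 2) (nm (Phi a1 m n d1))) => h2; first by constructor 2.
  case: (leP (kap * (b1 - m) ^+ 2) (nm (Phi m b1 c1 n))) => h3; first by constructor 3.
  case: (leP (kap * (b1 - m) ^+ 2) (nm (Phi m b1 n d1))) => h4; first by constructor 4.
  rewrite w1 w2 in h1 h2 h3 h4; lra.
have [a0 [b0 [c0 [d0 [[h1 h2 h3 h4] [h5 h6 h7 h8] _ _ _]]]]] := hxy 0%N.
have xab : a <= x <= b by lra.
have ycd : c <= y <= d by lra.
pose rho := (d - c) / (b - a).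
have rho0 : 0 < rho by rewrite divr_gt0 // subr_gt0.
have r1 : 0 < (1 + rho) ^+ 2 by rewrite exprn_gt0 //; lra.
(* [rho] is the aspect ratio, which bisection preserves. The four sides contribute 2 e (1 + rho)^2
   D^2 in all, that is kap D^2 / 2, too little for the small rectangle. *)
pose e := kap / (1 + rho) ^+ 2 / 4.
have e0 : 0 < e by do 2 apply: divr_gt0 => //.
set w0 := pt x y.
have /cdifP[l /(_ e e0)[de de0 hde]] := dG x y xab ycd.
have dd : 0 < de / (1 + rho) by rewrite divr_gt0 //; lra.
have [k hk] := half_pow_small (b - a) dd.
have [a' [b' [c' [d' [[k1 k2 k3 k4] [k5 k6 k7 k8] wid1 wid2 P]]]]] := hxy k.
rewrite -wid1 in hk.
have D0 : 0 < b' - a' by rewrite wid1 divr_gt0 // exprn_gt0.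
have wid2' : d' - c' = rho * (b' - a').
  by rewrite wid1 wid2 /rho mulrA divfK // gt_eqF.
set D := b' - a' in hk D0 wid2' P.
have Dde : D * (1 + rho) < de by rewrite -ltr_pdivlMr //; lra.
(* [Q] is a primitive of the affine approximation [q] of G at [w0]; its increments cancel around the
   rectangle. *)
pose Q w := G w0 * w + l * (w ^+ 2 / 2 - w0 * w).
pose q w := G w0 + l * (w - w0).
have close s t : a' <= s <= b' -> c' <= t <= d' -> nm (pt s t - w0) <= (1 + rho) * D.
  move=> hs ht; apply: le_trans (nm_le_ReIm _) _.
  have -> : pt s t - w0 = ((s - x) +i* (t - y))%C.
    by apply/eqP; rewrite eq_complex /=; apply/andP; split; apply/eqP; ring.
  rewrite /= mulrDl mul1r -wid2' /D; clear -hs ht k2 k3 k6 k7.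
  apply: lerD; rewrite ler_norml; lra.
have GQ s t : a' <= s <= b' -> c' <= t <= d' ->
    nm (G (pt s t) - q (pt s t)) <= e * ((1 + rho) * D).
  move=> hs ht; have h := close s t hs ht.
  rewrite /q opprD addrA; apply: le_trans (hde _ _) _; last by rewrite ler_pM2l.
  by apply: le_lt_trans h _; rewrite mulrC.
have derQ w : forall e : R, 0 < e -> exists2 d : R, 0 < d & forall v, nm (v - w) < d ->
      nm (Q v - Q w - q w * (v - w)) <= e * nm (v - w).
  move=> e' e0'; exists (e' / (nm l + 1)); first by rewrite divr_gt0 // ltr_wpDl ?nm_ge0.
  move=> v; rewrite ltr_pdivlMr; last by rewrite ltr_wpDl ?nm_ge0.
  have -> : Q v - Q w - q w * (v - w) = (l / 2) * (v - w) * (v - w) by rewrite /Q /q; field.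
  rewrite !nmM nmV nm_nat => hv; rewrite ler_wpM2r ?nm_ge0 //.
  have := nm_ge0 l; have := nm_ge0 (v - w); clear -hv; nra.
have dQs s t : rder (fun s => Q (pt s t)) s (q (pt s t)).
  have := @rder_line Q ('i%C * t%:C%C) 1 s (q (pt s t)).
  rewrite !mulr1 addrC => h.
  have := h (derQ _) (@nm1 R); rewrite /rder => h' e1 /h'[d1 d10 hd1].
  by exists d1 => // h0 /hd1; rewrite !mulr1 !(addrC ('i%C * t%:C%C)).
have dQt s t : rder (fun t => Q (pt s t)) t (q (pt s t) * 'i%C).
  have := @rder_line Q s%:C%C 'i%C t (q (pt s t)); rewrite (mulrC t%:C%C) => h.
  have := h (derQ _) (nm_i R); rewrite /rder => h' e1 /h'[d1 d10 hd1].
  by exists d1 => // h0 /hd1; rewrite !(mulrC 'i%C).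
have bdH t : c' <= t <= d' ->
    nm ((H t b' - H t a') - (Q (pt b' t) - Q (pt a' t))) <= e * ((1 + rho) * D) * D.
  move=> ht; rewrite (_ : _ - _ = (H t b' - Q (pt b' t)) - (H t a' - Q (pt a' t))); last by ring.
  apply: (@rder_bound (fun s => H t s - Q (pt s t)) (fun s => G (pt s t) - q (pt s t))).
  - by rewrite -subr_ge0 ltW.
  - by move=> s hs; apply: rderB; [apply: dH; clear -hs ht k1 k4 k5 k8; lra|exact: dQs].
  - by move=> s hs; exact: GQ.
have bdV s : a' <= s <= b' ->
    nm ('i%C * (V s d' - V s c') - (Q (pt s d') - Q (pt s c'))) <=
    e * ((1 + rho) * D) * (rho * D).
  move=> hs; rewrite -wid2' (_ : _ - _ = ('i%C * V s d' - Q (pt s d')) -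
      ('i%C * V s c' - Q (pt s c'))); last by ring.
  apply: (@rder_bound (fun t => 'i%C * V s t - Q (pt s t))
    (fun t => 'i%C * G (pt s t) - q (pt s t) * 'i%C)).
  - by rewrite -subr_ge0 wid2' mulr_ge0 // ltW.
  - by move=> t ht; apply: rderB; [apply: rderZ; apply: dV; clear -hs ht k1 k4 k5 k8; lra|exact: dQt].
  - move=> t ht; rewrite mulrC -mulrBl nmM.
    by rewrite nm_i mulr1; exact: GQ.
have c'd' : c' <= d' by rewrite -subr_ge0 wid2' mulr_ge0 // ltW.
have a'b' : a' <= b' by rewrite -subr_ge0 ltW.
have b1 := bdH c'; rewrite lexx c'd' in b1; have {}b1 := b1 isT.
have b2 := bdH d'; rewrite lexx c'd' in b2; have {}b2 := b2 isT.
have b3 := bdV a'; rewrite lexx a'b' in b3; have {}b3 := b3 isT.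
have b4 := bdV b'; rewrite lexx a'b' in b4; have {}b4 := b4 isT.
have E : Phi a' b' c' d' =
   (((H c' b' - H c' a') - (Q (pt b' c') - Q (pt a' c'))) -
    ((H d' b' - H d' a') - (Q (pt b' d') - Q (pt a' d')))) +
   (('i%C * (V b' d' - V b' c') - (Q (pt b' d') - Q (pt b' c'))) -
    ('i%C * (V a' d' - V a' c') - (Q (pt a' d') - Q (pt a' c')))).
  by rewrite /Phi; ring.
move: P; apply/negP; rewrite -ltNge E.
apply: le_lt_trans (nmD _ _) _.
apply: le_lt_trans (lerD (nmB _ _) (nmB _ _)) _.
apply: le_lt_trans (lerD (lerD b1 b2) (lerD b4 b3)) _.
have -> : e * ((1 + rho) * D) * D + e * ((1 + rho) * D) * D +
  (e * ((1 + rho) * D) * (rho * D) + e * ((1 + rho) * D) * (rho * D)) =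
  (e * (1 + rho) ^+ 2) * D ^+ 2 * 2 by ring.
have -> : e * (1 + rho) ^+ 2 = kap / 4 by rewrite /e mulrAC divfK // gt_eqF.
have : 0 < D ^+ 2 by rewrite exprn_gt0.
clear -kap0; nra.
Qed.

End Goursat.

(** * Mean value property and maximum principle *)

Section MaximumPrinciple.
Variable R : realType.
Local Notation C := R[i].

Let tau : R := pi *+ 2.

Let tau0 : 0 < tau. Proof. by rewrite pmulrn_lgt0 // pi_gt0. Qed.

Lemma ccont_rcont (g : C -> C) (w u : C) x :
  ccont g (w + u * x%:C%C) -> nm u <= 1 -> rcont (fun t => g (w + u * t%:C%C)) x.
Proof.
move=> cg u1 e e0; have [d d0 hd] := cg e e0; exists d => // h hh; apply: hd.
rewrite (_ : _ - _ = u * h%:C%C); last by rewrite rmorphD; ring.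
rewrite nmM nm_real; apply: le_lt_trans hh; have := normr_ge0 h; nra.
Qed.

Lemma mean_value (g : C -> C) (z0 : C) (r rho : R) : 0 < rho < r ->
  ccont g z0 -> (forall w, nm (w - z0) < r -> w != z0 -> cdif g w) ->
  exists F : R -> C,
   (forall t, 0 <= t <= tau ->
      rder F t (g (z0 + rho%:C%C * cexp ('i%C * t%:C%C)))) /\
   F tau - F 0 = tau%:C%C * g z0.
Proof.
move=> /andP[rho0 rhor] cg dg.
pose G w := g (z0 + cexp w).
pose s2 := ln rho.
have exps s t : s <= s2 -> nm (cexp (s%:C%C + 'i%C * t%:C%C)) <= rho.
  by rewrite nm_cexp /= mul0r mul1r subr0 addr0 -ler_expR /s2 lnK ?posrE.
have dG s t : s <= s2 -> cdif G (s%:C%C + 'i%C * t%:C%C).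
  move=> ss; have h := exps s t ss; apply: cdif_comp.
    by apply: cdifD; [exact: cdif_cst|exact: cdif_cexp].
  apply: dg; first by rewrite addrAC subrr add0r; lra.
  by rewrite -subr_eq0 addrAC subrr add0r cexp_neq0.
have exV s : exists F : R -> C, s <= s2 ->
    forall t, -1 < t -> rder F t (G (s%:C%C + 'i%C * t%:C%C)).
  case: (leP s s2) => ss; last by exists (fun=> 0).
  (* A primitive is differentiable from both sides only to the right of its base point; the base -1
     leaves room around t = 0. *)
  have [|F hF] := @cprimitive R (fun t => G (s%:C%C + 'i%C * t%:C%C)) (-1).
    move=> t; apply: ccont_rcont; first exact/cdif_ccont/dG.
    by rewrite nm_i.
  by exists F.
have [V hV] := choice exV.
have const s1 : s1 < s2 -> V s1 tau - V s1 0 = V s2 tau - V s2 0.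
  move=> s12.
  have exH t : exists F : R -> C,
      forall s, s1 <= s <= s2 -> rder F s (G (s%:C%C + 'i%C * t%:C%C)).
    (* The truncation at [s2] makes the integrand continuous on the whole line, as [cprimitive]
       demands, and changes nothing for s at most [s2]. *)
    have [|F hF] := @cprimitive R (fun s => G ((Num.min s s2)%:C%C + 'i%C * t%:C%C)) (s1 - 1).
      move=> s e e0.
      have cG : ccont G ('i%C * t%:C%C + 1 * (Num.min s s2)%:C%C).
        by rewrite mul1r addrC; apply/cdif_ccont/dG; rewrite ge_min lexx orbT.
      have u1 : nm (1 : C) <= 1 by rewrite nm1.
      have [d d0 hd] := ccont_rcont cG u1 e0.
      exists d => // h hh; have := hd (Num.min (s + h) s2 - Num.min s s2).
      rewrite subrKC !mul1r !(addrC ('i%C * _)); apply.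
      apply: le_lt_trans hh; rewrite ler_norml.
      have := ler_norm h; have := ler_norm (- h); rewrite normrN.
      rewrite /Num.min; case: ltP => k1; case: ltP => k2; lra.
    exists F => s /andP[s1s ss2]; have := hF s; rewrite min_l //; apply; lra.
  have [H hH] := choice exH.
  have := @goursat R G H V s1 s2 0 tau s12 tau0.
  rewrite (_ : (H 0 s2 - H 0 s1) - (H tau s2 - H tau s1) = 0); last first.
    apply/nm_le0.
    have -> : (H 0 s2 - H 0 s1) - (H tau s2 - H tau s1) =
             (H 0 s2 - H tau s2) - (H 0 s1 - H tau s1) by ring.
    have := @rder_bound R (fun s => H 0 s - H tau s) (fun=> 0) s1 s2 0 (ltW s12).
    rewrite mul0r; apply=> [s hs|s _]; last by rewrite nm0.
    have -> : (0 : C) = G (s%:C%C + 'i%C * 0%:C%C) - G (s%:C%C + 'i%C * tau%:C%C).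
      by rewrite /G !cexpD cexpi0 cexpi cos2pi sin2pi subrr.
    by apply: rderB; apply: hH.
  rewrite add0r => /(_ _ _ _)/eqP; rewrite mulf_eq0 => K.
  have /K{K}K : forall s t : R, s1 <= s <= s2 -> 0 <= t <= tau ->
      cdif G (s%:C%C + 'i%C * t%:C%C) by move=> s t /andP[_ hs] _; apply: dG.
  have /K{K}K : forall s t : R, s1 <= s <= s2 -> 0 <= t <= tau ->
      rder (H t) s (G (s%:C%C + 'i%C * t%:C%C)) by move=> s t hs _; apply: hH.
  have /K{K} : forall s t : R, s1 <= s <= s2 -> 0 <= t <= tau ->
      rder (V s) t (G (s%:C%C + 'i%C * t%:C%C)).
    by move=> s t /andP[_ hs] /andP[ht _]; apply: hV => //; lra.
  rewrite -nm_eq0 nm_i oner_eq0 /= subr_eq0 => /eqP K.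
  by rewrite K.
have ers : cexp s2%:C%C = rho%:C%C.
  by rewrite /cexp /= cos0 sin0 mulr1 mulr0 /s2 lnK ?posrE.
exists (V s2); split.
  move=> t ht; rewrite -ers -cexpD; apply: hV; lra.
apply/eqP; rewrite -subr_eq0 -nm_eq0 eq_le nm_ge0 andbT.
apply/ler_addgt0Pr => e e0; rewrite add0r.
have [d d0 hd] := cg _ (divr_gt0 e0 tau0).
pose s1 := Num.min (s2 - 1) (ln (d / 2)).
have s12 : s1 < s2 by rewrite gt_min; apply/orP; left; lra.
rewrite -(const _ s12).
rewrite (_ : _ - _ = (V s1 tau - tau%:C%C * g z0) - (V s1 0 - 0%:C%C * g z0)); last by rewrite mul0r; ring.
have := @rder_bound R (fun t => V s1 t - t%:C%C * g z0) (fun t => G (s1%:C%C + 'i%C * t%:C%C) - g z0)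
   0 tau (e / tau) (ltW tau0).
rewrite subr0 divfK ?gt_eqF //; apply.
- move=> t ht; apply: rderB; first by apply: hV; lra.
  move=> e' e0'; exists 1 => // h _.
  have -> : (t + h)%:C%C * g z0 - t%:C%C * g z0 - g z0 * h%:C%C = 0.
    by rewrite rmorphD; ring.
  by rewrite nm0 mulr_ge0 // ltW.
- move=> t _; apply: ltW; apply: hd; rewrite addrAC subrr add0r nm_cexp /=.
  rewrite mul0r mul1r subr0 addr0; apply: le_lt_trans (_ : d / 2 < d); last by lra.
  by rewrite -[leRHS]lnK ?posrE ?divr_gt0 // ler_expR ge_min lexx orbT.
Qed.

(** If the modulus dropped at angle 0, it would stay below some m' < m on an arc, and the mean over
    the circle could not have modulus m. *)
Lemma max_circle (g : C -> C) (z0 : C) (r rho : R) : 0 < rho < r ->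
  ccont g z0 -> (forall w, nm (w - z0) < r -> w != z0 -> cdif g w) ->
  (forall w, nm (w - z0) < r -> nm (g w) <= nm (g z0)) ->
  nm (g (z0 + rho%:C%C)) = nm (g z0).
Proof.
move=> hr cg dg mg; have [F [dF eF]] := mean_value hr cg dg.
case/andP: hr => rho0 rhor.
have inr t : nm (z0 + rho%:C%C * cexp ('i%C * t%:C%C) - z0) = rho.
  by rewrite addrAC subrr add0r nmM nm_real nm_cexp /= mul0r mul1r subrr expR0 mulr1 gtr0_norm.
have hM t : nm (g (z0 + rho%:C%C * cexp ('i%C * t%:C%C))) <= nm (g z0).
  by apply: mg; rewrite inr.
have h0 : nm (g (z0 + rho%:C%C)) <= nm (g z0).
  by have := hM 0; rewrite cexpi0 mulr1.
apply/eqP; rewrite eq_le h0 /= leNgt; apply/negP => hlt.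
set m := nm (g z0) in hM hlt.
pose m' := (nm (g (z0 + rho%:C%C)) + m) / 2.
have m'm : m' < m by rewrite /m'; lra.
have cont : rcont (fun t => g (z0 + rho%:C%C * cexp ('i%C * t%:C%C))) 0.
  have : ccont (fun w => g (z0 + rho%:C%C * cexp w)) (0 + 'i%C * 0%:C%C).
    apply: cdif_ccont; apply: cdif_comp.
      by apply: cdifD; [exact: cdif_cst|apply: cdifZ; exact: cdif_cexp].
    rewrite add0r; apply: dg; first by rewrite inr.
    by rewrite -subr_eq0 -nm_gt0 inr.
  move=> /ccont_rcont h; have := h _; rewrite nm_i => /(_ (lexx _)).
  by move=> k e /k[d d0 hd]; exists d => // x /hd; rewrite !add0r.
have e0 : 0 < m' - nm (g (z0 + rho%:C%C)) by rewrite /m'; lra.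
have [d d0 hd] := cont _ e0.
pose eta := Num.min tau (d / 2).
have eta0 : 0 < eta by rewrite lt_min tau0 divr_gt0.
have etat : eta <= tau by rewrite ge_min lexx.
have etad : eta < d by apply: le_lt_trans (_ : d / 2 < d); rewrite ?ge_min ?lexx ?orbT //; lra.
have b1 : nm (F eta - F 0) <= m' * (eta - 0).
  apply: (rder_bound (ltW eta0)) => [t ht|t /andP[t0 te]]; first by apply: dF; lra.
  have := hd t; rewrite add0r cexpi0 mulr1 ger0_norm // => /(_ (le_lt_trans te etad)).
  by have := nm_sub_ge (g (z0 + rho%:C%C * cexp ('i%C * t%:C%C))) (g (z0 + rho%:C%C)); lra.
have b2 : nm (F tau - F eta) <= m * (tau - eta).
  by apply: (rder_bound etat) => [t ht|t _]; [apply: dF; lra|exact: hM].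
have := nm_tri (F tau) (F eta) (F 0); rewrite eF nmM nm_real gtr0_norm // -/m.
nra.
Qed.

(** K is an arbitrary closed bounded set, so that discs and annuli are treated alike. Among the
    points where the modulus is maximal one of largest real part is chosen; [max_circle] produces
    another one to its right. *)
Theorem max_principle (K : C -> Prop) (g : C -> C) (M B : R) :
  closed1 K -> (forall z, K z -> nm z <= B) ->
  (forall z, K z -> ccont g z) ->
  (forall z, K z -> nm (g z) <= M \/ exists2 r, 0 < r &
     forall w, nm (w - z) < r -> K w /\ (w != z -> cdif g w)) ->
  forall z, K z -> nm (g z) <= M.
Proof.
move=> Kc Kb cg hK z Kz; rewrite leNgt; apply/negP => hz.
have [|z1 Kz1 max1] := @evt R K (fun w => nm (g w)) B z Kc Kb Kz.
  move=> w e Kw e0; have [d d0 hd] := cg _ Kw _ e0; exists d => // v Kv /hd.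
  by have := nm_sub_ge (g v) (g w); lra.
pose E w := K w /\ nm (g z1) <= nm (g w).
have Ec : closed1 E.
  move=> w hw; have Kw : K w by apply: Kc => e /hw[v [Kv _] hv]; exists v.
  split=> //; apply/ler_addgt0Pr => e e0; have [d d0 hd] := cg _ Kw _ e0.
  have [v [Kv hv] /hd] := hw _ d0; have := nm_sub_ge (g v) (g w); lra.
have [|z2 [Kz2 m2] max2] := @evt R E (fun w => Re w) B z1 Ec (fun w h => Kb w h.1) (conj Kz1 (lexx _)).
  move=> w e Ew e0; exists e => // v _ hv.
  by have := Re_le_nm (v - w); rewrite ReB; lra.
have M2 : M < nm (g z2) by apply: lt_le_trans hz _; apply: le_trans m2; exact: max1.
have [|[r r0 hr]] := hK _ Kz2; first by move=> ?; lra.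
have hr2 : 0 < r / 2 < r by lra.
have E2 : nm (g (z2 + (r / 2)%:C%C)) = nm (g z2).
  apply: (max_circle hr2 (cg _ Kz2)) => w /hr[Kw dw] //.
  by apply: le_trans m2; exact: max1.
have := max2 (z2 + (r / 2)%:C%C).
rewrite ReD /= => H; suff : Re z2 + r / 2 <= Re z2 by lra.
apply: H; split; last by rewrite E2.
apply: (hr _ _).1; rewrite addrAC subrr add0r nm_real gtr0_norm; lra.
Qed.

End MaximumPrinciple.

(** * Schwarz lemma, three circles theorem, linear interpolation *)

Section DiscEstimates.
Variable R : realType.
Local Notation C := R[i].
Implicit Types (g : C -> C) (p z w : C) (r rho M : R) (S : seq C).

Lemma closed1_annulus p r rho : closed1 (fun w : C => r <= nm (w - p) <= rho).
Proof.
move=> z hz; apply/andP; split; apply/ler_addgt0Pr => e /hz[w /andP[h1 h2] h3].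
  by have := nm_tri w z p; lra.
by have := nm_tri z w p; rewrite (nm_distC z w); lra.
Qed.

Lemma max_annulus g p r rho M :
  (forall w, r <= nm (w - p) <= rho -> cdif g w) ->
  (forall w, nm (w - p) = r -> nm (g w) <= M) ->
  (forall w, nm (w - p) = rho -> nm (g w) <= M) ->
  forall w, r <= nm (w - p) <= rho -> nm (g w) <= M.
Proof.
move=> dg M1 M2.
apply: (@max_principle R (fun w => r <= nm (w - p) <= rho) g M (rho + nm p)).
- exact: closed1_annulus.
- by move=> z /andP[_ h]; have := nmD (z - p) p; rewrite subrK; lra.
- by move=> z /dg/cdif_ccont.
move=> z /andP[]; rewrite le_eqVlt => /orP[/eqP/esym/M1|h1]; first by left.
rewrite le_eqVlt => /orP[/eqP/M2|h2]; first by left.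
right; exists (Num.min (nm (z - p) - r) (rho - nm (z - p))).
  by rewrite lt_min !subr_gt0 h1.
move=> w; rewrite lt_min => /andP[k1 k2].
have hw : r <= nm (w - p) <= rho.
  have t1 := nm_tri z w p; have t2 := nm_tri w z p; rewrite (nm_distC z w) in t1.
  by apply/andP; split; lra.
by split=> // _; exact: dg.
Qed.

Lemma isolated_seq S z : exists2 r : R, 0 < r &
  forall w, nm (w - z) < r -> w != z -> w \notin S.
Proof.
elim: S => [|s S [r r0 hr]]; first by exists 1.
have [->|sz] := eqVneq s z.
  by exists r => // w h wz; rewrite inE negb_or wz hr.
exists (Num.min r (nm (s - z))); first by rewrite lt_min r0 nm_gt0 subr_eq0.
move=> w; rewrite lt_min => /andP[h1 h2] wz; rewrite inE negb_or hr // andbT.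
by apply: contraTneq h2 => ->; rewrite ltxx.
Qed.

(** [S] lists finitely many points where continuity is enough; repeated difference quotients have
    such points at their nodes. *)
Lemma max_disc S g p rho M :
  (forall w, nm (w - p) <= rho -> ccont g w) ->
  (forall w, nm (w - p) <= rho -> w \notin S -> cdif g w) ->
  (forall w, nm (w - p) = rho -> nm (g w) <= M) ->
  forall w, nm (w - p) <= rho -> nm (g w) <= M.
Proof.
move=> cg dg M2.
apply: (@max_principle R (fun w => nm (w - p) <= rho) g M (rho + nm p)).
- move=> z hz; apply/ler_addgt0Pr => e /hz[w h1 h3].
  by have := nm_tri z w p; rewrite (nm_distC z w); lra.
- by move=> z h; have := nmD (z - p) p; rewrite subrK; lra.
- exact: cg.
move=> z; rewrite le_eqVlt => /orP[/eqP/M2|h2]; first by left.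
right; have [r r0 hr] := isolated_seq S z.
exists (Num.min r (rho - nm (z - p))); first by rewrite lt_min r0 subr_gt0.
move=> w; rewrite lt_min => /andP[k1 k2].
have hw : nm (w - p) <= rho by have t2 := nm_tri w z p; lra.
by split=> // wz; apply: dg => //; exact: hr.
Qed.

Lemma cdif_quot g a : cdif g a -> exists q : C -> C,
  [/\ ccont q a, forall w, g w - g a = q w * (w - a),
    forall w, ccont g w -> ccont q w &
    forall w, w != a -> cdif g w -> cdif q w].
Proof.
case=> q cq hq; exists q; split=> //.
  move=> w cg; have [->//|wa] := eqVneq w a.
  have wa0 : 0 < nm (w - a) by rewrite nm_gt0 subr_eq0.
  apply: (@ccont_near R (fun v => (g v - g a) / (v - a)) q w (nm (w - a)) wa0).
    move=> v hv; rewrite hq mulfK // subr_eq0; apply: contraTneq hv => ->.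
    by rewrite nm_distC ltxx.
  apply: ccontM; first by apply: ccontD => //; exact: ccont_cst.
  apply: ccontV; first by rewrite subr_eq0.
  by apply: ccontD; [exact: ccont_id|exact: ccont_cst].
move=> w wa dg.
have wa0 : 0 < nm (w - a) by rewrite nm_gt0 subr_eq0.
apply: (@cdif_near R (fun v => (g v - g a) / (v - a)) q w (nm (w - a)) wa0).
  move=> v hv; rewrite hq mulfK // subr_eq0; apply: contraTneq hv => ->.
  by rewrite nm_distC ltxx.
apply: cdif_div; rewrite ?subr_eq0 //.
  by apply: cdifB => //; exact: cdif_cst.
by apply: cdifB; [exact: cdif_id|exact: cdif_cst].
Qed.

Lemma schwarz S g p rho M : 0 < rho -> cdif g p ->
  (forall w, nm (w - p) <= rho -> ccont g w) ->
  (forall w, nm (w - p) <= rho -> w \notin S -> cdif g w) ->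
  (forall w, nm (w - p) = rho -> nm (g w - g p) <= M) ->
  forall w, nm (w - p) <= rho -> nm (g w - g p) <= M * nm (w - p) / rho.
Proof.
move=> rho0 dgp cg dg hM w hw.
have [q [_ hq cq dq]] := cdif_quot dgp.
have := @max_disc (p :: S) q p rho (M / rho) _ _ _ w hw.
move=> K; have {}K : nm (q w) <= M / rho.
  apply: K => v hv.
  - by apply/cq/cg.
  - rewrite inE negb_or => /andP[vp vS].
    by apply: dq => //; exact: dg.
  - by rewrite ler_pdivlMr // -hv -nmM -hq; exact: hM.
by rewrite hq nmM mulrAC ler_wpM2r // nm_ge0.
Qed.

(** Maximum principle for g / (w - p)^b. A natural exponent keeps this function single-valued; in
    the application to iterates the exponent has the size of D_n, so rounding it costs nothing in
    the limit. *)
Lemma three_circles g p r rho (A : R) (b : nat) : 0 < r -> r <= rho ->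
  (forall w, r <= nm (w - p) <= rho -> cdif g w) ->
  (forall w, nm (w - p) = r -> nm (g w) <= A) ->
  (forall w, nm (w - p) = rho -> nm (g w) <= A * (rho / r) ^+ b) ->
  forall w, r <= nm (w - p) <= rho -> nm (g w) <= A * (nm (w - p) / r) ^+ b.
Proof.
move=> r0 rrho dg h1 h2 w hw.
have wp v : r <= nm (v - p) <= rho -> 0 < nm (v - p) by move=> /andP[h _]; exact: lt_le_trans h.
have rho0 : 0 < rho by exact: lt_le_trans rrho.
have := @max_annulus (fun v => g v / (v - p) ^+ b) p r rho (A / r ^+ b) _ _ _ w hw.
rewrite nmf_div nmX ler_pdivrMr ?exprn_gt0 ?wp // expr_div_n mulrAC -mulrA; apply.
- move=> v hv; apply: cdif_div; first by rewrite expf_neq0 // -nm_gt0 wp.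
    exact: dg.
  by apply: cdifX; apply: cdifB; [exact: cdif_id|exact: cdif_cst].
- by move=> v hv; rewrite nmf_div nmX hv ler_pM2r ?invr_gt0 ?exprn_gt0 // h1.
- move=> v hv; rewrite nmf_div nmX hv ler_pdivrMr ?exprn_gt0 //.
  by have := h2 v hv; rewrite expr_div_n mulrA mulrAC.
Qed.

Lemma exp_decay (t e M : R) : 0 <= t < 1 -> 0 < e -> exists n : nat, M * t ^+ n <= e.
Proof.
move=> /andP[t0 t1] e0.
have := cvg_geometric M (_ : `|t| < 1); rewrite ger0_norm // => /(_ t1).
move/cvgrPdist_le => /(_ e e0)[n _ hn]; exists n.
have := hn n (leqnn n); rewrite /= sub0r normrN; exact: le_trans (ler_norm _).
Qed.

(** As g vanishes on the inner circle, the three circles theorem applies with A = M (r / rho)^n for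
    every n and gives |g w| <= M (|w - p| / rho)^n. *)
Lemma identity_disc g p r rho : 0 < r ->
  (forall w, nm (w - p) <= rho -> cdif g w) ->
  (forall w, nm (w - p) <= r -> g w = 0) ->
  forall w, nm (w - p) < rho -> g w = 0.
Proof.
move=> r0 dg g0 w hw.
have [h|h] := leP (nm (w - p)) r; first exact: g0.
have rrho : r <= rho by lra.
have rho0 : 0 < rho by lra.
have [||||z Kz hz] := @evt R (fun w => nm (w - p) <= rho) (fun w => nm (g w)) (rho + nm p) w.
- move=> z hz; apply/ler_addgt0Pr => e /hz[v h1 h3].
  by have := nm_tri z v p; rewrite (nm_distC z v); lra.
- by move=> z hz; have := nmD (z - p) p; rewrite subrK; lra.
- exact: ltW.
- move=> z e Kz e0; have [d d0 hd] := cdif_ccont (dg _ Kz) e0; exists d => // v _ /hd.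
  by have := nm_sub_ge (g v) (g z); lra.
set M := nm (g z) in hz.
apply/nm_le0/ler_addgt0Pr => e e0; rewrite add0r.
have [|n hn] := @exp_decay (nm (w - p) / rho) e M _ e0.
  by rewrite divr_ge0 ?nm_ge0 ?(ltW rho0) //= ltr_pdivrMr // mul1r.
apply: le_trans hn.
have -> : nm (w - p) / rho = r / rho * (nm (w - p) / r) by field; rewrite !gt_eqF.
rewrite exprMn mulrA; apply: (three_circles r0 rrho); last by rewrite !ltW.
- by move=> v /andP[_ /dg].
- move=> v hv; rewrite g0 ?hv // nm0 mulr_ge0 ?nm_ge0 ?exprn_ge0 ?divr_ge0 ?ltW //.
- move=> v hv; rewrite -mulrA -exprMn (_ : r / rho * (rho / r) = 1).
    by rewrite expr1n mulr1; apply: hz; rewrite hv.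
  by field; rewrite !gt_eqF.
Qed.

(** The error of the chord is (w - a) (w - b) times a second difference quotient, which the maximum
    principle bounds from |w| = rho, where both factors have modulus at least rho / 2. With M =
    O(rho) it follows that g is affine up to O(1 / rho) on bounded sets. *)
Lemma interpolation S g rho M a b : 0 < rho -> a != b ->
  nm a <= rho / 2 -> nm b <= rho / 2 -> a \notin S -> b \notin S ->
  (forall w, nm w <= rho -> ccont g w) ->
  (forall w, nm w <= rho -> w \notin S -> cdif g w) ->
  (forall w, nm w <= rho -> nm (g w) <= M) ->
  nm ((g b - g a) / (b - a)) <= 4 * M / rho /\
  forall w, nm w <= rho ->
  nm (g w - (g a + (g b - g a) / (b - a) * (w - a))) <= 40 * M * nm (w - a) * nm (w - b) / rho ^+ 2.
Proof.
move=> rho0 ab ha hb aS bS cg dg hM.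
have hs : nm ((g b - g a) / (b - a)) <= 4 * M / rho.
  have ba0 : 0 < nm (b - a) by rewrite nm_gt0 subr_eq0 eq_sym.
  rewrite nmf_div ler_pdivrMr //.
  have M0 : 0 <= M by apply: le_trans (hM a _); rewrite ?nm_ge0 //; lra.
  have [hba|hba] := leP (nm (b - a)) (rho / 2); last first.
    have h1 := hM a; have h2 := hM b; have := nmB (g b) (g a) => h3.
    have -> : 4 * M / rho * nm (b - a) = 2 * M * (nm (b - a) / (rho / 2)).
      by field; rewrite gt_eqF.
    have : 1 <= nm (b - a) / (rho / 2) by rewrite ler_pdivlMr ?mul1r ?ltW //; lra.
    have : nm (g a) <= M by apply: h1; lra.
    have : nm (g b) <= M by apply: h2; lra.
    nra.
  have sub w : nm (w - a) <= rho / 2 -> nm w <= rho.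
    by move=> h; have := nmD (w - a) a; rewrite subrK; lra.
  have r2 : 0 < rho / 2 by lra.
  have := @schwarz S g a (rho / 2) (2 * M) r2 _ _ _ _ b hba.
  rewrite (_ : 2 * M * nm (b - a) / (rho / 2) = 4 * M / rho * nm (b - a)); last first.
    by field; rewrite gt_eqF.
  apply.
  - by apply: dg => //; lra.
  - by move=> w /sub/cg.
  - by move=> w /sub/dg.
  - move=> w hw; have hw' : nm w <= rho by apply: sub; rewrite hw.
    have h1 := hM w hw'; have h2 := hM a; have := nmB (g w) (g a).
    have : nm a <= rho by lra.
    by move=> /h2; lra.
split=> // w hw; set s := (_ / _) in hs *.
have dga : cdif g a by apply: dg => //; lra.
have dgb : cdif g b by apply: dg => //; lra.
have [q [_ hq cq dq]] := cdif_quot dga.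
have qb : q b = s by rewrite /s hq mulfK // subr_eq0 eq_sym.
have dqb : cdif q b by apply: dq => //; rewrite eq_sym.
have [q2 [_ hq2 cq2 dq2]] := cdif_quot dqb.
have E v : g v - (g a + s * (v - a)) = q2 v * (v - b) * (v - a).
  by rewrite -hq2 qb mulrBl -hq; ring.
have bd v : nm v = rho -> nm (q2 v) <= 40 * M / rho ^+ 2.
  move=> hv.
  have va : rho / 2 <= nm (v - a) by have := nm_sub_ge v a; lra.
  have vb : rho / 2 <= nm (v - b) by have := nm_sub_ge v b; lra.
  have va2 : nm (v - a) <= 3 / 2 * rho by have := nmB v a; lra.
  have := E v => /(congr1 (@nm R)); rewrite !nmM => Ev.
  have hv' : nm v <= rho by rewrite hv.
  have ha' : nm a <= rho by lra.
  have h4 : nm (g v - (g a + s * (v - a))) <= 10 * M.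
    apply: le_trans (nmB _ _) _.
    have := nmD (g a) (s * (v - a)); rewrite nmM.
    have := hM v hv'; have := hM a ha'.
    have : nm s * nm (v - a) <= 4 * M / rho * (3 / 2 * rho).
      by apply: ler_pM; rewrite ?nm_ge0.
    rewrite (_ : 4 * M / rho * (3 / 2 * rho) = 6 * M); last by field; rewrite gt_eqF.
    have := nm_ge0 (g a); lra.
  rewrite Ev in h4.
  have h5 : nm (q2 v) * (rho / 2) * (rho / 2) <= 10 * M.
    apply: le_trans h4; apply: ler_pM => //.
    - by rewrite mulr_ge0 ?nm_ge0 // divr_ge0 // ltW.
    - by rewrite divr_ge0 // ltW.
    - by rewrite ler_wpM2l ?nm_ge0.
  rewrite ler_pdivlMr ?exprn_gt0 //.
  have -> : nm (q2 v) * rho ^+ 2 = 4 * (nm (q2 v) * (rho / 2) * (rho / 2)) by field.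
  lra.
have := @max_disc [:: a, b & S] q2 0 rho (40 * M / rho ^+ 2) _ _ _ w.
rewrite subr0 => K; have {}K : nm (q2 w) <= 40 * M / rho ^+ 2.
  apply: K => //.
  - by move=> v; rewrite subr0 => hv; apply/cq2/cq/cg.
  - move=> v; rewrite subr0 !inE !negb_or => hv /and3P[va vb vS].
    by apply: dq2 => //; apply: dq => //; exact: dg.
  - by move=> v; rewrite subr0; exact: bd.
rewrite E !nmM.
have -> : 40 * M * nm (w - a) * nm (w - b) / rho ^+ 2 =
  40 * M / rho ^+ 2 * nm (w - b) * nm (w - a) by field; rewrite gt_eqF.
by do 2 (apply: ler_wpM2r; first exact: nm_ge0).
Qed.

(** Schwarz lemma after the Möbius map M (u - 1) / (M^2 - u), which sends the disc of radius M into
    the unit disc and 1 to 0. The factor M^2 - 1 vanishes as M tends to 1, and this is what makes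
    the estimate useful for functions that are nearly constant. *)
Lemma schwarz_one g rho M : 0 < rho -> 1 < M -> g 0 = 1 ->
  (forall w, nm w <= rho -> cdif g w) ->
  (forall w, nm w <= rho -> nm (g w) <= M) ->
  forall w, nm w <= rho / 2 -> nm (g w - 1) <= 2 * (M ^+ 2 - 1) * nm w / rho.
Proof.
move=> rho0 M1 g1 dg hM w hw.
have M0 : 0 < M by lra.
pose MC : C := M%:C%C.
have nMC : nm MC = M by rewrite nm_real gtr0_norm.
have den w' : nm w' <= rho -> MC ^+ 2 - g w' != 0.
  move=> h; rewrite -nm_gt0; have := nm_sub_ge (MC ^+ 2) (g w').
  rewrite nmX nMC; have := hM w' h; nra.
pose phi v := MC * (g v - 1) / (MC ^+ 2 - g v).
have dphi v : nm v <= rho -> cdif phi v.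
  move=> h; apply: cdif_div; first exact: den.
    by apply: cdifZ; apply: cdifB; [exact: dg|exact: cdif_cst].
  by apply: cdifB; [exact: cdif_cst|exact: dg].
have phi0 : phi 0 = 0 by rewrite /phi g1 subrr mulr0 mul0r.
have bphi v : nm v <= rho -> nm (phi v) <= 1.
  move=> h; rewrite nmf_div ler_pdivrMr ?nm_gt0 ?den // mul1r nmM nMC.
  rewrite -(ler_pXn2r (ltn0Sn 1)) ?nnegrE ?mulr_ge0 ?nm_ge0 ?(ltW M0) //.
  have := hM v h; have n0 := nm_ge0 (g v).
  rewrite exprMn; move: n0; case: (g v) => x y; rewrite /MC /nm /= => n0 hn.
  have x2 : 0 <= x ^+ 2 + y ^+ 2 by rewrite addr_ge0 ?sqr_ge0.
  have : x ^+ 2 + y ^+ 2 <= M ^+ 2.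
    rewrite -(sqr_sqrtr x2) ler_pXn2r ?nnegrE ?(ltW M0) //.
  move=> hX; have M2 : 0 <= M ^+ 2 - 1 by rewrite subr_ge0 expr_ge1 // ltW.
  rewrite !sqr_sqrtr ?addr_ge0 ?sqr_ge0 // -subr_ge0.
  rewrite (_ : _ - _ = (M ^+ 2 - 1) * (M ^+ 2 - (x ^+ 2 + y ^+ 2))); last by ring.
  by rewrite mulr_ge0 // subr_ge0.
have := @schwarz [::] phi 0 rho 1 rho0 _ _ _ _ w.
rewrite !subr0 phi0 => K; have {}K : nm (phi w) <= 1 * nm w / rho.
  rewrite -[phi w]subr0; apply: K; rewrite ?nm0 ?(ltW rho0) //.
  - by apply: dphi; rewrite nm0 ltW.
  - by move=> v; rewrite subr0 => /dphi/cdif_ccont.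
  - by move=> v; rewrite subr0 => /dphi.
  - by move=> v; rewrite !subr0 => hv; apply: bphi; rewrite hv.
  - by lra.
have hw' : nm w <= rho by lra.
move: K; rewrite nmf_div ler_pdivrMr ?nm_gt0 ?den // nmM nMC mul1r.
set t := nm w / rho => K.
have t2 : t <= 1 / 2 by rewrite ler_pdivrMr //; lra.
have t0 : 0 <= t by rewrite divr_ge0 ?nm_ge0 // ltW.
have : nm (MC ^+ 2 - g w) <= (M ^+ 2 - 1) + nm (g w - 1).
  have -> : MC ^+ 2 - g w = (MC ^+ 2 - 1) - (g w - 1) by ring.
  apply: le_trans (nmB _ _) _; rewrite lerD2r.
  have -> : MC ^+ 2 - 1 = (M ^+ 2 - 1)%:C%C by rewrite rmorphB rmorphXn.
  by rewrite nm_real ger0_norm // subr_ge0 expr_ge1 // ltW.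
move=> K2; rewrite -mulrA -/t.
have := nm_ge0 (g w - 1).
nra.
Qed.

End DiscEstimates.

(** * Uniform limits and entire bijections *)

Section Entire.
Variable R : realType.
Local Notation C := R[i].
Implicit Types (g : C -> C) (p z w : C) (r rho M : R).

Lemma closed1_disc p rho : closed1 (fun w : C => nm (w - p) <= rho).
Proof.
move=> z hz; apply/ler_addgt0Pr => e /hz[v h1 h3].
by have := nm_tri z v p; rewrite (nm_distC z v); lra.
Qed.

Lemma disc_max (phi : C -> R) p rho : 0 <= rho ->
  (forall z (e : R), nm (z - p) <= rho -> 0 < e -> exists2 d : R, 0 < d &
     forall w, nm (w - z) < d -> phi w <= phi z + e) ->
  exists2 z, nm (z - p) <= rho & forall w, nm (w - p) <= rho -> phi w <= phi z.
Proof.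
move=> rho0 usc.
have [||||z Kz hz] := @evt R (fun w => nm (w - p) <= rho) phi (rho + nm p) p.
- exact: closed1_disc.
- by move=> z hz; have := nmD (z - p) p; rewrite subrK; lra.
- by rewrite subrr nm0.
- by move=> z e Kz e0; have [d d0 hd] := usc z e Kz e0; exists d => // w _ /hd.
by exists z.
Qed.

Lemma disc_bounded g p rho : (forall z, nm (z - p) <= rho -> ccont g z) ->
  exists2 M, 0 <= M & forall w, nm (w - p) <= rho -> nm (g w) <= M.
Proof.
move=> cg; have [rho0|rho0] := ltP rho 0.
  by exists 0 => // w; have := nm_ge0 (w - p) => h1 h2; lra.
have [|z Kz hz] := @disc_max (fun w => nm (g w)) p rho rho0.
  move=> z e Kz e0; have [d d0 hd] := cg _ Kz _ e0; exists d => // v /hd.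
  by have := nm_sub_ge (g v) (g z); lra.
by exists (nm (g z)) => //; exact: nm_ge0.
Qed.

(** The difference quotients at p are uniformly Cauchy on the circle, hence on the disc by the
    maximum principle; a cluster value of the derivatives at p is the derivative of the limit. *)
Lemma weierstrass (f : nat -> C -> C) g p rho : 0 < rho ->
  (forall n w, nm (w - p) <= rho -> cdif (f n) w) ->
  (forall e : R, 0 < e -> exists N, forall n w, (N <= n)%N -> nm (w - p) <= rho ->
     nm (f n w - g w) <= e) ->
  cdif g p.
Proof.
move=> rho0 df hf.
have pp : nm (p - p) <= rho by rewrite subrr nm0 ltW.
have [q hq] := choice (fun n => cdif_quot (df n p pp)).
have qq (e : R) : 0 < e -> exists N, forall n m w, (N <= n)%N -> (N <= m)%N ->
    nm (w - p) <= rho -> nm (q n w - q m w) <= e.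
  move=> e0; have e4 : 0 < e * rho / 4 by rewrite divr_gt0 // mulr_gt0.
  have [N hN] := hf _ e4; exists N => n m w Nn Nm.
  have [cn en ccn dn] := hq n; have [cm em ccm dm] := hq m.
  apply: (@max_disc R [:: p] (fun w => q n w - q m w) p rho e).
  - move=> v hv; apply: ccontD; last apply: ccontN.
      exact/ccn/cdif_ccont/df.
    exact/ccm/cdif_ccont/df.
  - move=> v hv; rewrite inE => vp; apply: cdifB; [apply: dn|apply: dm] => //; exact: df.
  - move=> v hv; rewrite -(ler_pM2r rho0) -{1}hv -nmM mulrBl -en -em.
    have -> : f n v - f n p - (f m v - f m p) =
      ((f n v - g v) - (f m v - g v)) - ((f n p - g p) - (f m p - g p)) by ring.
    have hv' : nm (v - p) <= rho by rewrite hv.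
    have h1 := hN n v Nn hv'; have h2 := hN m v Nm hv'.
    have h3 := hN n p Nn pp; have h4 := hN m p Nm pp.
    apply: le_trans (nmB _ _) _; apply: le_trans (lerD (nmB _ _) (nmB _ _)) _; lra.
have [N1 hN1] := qq _ (@ltr01 R).
have [|l hl] := @cluster_seq R (fun n => q (N1 + n)%N p) (nm (q N1 p) + 1).
  move=> n; have := hN1 (N1 + n)%N N1 p (leq_addr _ _) (leqnn _) pp.
  by have := nm_sub_ge (q (N1 + n)%N p) (q N1 p); lra.
apply/cdifP; exists l => e e0.
have e4 : 0 < e / 4 by lra.
have [N hN] := qq _ e4.
have [n0 Nn0 hn0] := hl _ N e4; set n := (N1 + n0)%N in hn0.
have Nn : (N <= n)%N by apply: leq_trans Nn0 _; exact: leq_addl.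
have [cn en ccn dn] := hq n.
have [d d0 hd] := cn _ e4.
exists (Num.min d rho); first by rewrite lt_min d0.
move=> w; rewrite lt_min => /andP[/hd h1 /ltW h2].
have [->|wp] := eqVneq w p; first by rewrite !subrr mulr0 subr0 nm0 mulr0.
have wp0 : 0 < nm (w - p) by rewrite nm_gt0 subr_eq0.
have e5 : 0 < e * nm (w - p) / 8 by rewrite divr_gt0 // mulr_gt0.
have [M hM] := hf _ e5.
pose m := maxn M N.
have h3 := hM m w (leq_maxl _ _) h2; have h4 := hM m p (leq_maxl _ _) pp.
have h5 := hN m n w (leq_maxr _ _) Nn h2.
have [_ em _ _] := hq m.
have -> : g w - g p - l * (w - p) = - (f m w - g w) + (f m p - g p) +
   ((q m w - q n w) + ((q n w - q n p) + (q n p - l))) * (w - p).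
  have -> : ((q m w - q n w) + ((q n w - q n p) + (q n p - l))) * (w - p) =
     q m w * (w - p) - l * (w - p) by ring.
  by rewrite -em; ring.
have kX : nm ((q m w - q n w) + ((q n w - q n p) + (q n p - l))) <= 3 * (e / 4).
  apply: le_trans (nmD _ _) _; have := nmD (q n w - q n p) (q n p - l); lra.
apply: le_trans (nmD _ _) _; rewrite nmM.
have := ler_wpM2r (nm_ge0 (w - p)) kX.
have := nmD (- (f m w - g w)) (f m p - g p); rewrite nmN; clear -h3 h4; lra.
Qed.

(** The function g(w) = w / h(w), completed at 0, has no zeros. Since k is bounded on the unit disc,
    |h| >= 1 far out, so |g(w)| <= |w| there and g is affine; an affine function without zeros is
    constant. *)
Lemma entire_bijection_linear (h k : C -> C) :
  (forall w, cdif h w) -> (forall w, cdif k w) ->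
  cancel h k -> cancel k h -> h 0 = 0 -> forall w, h w = h 1 * w.
Proof.
move=> dh dk hk kh h0.
have k0 : k 0 = 0 by rewrite -h0 hk.
have [q [cq hq ccq dq]] := cdif_quot (dh 0).
have hE w : h w = q w * w by rewrite -[h w]subr0 -{1}h0 hq subr0.
have hneq0 w : w != 0 -> h w != 0.
  by apply: contraNneq => hw; rewrite -(hk w) hw k0.
have [B B0 hB] : exists2 B : R, 0 <= B & forall w, nm (w - 0) <= 1 -> nm (k w) <= B.
  by apply: disc_bounded => z _; exact/cdif_ccont/dk.
(* The product of the derivatives of h and k at 0 is 1. *)
have q0 : q 0 != 0.
  have [u cu hu] := dk 0.
  have : ccont (fun w => u (h w) * q w) 0.
    apply: ccontM => //; apply: ccont_comp; first exact/cdif_ccont/dh.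
    by rewrite h0.
  move=> cuq; apply/eqP => q00.
  have [d d0 hd] := cuq 1 ltr01.
  pose w : C := (d / 2)%:C%C.
  have nw : nm w = d / 2 by rewrite nm_real gtr0_norm // divr_gt0.
  have w0 : w != 0 by rewrite -nm_gt0 nw divr_gt0.
  have := hd w; rewrite subr0 nw q00 mulr0 subr0.
  have -> : u (h w) * q w = 1.
    apply: (mulIf w0); rewrite -mulrA -hE mul1r.
    by have := hu (h w); rewrite k0 !subr0 hk => <-.
  by rewrite nm1 ltxx => /(_ _)/negP; apply=> //; lra.
have qneq0 w : q w != 0.
  have [->//|w0] := eqVneq w 0.
  by apply: contra_neq (hneq0 w w0) => qw; rewrite hE qw mul0r.
pose g w := (q w)^-1.
have cg w : ccont g w by apply: ccontV => //; exact/ccq/cdif_ccont/dh.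
have dg w : w != 0 -> cdif g w by move=> w0; apply: cdifV => //; apply: dq.
have hg w : B < nm w -> nm (g w) <= nm w.
  move=> Bw; have w0 : w != 0 by rewrite -nm_gt0; lra.
  rewrite nmV -ler_pV2 ?inE ?unitfE ?invr_eq0 ?gt_eqF ?nm_gt0 ?invr_eq0 ?qneq0 //=.
  - rewrite invrK -[_^-1]mul1r ler_pdivrMr ?nm_gt0 // -nmM -hE.
    rewrite leNgt; apply/negP => hlt; have := hB (h w); rewrite subr0 hk => /(_ (ltW hlt)).
    by apply/negP; rewrite -ltNge.
  - by rewrite invr_gt0 nm_gt0.
have aff w : g w = g 1 + (g 2 - g 1) / (2 - 1) * (w - 1).
  apply/eqP; rewrite -subr_eq0 -nm_eq0 eq_le nm_ge0 andbT.
  apply/ler_addgt0Pr => e e0; rewrite add0r.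
  pose A := 40 * nm (w - 1) * nm (w - 2).
  have A0 : 0 <= A by rewrite !mulr_ge0 ?nm_ge0.
  (* The bound [rho] for g on the disc of radius [rho] gives the interpolation error A / rho <= e;
     the summand 4 places the nodes 1 and 2 in the half disc. *)
  pose rho := nm w + B + 4 + A / e.
  have Ae : 0 <= A / e by rewrite divr_ge0 // ltW.
  have w0 := nm_ge0 w.
  have rho0 : 0 < rho by rewrite /rho; lra.
  have [||||||||_ K] := @interpolation R [:: 0] g rho rho 1 2 rho0.
  - by rewrite eq_sym -subr_eq0 -nm_gt0 (_ : 2 - 1 = 1 :> C) ?nm1 //; ring.
  - by rewrite nm1 /rho; lra.
  - by rewrite nm_nat /rho; lra.
  - by rewrite inE oner_eq0.
  - by rewrite inE pnatr_eq0.
  - by move=> v _; exact: cg.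
  - by move=> v _; rewrite inE => /dg.
  - move=> v hv.
    apply: (@max_disc R [:: 0] g 0 rho rho) => // [u _|u hu|]; last by rewrite subr0.
      by rewrite inE => /dg.
    rewrite subr0 in hu; rewrite -hu; apply: hg; rewrite hu /rho; lra.
  have wr : nm w <= rho by rewrite /rho; lra.
  apply: le_trans (K w wr) _.
  have -> : 40 * rho * nm (w - 1) * nm (w - 2) / rho ^+ 2 = A / rho.
    by rewrite /A; field; rewrite gt_eqF.
  rewrite ler_pdivrMr // mulrC -ler_pdivrMr // /rho; lra.
have [s0|s0] := eqVneq (g 2 - g 1) 0.
  have qc w : q w = q 1.
    by apply: invr_inj; have := aff w; rewrite s0 !mul0r addr0.
  by move=> w; rewrite !hE mulr1 qc.
exfalso; have := aff (1 - g 1 / (g 2 - g 1)).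
have -> : g 1 + (g 2 - g 1) / (2 - 1) * (1 - g 1 / (g 2 - g 1) - 1) = 0.
  by rewrite (_ : 2 - 1 = 1 :> C); [field | ring].
by move/eqP; rewrite invr_eq0 (negPf (qneq0 _)).
Qed.

End Entire.

(** * Holomorphic roots and Harnack's inequality *)

Section Harnack.
Variable R : realType.
Local Notation C := R[i].
Implicit Types (g : C -> C) (p z w : C) (r rho M : R).

Lemma disc_uniform g p rho (e : R) : (forall z, nm (z - p) <= rho -> ccont g z) -> 0 < e ->
  exists2 d : R, 0 < d & forall u v, nm (u - p) <= rho -> nm (v - p) <= rho ->
    nm (u - v) < d -> nm (g u - g v) < e.
Proof.
move=> cg e0; apply: contrapT => hno.
have bad (n : nat) : exists u : C, exists v : C, [/\ nm (u - p) <= rho,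
    nm (v - p) <= rho, nm (u - v) < n.+1%:R^-1 & e <= nm (g u - g v)].
  apply: contrapT => hn; apply: hno; exists n.+1%:R^-1; first by rewrite invr_gt0.
  move=> u v hu hv huv; rewrite ltNge; apply/negP => h; apply: hn.
  by exists u, v.
have [u hu] := choice bad.
have bu n : nm (u n) <= rho + nm p.
  by have [v [h _ _ _]] := hu n; have := nmD (u n - p) p; rewrite subrK; lra.
have [z hz] := cluster_seq bu.
have zr : nm (z - p) <= rho.
  apply: (@closed1_disc R p rho) => d d0; have [n _ hn] := hz d 0%N d0.
  by exists (u n) => //; have [v []] := hu n.
have e2 : 0 < e / 2 by lra.
have [d d0 hd] := cg z zr _ e2.
have d2 : 0 < d / 2 by lra.
pose N := Num.bound (2 / d).
have [n Nn hn] := hz _ N d2.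
have [v [h1 h2 h3 h4]] := hu n.
have nd : n.+1%:R^-1 < d / 2.
  rewrite invf_plt ?posrE // invf_div; apply: lt_le_trans (archi_boundP _) _.
    by rewrite divr_ge0 // ltW.
  by rewrite ler_nat; apply: leq_trans Nn _.
have h5 := lt_trans h3 nd; clear nd h3.
have k1 : nm (g (u n) - g z) < e / 2 by apply: hd; lra.
have k2 : nm (g v - g z) < e / 2.
  by apply: hd; have := nm_tri v (u n) z; rewrite (nm_distC v (u n)); lra.
by have := nm_tri (g (u n)) (g z) (g v); rewrite (nm_distC (g z)); lra.
Qed.

Lemma cdif_sqrtc z : 0 < Re z -> cdif (@sqrtc R) z.
Proof.
move=> z0.
have pos w : 0 < Re w -> 0 < Re (sqrtc w).
  move=> w0; have := sqr_sqrtc w; have : 0 <= Re (sqrtc w) by case: (w) => a b /=; exact: sqrtr_ge0.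
  rewrite le_eqVlt => /orP[/eqP E|//].
  case: (sqrtc w) E => a b /= <-; rewrite expr2 => /(congr1 (@complex.Re R)) /=.
  by move=> h; have := sqr_ge0 b; nra.
pose q w := (sqrtc w + sqrtc z)^-1.
have sz := pos z z0.
have den w : 0 < Re w -> Re (sqrtc z) <= nm (sqrtc w + sqrtc z).
  by move=> /pos w0; apply: le_trans (Re_le_nm _); rewrite ReD; lra.
have E w : 0 < Re w -> sqrtc w - sqrtc z = (w - z) / (sqrtc w + sqrtc z).
  move=> w0; apply: (mulIf (_ : sqrtc w + sqrtc z != 0)).
    by rewrite -nm_gt0; apply: lt_le_trans (den w w0).
  by rewrite divfK ?(-nm_gt0) -?subr_sqr ?sqr_sqrtc // -nm_gt0; apply: lt_le_trans (den w w0).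
have half w : nm (w - z) < Re z -> 0 < Re w.
  by move=> h; have := Re_le_nm (z - w); rewrite nm_distC ReB; lra.
have cs : ccont (@sqrtc R) z.
  move=> e e0; exists (Num.min (Re z) (e * Re (sqrtc z))).
    by rewrite lt_min z0 mulr_gt0.
  move=> w; rewrite lt_min => /andP[/half w0 h].
  rewrite E // nmf_div ltr_pdivrMr; last by apply: lt_le_trans (den w w0).
  by apply: lt_le_trans h _; rewrite ler_pM2l //; exact: den.
apply: (@cdif_near R (fun w => sqrtc z + q w * (w - z)) _ z (Re z) z0).
  by move=> w /half w0; rewrite /q mulrC -E // addrC subrK.
exists q => [|w]; last by rewrite subrr mulr0 addr0 addrAC subrr add0r.
apply: ccontV; first by rewrite -nm_gt0; apply: lt_le_trans (den z z0).
by apply: ccontD => //; exact: ccont_cst.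
Qed.

(** Along the segment from 0 to w the ratios of consecutive values of g at N equidistant points lie
    in the right half plane, where the principal root is holomorphic; g is g(0) times their
    product. *)
Lemma disc_sqrt g rho : 0 <= rho -> (forall w, nm w <= rho -> cdif g w) ->
  (forall w, nm w <= rho -> g w != 0) ->
  exists2 G, forall w, nm w <= rho -> cdif G w &
    forall w, nm w <= rho -> G w ^+ 2 = g w.
Proof.
move=> rho0 dg gn0.
have [M M0 hM] : exists2 M : R, 0 <= M & forall w, nm (w - 0) <= rho -> nm (g w)^-1 <= M.
  by apply: disc_bounded => z; rewrite subr0 => hz; apply: ccontV; [exact: gn0|exact/cdif_ccont/dg].
have e0 : 0 < 1 / 2 / (M + 1) by rewrite !divr_gt0 //; lra.
have [|d d0 hd] := @disc_uniform g 0 rho _ _ e0.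
  by move=> z; rewrite subr0 => /dg/cdif_ccont.
pose N := (Num.bound (rho / d)).+1.
have N0 : (0 : R) < N%:R by rewrite ltr0n.
have NC : (N%:R : C) != 0 by rewrite pnatr_eq0.
have rN : rho / N%:R < d.
  rewrite ltr_pdivrMr // mulrC -ltr_pdivrMr //.
  apply: lt_le_trans (archi_boundP _) _; first by rewrite divr_ge0 // ltW.
  by rewrite ler_nat.
pose t k w : C := w * (k%:R / N%:R).
have tle k w : (k <= N)%N -> nm w <= rho -> nm (t k w) <= rho.
  move=> kN hw; rewrite /t nmM nmf_div !nm_nat.
  have : k%:R / N%:R <= (1 : R) by rewrite ler_pdivrMr // mul1r ler_nat.
  have : 0 <= k%:R / N%:R :> R by rewrite divr_ge0.
  have := nm_ge0 w; set a := k%:R / N%:R; nra.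
pose rt k w := g (t k.+1 w) / g (t k w).
have rt1 k w : (k < N)%N -> nm w <= rho -> 0 < Re (rt k w).
  move=> kN hw; have h1 := tle _ _ kN hw; have h2 := tle _ _ (ltnW kN) hw.
  have : nm (rt k w - 1) < 1 / 2.
    rewrite /rt -[1](divff (gn0 _ h2)) -mulrBl nmM.
    have := hM (t k w); rewrite subr0 => /(_ h2) k1.
    have := hd (t k.+1 w) (t k w); rewrite !subr0 => /(_ h1 h2).
    rewrite /t -mulrBr -mulrBl -[k.+1]addn1 natrD addrAC subrr add0r nmM nmf_div nm1 nm_nat mul1r.
    have hh : nm w / N%:R < d by apply: le_lt_trans rN; rewrite ler_pM2r ?invr_gt0.
    move=> /(_ hh) k2; set A := nm (g _ - g _) in k2 *.
    have M1 : 0 < M + 1 by lra.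
    rewrite ltr_pdivlMr // in k2.
    apply: le_lt_trans (_ : A * (M + 1) < _) => //.
    by apply: ler_wpM2l; rewrite ?nm_ge0 //; lra.
  have := Re_le_nm (1 - rt k w); rewrite nm_distC ReB /=; lra.
have prodE n w : (n <= N)%N -> nm w <= rho -> g 0 * \prod_(k < n) rt k w = g (t n w).
  move=> nN hw; elim: n nN => [|n IH] nN.
    by rewrite big_ord0 mulr1 /t mul0r mulr0.
  rewrite big_ord_recr /= mulrA IH ?(ltnW nN) // /rt mulrCA divff ?mulr1 //.
  by apply: gn0; apply: tle => //; exact: ltnW.
exists (fun w => sqrtc (g 0) * \prod_(k < N) sqrtc (rt k w)).
  move=> w hw; apply: cdifZ; apply: (@cdif_prod R N (fun k w => sqrtc (rt k w))) => k kN.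
  apply: (cdif_comp (h := @sqrtc R)); last by apply: cdif_sqrtc; exact: rt1.
  have dt j : cdif (t j) w by apply: cdifM; [exact: cdif_id|exact: cdif_cst].
  have h1 := tle _ _ kN hw; have h2 := tle _ _ (ltnW kN) hw.
  apply: cdif_div; first exact: gn0.
    by apply: cdif_comp => //; exact: dg.
  by apply: cdif_comp => //; exact: dg.
move=> w hw; rewrite exprMn sqr_sqrtc -prodrXl.
under eq_bigr => k _ do rewrite sqr_sqrtc.
by rewrite prodE // /t divff // mulr1.
Qed.

Lemma disc_root j g rho : 0 <= rho -> (forall w, nm w <= rho -> cdif g w) ->
  (forall w, nm w <= rho -> g w != 0) ->
  exists2 G, forall w, nm w <= rho -> cdif G w &
    forall w, nm w <= rho -> G w ^+ (2 ^ j) = g w.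
Proof.
move=> rho0; elim: j g => [|j IH] g dg gn0; first by exists g.
have [G dG hG] := disc_sqrt rho0 dg gn0.
have [|Q dQ hQ] := IH G dG.
  by move=> w hw; have := gn0 w hw; rewrite -hG // expf_eq0.
by exists Q => // w hw; rewrite expnSr exprM hQ // hG.
Qed.

(** Both sides scale like ln |g|, so g may be replaced by a root of order 2^j, whose logarithm is
    bounded by lam < 1/32. This root divided by its value at 0 is so close to 1 that [schwarz_one]
    with M = exp(2 lam) is linear in lam. High roots thus replace a logarithm of g. *)
Lemma harnack g rho (L : R) : 0 < rho -> 0 < L ->
  (forall w, nm w <= rho -> cdif g w) -> (forall w, nm w <= rho -> g w != 0) ->
  (forall w, nm w <= rho -> `|ln (nm (g w))| <= L) ->
  forall w, nm w <= rho / 2 ->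
    `|ln (nm (g w)) - ln (nm (g 0))| <= 32 * L * nm w / rho.
Proof.
move=> rho0 L0 dg gn0 hL w hw.
have e32 : (0 : R) < 1 / 32 by lra.
have [j hj] := half_pow_small L e32.
have hj0 : 0 < (2 : R) ^+ j by rewrite exprn_gt0.
set lam := L / 2 ^+ j in hj.
have lam0 : 0 < lam by rewrite divr_gt0.
have [G dG hG] := disc_root j (ltW rho0) dg gn0.
have h00 : nm (0 : C) <= rho by rewrite nm0 ltW.
have Gn0 v : nm v <= rho -> G v != 0.
  by move=> hv; have := gn0 v hv; rewrite -hG // expf_eq0 negb_and => /orP[|//]; rewrite expn_gt0.
have lnG v : nm v <= rho -> ln (nm (g v)) = ln (nm (G v)) * 2 ^+ j.
  by move=> hv; rewrite -hG // nmX lnXn ?nm_gt0 ?Gn0 // -[_ *+ (2 ^ j)]mulr_natr natrX.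
have bG v : nm v <= rho -> `|ln (nm (G v))| <= lam.
  move=> hv; have := hL v hv; rewrite lnG // normrM (ger0_norm (ltW hj0)).
  by rewrite /lam ler_pdivlMr.
pose P v := G v / G 0.
have nP v : nm v <= rho -> 0 < nm (P v) by move=> hv; rewrite nmf_div divr_gt0 // nm_gt0 Gn0.
have lnP v : nm v <= rho -> ln (nm (P v)) = ln (nm (G v)) - ln (nm (G 0)).
  by move=> hv; rewrite nmf_div ln_div ?posrE ?nm_gt0 ?Gn0.
have exple (x : R) : 0 <= x <= 1 / 2 -> expR x <= 1 + 2 * x.
  move=> hx; have := expR_ge1Dx (- x); have := expRxMexpNx_1 x; have := expR_gt0 x.
  set a := expR x; set b := expR (- x) => a0 ab h.
  have : a * (1 - x) <= a * b by rewrite ler_wpM2l ?(ltW a0) //; lra.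
  rewrite ab; nra.
have M1 : 1 < expR (2 * lam) by rewrite expR_gt1 mulr_gt0.
have K := @schwarz_one R P rho (expR (2 * lam)) rho0 M1 _ _ _ w hw.
have {}K : nm (P w - 1) <= 2 * (expR (2 * lam) ^+ 2 - 1) * nm w / rho.
  apply: K.
  - by rewrite /P divff // Gn0.
  - by move=> v hv; apply: cdif_div; rewrite ?Gn0 //; [exact: dG|exact: cdif_cst].
  - move=> v hv; rewrite -[leLHS]lnK ?posrE ?nP // ler_expR lnP //.
    by have := bG v hv; have := bG 0 h00; rewrite !ler_norml; lra.
have hw' : nm w <= rho by lra.
set t := nm w / rho.
have t2 : t <= 1 / 2 by rewrite ler_pdivrMr //; lra.
have t0 : 0 <= t by rewrite divr_ge0 ?nm_ge0 // ltW.
have K1 : nm (P w - 1) <= 16 * lam * t.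
  apply: le_trans K _; rewrite -mulrA -/t; apply: ler_wpM2r => //.
  have := exple (2 * lam * 2); rewrite expRM_natr => H.
  have : expR (2 * lam) ^+ 2 <= 1 + 2 * (2 * lam * 2) by apply: H; lra.
  lra.
have d1 : 16 * lam * t <= 1 / 4 by nra.
set del := 16 * lam * t in K1 d1.
have del0 : 0 <= del.
  by apply: mulr_ge0 => //; apply: mulr_ge0 => //; exact: ltW.
have ub : nm (P w) <= 1 + del by have := nm_sub_ge (P w) 1; rewrite nm1; lra.
have lb : 1 - del <= nm (P w).
  by have := nm_sub_ge 1 (P w); rewrite nm1 nm_distC; lra.
have l1 : ln (nm (P w)) <= del.
  apply: le_trans (_ : ln (1 + del) <= _); last by apply: le_ln1Dx; lra.
  by rewrite ler_ln ?posrE ?nP //; lra.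
have l2 : - (2 * del) <= ln (nm (P w)).
  rewrite lerNl -lnV ?posrE ?nP //.
  apply: le_trans (_ : ln (1 + 2 * del) <= _); last by apply: le_ln1Dx; lra.
  rewrite ler_ln ?posrE ?invr_gt0 ?nP //; last by lra.
  rewrite -[_^-1]mul1r ler_pdivrMr ?nP //; nra.
have l3 : `|ln (nm (P w))| <= 2 * del by rewrite ler_norml; lra.
rewrite !lnG // -mulrBl -lnP // normrM (ger0_norm (ltW hj0)).
have -> : 32 * L * nm w / rho = 2 * del * 2 ^+ j.
  by rewrite /del /t /lam; field; rewrite !gt_eqF.
by rewrite ler_wpM2r // ltW.
Qed.

End Harnack.

(** * Orbits of sequences of Henon maps *)

Section PolynomialGrowth.
Variable R : realType.
Local Notation C := R[i].
Implicit Types (p : {poly C}) (y e : C) (M : R).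

Lemma nm_sum n (F : 'I_n -> C) : nm (\sum_(i < n) F i) <= \sum_(i < n) nm (F i).
Proof.
elim: n F => [|n IH] F; first by rewrite !big_ord0 nm0.
rewrite !big_ord_recr /=; apply: le_trans (nmD _ _) _.
by rewrite lerD2r; exact: IH.
Qed.

Lemma pow_lip k y y' M : nm y <= M -> nm y' <= M ->
  nm (y' ^+ k - y ^+ k) <= k%:R * M ^+ k.-1 * nm (y' - y).
Proof.
move=> hy hy'; have M0 : 0 <= M by apply: le_trans hy; exact: nm_ge0.
rewrite subrXX nmM mulrC; apply: ler_wpM2r; first exact: nm_ge0.
apply: le_trans (nm_sum _) _.
have -> : k%:R * M ^+ k.-1 = \sum_(i < k) M ^+ k.-1 by rewrite sumr_const card_ord mulr_natl.
apply: ler_sum => i _; rewrite nmM !nmX.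
have ik : (i <= k.-1)%N by have := ltn_ord i; lia.
rewrite -{2}(subnK ik) exprD; apply: ler_pM; rewrite ?exprn_ge0 ?nm_ge0 //.
  by apply: lerXn2r; rewrite ?nnegrE ?nm_ge0.
by apply: lerXn2r; rewrite ?nnegrE ?nm_ge0.
Qed.

Lemma pow_taylor k y e M : nm y <= M -> nm (y + e) <= M -> 0 < M ->
  nm ((y + e) ^+ k - y ^+ k - k%:R * y ^+ k.-1 * e) <= k%:R ^+ 2 * M ^+ k.-2 * nm e ^+ 2.
Proof.
move=> hy hye M0; elim: k => [|k IH].
  by rewrite !expr0 subrr sub0r !mul0r oppr0 nm0 expr0n /= !mul0r.
have [->|k0] := eqVneq k 0%N.
  rewrite !expr1 !expr0 mul1r mulr1 mul1r (_ : y + e - y - e = 0); last by ring.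
  by rewrite nm0 mulr_ge0 ?exprn_ge0 ?nm_ge0.
have -> : (y + e) ^+ k.+1 - y ^+ k.+1 - k.+1%:R * y ^+ k.+1.-1 * e =
   (y + e) * ((y + e) ^+ k - y ^+ k - k%:R * y ^+ k.-1 * e) + k%:R * y ^+ k.-1 * e ^+ 2.
  case: k k0 {IH} => // k _ /=; rewrite !exprS -natr1; ring.
apply: le_trans (nmD _ _) _; rewrite nmM.
have h1 : nm (y + e) * nm ((y + e) ^+ k - y ^+ k - k%:R * y ^+ k.-1 * e) <=
    k%:R ^+ 2 * M ^+ k.-1 * nm e ^+ 2.
  case: k k0 IH => // -[_ _|k _ IH].
    rewrite expr1 !expr0 mul1r mulr1 mul1r (_ : y + e - y - e = 0); last by ring.
    by rewrite nm0 mulr0 mulr_ge0 ?exprn_ge0 ?nm_ge0.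
  apply: le_trans (ler_pM _ _ hye IH) _; rewrite ?nm_ge0 //=.
  by rewrite [M ^+ k.+1]exprS le_eqVlt; apply/orP; left; apply/eqP; ring.
have h2 : nm (k%:R * y ^+ k.-1 * e ^+ 2) <= k%:R * M ^+ k.-1 * nm e ^+ 2.
  rewrite nmM nmX; apply: ler_wpM2r; first by rewrite exprn_ge0 ?nm_ge0.
  rewrite nmM nmX nm_nat; by apply: ler_wpM2l => //; apply: lerXn2r; rewrite ?nnegrE ?nm_ge0 ?(ltW M0).
apply: le_trans (lerD h1 h2) _.
have -> : k%:R ^+ 2 * M ^+ k.-1 * nm e ^+ 2 + k%:R * M ^+ k.-1 * nm e ^+ 2 =
  (k%:R ^+ 2 + k%:R) * (M ^+ k.-1 * nm e ^+ 2) by ring.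
rewrite /= -mulrA; apply: ler_wpM2r.
  by rewrite mulr_ge0 ?exprn_ge0 ?nm_ge0 // ltW.
rewrite -natr1; have : (0 : R) <= k%:R by []. nra.
Qed.

Lemma poly_bound p d : (size p <= d.+1)%N -> exists2 K : R, 0 <= K &
  forall y M, 1 <= M -> nm y <= M -> nm p.[y] <= K * M ^+ d.
Proof.
move=> sp; exists (\sum_(i < size p) nm p`_i); first by apply: sumr_ge0 => i _; exact: nm_ge0.
move=> y M M1 hy; rewrite horner_coef; apply: le_trans (nm_sum _) _.
rewrite mulr_suml; apply: ler_sum => i _; rewrite nmM nmX ler_wpM2l ?nm_ge0 //.
apply: le_trans (_ : M ^+ i <= _).
  by apply: lerXn2r; rewrite ?nnegrE ?nm_ge0 // (le_trans ler01).
apply: ler_weXn2l => //; have := ltn_ord i; lia.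
Qed.

Lemma poly_lip p d : (size p <= d.+1)%N -> exists2 K : R, 0 <= K &
  forall y y' M, 1 <= M -> nm y <= M -> nm y' <= M ->
    nm (p.[y'] - p.[y]) <= K * M ^+ d.-1 * nm (y' - y).
Proof.
move=> sp; exists (\sum_(i < size p) nm p`_i * i%:R).
  by apply: sumr_ge0 => i _; rewrite mulr_ge0 ?nm_ge0.
move=> y y' M M1 hy hy'; rewrite !horner_coef -sumrB; apply: le_trans (nm_sum _) _.
rewrite !mulr_suml; apply: ler_sum => i _; rewrite -mulrBr nmM -!mulrA.
apply: ler_wpM2l; first exact: nm_ge0.
apply: le_trans (pow_lip _ hy hy') _; rewrite -mulrA; apply: ler_wpM2l => //.
apply: ler_wpM2r; first exact: nm_ge0.
apply: ler_weXn2l => //; have := ltn_ord i; lia.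
Qed.

End PolynomialGrowth.

(** * Uniform constants for a Hénon map *)

Section Tame.
Variable R : realType.
Local Notation C := R[i].
Implicit Types (h : henon_data R) (K : R).

Definition hdeg h : nat := henon_degree h.
Definition hlead h : C := lead_coef h.1.

(** Everything that later estimates use about one map, with a single constant. [tame_lead] and
    [tame_taylor] say that for large y the polynomial and its increments are governed by the leading
    term, with one power of y to spare. *)
Record tame K h : Prop := Tame {
  tame_ge1 : 1 <= K;
  tame_deg2 : (2 <= hdeg h)%N;
  tame_degK : (hdeg h)%:R <= K;
  tame_jac_lb : K^-1 <= nm h.2;
  tame_jac_ub : nm h.2 <= K;
  tame_lead_lb : K^-1 <= nm (hlead h);
  tame_lead_ub : nm (hlead h) <= K;
  tame_lead : forall y, 1 <= nm y ->
    nm (h.1.[y] - hlead h * y ^+ hdeg h) <= K * nm y ^+ (hdeg h).-1;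
  tame_taylor : forall y e, 1 <= nm y -> nm e <= nm y ->
    nm (h.1.[y + e] - h.1.[y] - (hdeg h)%:R * hlead h * y ^+ (hdeg h).-1 * e) <=
      K * nm y ^+ (hdeg h).-2 * (1 + nm e) * nm e;
  tame_lip : forall y y' M, 1 <= M -> nm y <= M -> nm y' <= M ->
    nm (h.1.[y'] - h.1.[y]) <= K * M ^+ (hdeg h).-1 * nm (y' - y);
  tame_bound : forall y M, 1 <= M -> nm y <= M -> nm h.1.[y] <= K * M ^+ hdeg h }.

Lemma tame_mono K K' h : K <= K' -> tame K h -> tame K' h.
Proof.
move=> KK [K1 d2 dK j1 j2 l1 l2 ld ty lp bd].
have K0 : 0 < K by lra.
have iK : K'^-1 <= K^-1 by rewrite lef_pV2 ?posrE //; lra.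
split=> //; try lra.
- move=> y y1; apply: le_trans (ld y y1) _; apply: ler_wpM2r => //.
  by rewrite exprn_ge0 ?nm_ge0.
- move=> y e y1 ey; apply: le_trans (ty y e y1 ey) _; rewrite -!mulrA; apply: ler_wpM2r => //.
  by rewrite !mulr_ge0 ?addr_ge0 ?exprn_ge0 ?nm_ge0.
- move=> y y' M M1 hy hy'; apply: le_trans (lp y y' M M1 hy hy') _.
  rewrite -!mulrA; apply: ler_wpM2r => //.
  by rewrite mulr_ge0 ?exprn_ge0 ?nm_ge0 //; lra.
- move=> y M M1 hy; apply: le_trans (bd y M M1 hy) _; apply: ler_wpM2r => //.
  by rewrite exprn_ge0 //; lra.
Qed.

Lemma exists_tame1 h : is_henon h -> exists K, tame K h.
Proof.
case: h => p a /andP[/= d2 a0].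
set d := henon_degree (p, a) in d2.
have sp : size p = d.+1 by rewrite /d /henon_degree /= in d2 *; case: (size p) d2.
set c := lead_coef p.
have c0 : c != 0 by rewrite lead_coef_eq0 -size_poly_gt0 sp.
pose q := p - c *: 'X^d.
have sq : (size q <= d)%N.
  apply/leq_sizeP => j dj; rewrite coefB coefZ coefXn.
  move: dj; rewrite leq_eqVlt => /orP[/eqP <-|dj].
    by rewrite eqxx mulr1 /c lead_coefE sp subrr.
  by rewrite gtn_eqF // mulr0 subr0; apply: nth_default; rewrite sp.
have pq y : p.[y] = c * y ^+ d + q.[y] by rewrite /q hornerD hornerN hornerZ hornerXn; ring.
have sq' : (size q <= d.-1.+1)%N by rewrite prednK //; lia.
have sp' : (size p <= d.+1)%N by rewrite sp.
have [k1 k10 hk1] := poly_bound sq'.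
have [k2 k20 hk2] := poly_lip sq'.
have [k3 k30 hk3] := poly_lip sp'.
have [k4 k40 hk4] := poly_bound sp'.
have a0' : 0 < nm a by rewrite nm_gt0.
have c0' : 0 < nm c by rewrite nm_gt0.
pose b1 := k2 * 2 ^+ d.-2; pose b2 := nm c * d%:R ^+ 2 * 2 ^+ d.-2.
pose K := 1 + d%:R + nm a + (nm a)^-1 + nm c + (nm c)^-1 + k1 + b1 + b2 + k3 + k4.
have b10 : 0 <= b1 by rewrite mulr_ge0 ?exprn_ge0.
have b20 : 0 <= b2 by rewrite !mulr_ge0 ?exprn_ge0 ?nm_ge0.
have ia : 0 < (nm a)^-1 by rewrite invr_gt0.
have ic : 0 < (nm c)^-1 by rewrite invr_gt0.
have d0 : (0 : R) <= d%:R by [].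
have K0 : 0 < K by rewrite /K; lra.
exists K; split=> //=; rewrite -?/d -?/c.
- by rewrite /K; lra.
- by rewrite /K /hdeg -/d; lra.
- by rewrite -[leRHS]invrK lef_pV2 ?posrE // /K; lra.
- by rewrite /K; lra.
- by rewrite /hlead /= -/c -[leRHS]invrK lef_pV2 ?posrE // /K; lra.
- by rewrite /hlead /= -/c /K; lra.
- move=> y y1; rewrite /hlead /hdeg /= -/c -/d pq addrAC subrr add0r.
  apply: le_trans (hk1 y (nm y) y1 (lexx _)) _; apply: ler_wpM2r.
    by rewrite exprn_ge0 ?nm_ge0.
  by rewrite /K; lra.
- move=> y e y1 ey; rewrite /hlead /hdeg /= -/c -/d !pq.
  have -> : c * (y + e) ^+ d + q.[y + e] - (c * y ^+ d + q.[y]) - d%:R * c * y ^+ d.-1 * e =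
    c * ((y + e) ^+ d - y ^+ d - d%:R * y ^+ d.-1 * e) + (q.[y + e] - q.[y]) by ring.
  have y2 : nm y <= 2 * nm y by lra.
  have ye2 : nm (y + e) <= 2 * nm y by have := nmD y e; lra.
  have y20 : 0 < 2 * nm y by lra.
  apply: le_trans (nmD _ _) _; rewrite nmM.
  have h1 := pow_taylor d y2 ye2 y20.
  have h2 := hk2 y (y + e) (2 * nm y) _ y2 ye2.
  rewrite addrAC subrr add0r in h2.
  apply: le_trans (lerD (ler_wpM2l (nm_ge0 c) h1) (h2 _)) _; first by lra.
  rewrite !exprMn.
  have -> : nm c * (d%:R ^+ 2 * (2 ^+ d.-2 * nm y ^+ d.-2) * nm e ^+ 2) +
      k2 * (2 ^+ d.-1.-1 * nm y ^+ d.-1.-1) * nm e =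
      nm y ^+ d.-2 * (b2 * nm e + b1) * nm e by rewrite /b1 /b2; ring.
  apply: ler_wpM2r; first exact: nm_ge0.
  have -> : K * nm y ^+ d.-2 * (1 + nm e) = nm y ^+ d.-2 * (K * (1 + nm e)) by ring.
  apply: ler_wpM2l; first by rewrite exprn_ge0 ?nm_ge0.
  rewrite mulrDr mulr1 addrC; apply: lerD; first by rewrite /K; lra.
  by apply: ler_wpM2r; rewrite ?nm_ge0 // /K; lra.
- move=> y y' M M1 hy hy'; apply: le_trans (hk3 y y' M M1 hy hy') _.
  rewrite -!mulrA; apply: ler_wpM2r; last by rewrite /K; lra.
  by rewrite mulr_ge0 ?exprn_ge0 ?nm_ge0 //; lra.
- move=> y M M1 hy; apply: le_trans (hk4 y M M1 hy) _; apply: ler_wpM2r.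
    by rewrite exprn_ge0 //; lra.
  by rewrite /K; lra.
Qed.

Lemma exists_tame (hs : seq (henon_data R)) : all (@is_henon R) hs ->
  exists2 K, 1 <= K & forall h, h \in hs -> tame K h.
Proof.
elim: hs => [|h hs IH]; first by exists 1.
move=> /= /andP[/exists_tame1[K hK] /IH[K' K'1 hK']].
exists (Num.max K K'); first by rewrite le_max K'1 orbT.
move=> h'; rewrite inE => /orP[/eqP ->|/hK' H].
  by apply: tame_mono hK; rewrite le_max lexx.
by apply: tame_mono H; rewrite le_max lexx orbT.
Qed.

End Tame.

(** * Orbits under a sequence of Hénon maps *)

Section Orbits.
Variable R : realType.
Local Notation C := R[i].
Implicit Types (s : nat -> henon_data R) (z w : C2 R).

Definition sshift s k : nat -> henon_data R := fun i => s (k + i)%N.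

(** A step is a single Hénon map, so that the new first coordinate is the old second one ([orb1]).
    The composite map is recovered from the periodic sequence [cyc]. *)
Fixpoint orb s n z : C2 R := if n is n'.+1 then henon (s n') (orb s n' z) else z.

Fixpoint orbV s n z : C2 R :=
  if n is n'.+1 then orbV s n' (henon_inv (s n') z) else z.

Fixpoint Deg s n : R := if n is n'.+1 then Deg s n' * (hdeg (s n'))%:R else 1.

Lemma orb_shift s k n z : orb s (k + n) z = orb (sshift s k) n (orb s k z).
Proof. by elim: n => [|n IH]; rewrite ?addn0 // addnS /= IH. Qed.

Lemma orbV_shift s k n z : orbV s (k + n) z = orbV s k (orbV (sshift s k) n z).
Proof. by elim: n z => [|n IH] z; rewrite ?addn0 // addnS /= IH. Qed.

Lemma Deg_shift s k n : Deg s (k + n) = Deg s k * Deg (sshift s k) n.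
Proof. by elim: n => [|n IH]; rewrite ?addn0 ?mulr1 // addnS /= IH mulrA. Qed.

Lemma orbitK s n : (forall k, (s k).2 != 0) -> cancel (orb s n) (orbV s n).
Proof.
by move=> s0; elim: n => [|n IH] z //=; rewrite henonK.
Qed.

Lemma orbitVK s n : (forall k, (s k).2 != 0) -> cancel (orbV s n) (orb s n).
Proof.
by move=> s0; elim: n => [|n IH] z //=; rewrite IH henon_invK.
Qed.

Lemma orb1 s n z : (orb s n.+1 z).1 = (orb s n z).2. Proof. by []. Qed.

Lemma orb2 s n z :
  (orb s n.+1 z).2 = (s n).1.[(orb s n z).2] - (s n).2 * (orb s n z).1.
Proof. by []. Qed.

Definition n2 z : R := Num.max (nm z.1) (nm z.2).

Lemma n2_ge0 z : 0 <= n2 z. Proof. by rewrite le_max nm_ge0. Qed.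
Lemma n2_1 z : nm z.1 <= n2 z. Proof. by rewrite le_max lexx. Qed.
Lemma n2_2 z : nm z.2 <= n2 z. Proof. by rewrite le_max lexx orbT. Qed.
Lemma n2_le z (r : R) : (n2 z <= r) = (nm z.1 <= r) && (nm z.2 <= r).
Proof. by rewrite ge_max. Qed.
End Orbits.

(** * Escape region and logarithmic growth *)

Section Green.
Variable R : realType.
Local Notation C := R[i].
Variable K : R.
Hypothesis K1 : 1 <= K.

(* The radius beyond which |y| dominates the dynamics. *)
Definition esc_rad : R := locked (100 * K ^+ 4).
Local Notation rad := esc_rad.

(* The additive error, per step, of ln |(x, y)| under a Henon map. *)
Definition esc_err : R := locked (K * (ln (16 * K * rad) + 1)).
Local Notation err := esc_err.

Definition adm (s : nat -> henon_data R) := forall k, tame K (s k).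

Implicit Types (s : nat -> henon_data R) (z w : C2 R) (h : henon_data R).

Lemma adm_shift s k : adm s -> adm (sshift s k).
Proof. by move=> hs i; exact: hs. Qed.

Lemma K_gt0 : 0 < K. Proof. exact: lt_le_trans K1. Qed.
Hint Resolve K_gt0 : core.

Lemma rad_ge n : (n <= 4)%N -> 100 * K ^+ n <= rad.
Proof. by move=> n4; rewrite /rad -lock ler_pM2l //; apply: ler_weXn2l. Qed.

Lemma rad_ge100 : 100 <= rad. Proof. by have := @rad_ge 0 isT; rewrite mulr1. Qed.

Lemma rad_gt0 : 0 < rad. Proof. by have := rad_ge100; lra. Qed.
Hint Resolve rad_gt0 : core.

Definition Vplus z := rad <= nm z.2 /\ nm z.1 <= 2 * nm z.2.
(** Forward invariant and entered by every orbit. The factor 2 is slack: one step improves it to 1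
    ([W_step]), so that points near a point of W are in W one step later ([W_near]). *)
Definition Wset z := nm z.1 <= 2 * Num.max (nm z.2) rad.

Lemma WsetE z : Wset z = (nm z.1 <= 2 * Num.max (nm z.2) rad). Proof. by []. Qed.

Lemma Vplus_W z : Vplus z -> Wset z.
Proof. by move=> [h1 h2]; rewrite /Wset; apply: le_trans h2 _; rewrite ler_pM2l // le_max lexx. Qed.

Lemma W_Vplus z : Wset z -> rad <= nm z.2 -> Vplus z.
Proof. by move=> hW h; split=> //; move: hW; rewrite /Wset max_l. Qed.

Lemma tame_jac h : tame K h -> h.2 != 0.
Proof.
move=> th; rewrite -nm_gt0; apply: lt_le_trans (tame_jac_lb th).
by rewrite invr_gt0.
Qed.

Lemma Vplus_step h z : tame K h -> Vplus z ->
  [/\ nm ((henon h z).2 - hlead h * z.2 ^+ hdeg h) <= 3 * K * nm z.2 ^+ (hdeg h).-1,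
      nm z.2 ^+ hdeg h / (2 * K) <= nm (henon h z).2,
      nm (henon h z).2 <= 2 * K * nm z.2 ^+ hdeg h &
      4 * nm z.2 <= nm (henon h z).2].
Proof.
move=> th [hR hx]; have d2 := tame_deg2 th.
set d := hdeg h in d2 *; set y := z.2 in hR hx *.
have R1 := rad_ge100; have RK := @rad_ge 1 isT; have RK2 := @rad_ge 2 isT.
rewrite expr1 in RK.
have y1 : 1 <= nm y by lra.
have y0 : 0 < nm y by lra.
have yd1 : nm y <= nm y ^+ d.-1.
  by rewrite -[leLHS]expr1; apply: ler_weXn2l => //; lia.
have ydE : nm y ^+ d = nm y * nm y ^+ d.-1.
  by rewrite -exprS prednK // (leq_trans _ d2).
have P0 : 0 < nm y ^+ d.-1 by rewrite exprn_gt0.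
have k1 := K1; have k0 := K_gt0.
have A : nm ((henon h z).2 - hlead h * y ^+ d) <= 3 * K * nm y ^+ d.-1.
  have -> : (henon h z).2 - hlead h * y ^+ d = (h.1.[y] - hlead h * y ^+ d) - h.2 * z.1.
    by rewrite /= -/y addrAC.
  apply: le_trans (nmB _ _) _; rewrite nmM.
  have h1 := tame_lead th y1; rewrite -/d in h1.
  have h2 : nm h.2 * nm z.1 <= K * (2 * nm y).
    by apply: ler_pM; rewrite ?nm_ge0 // (tame_jac_ub th).
  have h3 : K * nm y <= K * nm y ^+ d.-1 by rewrite ler_pM2l.
  move: h1 h2 h3; set a := nm (_ - _); set b := _ * nm z.1; set e := nm y ^+ d.-1.
  by clear; lra.
have c1 : nm y ^+ d / K <= nm (hlead h * y ^+ d).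
  by rewrite nmM nmX mulrC ler_pM2r ?exprn_gt0 // (tame_lead_lb th).
have c2 : nm (hlead h * y ^+ d) <= K * nm y ^+ d.
  by rewrite nmM nmX ler_pM2r ?exprn_gt0 // (tame_lead_ub th).
have t1 := nm_sub_ge (hlead h * y ^+ d) (henon h z).2.
have t2 := nm_sub_ge (henon h z).2 (hlead h * y ^+ d).
rewrite nm_distC in t1; rewrite ydE in c1 c2 *.
move: A c1 c2 t1 t2; set N := nm (_ - _); set M := nm (_ * y ^+ d).
set N' := nm (henon h z).2; set P := nm y ^+ d.-1 in P0 yd1 *.
set Y := nm y in hR y1 y0 yd1 *.
clear -hR y1 y0 yd1 P0 k1 k0 RK RK2 => A c1 c2 t1 t2.
have YP0 : 0 < Y * P by rewrite mulr_gt0.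
have Q : 3 * K * P <= Y * P / (2 * K).
  rewrite ler_pdivlMr ?mulr_gt0 // mulrAC; apply: ler_wpM2r; first exact: ltW.
  by have -> : 3 * K * (2 * K) = 6 * K ^+ 2 by [ring]; have := sqr_ge0 K; lra.
have Q2 : Y * P / K = Y * P / (2 * K) + Y * P / (2 * K) by field; rewrite gt_eqF.
have Q3 : Y * P / (2 * K) <= K * (Y * P).
  by rewrite ler_pdivrMr ?mulr_gt0 //; nra.
split; [exact: A|lra|lra|].
have Q4 : Y * (8 * K) <= Y * P by rewrite ler_pM2l //; lra.
have Q5 : 4 * Y <= Y * P / (2 * K) by rewrite ler_pdivlMr ?mulr_gt0 //; lra.
lra.
Qed.

Lemma W_step h z : tame K h -> Wset z -> nm (henon h z).1 <= Num.max (nm (henon h z).2) rad.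
Proof.
move=> th hW; rewrite [(henon h z).1]/=; have [hy|hy] := leP rad (nm z.2).
  have [_ _ _ h4] := Vplus_step th (W_Vplus hW hy).
  by rewrite le_max; apply/orP; left; have := nm_ge0 z.2; lra.
by rewrite le_max (ltW hy) orbT.
Qed.

Lemma W_henon h z : tame K h -> Wset z -> Wset (henon h z).
Proof.
move=> th /(W_step th) hh; rewrite /Wset.
have : 0 <= Num.max (nm (henon h z).2) rad by rewrite le_max nm_ge0.
lra.
Qed.

Lemma Vplus_henon h z : tame K h -> Vplus z -> Vplus (henon h z).
Proof.
move=> th hV; have [_ _ _ h4] := Vplus_step th hV; case: hV => hR _.
by split; have := nm_ge0 z.2; rewrite /= in h4 *; lra.
Qed.

Lemma orb_W s n k z : adm s -> Wset (orb s n z) -> Wset (orb s (n + k) z).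
Proof. by move=> hs hW; elim: k => [|k IH]; rewrite ?addn0 // addnS; exact: W_henon. Qed.

Lemma orb_W_le s n m z : adm s -> (n <= m)%N -> Wset (orb s n z) -> Wset (orb s m z).
Proof. by move=> hs nm_; rewrite -(subnKC nm_); exact: orb_W. Qed.

Lemma orb_Vplus s n k z : adm s -> Vplus (orb s n z) -> Vplus (orb s (n + k) z).
Proof. by move=> hs hV; elim: k => [|k IH]; rewrite ?addn0 // addnS; exact: Vplus_henon. Qed.

Lemma Vplus_growth s k z : adm s -> Vplus z -> 4 ^+ k * nm z.2 <= nm (orb s k z).2.
Proof.
move=> hs hV; elim: k => [|k IH]; first by rewrite mul1r.
have := @orb_Vplus s 0 k z hs hV; rewrite add0n => hVk.
have [_ _ _ h4] := Vplus_step (hs k) hVk.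
rewrite exprS -mulrA; apply: le_trans h4; rewrite ler_pM2l //.
Qed.

(** Outside W the second coordinate is less than half of the first, and it becomes the next first
    coordinate. The first coordinate would thus halve forever, although it exceeds 2 [rad]. *)
Lemma orb_enter_W s z : adm s -> exists n, Wset (orb s n z).
Proof.
move=> hs; apply: contrapT => hno.
have hW n : 2 * Num.max (nm (orb s n z).2) rad < nm (orb s n z).1.
  by rewrite ltNge; apply/negP => h; apply: hno; exists n.
have half n : nm (orb s n z).1 <= nm z.1 / 2 ^+ n.
  elim: n => [|n IH]; first by rewrite divr1.
  rewrite orb1 exprS invfM mulrCA mulrC ler_pdivlMr // mulrC.
  apply: le_trans IH; apply: le_trans (ltW (hW n)); rewrite ler_pM2l // le_max lexx //.
have [k hk] := half_pow_small (nm z.1) rad_gt0.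
have := hW k; have := half k; have : rad <= Num.max (nm (orb s k z).2) rad by rewrite le_max lexx orbT.
by have := rad_gt0; lra.
Qed.

Definition Lrad w : R := ln (Num.max rad (n2 w)).

Lemma LradE w : Lrad w = ln (Num.max rad (n2 w)). Proof. by []. Qed.

Lemma maxrad_ge w : rad <= Num.max rad (n2 w). Proof. by rewrite le_max lexx. Qed.

Lemma maxrad_gt0 w : 0 < Num.max rad (n2 w).
Proof. exact: lt_le_trans rad_gt0 (maxrad_ge w). Qed.
Hint Resolve maxrad_gt0 : core.

Lemma L_ge0 w : 0 <= Lrad w.
Proof. by apply: ln_ge0; have := maxrad_ge w; have := rad_ge100; lra. Qed.

Lemma ln_rad_le w : ln rad <= Lrad w.
Proof. by rewrite ler_ln ?posrE // maxrad_ge. Qed.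

Lemma lnK0 : 0 <= ln K. Proof. exact: ln_ge0. Qed.
Lemma ln_rad0 : 0 <= ln rad. Proof. by apply: ln_ge0; have := rad_ge100; lra. Qed.
Lemma ln2_ge0 : 0 <= ln (2 : R). Proof. by apply: ln_ge0; lra. Qed.

Lemma err_ge : 2 * ln 2 + ln K + K * ln rad + K * ln 2 + 1 <= err.
Proof.
rewrite /err -lock lnM ?posrE ?mulr_gt0 // lnM ?posrE //.
have -> : ln 16 = ln 2 + ln 2 + (ln 2 + ln 2) :> R.
  by rewrite -!lnM ?posrE ?mulr_gt0 //; congr ln; lra.
have := lnK0; have := ln_rad0; have := ln2_ge0; move: K1.
set a := ln K; set b := ln rad; set c := ln 2 => k1 a0 b0 c0.
nra.
Qed.

Lemma err_gt0 : 0 < err.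
Proof.
have := err_ge; have := lnK0; have := ln_rad0; have := ln2_ge0; move: K1.
set a := ln K; set b := ln rad; set c := ln 2 => k1 a0 b0 c0 h.
have : 0 <= K * b by rewrite mulr_ge0 // ltW.
have : 0 <= K * c by rewrite mulr_ge0 // ltW.
lra.
Qed.

Lemma L_henon_ub h w : tame K h -> Lrad (henon h w) <= (hdeg h)%:R * Lrad w + err.
Proof.
move=> th; set M := Num.max rad (n2 w).
have M1 : 1 <= M by have := maxrad_ge w; have := rad_ge100; rewrite -/M; lra.
have d2 := tame_deg2 th.
have Md : M <= M ^+ hdeg h by rewrite -[leLHS]expr1; apply: ler_weXn2l => //; lia.
have x1 : nm w.1 <= M by rewrite /M le_max n2_1 orbT.
have y1 : nm w.2 <= M by rewrite /M le_max n2_2 orbT.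
have h2 : nm (henon h w).2 <= 2 * K * M ^+ hdeg h.
  apply: le_trans (nmB _ _) _; rewrite nmM.
  have := tame_bound th M1 y1.
  have : nm h.2 * nm w.1 <= K * M by apply: ler_pM; rewrite ?nm_ge0 // (tame_jac_ub th).
  have : K * M <= K * M ^+ hdeg h by rewrite ler_pM2l.
  by clear; lra.
have KM : M ^+ hdeg h <= 2 * K * M ^+ hdeg h.
  by rewrite -{1}[M ^+ _]mul1r ler_wpM2r ?exprn_ge0 ?(le_trans ler01 M1) //; have := K1; clear; lra.
have : Num.max rad (n2 (henon h w)) <= 2 * K * M ^+ hdeg h.
  rewrite ge_max n2_le h2 andbT; apply/andP; split.
    by apply: le_trans KM; apply: le_trans Md; exact: maxrad_ge.
  by apply: le_trans KM; apply: le_trans Md.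
move=> hm; have M0 : 0 < M := lt_le_trans ltr01 M1.
rewrite /Lrad; apply: le_trans (_ : ln (2 * K * M ^+ hdeg h) <= _).
  by rewrite ler_ln ?posrE ?mulr_gt0 ?exprn_gt0.
rewrite lnM ?posrE ?mulr_gt0 ?exprn_gt0 // lnM ?posrE // lnXn // -/M.
rewrite mulr_natl addrC lerD2l.
have := err_ge; have := lnK0; have := ln_rad0; have := ln2_ge0; move: K1.
set a := ln K; set b := ln rad; set c := ln 2 => k1 a0 b0 c0.
have : 0 <= K * b by rewrite mulr_ge0 // ltW.
have : 0 <= K * c by rewrite mulr_ge0 // ltW.
by clear -k1 a0 b0 c0; lra.
Qed.

Lemma L_W w : Wset w -> Lrad w <= ln 2 + ln (Num.max rad (nm w.2)).
Proof.
move=> hW; have m0 : 0 < Num.max rad (nm w.2) by rewrite lt_max rad_gt0.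
rewrite -lnM ?posrE // /Lrad ler_ln ?posrE ?mulr_gt0 // ge_max n2_le.
rewrite /Wset maxC in hW; rewrite hW /=.
have h1 : rad <= Num.max rad (nm w.2) by rewrite le_max lexx.
have h2 : nm w.2 <= Num.max rad (nm w.2) by rewrite le_max lexx orbT.
have r0 := rad_gt0; apply/andP; split; lra.
Qed.

(** In W the term a x cannot cancel the leading term of p(y): either |y| >= [rad] and [Vplus_step]
    applies, or [Lrad w] is at most ln 2 + ln [rad] and the left side is absorbed by [err]. *)
Lemma L_henon_lb h w : tame K h -> Wset w -> (hdeg h)%:R * Lrad w - err <= Lrad (henon h w).
Proof.
move=> th hW; have dK := tame_degK th.
have hL := L_W hW.
have d0 : 0 <= (hdeg h)%:R :> R by [].
have hdL : (hdeg h)%:R * Lrad w <= (hdeg h)%:R * ln 2 + (hdeg h)%:R * ln (Num.max rad (nm w.2)).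
  by rewrite -mulrDr ler_wpM2l.
have e0 := err_ge; have l1 := lnK0; have l2 := ln_rad0; have l3 := ln2_ge0.
have c1 : (hdeg h)%:R * ln 2 <= K * ln 2 by rewrite ler_wpM2r.
have [hy|hy] := leP rad (nm w.2); last first.
  rewrite max_l in hdL; last exact: ltW.
  have := ln_rad_le (henon h w).
  have : (hdeg h)%:R * ln rad <= K * ln rad by rewrite ler_wpM2r.
  lra.
have [_ h2 _ _] := Vplus_step th (W_Vplus hW hy).
rewrite max_r // in hdL.
have y0 : 0 < nm w.2 by apply: lt_le_trans rad_gt0 hy.
have : ln (nm w.2 ^+ hdeg h / (2 * K)) <= Lrad (henon h w).
  rewrite ler_ln ?posrE ?divr_gt0 ?exprn_gt0 ?mulr_gt0 //.
  by apply: le_trans h2 _; rewrite le_max n2_2 orbT.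
rewrite ln_div ?posrE ?exprn_gt0 ?mulr_gt0 // lnXn // lnM ?posrE // -[_ *+ hdeg h]mulr_natl.
have : 0 <= K * ln rad by rewrite mulr_ge0 // ltW.
lra.
Qed.

End Green.

(** * Holomorphy and compactness in two variables *)

Section TwoVariables.
Variable R : realType.
Local Notation C := R[i].
Implicit Types (F G : C2 R -> C) (f g : C2 R -> C2 R) (z w : C2 R) (c : C -> C2 R).

Definition dist2 z w : R := Num.max (nm (z.1 - w.1)) (nm (z.2 - w.2)).

Lemma dist2_ge0 z w : 0 <= dist2 z w. Proof. by rewrite le_max nm_ge0. Qed.
Lemma dist2_1 z w : nm (z.1 - w.1) <= dist2 z w. Proof. by rewrite le_max lexx. Qed.
Lemma dist2_2 z w : nm (z.2 - w.2) <= dist2 z w. Proof. by rewrite le_max lexx orbT. Qed.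
Lemma dist2_le z w (r : R) :
  (dist2 z w <= r) = (nm (z.1 - w.1) <= r) && (nm (z.2 - w.2) <= r).
Proof. by rewrite ge_max. Qed.
Lemma dist2_lt z w (r : R) :
  (dist2 z w < r) = (nm (z.1 - w.1) < r) && (nm (z.2 - w.2) < r).
Proof. by rewrite gt_max. Qed.
Lemma dist2_sym z w : dist2 z w = dist2 w z.
Proof. by rewrite /dist2 nm_distC (nm_distC z.2). Qed.
Lemma dist2_eq0 z w : dist2 z w <= 0 -> z = w.
Proof.
rewrite dist2_le => /andP[/nm_le0/eqP h1 /nm_le0/eqP h2].
rewrite !subr_eq0 in h1 h2; rewrite [z]surjective_pairing [w]surjective_pairing.
by rewrite (eqP h1) (eqP h2).
Qed.
Lemma dist2_tri u z w : dist2 z w <= dist2 z u + dist2 u w.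
Proof.
rewrite dist2_le; apply/andP; split; apply: le_trans (nm_tri _ _ _) _; apply: lerD;
  by [exact: dist2_1|exact: dist2_2].
Qed.
Lemma n2_dist2 z w : n2 z <= n2 w + dist2 z w.
Proof.
rewrite n2_le; apply/andP; split.
  by have := nm_sub_ge z.1 w.1; have := n2_1 w; have := dist2_1 z w; lra.
by have := nm_sub_ge z.2 w.2; have := n2_2 w; have := dist2_2 z w; lra.
Qed.
Lemma dist2_n2 z w : dist2 z w <= n2 z + n2 w.
Proof.
rewrite dist2_le; apply/andP; split; apply: le_trans (nmB _ _) _; apply: lerD;
  by rewrite ?n2_1 ?n2_2.
Qed.

Definition cont2 F z := forall e : R, 0 < e ->
  exists2 d : R, 0 < d & forall w, dist2 w z < d -> nm (F w - F z) < e.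

(** Two-variable analogue of [cdif]: the increment is a combination of the coordinate increments
    with factors continuous at z, so that compositions with maps and with curves reduce to
    algebra. *)
Definition dif2 F z := exists q1, exists q2, [/\ cont2 q1 z, cont2 q2 z &
  forall w, F w - F z = q1 w * (w.1 - z.1) + q2 w * (w.2 - z.2)].

Definition holo f z := dif2 (fun w => (f w).1) z /\ dif2 (fun w => (f w).2) z.

Definition hcurve c t := cdif (fun u => (c u).1) t /\ cdif (fun u => (c u).2) t.

Lemma cont2_cst a z : cont2 (fun=> a) z.
Proof. by move=> e e0; exists 1 => // w _; rewrite subrr nm0. Qed.

Lemma cont2_1 z : cont2 (fun w => w.1) z.
Proof. by move=> e e0; exists e => // w; rewrite dist2_lt => /andP[]. Qed.

Lemma cont2_2 z : cont2 (fun w => w.2) z.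
Proof. by move=> e e0; exists e => // w; rewrite dist2_lt => /andP[]. Qed.

Lemma cont2_op (op : C -> C -> C) F G z :
  (forall e : R, 0 < e -> exists2 d : R, 0 < d & forall a b,
     nm (a - F z) < d -> nm (b - G z) < d -> nm (op a b - op (F z) (G z)) < e) ->
  cont2 F z -> cont2 G z -> cont2 (fun w => op (F w) (G w)) z.
Proof.
move=> hop hF hG e e0; have [d d0 hd] := hop e e0.
have [d1 d10 h1] := hF d d0; have [d2 d20 h2] := hG d d0.
exists (Num.min d1 d2); first by rewrite lt_min d10.
by move=> w; rewrite lt_min => /andP[/h1 k1 /h2 k2]; exact: hd.
Qed.

Lemma cont2D F G z : cont2 F z -> cont2 G z -> cont2 (fun w => F w + G w) z.
Proof.
apply: (cont2_op (op := +%R)) => e e0; exists (e / 2) => [|a b ha hb]; first by lra.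
rewrite opprD addrACA; apply: le_lt_trans (nmD _ _) _; lra.
Qed.

Lemma cont2M F G z : cont2 F z -> cont2 G z -> cont2 (fun w => F w * G w) z.
Proof.
apply: (cont2_op (op := *%R)) => e e0.
set A := nm (F z); set B := nm (G z).
have A0 : 0 <= A := nm_ge0 _; have B0 : 0 <= B := nm_ge0 _.
have S0 : 0 < A + B + 1 by lra.
exists (Num.min 1 (e / (A + B + 1) / 2)); first by rewrite lt_min ltr01 !divr_gt0.
move=> a b; rewrite !lt_min => /andP[a1 a2] /andP[b1 b2].
have -> : a * b - F z * G z = (a - F z) * (b - G z) + ((a - F z) * G z + F z * (b - G z)).
  by ring.
apply: le_lt_trans (nmD _ _) _; have := nmD ((a - F z) * G z) (F z * (b - G z)).
rewrite !nmM -/A -/B; set x := nm (a - F z) in a1 a2 *; set y := nm (b - G z) in b1 b2 *.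
have x0 : 0 <= x := nm_ge0 _; have y0 : 0 <= y := nm_ge0 _.
have : e / (A + B + 1) / 2 * (A + B + 1) = e / 2 by field; rewrite gt_eqF.
move: a2 b2; set t := _ / 2 => a2 b2 tE.
clear -A0 B0 x0 y0 a1 b1 a2 b2 tE e0; nra.
Qed.

Lemma cont2_holo_comp F f z : cont2 (fun w => (f w).1) z -> cont2 (fun w => (f w).2) z ->
  cont2 F (f z) -> cont2 (fun w => F (f w)) z.
Proof.
move=> h1 h2 hF e e0; have [d d0 hd] := hF e e0.
have [d1 d10 k1] := h1 d d0; have [d2 d20 k2] := h2 d d0.
exists (Num.min d1 d2); first by rewrite lt_min d10.
by move=> w; rewrite lt_min => /andP[/k1 l1 /k2 l2]; apply: hd; rewrite dist2_lt l1.
Qed.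

Lemma cont2_curve F c t : ccont (fun u => (c u).1) t -> ccont (fun u => (c u).2) t ->
  cont2 F (c t) -> ccont (fun u => F (c u)) t.
Proof.
move=> h1 h2 hF e e0; have [d d0 hd] := hF e e0.
have [d1 d10 k1] := h1 d d0; have [d2 d20 k2] := h2 d d0.
exists (Num.min d1 d2); first by rewrite lt_min d10.
by move=> w; rewrite lt_min => /andP[/k1 l1 /k2 l2]; apply: hd; rewrite dist2_lt l1.
Qed.

Lemma dif2_cont F z : dif2 F z -> cont2 F z.
Proof.
move=> [q1 [q2 [c1 c2 hF]]].
have h : cont2 (fun w => F z + (q1 w * (w.1 - z.1) + q2 w * (w.2 - z.2))) z.
  apply: cont2D; first exact: cont2_cst.
  by apply: cont2D; apply: cont2M => //; apply: cont2D; rewrite ?opprK;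
    by [exact: cont2_1|exact: cont2_2|exact: cont2_cst].
move=> e /h[d d0 hd]; exists d => // w /hd.
by rewrite -!hF !subrKC.
Qed.

Lemma dif2_cst a z : dif2 (fun=> a) z.
Proof.
by exists (fun=> 0), (fun=> 0); split; try exact: cont2_cst; move=> w; rewrite subrr !mul0r addr0.
Qed.

Lemma dif2_1 z : dif2 (fun w => w.1) z.
Proof.
by exists (fun=> 1), (fun=> 0); split; try exact: cont2_cst; move=> w; rewrite mul1r mul0r addr0.
Qed.

Lemma dif2_2 z : dif2 (fun w => w.2) z.
Proof.
by exists (fun=> 0), (fun=> 1); split; try exact: cont2_cst; move=> w; rewrite mul1r mul0r add0r.
Qed.

Lemma dif2D F G z : dif2 F z -> dif2 G z -> dif2 (fun w => F w + G w) z.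
Proof.
move=> [q1 [q2 [c1 c2 hF]]] [r1 [r2 [k1 k2 hG]]].
exists (fun w => q1 w + r1 w), (fun w => q2 w + r2 w); split; try exact: cont2D.
move=> w; transitivity ((F w - F z) + (G w - G z)); first by ring.
by rewrite hF hG; ring.
Qed.

Lemma dif2M F G z : dif2 F z -> dif2 G z -> dif2 (fun w => F w * G w) z.
Proof.
move=> dF dG; have cF := dif2_cont dF.
move: dF dG => [q1 [q2 [c1 c2 hF]]] [r1 [r2 [k1 k2 hG]]].
exists (fun w => q1 w * G z + F w * r1 w), (fun w => q2 w * G z + F w * r2 w); split.
- by apply: cont2D; apply: cont2M => //; exact: cont2_cst.
- by apply: cont2D; apply: cont2M => //; exact: cont2_cst.
move=> w; transitivity ((F w - F z) * G z + F w * (G w - G z)); first by ring.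
by rewrite hF hG; ring.
Qed.

Lemma dif2N F z : dif2 F z -> dif2 (fun w => - F w) z.
Proof.
move=> dF; have [q1 [q2 [c1 c2 h]]] := dif2M (dif2_cst (-1) z) dF.
by exists q1, q2; split=> // w; rewrite -h !mulN1r.
Qed.

Lemma dif2B F G z : dif2 F z -> dif2 G z -> dif2 (fun w => F w - G w) z.
Proof. by move=> dF dG; apply: dif2D => //; apply: dif2N. Qed.

Lemma dif2_poly (p : {poly C}) F z : dif2 F z -> dif2 (fun w => p.[F w]) z.
Proof.
move=> dF; elim/poly_ind: p => [|p a IH].
  have [q1 [q2 [c1 c2 h]]] := dif2_cst 0 z.
  by exists q1, q2; split=> // w; rewrite !horner0 -h.
have [q1 [q2 [c1 c2 h]]] := dif2D (dif2M IH dF) (dif2_cst a z).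
by exists q1, q2; split=> // w; rewrite !hornerMXaddC -h.
Qed.

Lemma holo_cont f z : holo f z -> forall e : R, 0 < e -> exists2 d : R, 0 < d &
  forall w, dist2 w z < d -> dist2 (f w) (f z) < e.
Proof.
move=> [/dif2_cont h1 /dif2_cont h2] e e0.
have [d1 d10 k1] := h1 e e0; have [d2 d20 k2] := h2 e e0.
exists (Num.min d1 d2); first by rewrite lt_min d10.
by move=> w; rewrite lt_min => /andP[/k1 l1 /k2 l2]; rewrite dist2_lt l1.
Qed.

Lemma dif2_comp F f z : holo f z -> dif2 F (f z) -> dif2 (fun w => F (f w)) z.
Proof.
move=> [d1 d2] [q1 [q2 [c1 c2 hF]]].
have k1 := dif2_cont d1; have k2 := dif2_cont d2.
move: d1 d2 => [r1 [r2 [l1 l2 h1]]] [s1 [s2 [m1 m2 h2]]].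
exists (fun w => q1 (f w) * r1 w + q2 (f w) * s1 w),
       (fun w => q1 (f w) * r2 w + q2 (f w) * s2 w); split.
- by apply: cont2D; apply: cont2M => //; apply: cont2_holo_comp.
- by apply: cont2D; apply: cont2M => //; apply: cont2_holo_comp.
by move=> w; rewrite hF h1 h2; ring.
Qed.

Lemma holo_comp f g z : holo f z -> holo g (f z) -> holo (fun w => g (f w)) z.
Proof. by move=> hf [g1 g2]; split; [apply: (dif2_comp (F := fun w => (g w).1))|apply: (dif2_comp (F := fun w => (g w).2))]. Qed.

Lemma holo_id z : holo id z. Proof. by split; [exact: dif2_1|exact: dif2_2]. Qed.

Lemma dif2_curve F c t : hcurve c t -> dif2 F (c t) -> cdif (fun u => F (c u)) t.
Proof.
move=> [d1 d2] [q1 [q2 [c1 c2 hF]]].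
have k1 := cdif_ccont d1; have k2 := cdif_ccont d2.
move: d1 d2 => [r1 l1 h1] [r2 l2 h2].
exists (fun u => q1 (c u) * r1 u + q2 (c u) * r2 u).
  by apply: ccontD; apply: ccontM => //; apply: cont2_curve.
by move=> u; rewrite hF h1 h2; ring.
Qed.

Lemma hcurve_comp f c t : hcurve c t -> holo f (c t) -> hcurve (fun u => f (c u)) t.
Proof. by move=> hc [f1 f2]; split; [apply: (dif2_curve (F := fun w => (f w).1))|apply: (dif2_curve (F := fun w => (f w).2))]. Qed.

Lemma hcurve_cont c t : hcurve c t -> forall e : R, 0 < e -> exists2 d : R, 0 < d &
  forall u, nm (u - t) < d -> dist2 (c u) (c t) < e.
Proof.
move=> [/cdif_ccont h1 /cdif_ccont h2] e e0.
have [d1 d10 k1] := h1 e e0; have [d2 d20 k2] := h2 e e0.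
exists (Num.min d1 d2); first by rewrite lt_min d10.
by move=> w; rewrite lt_min => /andP[/k1 l1 /k2 l2]; rewrite dist2_lt l1.
Qed.

Lemma holo_henon h z : holo (henon h) z.
Proof.
split; first exact: dif2_2.
by apply: dif2B; [apply/dif2_poly/dif2_2|apply: dif2M; [exact: dif2_cst|exact: dif2_1]].
Qed.

Lemma holo_henon_inv h z : holo (henon_inv h) z.
Proof.
split; last exact: dif2_1.
apply: dif2M; last exact: dif2_cst.
by apply: dif2B; [apply/dif2_poly/dif2_1|exact: dif2_2].
Qed.

Lemma holo_orb s n z : holo (orb s n) z.
Proof.
by elim: n => [|n IH] /=; [exact: holo_id|exact: (holo_comp IH (holo_henon _ _))].
Qed.

Lemma holo_orbV s n z : holo (orbV s n) z.
Proof.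
by elim: n z => [|n IH] z /=; [exact: holo_id|exact: (holo_comp (holo_henon_inv _ _) (IH _))].
Qed.

Lemma compact_prime2 (Bad : (C2 R -> Prop) -> Prop) (r : R) :
  (forall A B : C2 R -> Prop, (forall z, A z -> B z) -> Bad A -> Bad B) ->
  (forall A B : C2 R -> Prop, Bad (fun z => A z \/ B z) -> Bad A \/ Bad B) ->
  0 <= r -> Bad (fun z => n2 z <= r) ->
  exists z, forall e, 0 < e -> Bad (fun w => dist2 w z < e).
Proof.
move=> Bmono Bprime r0 Br.
have [||//||x hx] := @compact_prime R (fun A => Bad (fun z => A z.1 /\ n2 z <= r)) r.
- by move=> A B AB; apply: Bmono => z [/AB].
- move=> A B hAB; apply: Bprime; apply: Bmono hAB => z [[h|h] h']; by [left|right].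
- by apply: Bmono Br => z h; split=> //; apply: le_trans h; exact: n2_1.
have [||//||y hy] := @compact_prime R
   (fun A => forall e : R, 0 < e -> Bad (fun z => nm (z.1 - x) < e /\ A z.2)) r.
- by move=> A B AB h e e0; apply: Bmono (h e e0) => z [h1 /AB].
- move=> A B hAB; apply: contrapT => /not_orP[/existsNP[e1 /not_implyP[e10 h1]]
    /existsNP[e2 /not_implyP[e20 h2]]].
  have e0 : 0 < Num.min e1 e2 by rewrite lt_min e10.
  have [|h|h] := Bprime (fun z => nm (z.1 - x) < Num.min e1 e2 /\ A z.2)
              (fun z => nm (z.1 - x) < Num.min e1 e2 /\ B z.2).
  + by apply: Bmono (hAB _ e0) => z [h [k|k]]; [left|right].
  + by apply: h1; apply: Bmono h => z []; rewrite lt_min => /andP[].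
  + by apply: h2; apply: Bmono h => z []; rewrite lt_min => /andP[].
- move=> e e0; apply: Bmono (hx e e0) => z [h1 h2]; split=> //.
  by apply: le_trans h2; exact: n2_2.
exists (x, y) => e e0; apply: Bmono (hy e e0 e e0) => z [h1 h2].
by rewrite dist2_lt h1.
Qed.

Lemma cluster_seq2 (u : nat -> C2 R) (r : R) : (forall n, n2 (u n) <= r) ->
  exists z, forall e N, 0 < e -> exists2 n, (N <= n)%N & dist2 (u n) z < e.
Proof.
move=> ur; have r0 : 0 <= r by apply: le_trans (ur 0%N); exact: n2_ge0.
have [||//||z hz] := @compact_prime2
   (fun A => forall N, exists2 n, (N <= n)%N & A (u n)) r.
- by move=> A B AB hA N; have [n Nn /AB] := hA N; exists n.
- move=> A B hAB; apply: contrapT => /not_orP [/existsNP[N1 h1] /existsNP[N2 h2]].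
  have [n hn [An|Bn]] := hAB (maxn N1 N2).
  + by apply: h1; exists n => //; apply: leq_trans hn; exact: leq_maxl.
  + by apply: h2; exists n => //; apply: leq_trans hn; exact: leq_maxr.
- by move=> N; exists N.
by exists z => e N e0; exact: hz.
Qed.

Definition closed2 (A : C2 R -> Prop) :=
  forall z, (forall e : R, 0 < e -> exists2 w, A w & dist2 w z < e) -> A z.

(** Turns times that are locally uniform into one common time: otherwise counterexamples for n
    tending to infinity would cluster at a point of A. *)
Lemma compact_uniform (A : C2 R -> Prop) (P : nat -> C2 R -> Prop) (r : R) :
  closed2 A -> (forall z, A z -> n2 z <= r) ->
  (forall n m z, (n <= m)%N -> P n z -> P m z) ->
  (forall z, A z -> exists n, exists2 d : R, 0 < d & forall w, dist2 w z < d -> P n w) ->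
  exists n, forall z, A z -> P n z.
Proof.
move=> Ac Ar Pmono Ploc; apply: contrapT => hno.
have bad n : exists z, A z /\ ~ P n z.
  by apply: contrapT => h; apply: hno; exists n => z Az; apply: contrapT => nP; apply: h; exists z.
have [u hu] := choice bad.
have [z hz] := @cluster_seq2 u r (fun n => Ar _ (hu n).1).
have Az : A z by apply: Ac => e e0; have [n _ hn] := hz e 0%N e0; exists (u n) => //; exact: (hu n).1.
have [n [d d0 hd]] := Ploc z Az.
have [m nm_ hm] := hz d n d0.
by have [_] := hu m; apply; apply: Pmono (hd _ hm).
Qed.

End TwoVariables.

(** * The Green function *)

Section GreenFunction.
Variable R : realType.
Local Notation C := R[i].
Variable K : R.
Hypothesis K1 : 1 <= K.
Local Notation rad := (esc_rad K).
Local Notation err := (esc_err K).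
Local Notation Lrad := (Lrad K).
Local Notation Wset := (Wset K).
Local Notation Vplus := (Vplus K).
Implicit Types (s : nat -> henon_data R) (z w : C2 R) (h : henon_data R).

Lemma Deg_ge s n : adm K s -> 2 ^+ n <= Deg s n.
Proof.
move=> hs; elim: n => [|n IH] //=; rewrite exprSr; apply: ler_pM => //.
by rewrite (ler_nat _ 2); exact: tame_deg2 (hs n).
Qed.

Lemma Deg_gt0 s n : adm K s -> 0 < Deg s n.
Proof. by move=> hs; apply: lt_le_trans (Deg_ge n hs); rewrite exprn_gt0. Qed.

Lemma Deg_big s (x : R) : adm K s -> exists N, forall n, (N <= n)%N -> x <= Deg s n.
Proof.
move=> hs; have [k hk] := half_pow_small x (@ltr01 R); exists k => n kn.
apply: le_trans (Deg_ge n hs); apply: le_trans (_ : 2 ^+ k <= _).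
  by move: hk; rewrite ltr_pdivrMr ?exprn_gt0 // mul1r => /ltW.
by apply: ler_weXn2l => //; lra.
Qed.

(* The sequence decreases, hence the infimum is its limit. *)
Definition green s z : R := inf [set (Lrad (orb s n z) + err) / Deg s n | n in [set: nat]]%classic.

Lemma green_step s n z : adm K s ->
  (Lrad (orb s n.+1 z) + err) / Deg s n.+1 <= (Lrad (orb s n z) + err) / Deg s n.
Proof.
move=> hs; have D0 := Deg_gt0 n hs; have d2 := tame_deg2 (hs n).
have d0 : (2 : R) <= (hdeg (s n))%:R by rewrite (ler_nat _ 2).
have dp : (0 : R) < (hdeg (s n))%:R by lra.
rewrite /= ler_pdivrMr ?mulr_gt0 // mulrA divfK ?gt_eqF //.
have := L_henon_ub K1 (orb s n z) (hs n); have := err_gt0 K1.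
set a := Lrad _; set b := Lrad _; set e := err; set d := _%:R in d0 *.
clear -d0; move=> e0 h; nra.
Qed.

Lemma green_mono s n m z : adm K s -> (n <= m)%N ->
  (Lrad (orb s m z) + err) / Deg s m <= (Lrad (orb s n z) + err) / Deg s n.
Proof.
move=> hs nm_; rewrite -(subnKC nm_); elim: (m - n)%N => [|k IH]; first by rewrite addn0.
by rewrite addnS; apply: le_trans IH; exact: green_step.
Qed.

Lemma green_lb_step s n z : adm K s -> Wset (orb s n z) ->
  (Lrad (orb s n z) - err) / Deg s n <= (Lrad (orb s n.+1 z) - err) / Deg s n.+1.
Proof.
move=> hs hW; have D0 := Deg_gt0 n hs; have d2 := tame_deg2 (hs n).
have d0 : (2 : R) <= (hdeg (s n))%:R by rewrite (ler_nat _ 2).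
have dp : (0 : R) < (hdeg (s n))%:R by lra.
rewrite /= ler_pdivlMr ?mulr_gt0 // mulrA divfK ?gt_eqF //.
have := L_henon_lb K1 (hs n) hW; have := err_gt0 K1.
set a := Lrad _; set b := Lrad _; set e := err; set d := _%:R in d0 *.
clear -d0; move=> e0 h; nra.
Qed.

Lemma green_lb_mono s n m z : adm K s -> Wset (orb s n z) -> (n <= m)%N ->
  (Lrad (orb s n z) - err) / Deg s n <= (Lrad (orb s m z) - err) / Deg s m.
Proof.
move=> hs hW nm_; rewrite -(subnKC nm_); elim: (m - n)%N => [|k IH]; first by rewrite addn0.
rewrite addnS; apply: le_trans IH _; apply: green_lb_step => //.
exact: orb_W.
Qed.

Let gset s z := [set (Lrad (orb s n z) + err) / Deg s n | n in [set: nat]]%classic.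

Lemma green_bounds s n z : adm K s ->
  green s z <= (Lrad (orb s n z) + err) / Deg s n /\
  (Wset (orb s n z) -> (Lrad (orb s n z) - err) / Deg s n <= green s z).
Proof.
move=> hs; have e0 := err_gt0 K1.
have lb0 : lbound (gset s z) 0.
  move=> _ [m _ <-]; rewrite divr_ge0 ?(ltW (Deg_gt0 m hs)) //.
  by have := L_ge0 K1 (orb s m z); lra.
split.
  by apply: (ge_inf (ex_intro _ _ lb0)); exists n.
move=> hW; apply: lb_le_inf; first by exists ((Lrad (orb s 0 z) + err) / Deg s 0); exists 0%N.
move=> _ [m _ <-]; have [nm_|mn] := leqP n m.
  apply: le_trans (green_lb_mono hs hW nm_) _.
  by rewrite ler_pM2r ?invr_gt0 ?Deg_gt0 //; lra.
apply: le_trans (green_mono z hs (ltnW mn)).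
by rewrite ler_pM2r ?invr_gt0 ?Deg_gt0 //; lra.
Qed.

Lemma green_ub s n z : adm K s -> Deg s n * green s z <= Lrad (orb s n z) + err.
Proof.
move=> hs; have [h _] := green_bounds n z hs.
by rewrite mulrC -ler_pdivlMr ?Deg_gt0.
Qed.

Lemma green_lb s n z : adm K s -> Wset (orb s n z) ->
  Lrad (orb s n z) - err <= Deg s n * green s z.
Proof.
move=> hs hW; have [_ /(_ hW) h] := green_bounds n z hs.
by rewrite mulrC -ler_pdivrMr ?Deg_gt0.
Qed.

Lemma green_ge0 s z : adm K s -> 0 <= green s z.
Proof.
move=> hs; apply: lb_le_inf; first by exists ((Lrad (orb s 0 z) + err) / Deg s 0); exists 0%N.
move=> _ [m _ <-]; rewrite divr_ge0 ?(ltW (Deg_gt0 m hs)) //.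
by have := L_ge0 K1 (orb s m z); have := err_gt0 K1; lra.
Qed.

(** Since Deg tends to infinity, a bounded error at each time determines the value; this is how
    functional equations of G are verified. *)
Lemma green_uniq s z (g B : R) : adm K s ->
  (exists N, forall n, (N <= n)%N -> `|Deg s n * g - Lrad (orb s n z)| <= B) -> green s z = g.
Proof.
move=> hs [N hN]; apply/eqP; rewrite -subr_eq0 -normr_le0.
apply/ler_addgt0Pr => e e0; rewrite add0r.
have [M hM] := @Deg_big s ((B + err) / e) hs.
have [n0 hn0] := orb_enter_W K1 z hs.
pose n := (maxn N M + n0)%N.
have Nn : (N <= n)%N by rewrite (leq_trans (leq_maxl N M)) // leq_addr.
have Mn : (M <= n)%N by rewrite (leq_trans (leq_maxr N M)) // leq_addr.
have hW : Wset (orb s n z) by apply: (orb_W_le K1 hs _ hn0); exact: leq_addl.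
have := hN n Nn; have := hM n Mn; have := green_ub n z hs; have := green_lb hs hW.
have D0 := Deg_gt0 n hs; have er0 := err_gt0 K1.
rewrite ler_pdivrMr // !ler_norml.
set D := Deg s n in D0 *; set gr := green s z; set l := Lrad _; set er := err in er0 *.
clear -D0 e0 er0 => h1 h2 h3 h4.
have h5 : D * (gr - g) <= D * e by nra.
have h6 : D * (- e) <= D * (gr - g) by nra.
by move: h5 h6; rewrite !ler_pM2l // => -> ->.
Qed.

Lemma green_shift s k z : adm K s -> green (sshift s k) (orb s k z) = Deg s k * green s z.
Proof.
move=> hs; apply: (@green_uniq _ _ _ err); first exact: adm_shift.
have [n0 hn0] := orb_enter_W K1 z hs; exists n0 => n hn.
rewrite -orb_shift mulrCA mulrC -[_ * Deg s k]mulrC mulrA -Deg_shift.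
have hW : Wset (orb s (k + n) z).
  by apply: (orb_W_le K1 hs _ hn0); apply: leq_trans hn _; exact: leq_addl.
have := green_ub (k + n) z hs; have := green_lb hs hW.
rewrite ler_norml; set a := Deg _ _ * _; set l := Lrad _; set e := err; clear; lra.
Qed.

Lemma green_0_bounded s n z : adm K s -> green s z = 0 -> Wset (orb s n z) ->
  Lrad (orb s n z) <= err.
Proof. by move=> hs g0 /(green_lb hs); rewrite g0 mulr0; lra. Qed.

Lemma bounded_green_0 s z (B : R) : adm K s ->
  (forall N, exists2 n, (N <= n)%N & Lrad (orb s n z) <= B) -> green s z = 0.
Proof.
move=> hs hB; apply/eqP; rewrite eq_le green_ge0 // andbT.
apply/ler_addgt0Pr => e e0; rewrite add0r.
have [M hM] := @Deg_big s ((B + err) / e) hs.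
have [n Mn hn] := hB M; have := green_ub n z hs; have := hM n Mn.
have D0 := Deg_gt0 n hs; rewrite ler_pdivrMr //.
set D := Deg s n in D0 *; set gr := green s z; set l := Lrad _ in hn *; set er := err.
move=> h1 h2; rewrite -(ler_pM2l D0); clear -h1 h2 hn; lra.
Qed.

Lemma L_exp w (r : R) : rad <= r -> n2 w <= r -> Lrad w <= ln r.
Proof.
move=> h1 h2; rewrite ler_ln ?posrE ?maxrad_gt0 //; first by rewrite ge_max h1.
exact: lt_le_trans (rad_gt0 K1) h1.
Qed.

Lemma n2_le_exp w : n2 w <= expR (Lrad w).
Proof. by rewrite lnK ?posrE ?maxrad_gt0 // le_max lexx orbT. Qed.

Lemma L_ge_n2 w : 0 < n2 w -> ln (n2 w) <= Lrad w.
Proof. by move=> h; rewrite ler_ln ?posrE ?maxrad_gt0 // le_max lexx orbT. Qed.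

Lemma W_big_V w : Wset w -> ln (2 * rad) < Lrad w -> Vplus w.
Proof.
move=> hW hL; apply: (W_Vplus hW); rewrite leNgt; apply/negP => hy.
move: hL; apply/negP; rewrite -leNgt; apply: L_exp.
  by have := rad_gt0 K1; lra.
rewrite n2_le; apply/andP; split; last by have := rad_gt0 K1; lra.
by move: hW; rewrite WsetE max_r // ltW.
Qed.

Lemma green_V_of s n z : adm K s -> Wset (orb s n z) ->
  ln (2 * rad) + err < Deg s n * green s z -> Vplus (orb s n z).
Proof.
move=> hs hW hg; apply: W_big_V => //; have := green_ub n z hs; lra.
Qed.

Lemma green_pos_V s z : adm K s -> 0 < green s z -> exists n, Vplus (orb s n z).
Proof.
move=> hs g0; have [N hN] := @Deg_big s ((ln (2 * rad) + err + 1) / green s z) hs.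
have [n0 hn0] := orb_enter_W K1 z hs.
exists (N + n0)%N; apply: green_V_of => //.
  by apply: (orb_W_le K1 hs _ hn0); exact: leq_addl.
have := hN (N + n0)%N (leq_addr _ _); rewrite ler_pdivrMr //; lra.
Qed.

Lemma L_lip w w' : `|Lrad w - Lrad w'| <= dist2 w w'.
Proof.
have r1 : 1 <= rad by have := rad_ge100 K1; lra.
suff H u v : Lrad u - Lrad v <= dist2 u v.
  by rewrite ler_norml lerNl opprB {1}dist2_sym !H.
set a := Num.max rad (n2 u); set b := Num.max rad (n2 v).
have b1 : 1 <= b by rewrite /b le_max r1.
have b0 : 0 < b by lra.
have a0 : 0 < a by rewrite /a; exact: maxrad_gt0.
have ab : a <= b + dist2 u v.
  rewrite /a ge_max; have h1 : rad <= b by rewrite /b le_max lexx.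
  have h2 : n2 v <= b by rewrite /b le_max lexx orbT.
  have := n2_dist2 u v; have := dist2_ge0 u v => h3 h4.
  by apply/andP; split; clear -h1 h2 h3 h4; lra.
have E : a / b = 1 + (a / b - 1) by ring.
have h0 : 0 < a / b by rewrite divr_gt0.
rewrite !LradE -/a -/b -ln_div ?posrE // E.
apply: le_trans (le_ln1Dx _) _; first by clear -h0; lra.
have d0 := dist2_ge0 u v.
have : a / b <= 1 + dist2 u v; last by clear; lra.
by rewrite ler_pdivrMr //; clear -ab b1 d0; nra.
Qed.

Lemma W_near s n z : adm K s -> Wset (orb s n z) -> exists2 d : R, 0 < d &
  forall w, dist2 w z < d -> Wset (orb s n.+1 w).
Proof.
move=> hs hW; have h := W_step K1 (hs n) hW.
have r0 := rad_gt0 K1; have r4 : 0 < rad / 4 by lra.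
have [d d0 hd] := holo_cont (holo_orb s n.+1 z) r4.
exists d => // w /hd; set u := orb s n.+1 w; set v := orb s n.+1 z => huv.
rewrite -[henon _ _]/v in h; rewrite WsetE.
have m1 : rad <= Num.max (nm u.2) rad by rewrite le_max lexx orbT.
have m2 : Num.max (nm v.2) rad <= Num.max (nm u.2) rad + rad / 4.
  rewrite ge_max; apply/andP; split; last by clear -r0 m1; lra.
  have : nm u.2 <= Num.max (nm u.2) rad by rewrite le_max lexx.
  have := nm_sub_ge v.2 u.2; have := dist2_2 u v; rewrite (nm_distC v.2); clear -huv; lra.
have := nm_sub_ge u.1 v.1; have := dist2_1 u v.
clear -huv h m1 m2 r0; lra.
Qed.

Lemma green_cont s z (e : R) : adm K s -> 0 < e -> exists2 d : R, 0 < d &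
  forall w, dist2 w z < d -> `|green s w - green s z| < e.
Proof.
move=> hs e0; have er0 := err_gt0 K1.
have [N hN] := @Deg_big s ((2 * err + 2) / e) hs.
have [n0 hn0] := orb_enter_W K1 z hs.
pose n := (N + n0)%N.
have hW : Wset (orb s n z) by apply: (orb_W_le K1 hs _ hn0); exact: leq_addl.
have [d d0 hd] := W_near hs hW.
have [d' d0' hd'] := holo_cont (holo_orb s n.+1 z) (@ltr01 R).
exists (Num.min d d'); first by rewrite lt_min d0.
move=> w; rewrite lt_min => /andP[/hd h1 /hd' h2].
have hW' : Wset (orb s n.+1 z) by apply: (orb_W_le K1 hs _ hW).
have k1 := green_ub n.+1 z hs; have k2 := green_ub n.+1 w hs.
have k3 := green_lb hs hW'; have k4 := green_lb hs h1.
have k5 := L_lip (orb s n.+1 w) (orb s n.+1 z).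
have D0 := Deg_gt0 n.+1 hs.
have := hN n.+1 (leq_trans (leq_addr n0 N) (leqnSn _)); rewrite ler_pdivrMr //.
move: k5; rewrite !ler_norml !ltr_norml => /andP[k5 k6] k7.
set D := Deg s n.+1 in D0 k1 k2 k3 k4 k7 *.
set a := Lrad _ in k1 k3 k5 k6; set b := Lrad _ in k2 k4 k5 k6.
set g := green s z in k1 k3 *; set g' := green s w in k2 k4 *.
have j1 : D * (- e) < D * (g' - g) by clear -k1 k2 k3 k4 k5 k6 k7 h2 er0; nra.
have j2 : D * (g' - g) < D * e by clear -k1 k2 k3 k4 k5 k6 k7 h2 er0; nra.
by move: j1 j2; rewrite !ltr_pM2l // => -> ->.
Qed.

(** The map F is kept general in order to cover automorphisms on compact sets and, through
    [holo_fst], parametrised curves. *)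
Lemma V_uniform s (A : C2 R -> Prop) (F : C2 R -> C2 R) (r : R) : adm K s ->
  closed2 A -> (forall z, A z -> n2 z <= r) -> (forall z, A z -> holo F z) ->
  (forall z, A z -> 0 < green s (F z)) ->
  exists N, forall n z, (N <= n)%N -> A z -> Vplus (orb s n (F z)).
Proof.
move=> hs Ac Ar Ah Ag.
have [||N hN] := @compact_uniform R A (fun n z => Vplus (orb s n (F z))) r Ac Ar.
- by move=> n m z nm_ h; rewrite -(subnKC nm_); exact: orb_Vplus.
- move=> z Az; have g0 := Ag _ Az.
  have g2 : 0 < green s (F z) / 2 by lra.
  have [d d0 hd] := green_cont (F z) hs g2.
  have [N hN] := @Deg_big s ((ln (2 * rad) + err + 1) / (green s (F z) / 2)) hs.
  have [n0 hn0] := orb_enter_W K1 (F z) hs.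
  have hW : Wset (orb s (N + n0) (F z)) by apply: (orb_W_le K1 hs _ hn0); exact: leq_addl.
  have [d' d0' hd'] := W_near hs hW.
  have dd0 : 0 < Num.min d d' by rewrite lt_min d0.
  have [d2 d20 hd2] := holo_cont (Ah _ Az) dd0.
  exists (N + n0).+1; exists d2 => // w0 /hd2; set w := F w0.
  rewrite lt_min => /andP[/hd h1 /hd' h2]; apply: green_V_of => //.
  have := hN (N + n0).+1 (leq_trans (leq_addr n0 N) (leqnSn _)); rewrite ler_pdivrMr //.
  have D0 := Deg_gt0 (N + n0).+1 hs; set D := Deg s _ in D0 *.
  move: h1; rewrite ltr_norml; set g := green s (F z) in g2 *; set g' := green s w.
  clear -D0 g2 => h3 h4.
  have : D * (g / 2) < D * g' by rewrite ltr_pM2l //; lra.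
  lra.
by exists N => n z Nn Az; rewrite -(subnKC Nn); apply: orb_Vplus => //; exact: hN.
Qed.

(** In [Vplus] a step changes ln |y| to d ln |y| + ln |lead| + O(1 / |y|). The difference of two
    such logarithms is therefore divided by d when going back one step, with errors that sum
    geometrically. So equal Green values force |y'| / |y| = 1 + O(1 / |y|), not merely a bounded
    ratio. *)
Lemma green_eq_ratio s z z' : adm K s -> Vplus z -> Vplus z' -> green s z = green s z' ->
  ln (nm z'.2) - ln (nm z.2) <= 24 * K ^+ 2 / Num.min (nm z.2) (nm z'.2).
Proof.
move=> hs hV hV' gE; have k0 := K_gt0 K1.
pose mu n := Num.min (nm (orb s n z).2) (nm (orb s n z').2).
pose D n := ln (nm (orb s n z').2) - ln (nm (orb s n z).2).
have Vn n : Vplus (orb s n z) := orb_Vplus K1 (n := 0) n hs hV.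
have Vn' n : Vplus (orb s n z') := orb_Vplus K1 (n := 0) n hs hV'.
have r0 := rad_gt0 K1.
have mu0 : 0 < mu 0%N by rewrite lt_min; case: hV => h _; case: hV' => h' _; apply/andP; split; apply: lt_le_trans r0 _.
have mun n : 2 ^+ n * mu 0%N <= mu n.
  rewrite le_min; apply/andP; split.
    apply: le_trans (Vplus_growth K1 n hs hV); apply: ler_pM; rewrite ?exprn_ge0 ?(ltW mu0) //.
      by apply: lerXn2r; rewrite ?nnegrE //; lra.
    by rewrite ge_min lexx.
  apply: le_trans (Vplus_growth K1 n hs hV'); apply: ler_pM; rewrite ?exprn_ge0 ?(ltW mu0) //.
    by apply: lerXn2r; rewrite ?nnegrE //; lra.
  by rewrite ge_min lexx orbT.
have stepln w n : Vplus w -> `|ln (nm (henon (s n) w).2) -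
     ((hdeg (s n))%:R * ln (nm w.2) + ln (nm (hlead (s n))))| <= 6 * K ^+ 2 / nm w.2.
  move=> hw; have [h1 _ _ _] := Vplus_step K1 (hs n) hw.
  have [hR _] := hw; have th := hs n.
  set h := s n in h1 th *; set d := hdeg h in h1 *; set y := w.2 in h1 hR *.
  have y0 : 0 < nm y by apply: lt_le_trans r0 hR.
  have c0 : 0 < nm (hlead h) by apply: lt_le_trans (tame_lead_lb th); rewrite invr_gt0.
  set q := hlead h * y ^+ d in h1.
  have q0 : 0 < nm q by rewrite /q nmM nmX mulr_gt0 // exprn_gt0.
  have qE : d%:R * ln (nm y) + ln (nm (hlead h)) = ln (nm q).
    have -> : nm q = nm (hlead h) * nm y ^+ d by rewrite /q nmM nmX.
    have e0 : 0 < nm y ^+ d by rewrite exprn_gt0.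
    by rewrite lnM ?posrE // lnXn // -[ln (nm y) *+ d]mulr_natl addrC.
  rewrite qE; set Y := (henon h w).2 in h1 *.
  have t : 3 * K * nm y ^+ d.-1 <= nm q * (3 * K ^+ 2 / nm y).
    have -> : nm q = nm (hlead h) * (nm y * nm y ^+ d.-1).
      by rewrite /q nmM nmX -exprS prednK // (leq_trans _ (tame_deg2 th)).
    have cl := tame_lead_lb th; have := exprn_gt0 d.-1 y0; set P := nm y ^+ d.-1 => P0.
    have : 1 <= nm (hlead h) * K by rewrite mulrC -ler_pdivrMl // mulr1.
    have yn : nm y != 0 by rewrite gt_eqF.
    set c := nm (hlead h) in c0 *; clear -P0 k0 c0 yn => hc.
    have -> : c * (nm y * P) * (3 * K ^+ 2 / nm y) = (c * K) * (3 * K * P) by field.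
    have : 0 < 3 * K * P by rewrite !mulr_gt0.
    nra.
  set u := 3 * K ^+ 2 / nm y in t.
  have u0 : 0 <= u by apply: divr_ge0 => //; [apply: mulr_ge0 => //; exact: sqr_ge0|exact: ltW].
  have u2 : u <= 1 / 2.
    rewrite /u ler_pdivrMr //; have := @rad_ge R K K1 2 isT; have := sqr_ge0 K; clear -hR; lra.
  have a1 := nm_sub_ge Y q; have a2 := nm_sub_ge q Y; rewrite (nm_distC q) in a2.
  have [b1 b2] : nm Y <= nm q * (1 + u) /\ nm q * (1 - u) <= nm Y.
    move: (le_trans h1 t) a1 a2; rewrite mulrBr mulrDr !mulr1; set qu := nm q * u.
    by set m := nm (_ - _); clear; split; lra.
  have Y0 : 0 < nm Y by apply: lt_le_trans b2; rewrite mulr_gt0 //; clear -u2; lra.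
  have l1 : ln (nm Y) - ln (nm q) <= u.
    rewrite -ln_div ?posrE //; apply: le_trans (_ : ln (1 + u) <= _); last by apply: le_ln1Dx; clear -u0; lra.
    rewrite ler_ln ?posrE ?divr_gt0 //; last by clear -u0; lra.
    by rewrite ler_pdivrMr // mulrC.
  have l2 : ln (nm q) - ln (nm Y) <= 2 * u.
    rewrite -ln_div ?posrE //; apply: le_trans (_ : ln (1 + 2 * u) <= _); last by apply: le_ln1Dx; clear -u0; lra.
    rewrite ler_ln ?posrE ?divr_gt0 //; last by clear -u0; lra.
    rewrite ler_pdivrMr //; apply: le_trans (_ : (1 + 2 * u) * (nm q * (1 - u)) <= _).
      have -> : (1 + 2 * u) * (nm q * (1 - u)) = nm q + nm q * (u * (1 - 2 * u)) by ring.
      rewrite lerDl; apply: mulr_ge0 (ltW q0) _; apply: mulr_ge0 u0 _.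
      by clear -u2; lra.
    by rewrite ler_wpM2l //; clear -u0; lra.
  rewrite (_ : 6 * K ^+ 2 / nm y = 2 * u); last by rewrite /u; field; rewrite gt_eqF.
  by rewrite ler_norml; clear -l1 l2 u0; lra.
have stepD n : D n <= (D n.+1 + 12 * K ^+ 2 / mu n) / (hdeg (s n))%:R.
  have d2 : (2 : R) <= (hdeg (s n))%:R by rewrite (ler_nat _ 2); exact: tame_deg2 (hs n).
  rewrite ler_pdivlMr; last by clear -d2; lra.
  have := stepln _ n (Vn n); have := stepln _ n (Vn' n).
  rewrite !ler_norml /D /=.
  have m0 : 0 < mu n by apply: lt_le_trans (mun n); rewrite mulr_gt0 // exprn_gt0.
  have i1 : 6 * K ^+ 2 / nm (orb s n z).2 <= 6 * K ^+ 2 / mu n.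
    apply: ler_wpM2l; first by rewrite mulr_ge0 ?sqr_ge0.
    by rewrite lef_pV2 ?posrE ?ge_min ?lexx // (lt_le_trans m0) // ge_min lexx.
  have i2 : 6 * K ^+ 2 / nm (orb s n z').2 <= 6 * K ^+ 2 / mu n.
    apply: ler_wpM2l; first by rewrite mulr_ge0 ?sqr_ge0.
    by rewrite lef_pV2 ?posrE ?ge_min ?lexx ?orbT // (lt_le_trans m0) // ge_min lexx orbT.
  have -> : 12 * K ^+ 2 / mu n = 6 * K ^+ 2 / mu n + 6 * K ^+ 2 / mu n by field; rewrite gt_eqF.
  move: i1 i2; set m := _ / mu n; set x1 := _ / nm _; set x2 := _ / nm _.
  set dd := (hdeg (s n))%:R; set l1 := ln _; set l2 := ln _; set l3 := ln _; set l4 := ln _; set l5 := ln _.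
  by clear; lra.
have D0 n : 0 < Deg s n := Deg_gt0 n hs.
pose A := 12 * K ^+ 2 / mu 0%N.
have A0 : 0 <= A by rewrite divr_ge0 ?mulr_ge0 ?sqr_ge0 // ltW.
have main n : D 0%N <= D n / Deg s n + A * (2 - 2 / 2 ^+ n).
  elim: n => [|n IH]; first by rewrite expr0 !divr1 subrr mulr0 addr0.
  apply: le_trans IH _.
  have dn : 0 < (hdeg (s n))%:R :> R by rewrite ltr0n; apply: leq_trans (tame_deg2 (hs n)).
  have h1 : D n / Deg s n <= D n.+1 / Deg s n.+1 + 12 * K ^+ 2 / mu n / Deg s n.+1.
    apply: le_trans (_ : (D n.+1 + 12 * K ^+ 2 / mu n) / (hdeg (s n))%:R / Deg s n <= _).
      by rewrite ler_pM2r ?invr_gt0.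
    have -> : Deg s n.+1 = Deg s n * (hdeg (s n))%:R by [].
    move: (D n.+1) (12 * K ^+ 2 / mu n) => u v.
    by rewrite -(mulrDl u v) invfM [(Deg s n)^-1 * _]mulrC mulrA.
  have h2 : 12 * K ^+ 2 / mu n / Deg s n.+1 <= A / 2 ^+ n.
    have p0 : (0 : R) < 2 ^+ n by rewrite exprn_gt0.
    have Dg1 : 1 <= Deg s n.+1.
      by apply: le_trans (Deg_ge n.+1 hs); apply: exprn_ege1; lra.
    have m0 : 0 < mu n by apply: lt_le_trans (mun n); rewrite mulr_gt0.
    rewrite ler_pdivrMr //; apply: le_trans (_ : A / 2 ^+ n * 1 <= _); last first.
      by rewrite ler_wpM2l // divr_ge0 // ltW.
    rewrite mulr1 /A -[_ / 2 ^+ n]mulrA; apply: ler_wpM2l; first by rewrite mulr_ge0 ?sqr_ge0.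
    have := mun n; move: m0 mu0 p0; set a := mu n; set b := mu 0%N; set c := 2 ^+ n.
    by clear => a0 b0 c0 h; rewrite -invfM lef_pV2 ?posrE ?mulr_gt0 // mulrC.
  have h3 : 2 / 2 ^+ n = 2 / 2 ^+ n.+1 + 1 / 2 ^+ n :> R.
    by rewrite exprS; field; rewrite expf_neq0.
  rewrite h3; have : A * (1 / 2 ^+ n) = A / 2 ^+ n by rewrite mul1r.
  clear -h1 h2; move: h1 h2.
  set a := D n / _; set b := D n.+1 / _; set c := _ / Deg s n.+1; set e := A / _.
  set t := 1 / _; set t' := 2 / _; lra.
(* Equal Green values keep the difference of the logarithms bounded at all times, so it disappears
   after division by [Deg s n]. *)
have big n : D n <= 2 * err + ln 2.
  have hL := green_ub n z' hs; have hL' := green_lb hs (Vplus_W (Vn n)).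
  have hL1 := green_lb hs (Vplus_W (Vn' n)).
  rewrite -gE in hL1 hL.
  have j1 : ln (nm (orb s n z').2) <= Lrad (orb s n z').
    rewrite ler_ln ?posrE ?maxrad_gt0 //; last by apply: lt_le_trans r0 (Vn' n).1.
    by rewrite le_max n2_2 orbT.
  have j2 : Lrad (orb s n z) <= ln 2 + ln (nm (orb s n z).2).
    apply: le_trans (L_W K1 (Vplus_W (Vn n))) _; rewrite max_r //; exact: (Vn n).1.
  have hL2 := green_ub n z hs.
  move: hL hL' hL1 hL2 j1 j2; rewrite /D; set l1 := Lrad _; set l2 := Lrad _; set g := _ * green s z.
  set a := ln (nm (orb s n z').2); set b := ln (nm (orb s n z).2); set c := ln 2.
  by set e := err; clear; lra.
have AE : 24 * K ^+ 2 / Num.min (nm z.2) (nm z'.2) = A * 2.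
  by rewrite /A /mu /=; field; rewrite gt_eqF.
rewrite AE; apply/ler_addgt0Pr => e e0.
have [N hN] := @Deg_big s ((2 * err + ln 2) / e) hs.
apply: le_trans (main N) _; rewrite addrC; apply: lerD.
  rewrite ler_wpM2l //; have : 0 <= 2 / 2 ^+ N :> R by rewrite divr_ge0 ?exprn_ge0.
  by rewrite gerBl.
rewrite ler_pdivrMr //; apply: le_trans (big N) _.
by rewrite [e * _]mulrC -ler_pdivrMr //; exact: hN.
Qed.

End GreenFunction.

Lemma large4 (a b c d : nat) :
  exists n, [/\ (a <= n)%N, (b <= n)%N, (c <= n)%N & (d <= n)%N].
Proof. by exists (a + b + c + d)%N; split; lia. Qed.

(** * The Green function along curves; inverse orbits *)

Section Invariance.
Variable R : realType.
Local Notation C := R[i].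
Variable K : R.
Hypothesis K1 : 1 <= K.
Local Notation rad := (esc_rad K).
Local Notation err := (esc_err K).
Local Notation Lrad := (Lrad K).
Local Notation Wset := (Wset K).
Local Notation Vplus := (Vplus K).
Local Notation green := (green K).
Implicit Types (s : nat -> henon_data R) (z w p : C2 R) (h : henon_data R).

(** Either S_n z is in W and the lower bound for G applies, or the orbit has not met W up to time n
    and its first coordinate has only decreased. *)
Lemma n2_orb_le s n z : adm K s ->
  n2 (orb s n z) <= Num.max (n2 z) (expR (Deg s n * green s z + err)).
Proof.
move=> hs; rewrite le_max; have [hW|nW] := pselect (Wset (orb s n z)).
  apply/orP; right; apply: le_trans (n2_le_exp K1 _) _; rewrite ler_expR.
  by have := green_lb K1 hs hW; lra.
have nWk k : (k <= n)%N -> 2 * nm (orb s k z).2 < nm (orb s k z).1.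
  move=> kn; rewrite ltNge; apply/negP => h; apply: nW.
  apply: (orb_W_le K1 hs kn); rewrite WsetE; apply: le_trans h _.
  by rewrite ler_pM2l // le_max lexx.
have hk k : (k <= n)%N -> nm (orb s k z).1 <= nm z.1.
  elim: k => [|k IH] kn //; rewrite orb1.
  by have := nWk k (ltnW kn); have := IH (ltnW kn); have := nm_ge0 (orb s k z).2; lra.
apply/orP; left; apply: le_trans (n2_1 z); rewrite n2_le hk //=.
by have := nWk n (leqnn n); have := hk n (leqnn n); have := nm_ge0 (orb s n z).2; lra.
Qed.

Lemma Deg_lim s (a b e : R) : adm K s -> 0 <= b -> 0 < e ->
  exists N, forall n, (N <= n)%N -> a + n%:R * b <= e * Deg s n.
Proof.
move=> hs b0 e0; have [k hk] := half_pow_small ((`|a| + 3 * b) / e) (@ltr01 R).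
exists k.*2 => n hn; set j := n./2.
have kj : (k <= j)%N by rewrite /j -(doubleK k) half_leq.
have jn : (n <= j.*2.+1)%N by rewrite -[leqLHS]odd_double_half -/j; case: (odd n).
have P0 : (0 : R) < 2 ^+ j by rewrite exprn_gt0.
have h1 : `|a| + 3 * b <= e * 2 ^+ j.
  rewrite [e * _]mulrC -ler_pdivrMr //; move: hk; rewrite ltr_pdivrMr ?exprn_gt0 // mul1r => /ltW hk.
  by apply: le_trans hk _; apply: ler_weXn2l => //; lra.
have h2 : 1 <= 2 ^+ j :> R by apply: exprn_ege1; lra.
have h3 : j%:R <= 2 ^+ j :> R by rewrite -natrX ler_nat ltnW // ltn_expl.
have h4 : n%:R <= 2 * j%:R + 1 :> R.
  by rewrite -natrM natr1 ler_nat mul2n.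
have h5 : 2 ^+ j * 2 ^+ j <= Deg s n.
  apply: le_trans (Deg_ge n hs); rewrite -exprD addnn; apply: ler_weXn2l; first by lra.
  by rewrite -[leqRHS]odd_double_half leq_addl.
apply: le_trans (_ : (`|a| + 3 * b) * 2 ^+ j <= _).
  have h6 := ler_norm a; have h7 : n%:R * b <= (2 * j%:R + 1) * b by rewrite ler_wpM2r.
  have h8 := normr_ge0 a; clear -h2 h3 h6 h7 h8 b0; set P := 2 ^+ j in h2 h3 *; set m := `|a| in h6 h8 *.
  have : m <= m * P by rewrite ler_peMr.
  have : j%:R * b <= P * b by rewrite ler_wpM2r.
  have : b <= b * P by rewrite ler_peMr.
  have E : (2 * j%:R + 1) * b = 2 * (j%:R * b) + b by ring.
  rewrite E in h7.
  have -> : (m + 3 * b) * P = m * P + 3 * (b * P) by ring.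
  have -> : P * b = b * P by ring.
  lra.
apply: le_trans (_ : e * (2 ^+ j * 2 ^+ j) <= _); last by rewrite ler_pM2l.
by rewrite mulrA ler_pM2r.
Qed.

Lemma le_of_Deg s (x y c : R) : adm K s ->
  (exists N, forall n, (N <= n)%N -> Deg s n * x <= Deg s n * y + c) -> x <= y.
Proof.
move=> hs [N hN]; apply/ler_addgt0Pr => e e0.
have [N' hN'] := @Deg_lim s c 0 e hs (lexx _) e0.
have := hN _ (leq_maxl N N'); have := hN' _ (leq_maxr N N'); rewrite mulr0 addr0.
have D0 := Deg_gt0 (maxn N N') hs; set D := Deg s _ in D0 *.
move=> h1 h2; rewrite -(ler_pM2l D0) mulrDr; have -> : D * e = e * D by ring.
by lra.
Qed.

(** Hadamard's theorem for G along a holomorphic curve: the three circles theorem is applied to both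
    coordinates of the n-th iterate, and the result is divided by D_n. *)
Lemma three_circles_green s (c : C -> C2 R) (p : C) (r rho A B : R) : adm K s ->
  0 < r -> r < rho -> 0 <= B ->
  (forall t, nm (t - p) <= rho -> hcurve c t) ->
  (forall t, nm (t - p) = r -> green s (c t) <= A) ->
  (forall t, nm (t - p) = rho -> green s (c t) <= A + B) ->
  forall t, r <= nm (t - p) <= rho ->
    green s (c t) <= A + B * (ln (nm (t - p) / r) / ln (rho / r)).
Proof.
move=> hs r0 rr B0 hc hA hB t ht; have r1 : 1 <= rad by have := rad_ge100 K1; lra.
have rho0 : 0 < rho by lra.
have t0 : 0 < nm (t - p) by case/andP: ht; lra.
have [M1 M10 hM1] := disc_bounded (fun v hv => cdif_ccont (hc v hv).1).
have [M2 M20 hM2] := disc_bounded (fun v hv => cdif_ccont (hc v hv).2).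
pose M := 1 + M1 + M2.
have Mb u : nm (u - p) <= rho -> n2 (c u) <= M.
  by move=> hu; rewrite n2_le /M; have := hM1 u hu; have := hM2 u hu; clear -M10 M20; lra.
have M1' : 1 <= M by rewrite /M; clear -M10 M20; lra.
have er0 := err_gt0 K1.
pose l := ln (rho / r).
have l0 : 0 < l by apply: ln_gt0; rewrite ltr_pdivlMr // mul1r.
set lam := ln (nm (t - p) / r).
have lam0 : 0 <= lam by apply: ln_ge0; rewrite ler_pdivlMr // mul1r; case/andP: ht.
apply: (@le_of_Deg s _ _ (2 * err + ln rad + ln M + lam) hs); exists 0%N => n _.
have D0 := Deg_gt0 n hs; set D := Deg s n in D0 *.
have A0 : 0 <= A.
  apply: le_trans (hA (p + r%:C%C) _); first exact: green_ge0.
  by rewrite addrAC subrr add0r nm_real ger0_norm // ltW.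
(* Least natural exponent strictly above D B / l; the excess of at most 1 costs [lam], which does
   not grow with n. *)
pose b := (Num.trunc (D * B / l)).+1.
have hb : D * B / l <= b%:R.
  by apply/ltW/truncnS_gt.
have hb' : b%:R <= D * B / l + 1.
  rewrite -natr1 lerD2r -truncn_ge_nat //; apply: divr_ge0; last exact: ltW.
  by apply: mulr_ge0 => //; exact: ltW.
pose Q := M * expR (D * A + err).
have Q0 : 0 < Q by rewrite /Q; apply: mulr_gt0; [clear -M1'; lra|exact: expR_gt0].
have expbound u (X : R) : nm (u - p) <= rho -> green s (c u) <= X -> 0 <= X ->
    n2 (orb s n (c u)) <= M * expR (D * X + err).
  move=> hu hX X0; apply: le_trans (n2_orb_le n _ hs) _; rewrite ge_max; apply/andP; split.
    apply: le_trans (Mb _ hu) _; rewrite ler_peMr //; first by clear -M1'; lra.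
    rewrite -expR0 ler_expR; apply: addr_ge0; last exact: ltW.
    by apply: mulr_ge0 => //; exact: ltW.
  apply: le_trans (_ : expR (D * X + err) <= _).
    by rewrite ler_expR lerD2r ler_pM2l.
  by rewrite ler_peMl ?expR_ge0.
have inner u : nm (u - p) = r -> n2 (orb s n (c u)) <= Q.
  by move=> hu; apply: expbound; [rewrite hu ltW|exact: hA|].
have outer u : nm (u - p) = rho -> n2 (orb s n (c u)) <= Q * (rho / r) ^+ b.
  move=> hu; apply: le_trans (_ : M * expR (D * (A + B) + err) <= _).
    by apply: expbound; [rewrite hu|exact: hB|apply: addr_ge0].
  have -> : D * (A + B) + err = (D * A + err) + D * B by ring.
  rewrite expRD mulrA -/Q ler_pM2l //.
  have -> : rho / r = expR l by rewrite lnK // posrE divr_gt0.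
  by rewrite -expRM_natl ler_expR -ler_pdivrMr.
have cd u : r <= nm (u - p) <= rho -> hcurve (fun v => orb s n (c v)) u.
  by case/andP=> _ hu; apply: hcurve_comp; [exact: hc|exact: holo_orb].
have T1 := three_circles r0 (ltW rr) (fun u hu => (cd u hu).1)
  (fun u hu => le_trans (n2_1 _) (inner u hu)) (fun u hu => le_trans (n2_1 _) (outer u hu)) ht.
have T2 := three_circles r0 (ltW rr) (fun u hu => (cd u hu).2)
  (fun u hu => le_trans (n2_2 _) (inner u hu)) (fun u hu => le_trans (n2_2 _) (outer u hu)) ht.
have T : n2 (orb s n (c t)) <= Q * (nm (t - p) / r) ^+ b by rewrite n2_le T1 T2.
have e1 : nm (t - p) / r = expR lam by rewrite lnK // posrE divr_gt0.
have X1 : 1 <= Q * (nm (t - p) / r) ^+ b.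
  rewrite e1 -expRM_natl /Q -mulrA -expRD; apply: le_trans (M1') _; rewrite ler_peMr //; first by clear -M1'; lra.
  rewrite -expR0 ler_expR; apply: addr_ge0; last exact: mulr_ge0.
  by apply: addr_ge0; [apply: mulr_ge0 => //|]; exact: ltW.
have hub := green_ub K1 n (c t) hs; rewrite -/D in hub.
have hL : Lrad (orb s n (c t)) <= ln (rad * (Q * (nm (t - p) / r) ^+ b)).
  apply: L_exp => //; first by rewrite ler_peMr // ltW // rad_gt0.
  by apply: le_trans T _; rewrite ler_peMl // (le_trans ler01 X1).
move: hL; rewrite -/l lnM ?posrE ?rad_gt0 ?(lt_le_trans ltr01 X1) //.
have -> : Q * (nm (t - p) / r) ^+ b = M * expR (D * A + err + b%:R * lam).
  by rewrite e1 -expRM_natl /Q -mulrA -expRD.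
have -> (X : R) : ln (M * expR X) = ln M + X.
  by rewrite (@lnM _ M) ?posrE ?expR_gt0 ?(lt_le_trans ltr01 M1') // expRK.
move=> hL.
have hl : b%:R * lam <= (D * B / l + 1) * lam by rewrite ler_wpM2r.
have E1 : D * (A + B * (lam / l)) = D * A + D * B / l * lam by field; rewrite gt_eqF.
rewrite E1; have E2 : (D * B / l + 1) * lam = D * B / l * lam + lam by ring.
rewrite E2 in hl; clear -hub hL hl.
move: hub hL hl; set x := D * green _ _; set y := b%:R * _; set v := D * B / l * lam.
set u := Lrad _; set w := D * A; lra.
Qed.

Lemma green_bounded_orbit s p : adm K s -> green s p = 0 ->
  exists2 M, 1 <= M & forall n, n2 (orb s n p) <= M.
Proof.
move=> hs g0; have [n0 hn0] := orb_enter_W K1 p hs.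
have fin n : exists2 M, 1 <= M & forall k, (k < n)%N -> n2 (orb s k p) <= M.
  elim: n => [|n [M M1 hM]]; first by exists 1.
  exists (Num.max M (n2 (orb s n p))); first by rewrite le_max M1.
  move=> k; rewrite ltnS leq_eqVlt => /orP[/eqP ->|/hM h]; rewrite le_max ?lexx ?orbT //.
  by rewrite h.
have [M M1 hM] := fin n0; exists (Num.max M (expR err)); first by rewrite le_max M1.
move=> n; have [/hM h|hn] := ltnP n n0; first by rewrite le_max h.
rewrite le_max; apply/orP; right; apply: le_trans (n2_le_exp K1 _) _; rewrite ler_expR.
by apply: (green_0_bounded K1 hs g0); exact: orb_W_le hn0.
Qed.

Definition deg_cap : nat := (Num.trunc K).+1.

(* A Lipschitz constant of the inverse maps on bidiscs of radius M + 1. *)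
Definition lipc (M : R) : R := 2 * K ^+ 2 * (M + 1) ^+ deg_cap.

Lemma hdeg_cap h : tame K h -> (hdeg h <= deg_cap)%N.
Proof.
move=> th; apply: leqW; rewrite truncn_ge_nat; last by rewrite ltW // K_gt0.
exact: tame_degK th.
Qed.

Lemma lipc_ge1 M : 0 <= M -> 1 <= lipc M.
Proof.
move=> M0; have k0 := K1; apply: mulr_ege1; last by apply: exprn_ege1; lra.
have : 1 <= K ^+ 2 by apply: exprn_ege1.
by clear; lra.
Qed.

Lemma henon_inv_lip h z w M : tame K h -> 0 <= M -> n2 z <= M -> dist2 w z <= 1 ->
  dist2 (henon_inv h w) (henon_inv h z) <= lipc M * dist2 w z.
Proof.
move=> th M0; rewrite n2_le => /andP[hz _] hd.
have k1 := K1; have k0 := K_gt0 K1; set D := dist2 w z in hd *.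
have D0 : 0 <= D := dist2_ge0 _ _.
have lM := lipc_ge1 M0.
have hw : nm w.1 <= M + 1.
  have -> : w.1 = z.1 + (w.1 - z.1) by rewrite addrC subrK.
  by apply: le_trans (nmD _ _) _; apply: lerD => //; apply: le_trans hd; exact: dist2_1.
rewrite dist2_le; apply/andP; split; last first.
  apply: le_trans (dist2_1 w z) _; rewrite -/D; exact: ler_peMl.
rewrite [(henon_inv h w).1]/= [(henon_inv h z).1]/= -mulrBl nmf_div.
have h1 : nm (h.1.[w.1] - h.1.[z.1]) <= K * (M + 1) ^+ (hdeg h).-1 * nm (w.1 - z.1).
  by apply: (tame_lip th) => //; clear -M0 hz; lra.
have h2 : (M + 1) ^+ (hdeg h).-1 <= (M + 1) ^+ deg_cap.
  apply: ler_weXn2l; first by clear -M0; lra.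
  by apply: leq_trans (leq_pred _) _; exact: hdeg_cap.
have h3 : 1 <= (M + 1) ^+ deg_cap by apply: exprn_ege1; clear -M0; lra.
rewrite ler_pdivrMr ?nm_gt0 ?(tame_jac K1 th) //.
have -> : h.1.[w.1] - w.2 - (h.1.[z.1] - z.2) = (h.1.[w.1] - h.1.[z.1]) - (w.2 - z.2) by ring.
apply: le_trans (nmB _ _) _.
have d1 : nm (w.1 - z.1) <= D := dist2_1 _ _; have d2 : nm (w.2 - z.2) <= D := dist2_2 _ _.
apply: le_trans (_ : K * (M + 1) ^+ deg_cap * D + D <= _).
  apply: lerD => //; apply: le_trans h1 _; apply: ler_pM => //; rewrite ?nm_ge0 //.
    by rewrite mulr_ge0 ?exprn_ge0 ?(ltW k0) //; clear -M0; lra.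
  by rewrite ler_wpM2l // ltW.
have jl := tame_jac_lb th; set P := (M + 1) ^+ deg_cap in h3 *.
apply: le_trans (_ : 2 * K * P * D <= _).
  have -> : 2 * K * P * D = K * P * D + K * P * D by ring.
  rewrite lerD2l ler_peMl //; exact: mulr_ege1.
rewrite /lipc -/P; have -> : 2 * K ^+ 2 * P * D * nm h.2 = (2 * K * P * D) * (K * nm h.2) by ring.
rewrite ler_peMr //; last by rewrite mulrC -ler_pdivrMr // mul1r.
by rewrite !mulr_ge0 // ?(ltW k0) //; clear -h3; lra.
Qed.

(** The product bounds the Lipschitz constant of the n-th inverse iterate near the orbit of p. The
    condition r <= 1 keeps all intermediate points at distance at most 1 from this orbit, where
    [lipc] is valid. *)
Lemma orbV_lip s (M : nat -> R) n p w (r : R) : adm K s -> r <= 1 ->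
  (forall k, (k <= n)%N -> n2 (orb s k p) <= M k) ->
  dist2 w (orb s n p) <= r / \prod_(k < n) lipc (M k.+1) -> dist2 (orbV s n w) p <= r.
Proof.
move=> hs r1; elim: n w => [|n IH] w hM; first by rewrite big_ord0 divr1.
rewrite big_ord_recr /=; set P := \prod_(k < n) _ => hw.
have M0 k : (k <= n.+1)%N -> 0 <= M k by move=> /hM; apply: le_trans (n2_ge0 _).
have P1 : 1 <= P.
  rewrite /P; elim/big_rec: _ => // i x _ hx; apply: mulr_ege1 => //.
  by apply: lipc_ge1; apply: M0; rewrite ltnS ltnW.
have L1 : 1 <= lipc (M n.+1) by apply: lipc_ge1; exact: M0.
apply: IH; first by move=> k kn; apply: hM; exact: leqW.
have -> : orb s n p = henon_inv (s n) (orb s n.+1 p) by rewrite /= henonK // (tame_jac K1 (hs n)).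
have PL : 0 < P * lipc (M n.+1) by rewrite mulr_gt0 //; clear -P1 L1; lra.
have r0 : 0 <= r.
  by have := le_trans (dist2_ge0 _ _) hw; rewrite ler_pdivlMr // mul0r.
apply: le_trans (henon_inv_lip (hs n) (M0 n.+1 _) (hM n.+1 _) _) _ => //.
  apply: le_trans hw _; rewrite ler_pdivrMr // mul1r; apply: le_trans r1 _; exact: mulr_ege1.
apply: le_trans (_ : lipc (M n.+1) * (r / (P * lipc (M n.+1))) <= _).
  by rewrite ler_wpM2l //; clear -L1; lra.
rewrite -/P; move: (lipc _) L1 => l L1.
rewrite le_eqVlt; apply/orP; left; apply/eqP; field.
by rewrite (gt_eqF (lt_le_trans ltr01 P1)) (gt_eqF (lt_le_trans ltr01 L1)).
Qed.

Definition line p (u : C2 R) (t : C) : C2 R := (p.1 + t * u.1, p.2 + t * u.2).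

Lemma line0 p u : line p u 0 = p.
Proof. by case: p => a b; rewrite /line !mul0r !addr0. Qed.

Lemma hcurve_line p u t : hcurve (line p u) t.
Proof.
by split; apply: cdifD; rewrite /=; [exact: cdif_cst|apply: cdifM|exact: cdif_cst|apply: cdifM];
   do ?[exact: cdif_id|exact: cdif_cst].
Qed.

Lemma line_dist p u t : n2 u <= 1 -> dist2 (line p u t) p <= nm t.
Proof.
rewrite n2_le => /andP[h1 h2]; rewrite dist2_le /=.
rewrite [p.1 + _]addrC [p.2 + _]addrC !addrK !nmM.
by rewrite !ler_piMr ?nm_ge0.
Qed.

Lemma line_through p w : 0 < dist2 w p ->
  exists2 u, n2 u <= 1 & line p u (dist2 w p)%:C%C = w.
Proof.
move=> d0; set d := dist2 w p in d0 *.
have dn : d%:C%C != 0 :> C by rewrite -nm_eq0 nm_real normr_eq0 gt_eqF.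
exists ((w.1 - p.1) / d%:C%C, (w.2 - p.2) / d%:C%C).
  rewrite n2_le /= !nmf_div nm_real gtr0_norm // !ler_pdivrMr // !mul1r.
  by rewrite dist2_1 dist2_2.
by case: w @d d0 dn => a b d d0 dn; rewrite /line /= !(mulrC d%:C%C) !divfK // !(addrC _ (_ - _)) !subrK.
Qed.

Lemma polydisc_green s n w (r : R) : adm K s -> rad <= r -> n2 w <= r ->
  Deg s n * green s (orbV s n w) <= ln r + err.
Proof.
move=> hs h1 h2; apply: le_trans (green_ub K1 n _ hs) _.
rewrite orbitVK; last by move=> k; exact: (tame_jac K1 (hs k)).
by rewrite lerD2r; exact: L_exp.
Qed.

Lemma dist_orb_le s n p z M : adm K s -> 0 <= M -> n2 (orb s n p) <= M ->
  dist2 (orb s n z) (orb s n p) <= expR (Deg s n * green s z + (err + ln (n2 z + M + 1))).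
Proof.
move=> hs M0 hM; have z0 := n2_ge0 z; have D0 := Deg_gt0 n hs; have g0 := green_ge0 K1 z hs.
have er0 := err_gt0 K1.
apply: le_trans (dist2_n2 _ _) _; have := n2_orb_le n z hs.
rewrite addrA [expR (_ + ln _)]expRD (@lnK _ (n2 z + M + 1)); last by rewrite posrE; clear -z0 M0; lra.
set X := expR _; have X1 : 1 <= X.
  by rewrite /X -expR0 ler_expR; apply: addr_ge0; [apply: mulr_ge0 => //|]; exact: ltW.
move=> h; apply: le_trans (lerD h hM) _.
have h2 : M <= X * M by rewrite ler_peMl.
have h3 : n2 z <= X * n2 z by rewrite ler_peMl.
have -> : X * (n2 z + M + 1) = X * n2 z + X * M + X by ring.
have h4 : Num.max (n2 z) X <= X * n2 z + X.
  have h5 : 0 <= X * n2 z by clear -z0 h3; lra.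
  by rewrite ge_max; clear -h3 h5 X1; apply/andP; split; lra.
by clear -h2 h4; lra.
Qed.

End Invariance.

(** * Automorphisms of a sublevel set preserve the Green function *)

Section GreenGrowth.
Variable R : realType.
Local Notation C := R[i].
Variable K : R.
Hypothesis K1 : 1 <= K.
Local Notation rad := (esc_rad K).
Local Notation err := (esc_err K).
Local Notation green := (green K).
Local Notation lipc := (lipc K).
Implicit Types (s : nat -> henon_data R) (z w p : C2 R) (h : henon_data R).

Definition aut2 (U : C2 R -> Prop) (f g : C2 R -> C2 R) :=
  (forall z, U z -> [/\ holo f z, U (f z) & g (f z) = z]) /\
  (forall z, U z -> [/\ holo g z, U (g z) & f (g z) = z]).

Lemma aut2_sym U f g : aut2 U f g -> aut2 U g f.
Proof. by case. Qed.

Lemma polydisc_lt s n w (c c' : R) : adm K s -> rad <= expR (Deg s n * c') ->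
  err + 1 <= (c - c') * Deg s n -> n2 w <= expR (Deg s n * c') -> green s (orbV s n w) < c.
Proof.
move=> hs h1 h2 hw; have := polydisc_green K1 n hs h1 hw; rewrite expRK => h.
have D0 := Deg_gt0 n hs; rewrite -(ltr_pM2l D0); apply: le_lt_trans h _.
by move: h2; rewrite mulrBl [c * _]mulrC [c' * _]mulrC; clear; lra.
Qed.

(* The three circles theorem on the complex line joining the n-th iterates of
   p and z, between a disc around the former of radius exp(-O(n)) and one of
   radius exp(D_n c'). *)
Lemma green_aut_growth s c f g p z : adm K s -> aut2 (fun w => green s w < c) f g ->
  green s p = 0 -> green s z < c -> green s (f z) <= green s (f p) + green s z.
Proof.
move=> hs [hf _] p0 zc; have g0 := green_ge0 K1 z hs; have c0 : 0 < c by lra.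
have pc : green s p < c by rewrite p0.
(* For c' < c the inverse iterate maps the polydisc of radius exp(D_n c') into the domain {G < c} of
   f, for n large; the claim follows as c' tends to c. *)
suff main c' : 0 < c' -> green s z < c' < c ->
    c' * (green s (f z) - green s (f p)) <= c * green s z.
  rewrite -lerBlDl leNgt; apply/negP => hlt.
  set v := green s (f z) - green s (f p) in main hlt.
  have v0 : 0 < v by lra.
  pose th := Num.min ((c - green s z) / 2) (c * (v - green s z) / (2 * v)).
  have th0 : 0 < th.
    by rewrite lt_min; apply/andP; split; apply: divr_gt0; rewrite ?mulr_gt0 //; lra.
  have th1 : th <= (c - green s z) / 2 by rewrite ge_min lexx.
  have th2 : th * v <= c * (v - green s z) / 2.
    rewrite -ler_pdivlMr //; apply: le_trans (_ : c * (v - green s z) / (2 * v) <= _).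
      by rewrite ge_min lexx orbT.
    by rewrite le_eqVlt; apply/orP; left; apply/eqP; field; rewrite gt_eqF.
  have h1 : 0 < c - th by clear -th1 zc c0 g0; lra.
  have h2 : green s z < c - th < c by clear -th1 th0 zc; apply/andP; split; lra.
  have := main _ h1 h2; rewrite mulrBl; move: th2; rewrite mulrBr.
  have : 0 < c * (v - green s z) by rewrite mulr_gt0 // subr_gt0.
  by rewrite mulrBr; clear; lra.
move=> c'0 /andP[zc' cc']; apply/ler_addgt0Pr => e0 e00.
pose e := e0 / (2 * c'); have ee : 0 < e by rewrite divr_gt0 // mulr_gt0.
have [[hfp fpc _] [_ fzc _]] := (hf p pc, hf z zc).
have [M M1 hM] := green_bounded_orbit K1 hs p0.
have M0 : 0 <= M by lra.
have [d1 d10 hd1] := green_cont K1 (f p) hs ee.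
have [d2 d20 hd2] := holo_cont hfp d10.
pose s0 := Num.min 1 (d2 / 2).
have s00 : 0 < s0 by rewrite lt_min ltr01 divr_gt0.
have s01 : s0 <= 1 by rewrite ge_min lexx.
pose L := lipc M; have L1 : 1 <= L := lipc_ge1 K1 M0.
have L0 : 0 < L by lra.
have lL0 : 0 <= ln L by apply: ln_ge0.
pose kap := err + ln (n2 z + M + 1).
have c'c : 0 < c - c' by lra.
have zc'' : 0 < c' - green s z by lra.
have ec0 : 0 < e * c' by rewrite mulr_gt0.
have [N1 hN1] := @Deg_lim R K s (err + 1) 0 (c - c') hs (lexx _) c'c.
have [N2 hN2] := @Deg_lim R K s (ln (2 * rad) + ln (2 * (M + 1))) 0 c' hs (lexx _) c'0.
have [N3 hN3] := @Deg_lim R K s (kap + ln 4) 0 _ hs (lexx _) zc''.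
(* The slope c ln L accounts for the inner radius s0 / L^n, L being the Lipschitz constant of one
   inverse step near the bounded orbit of p: a loss linear in n, against D_n. *)
have [N4 hN4] := @Deg_lim R K s (c * (kap - ln s0) + (c * green s z / c' + e) * ln 2) (c * ln L) _ hs
   (mulr_ge0 (ltW c0) lL0) ec0.
have [n [/hN1 h1 /hN2 h2 /hN3 h3 /hN4 h4]] := large4 N1 N2 N3 N4.
clear hN1 hN2 hN3 hN4.
have D0 := Deg_gt0 n hs; set D := Deg s n in D0 h1 h2 h3 h4.
rewrite !mulr0 !addr0 in h1 h2 h3.
pose rho1 := expR (D * c').
have r0 := rad_gt0 K1; have r100 := rad_ge100 K1.
have hrho : rad + 2 * M <= rho1 / 2 + M.
  have : rad * 2 * (2 * (M + 1)) <= rho1.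
    rewrite /rho1 -[leLHS]lnK ?posrE; last by rewrite !mulr_gt0 //; lra.
    rewrite ler_expR lnM ?posrE; [|by lra|by lra].
    by rewrite [rad * 2]mulrC [D * _]mulrC.
  have : 0 <= (rad - 1) * M by rewrite mulr_ge0 //; lra.
  by clear -r100 M0; lra.
pose rho := rho1 - M.
pose pn := orb s n p; pose zn := orb s n z; pose tau := dist2 zn pn.
pose rn := s0 / L ^+ n.
have Ln1 : 1 <= L ^+ n by apply: exprn_ege1.
have rn0 : 0 < rn by rewrite divr_gt0 // exprn_gt0.
have rns : rn <= s0 by rewrite ler_pdivrMr ?exprn_gt0 // ler_peMr // ltW.
have jacs k : (s k).2 != 0 by exact: (tame_jac K1 (hs k)).
have near_p w : dist2 w pn <= rn -> green s (f (orbV s n w)) <= green s (f p) + e.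
  move=> hw; have : dist2 (orbV s n w) p <= s0.
    apply: (@orbV_lip R K K1 s (fun=> M) n) => //.
    by rewrite big_const_ord iter_mulr_1.
  move=> hw2; have /hd2 /hd1 : dist2 (orbV s n w) p < d2.
    apply: le_lt_trans hw2 _; rewrite gt_min; apply/orP; right.
    by clear -d20; lra.
  by rewrite ltr_norml => /andP[_]; clear; lra.
have hr : rad <= rho1 by clear -hrho M0 r100; lra.
have polyd w : n2 w <= rho1 -> green s (orbV s n w) < c by exact: polydisc_lt.
have znE : orbV s n zn = z by rewrite /zn orbitK.
have fin : green s (f z) <= green s (f p) + e + (c * green s z / c' + e) ->
    c' * (green s (f z) - green s (f p)) <= c * green s z + e0.
  have -> : c * green s z + e0 = c' * (e + (c * green s z / c' + e)).
    by rewrite /e; field; rewrite gt_eqF.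
  by rewrite ler_pM2l //; clear; lra.
have cg0 : 0 <= c * green s z / c' by rewrite divr_ge0 ?mulr_ge0 // ltW.
apply: fin; have [hle|hlt] := leP tau rn.
  by have := near_p zn hle; rewrite znE; move: cg0 ee; clear; lra.
have tau0 : 0 < tau by apply: lt_trans hlt.
have htau : tau <= expR (D * green s z + kap) by exact: dist_orb_le.
have tau4 : tau * 4 <= rho1.
  apply: le_trans (_ : expR (D * green s z + kap) * 4 <= _); first by rewrite ler_pM2r.
  rewrite -[X in _ * X]lnK ?posrE // -expRD ler_expR.
  by move: h3; rewrite mulrBl [c' * _]mulrC [green s z * _]mulrC; clear; lra.
have [u u1 hu] := line_through tau0.
pose cv t := f (orbV s n (line pn u t)).
have cn t : nm t <= rho -> n2 (line pn u t) <= rho1.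
  move=> ht; apply: le_trans (n2_dist2 _ pn) _; have := line_dist pn t u1.
  by have := hM n; rewrite -/pn; move: ht; rewrite /rho; clear; lra.
have rhoge : rho1 / 2 <= rho by rewrite /rho; clear -hrho r0 M0; lra.
have taurho : tau < rho by clear -tau4 rhoge tau0; lra.
have rrho : rn < rho by apply: lt_trans hlt taurho.
have nmt : nm (tau%:C%C - 0 : C) = tau by rewrite subr0 nm_real gtr0_norm.
(* The ratio ln(tau / rn) / ln(rho / rn) is (D_n G(z) + O(n)) / (D_n c' - O(1)), so the limit of the
   bound is G(f p) + c G(z) / c'. *)
have TC := @three_circles_green R K K1 s cv 0 rn rho (green s (f p) + e) c hs rn0 rrho (ltW c0).
have {TC} := TC _ _ _ tau%:C%C; rewrite nmt.
have hcv t : nm (t - 0) <= rho -> hcurve cv t.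
  rewrite subr0 => ht; apply: (@hcurve_comp _ (fun w => f (orbV s n w))); first exact: hcurve_line.
  apply: holo_comp; first exact: holo_orbV.
  by have [] := hf _ (polyd _ (cn t ht)).
have hin t : nm (t - 0) = rn -> green s (cv t) <= green s (f p) + e.
  rewrite subr0 => ht; apply: near_p; rewrite -ht; exact: line_dist.
have hout t : nm (t - 0) = rho -> green s (cv t) <= green s (f p) + e + c.
  rewrite subr0 => ht; have [|_ + _] := hf _ (polyd (line pn u t) _).
    by apply: cn; rewrite ht.
  by rewrite -/(cv t); have := green_ge0 K1 (f p) hs; move: ee; clear; lra.
move=> /(_ hcv hin hout); rewrite (ltW hlt) (ltW taurho) => /(_ isT).
rewrite /cv hu znE => h; apply: le_trans h _; rewrite lerD2l.
have Y0 : 0 < D * c' - ln 2.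
  have : ln 2 < ln (2 * rad) + ln (2 * (M + 1)).
    rewrite lnM ?posrE // -addrA ltrDl; apply: addr_gt0; apply: ln_gt0; clear -r100 M0; lra.
  by move: h2; rewrite [c' * _]mulrC; clear; lra.
have Yge : D * c' - ln 2 <= ln (rho / rn).
  have -> : D * c' - ln 2 = ln (rho1 / 2) by rewrite ln_div ?posrE ?expR_gt0 // expRK.
  have rho10 : 0 < rho1 / 2 by rewrite divr_gt0 ?expR_gt0.
  have rho0 : 0 < rho by apply: lt_le_trans rhoge.
  have rr0 : 0 < rho / rn by exact: divr_gt0.
  rewrite ler_ln ?posrE //; apply: le_trans rhoge _.
  by rewrite ler_pdivlMr // ler_piMr ?(ltW rho0) // (le_trans rns).
have Xle : ln (tau / rn) <= D * green s z + (kap - ln s0) + n%:R * ln L.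
  rewrite ln_div ?posrE // /rn ln_div ?posrE ?exprn_gt0 // lnXn // -[ln L *+ n]mulr_natl.
  have : ln tau <= D * green s z + kap.
    by rewrite -[leRHS]expRK ler_ln ?posrE ?expR_gt0.
  by clear; lra.
have Y0' : 0 < ln (rho / rn) by apply: lt_le_trans Yge.
rewrite mulrA ler_pdivrMr //.
apply: le_trans (_ : (c * green s z / c' + e) * (D * c' - ln 2) <= _); last first.
  by rewrite ler_wpM2l // addr_ge0 // ltW.
apply: le_trans (_ : c * (D * green s z + (kap - ln s0) + n%:R * ln L) <= _).
  by rewrite ler_wpM2l // ltW.
have -> : (c * green s z / c' + e) * (D * c' - ln 2) =
    c * green s z * D + e * c' * D - (c * green s z / c' + e) * ln 2.
  by field; rewrite gt_eqF.
move: h4; set q := (c * green s z / c' + e) * ln 2.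
rewrite !mulrDr (_ : n%:R * (c * ln L) = c * (n%:R * ln L)); last by ring.
rewrite (_ : c * (D * green s z) = c * green s z * D); last by ring.
by clear; lra.
Qed.

End GreenGrowth.

(** * Holomorphic curves in level sets of the Green function *)

Section LevelCurves.
Variable R : realType.
Local Notation C := R[i].
Variable K : R.
Hypothesis K1 : 1 <= K.
Local Notation rad := (esc_rad K).
Local Notation Vplus := (Vplus K).
Local Notation green := (green K).
Implicit Types (s : nat -> henon_data R) (z w p : C2 R) (h : henon_data R).

Lemma ln_ratio (a b x : R) : 0 < a -> 0 < b -> ln a - ln b <= x -> a * (1 - x) <= b.
Proof.
move=> a0 b0 h; have e1 := expR_ge1Dx (- x).
have : expR (- x) <= b / a.
  rewrite -[leRHS]lnK ?posrE ?divr_gt0 // ler_expR ln_div ?posrE //.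
  by clear -h; lra.
rewrite ler_pdivlMr // => h2; apply: le_trans h2; rewrite mulrC ler_pM2r //.
Qed.

(** By [green_eq_ratio] the quotient of second coordinates is bounded by 1 + O(1 / |y|), so by
    [schwarz_one] it differs from 1 by O(1 / |y|). Multiplied by |y| this gives a displacement bound
    independent of y, which therefore holds along the whole forward orbit ([level_curve]). *)
Lemma level_curve0 s (c : C -> C2 R) (rho : R) : adm K s -> 0 < rho ->
  (forall t, nm t <= rho -> [/\ hcurve c t, Vplus (c t) & green s (c t) = green s (c 0)]) ->
  forall t, nm t <= rho / 2 -> nm ((c t).2 - (c 0).2) <= 288 * K ^+ 2 * (2 * nm t / rho).
Proof.
move=> hs rho0 hc t ht; have k2 : 1 <= K ^+ 2 by apply: exprn_ege1.
have [_ [hy _] _] : [/\ hcurve c 0, Vplus (c 0) & green s (c 0) = green s (c 0)].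
  by apply: hc; rewrite nm0 ltW.
set y := (c 0).2 in hy *.
have r0 := rad_gt0 K1; have rK : 100 * K ^+ 2 <= rad by exact: (rad_ge K1).
have y0 : 0 < nm y by lra.
have yn : y != 0 by rewrite -nm_gt0.
have bound u : nm u <= rho -> nm ((c u).2 / y) <= 1 + 96 * K ^+ 2 / nm y.
  move=> hu; have [_ hV gE] := hc u hu; have [_ hV0 _] := hc 0 (eq_ind_r (fun x => x <= rho) (ltW rho0) (nm0 R)).
  have [hY _] := hV; set Y := (c u).2 in hY *.
  have Y0 : 0 < nm Y by lra.
  have m0 : 0 < Num.min (nm y) (nm Y) by rewrite lt_min y0.
  have q1 := green_eq_ratio K1 hs hV0 hV (esym gE).
  have q2 := green_eq_ratio K1 hs hV hV0 gE.
  rewrite -/y -/Y in q1 q2; rewrite minC in q2.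
  set m := Num.min _ _ in m0 q1 q2.
  have mr : rad <= m by rewrite le_min hy.
  have x1 : 24 * K ^+ 2 / m <= 1 / 2.
    by rewrite ler_pdivrMr //; clear -mr rK k2; lra.
  have h1 := ln_ratio y0 Y0 q2; have h2 := ln_ratio Y0 y0 q1.
  have h3 : nm y / 2 <= nm Y.
    by apply: le_trans h1; rewrite ler_pM2l //; clear -x1; lra.
  have my : nm y / 2 <= m.
    by rewrite le_min h3 andbT; clear -y0; lra.
  have x2 : 24 * K ^+ 2 / m <= 48 * K ^+ 2 / nm y.
    rewrite ler_pdivrMr // mulrAC ler_pdivlMr //.
    have : K ^+ 2 * (nm y / 2) <= K ^+ 2 * m by rewrite ler_wpM2l // sqr_ge0.
    by clear; lra.
  have {h2} h2 : nm Y * (1 - 48 * K ^+ 2 / nm y) <= nm y.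
    apply: le_trans h2; rewrite ler_pM2l //; clear -x2; lra.
  have x3 : 48 * K ^+ 2 / nm y <= 1 / 2.
    by rewrite ler_pdivrMr //; clear -hy rK k2; lra.
  set x := 48 * K ^+ 2 / nm y in h2 x3.
  have x0 : 0 <= x by apply: divr_ge0; [apply: mulr_ge0 => //; exact: sqr_ge0|exact: ltW].
  rewrite nmf_div ler_pdivrMr // (_ : 96 * K ^+ 2 / nm y = 2 * x); last first.
    by rewrite /x; field; rewrite gt_eqF.
  have h4 : 0 <= x * (1 - 2 * x) by apply: mulr_ge0 => //; clear -x3; lra.
  have h5 : 0 <= nm Y * (x * (1 - 2 * x)) by apply: mulr_ge0 => //; exact: ltW.
  have h6 : (1 + 2 * x) * (nm Y * (1 - x)) <= (1 + 2 * x) * nm y.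
    by rewrite ler_wpM2l //; clear -x0; lra.
  have E : (1 + 2 * x) * (nm Y * (1 - x)) = nm Y + nm Y * (x * (1 - 2 * x)) by ring.
  rewrite E in h6; clear -h5 h6.
  by move: h5 h6; set a := _ * (x * _); lra.
set M := 1 + 96 * K ^+ 2 / nm y in bound.
have xM : 0 < 96 * K ^+ 2 / nm y <= 1.
  apply/andP; split; first by apply: divr_gt0 => //; lra.
  by rewrite ler_pdivrMr //; clear -hy rK k2; lra.
have M1 : 1 < M by rewrite ltrDl; case/andP: xM.
have g0 : (c 0).2 / y = 1 by rewrite /y divff.
have gd u : nm u <= rho -> cdif (fun v => (c v).2 / y) u.
  by move=> /hc [[_ h] _ _]; apply: cdifM => //; exact: cdif_cst.
have := schwarz_one rho0 M1 g0 gd bound ht.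
rewrite (_ : (c t).2 / y - 1 = ((c t).2 - y) / y); last by rewrite mulrBl divff.
rewrite nmf_div ler_pdivrMr // => h; apply: le_trans h _.
have hM : (M ^+ 2 - 1) * nm y <= 288 * K ^+ 2.
  rewrite /M; move: xM; set x := 96 * K ^+ 2 / nm y => /andP[x0 x1].
  have -> : ((1 + x) ^+ 2 - 1) * nm y = x * nm y * (2 + x) by ring.
  rewrite /x divfK ?gt_eqF // -/x; have : K ^+ 2 * x <= K ^+ 2 by rewrite ler_piMr // ltW //; lra.
  by clear; lra.
have tr : 0 <= nm t / rho by rewrite divr_ge0 ?nm_ge0 // ltW.
have -> : 2 * (M ^+ 2 - 1) * nm t / rho * nm y = ((M ^+ 2 - 1) * nm y) * (2 * (nm t / rho)) by ring.
have -> : 288 * K ^+ 2 * (2 * nm t / rho) = 288 * K ^+ 2 * (2 * (nm t / rho)) by ring.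
by rewrite ler_wpM2r // mulr_ge0.
Qed.

Lemma level_curve s (c : C -> C2 R) (rho : R) : adm K s -> 0 < rho ->
  (forall t, nm t <= rho -> [/\ hcurve c t, Vplus (c t) & green s (c t) = green s (c 0)]) ->
  forall n t, nm t <= rho / 2 ->
    nm ((orb s n (c t)).2 - (orb s n (c 0)).2) <= 288 * K ^+ 2 * (2 * nm t / rho).
Proof.
move=> hs rho0 hc n; apply: (@level_curve0 (sshift s n) (fun t => orb s n (c t))) => //.
  exact: adm_shift.
move=> t /hc [h1 h2 h3]; split; first by apply: hcurve_comp h1 _; exact: holo_orb.
  by have := @orb_Vplus R K K1 s 0 n (c t) hs h2.
by rewrite !(green_shift K1) // h3.
Qed.

(** Expansion in the second coordinate: the derivative of p at y has modulus about d |lead|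
    |y|^(d-1), at least 2 |y| / K, and the higher Taylor terms spoil at most a quarter of it. *)
Lemma leaf_step h y y' B : tame K h -> 0 <= B -> nm (y' - y) <= B ->
  2 * K ^+ 2 * (1 + B) <= nm y -> nm y * nm (y' - y) / K <= nm (h.1.[y'] - h.1.[y]).
Proof.
move=> th B0 he hy; set e := y' - y in he *.
have k1 := K1; have k0 := K_gt0 K1; have k2 : 1 <= K ^+ 2 by apply: exprn_ege1.
have d2 := tame_deg2 th; set d := hdeg h in d2.
have hy1 : 2 * (1 + B) <= nm y by apply: le_trans hy; rewrite ler_wpM2r //; lra.
have y1 : 1 <= nm y by lra.
have y0 : 0 < nm y by lra.
have ey : nm e <= nm y by lra.
have T := tame_taylor th y1 ey; rewrite /e (addrC y) subrK -/e in T.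
set dp := h.1.[y'] - h.1.[y] in T *; set q := _ * e in T.
have e0 := nm_ge0 e.
have P1 : 1 <= nm y ^+ d.-2 by apply: exprn_ege1.
have qlb : 2 / K * (nm y * nm y ^+ d.-2) * nm e <= nm q.
  rewrite /q !nmM nmX nm_nat -/d; apply: ler_wpM2r => //.
  have -> : nm y ^+ d.-1 = nm y * nm y ^+ d.-2.
    by rewrite -exprS; congr (_ ^+ _); move: d2; clear; lia.
  apply: ler_wpM2r; first by rewrite mulr_ge0 // ltW // (lt_le_trans ltr01).
  have cl := tame_lead_lb th; apply: ler_pM => //; first by rewrite invr_ge0 ltW.
  by rewrite (ler_nat _ 2).
have T2 : nm (dp - q) <= nm y / (2 * K) * nm y ^+ d.-2 * nm e.
  apply: le_trans T _; rewrite -/d; apply: ler_wpM2r => //.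
  rewrite mulrAC.
  apply: ler_wpM2r; first exact: (le_trans ler01 P1).
  rewrite ler_pdivlMr ?mulr_gt0 //; apply: le_trans hy.
  have -> : K * (1 + nm e) * (2 * K) = 2 * K ^+ 2 * (1 + nm e) by ring.
  by apply: ler_wpM2l; [apply: mulr_ge0 => //; exact: sqr_ge0|rewrite lerD2l].
have T3 := nm_sub_ge q dp; rewrite nm_distC in T3.
set P := nm y ^+ d.-2 in P1 qlb T2 *.
apply: le_trans (_ : 3 / 2 * (nm y / K * P * nm e) <= _); last first.
  have E1 : 2 / K * (nm y * P) * nm e = 2 * (nm y / K * P * nm e) by ring.
  have E2 : nm y / (2 * K) * P * nm e = 1 / 2 * (nm y / K * P * nm e).
    by field; rewrite gt_eqF.
  rewrite E1 in qlb; rewrite E2 in T2; clear -qlb T2 T3.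
  by move: qlb T2 T3; set a := nm y / K * _ * _; lra.
have X0 : 0 <= nm y / K * nm e by rewrite mulr_ge0 // divr_ge0 // ltW.
have : nm y / K * nm e <= nm y / K * P * nm e.
  by rewrite [leRHS]mulrAC ler_peMr.
rewrite (_ : nm y * nm e / K = nm y / K * nm e); last by ring.
by move: X0; clear; lra.
Qed.

(* Otherwise the displacement would double at every step. *)
Lemma leaf_contract s z z' (B : R) : adm K s -> 1 <= B -> Vplus z ->
  (forall n, nm ((orb s n z').2 - (orb s n z).2) <= B) ->
  4 * K ^+ 2 * (1 + B) <= nm z.2 ->
  nm (z'.2 - z.2) <= 2 * K ^+ 2 / nm z.2 * nm (z'.1 - z.1).
Proof.
move=> hs B1 hV hB hy; rewrite leNgt; apply/negP => hlt.
have k1 := K1; have k0 := K_gt0 K1; have k2 : K <= K ^+ 2 by rewrite expr2 ler_peMl // ltW.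
pose y n := (orb s n z).2; pose e n := nm ((orb s n z').2 - y n).
pose x n := nm ((orb s n z').1 - (orb s n z).1).
have yg n : nm z.2 <= nm (y n).
  apply: le_trans (Vplus_growth K1 n hs hV); rewrite ler_peMl ?nm_ge0 //.
  by apply: exprn_ege1; lra.
have B0 : 0 <= 1 + B by lra.
have yK n : 4 * K ^+ 2 * 2 <= nm (y n).
  apply: le_trans (yg n); apply: le_trans hy; rewrite ler_wpM2l //; last by lra.
  by rewrite mulr_ge0 // sqr_ge0.
have y0 n : 0 < nm (y n) by have := yK n; lra.
have inv n : e 0%N * 2 ^+ n <= e n /\ 2 * K ^+ 2 * x n < nm (y n) * e n.
  elim: n => [|n [IH1 IH2]].
    rewrite mulr1; split=> //; rewrite -ltr_pdivrMl //.
    by apply: le_lt_trans hlt; rewrite le_eqVlt; apply/orP; left; apply/eqP; rewrite /x /=; ring.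
  have st := @leaf_step (s n) (y n) (orb s n z').2 B (hs n).
  have {st} st : nm (y n) * e n / K <= nm ((s n).1.[(orb s n z').2] - (s n).1.[y n]).
    apply: st => //; [by lra|]; apply: le_trans (yg n); apply: le_trans hy.
    by rewrite ler_wpM2r //; have := sqr_ge0 K; lra.
  have en1 : nm (y n) * e n / K - K * x n <= e n.+1.
    rewrite [e n.+1]/e /y !orb2 -/(y n).
    rewrite (_ : _ - _ - _ = ((s n).1.[(orb s n z').2] - (s n).1.[y n]) -
       (s n).2 * ((orb s n z').1 - (orb s n z).1)); last by ring.
    have := nm_sub_ge ((s n).1.[(orb s n z').2] - (s n).1.[y n]) ((s n).2 * ((orb s n z').1 - (orb s n z).1)).
    rewrite nmM -/(x n); have : nm (s n).2 * x n <= K * x n.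
      by rewrite ler_wpM2r ?nm_ge0 // (tame_jac_ub (hs n)).
    by move: st; clear; lra.
  have en2 : nm (y n) * e n / (2 * K) <= e n.+1.
    apply: le_trans en1; have : K * x n <= nm (y n) * e n / (2 * K).
      rewrite ler_pdivlMr ?mulr_gt0 //; move/ltW: IH2; apply: le_trans.
      by rewrite le_eqVlt; apply/orP; left; apply/eqP; ring.
    have -> : nm (y n) * e n / K = nm (y n) * e n / (2 * K) + nm (y n) * e n / (2 * K).
      by field; rewrite gt_eqF.
    by clear; lra.
  have en0 : 0 < e n.
    have x0 : 0 <= 2 * K ^+ 2 * x n by rewrite !mulr_ge0 ?nm_ge0 ?(ltW k0).
    by move: (le_lt_trans x0 IH2); rewrite pmulr_rgt0.
  have en3 : 2 * e n <= e n.+1.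
    apply: le_trans en2; rewrite mulrAC ler_pM2r // ler_pdivlMr ?mulr_gt0 //.
    by have := yK n; clear -k2 k0; lra.
  split; first by rewrite exprS mulrCA; apply: le_trans en3; rewrite ler_pM2l.
  have xE : x n.+1 = e n by [].
  rewrite xE; apply: le_lt_trans (_ : nm (y n.+1) * e n < _).
    by rewrite ler_wpM2r ?(ltW en0) //; have := yK n.+1; have := sqr_ge0 K; lra.
  by rewrite ltr_pM2l //; clear -en3 en0; lra.
have e00 : 0 < e 0%N.
  by apply: le_lt_trans hlt; rewrite mulr_ge0 ?nm_ge0 // divr_ge0 ?nm_ge0 // mulr_ge0 ?sqr_ge0.
have [k hk] := half_pow_small B e00.
have := (inv k).1; have := hB k; rewrite -/(y k) -/(e k) => h1 h2.
move: hk; rewrite ltr_pdivrMr ?exprn_gt0 //; have := le_trans h2 h1; clear; lra.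
Qed.

End LevelCurves.

(** * Harnack's inequality for the Green function *)

Section HarnackGreen.
Variable R : realType.
Local Notation C := R[i].
Variable K : R.
Hypothesis K1 : 1 <= K.
Local Notation rad := (esc_rad K).
Local Notation err := (esc_err K).
Local Notation Lrad := (Lrad K).
Local Notation Vplus := (Vplus K).
Local Notation green := (green K).
Implicit Types (s : nat -> henon_data R) (z w p : C2 R) (h : henon_data R).

(** Otherwise a small vertical disc at a late iterate of z would be a level curve, and its points
    would stay at bounded distance forever. But [leaf_contract] forbids this for two points with
    equal first coordinates. *)
Lemma green_not_const s z (d : R) : adm K s -> 0 < d -> 0 < green s z ->
  (forall w, dist2 w z < d -> green s w = green s z) -> False.
Proof.
move=> hs d0 g0 hc; have k1 := K1; have k2 : 1 <= K ^+ 2 by apply: exprn_ege1.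
have r0 := rad_gt0 K1; have r100 := rad_ge100 K1.
have [n0 hn0] := green_pos_V K1 hs g0.
set B := 288 * K ^+ 2.
have B1 : 1 <= B by rewrite /B; lra.
pose big := 4 * K ^+ 2 * (1 + B) + rad + 1.
have [k hk] := half_pow_small big r0.
set m := (n0 + k)%N.
have hm : Vplus (orb s m z) by exact: orb_Vplus.
have ym : big <= nm (orb s m z).2.
  have := Vplus_growth K1 k (adm_shift n0 hs) hn0; rewrite -orb_shift -/m; apply: le_trans.
  move: hk; rewrite ltr_pdivrMr ?exprn_gt0 // => /ltW hk; apply: le_trans hk _.
  rewrite mulrC; apply: ler_pM => //; [exact: ltW| |exact: hn0.1].
  by apply: lerXn2r; rewrite ?nnegrE; lra.
have [_ _ _ h4] := Vplus_step K1 (hs m) hm.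
(* One further step makes the first coordinate at most a quarter of the second, so that the vertical
   disc stays in [Vplus]. *)
set j := m.+1; set w := orb s j z; set s' := sshift s j.
have hs' : adm K s' by exact: adm_shift.
have wx : nm w.1 <= nm w.2 / 4.
  by rewrite ler_pdivlMr // mulrC.
have wy : big <= nm w.2.
  by apply: le_trans ym _; apply: le_trans h4; have := nm_ge0 (orb s m z).2; lra.
have [d1 d10 hd1] := holo_cont (holo_orbV s j w) d0.
pose rho := Num.min 1 (d1 / 2).
have rho0 : 0 < rho by rewrite lt_min ltr01 divr_gt0.
have rho1 : rho <= 1 by rewrite ge_min lexx.
have rhod : rho < d1.
  by apply: le_lt_trans (_ : d1 / 2 < _); [rewrite ge_min lexx orbT|lra].
pose c := line w (0, 1).
have jacs i : (s i).2 != 0 by exact: (tame_jac K1 (hs i)).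
have orbVw : orbV s j w = z by rewrite /w orbitK.
have u1 : n2 ((0, 1) : C2 R) <= 1 by rewrite n2_le /= nm0 nm1 ler01 lexx.
have ct t : nm t <= rho -> [/\ hcurve c t, Vplus (c t) & green s' (c t) = green s' (c 0)].
  move=> ht; have lc v : nm v <= rho -> green s' (c v) = Deg s j * green s z.
    move=> hv; rewrite -{1}(orbitVK j jacs (c v)) (green_shift K1) //; congr (_ * _); apply: hc.
    by rewrite -[X in dist2 _ X]orbVw; apply: hd1; apply: le_lt_trans rhod; apply: le_trans hv; exact: line_dist.
  split; [exact: hcurve_line| |by rewrite !lc // nm0 ltW].
  have hb : 0 <= 4 * K ^+ 2 * (1 + B) by rewrite mulr_ge0 //; lra.
  have e1 := nm_sub_ge w.2 (- t); rewrite nmN opprK in e1.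
  rewrite /Vplus /c /line /= mulr0 addr0 mulr1; move: wy; rewrite /big => wy.
  by split; move: e1 ht rho1 wx wy hb; clear -r100; lra.
have E n : nm ((orb s' n (c (rho / 2)%:C%C)).2 - (orb s' n (c 0)).2) <= B.
  apply: le_trans (level_curve K1 hs' rho0 ct n _) _.
    by rewrite nm_real ger0_norm // divr_ge0 // ltW.
  rewrite nm_real ger0_norm; last by rewrite divr_ge0 // ltW.
  by rewrite (_ : 2 * (rho / 2) / rho = 1) ?mulr1 //; field; rewrite gt_eqF.
have [_ V0 _] := ct 0 (eq_ind_r (fun x => x <= rho) (ltW rho0) (nm0 R)).
have := leaf_contract K1 hs' B1 V0 E.
rewrite /c line0 /line /= mulr1 mulr0 addr0 subrr nm0 mulr0 (addrC w.2) addrK nm_real.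
rewrite ger0_norm; last by rewrite divr_ge0 // ltW.
have hb : 4 * K ^+ 2 * (1 + B) <= nm w.2 by apply: le_trans wy; rewrite /big; lra.
by move=> /(_ hb); lra.
Qed.

Lemma holo_fst (c : C -> C2 R) z : hcurve c z.1 -> holo (fun w => c w.1) z.
Proof.
have H (g : C -> C) : cdif g z.1 -> dif2 (fun w => g w.1) z.
  move=> [q qc hq]; exists (fun w => q w.1), (fun=> 0); split.
  - move=> e e0; have [d d0 hd] := qc e e0; exists d => // w hw; apply: hd.
    by apply: le_lt_trans hw; exact: dist2_1.
  - exact: cont2_cst.
  - by move=> w; rewrite mul0r addr0 hq.
by case=> h1 h2; split; [exact: (H (fun u => (c u).1))|exact: (H (fun u => (c u).2))].
Qed.

Lemma closed2_ball (r : R) : closed2 (fun z : C2 R => n2 z <= r).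
Proof.
move=> z hz; apply/ler_addgt0Pr => e e0; have [w hw hd] := hz _ e0.
by apply: le_trans (n2_dist2 z w) _; rewrite dist2_sym; apply: lerD => //; exact: ltW.
Qed.

Lemma green_V_ln s n z : adm K s -> Vplus (orb s n z) ->
  `|Deg s n * green s z - ln (nm (orb s n z).2)| <= err + ln 2.
Proof.
move=> hs hV; have h1 := green_ub K1 n z hs; have h2 := green_lb K1 hs (Vplus_W hV).
have h3 := L_W K1 (Vplus_W hV); rewrite max_r in h3; last exact: hV.1.
have h4 : ln (nm (orb s n z).2) <= Lrad (orb s n z).
  rewrite ler_ln ?posrE ?maxrad_gt0 //; last exact: lt_le_trans (rad_gt0 K1) hV.1.
  by rewrite le_max n2_2 orbT.
have := @ln2_ge0 R; rewrite ler_norml; move: h1 h2 h3 h4.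
set a := Deg s n * _; set b := Lrad _; set d := ln (nm _); set l2 := ln 2; set e := err.
by clear; move=> h1 h2 h3 h4 h5; apply/andP; split; lra.
Qed.

(** By compactness the whole curve is in [Vplus] from a common time on, so the second coordinate of
    the n-th iterate has no zeros; Harnack's inequality for it is divided by D_n. *)
Lemma harnack_green s (c : C -> C2 R) (rho c0 : R) : adm K s -> 0 < rho ->
  (forall t, nm t <= rho -> [/\ hcurve c t, 0 < green s (c t) & green s (c t) <= c0]) ->
  forall t, nm t <= rho / 2 -> `|green s (c t) - green s (c 0)| <= 32 * c0 * nm t / rho.
Proof.
move=> hs rho0 hc t ht; have er0 := err_gt0 K1.
have [||N hN] := @V_uniform R K K1 s (fun w => n2 w <= rho) (fun w => c w.1) rho hs
   (@closed2_ball rho) (fun _ => id).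
- by move=> w; rewrite n2_le => /andP[/hc[h _ _] _]; exact: holo_fst.
- by move=> w; rewrite n2_le => /andP[/hc[_ h _] _].
have {hN} hN n v : (N <= n)%N -> nm v <= rho -> Vplus (orb s n (c v)).
  by move=> Nn hv; apply: (hN n (v, 0)) => //; rewrite n2_le /= hv nm0 ltW.
have c00 : 0 < c0.
  by have [_ h1 h2] := hc 0 (eq_ind_r (fun x => x <= rho) (ltW rho0) (nm0 R)); lra.
apply: (@le_of_Deg R K s _ _ (18 * err + 2 * ln 2) hs); exists N => n Nn.
have D0 := Deg_gt0 n hs; set D := Deg s n in D0 *.
pose g v := (orb s n (c v)).2.
have lb v : nm v <= rho -> 0 <= ln (nm (g v)).
  by move=> hv; apply: ln_ge0; have := (hN n v Nn hv).1; have := rad_ge100 K1; rewrite -/(g v); lra.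
have bd v : nm v <= rho -> `|ln (nm (g v))| <= D * c0 + err.
  move=> hv; have [_ _ h] := hc v hv; rewrite ger0_norm ?lb //.
  have h4 : ln (nm (g v)) <= Lrad (orb s n (c v)).
    rewrite ler_ln ?posrE ?maxrad_gt0 //; last exact: lt_le_trans (rad_gt0 K1) (hN n v Nn hv).1.
    by rewrite le_max n2_2 orbT.
  have h5 := green_lb K1 hs (Vplus_W (hN n v Nn hv)); rewrite -/D in h5.
  have : D * green s (c v) <= D * c0 by rewrite ler_pM2l.
  by move: h4 h5; set a := Lrad _; set b := ln _; set e := err; clear; lra.
have L0 : 0 < D * c0 + err by rewrite addr_gt0 // mulr_gt0.
have gd v : nm v <= rho -> cdif g v.
  by move=> /hc[h _ _]; have [] := hcurve_comp h (holo_orb s n (c v)).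
have gn v : nm v <= rho -> g v != 0.
  by move=> hv; rewrite -nm_gt0; exact: lt_le_trans (rad_gt0 K1) (hN n v Nn hv).1.
have H := harnack rho0 L0 gd gn bd ht.
have t1 : nm t <= rho by lra.
have n00 : nm (0 : C) <= rho by rewrite nm0 ltW.
have e1 := green_V_ln hs (hN n t Nn t1); have e2 := green_V_ln hs (hN n 0 Nn n00).
rewrite -/(g t) -/(g 0) -/D in e1 e2.
have tr : 32 * (D * c0 + err) * nm t / rho <= D * (32 * c0 * nm t / rho) + 16 * err.
  have -> : 32 * (D * c0 + err) * nm t / rho = D * (32 * c0 * nm t / rho) + 32 * err * (nm t / rho) by ring.
  rewrite lerD2l; have : err * (nm t / rho) <= err * (1 / 2).
    by rewrite ler_pM2l // ler_pdivrMr //; lra.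
  by clear; lra.
rewrite -[X in X * `|_|](gtr0_norm D0) -normrM mulrBr.
move: e1 e2 (le_trans H tr); rewrite !ler_norml.
set x := D * green s (c t); set x0 := D * green s (c 0); set l := ln (nm (g t)); set l0 := ln (nm (g 0)).
set q := D * (32 * _ * _ / _); set e := err; set l2 := ln 2.
by clear; move=> /andP[? ?] /andP[? ?] /andP[? ?]; apply/andP; split; lra.
Qed.

End HarnackGreen.

Section GreenInvariance.
Variable R : realType.
Local Notation C := R[i].
Variable K : R.
Hypothesis K1 : 1 <= K.
Local Notation rad := (esc_rad K).
Local Notation err := (esc_err K).
Local Notation green := (green K).
Implicit Types (s : nat -> henon_data R) (z w p : C2 R) (h : henon_data R).

(* If G o f = b > 0 on the filled set, Harnack's inequality on huge discs makes
   G o f constant near it, which contradicts [green_not_const]. *)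
Lemma green_aut_zero s c f g p : adm K s -> aut2 (fun w => green s w < c) f g ->
  green s p = 0 -> 0 < c -> green s (f p) = 0.
Proof.
move=> hs hfg p0 c0; have [hf hg] := hfg.
have growf q z (q0 : green s q = 0) (zc : green s z < c) := green_aut_growth K1 hs hfg q0 zc.
have growg q z (q0 : green s q = 0) (zc : green s z < c) :=
  green_aut_growth K1 hs (aut2_sym hfg) q0 zc.
have Kc q : green s q = 0 -> green s q < c by move=> ->.
have cf q : green s q = 0 -> green s (f q) = green s (f p).
  move=> q0; apply/eqP; rewrite eq_le; have := growf p q p0 (Kc _ q0); rewrite q0 addr0 => ->.
  by have := growf q p q0 (Kc _ p0); rewrite p0 addr0.
have cg q : green s q = 0 -> green s (g q) = green s (g p).
  move=> q0; apply/eqP; rewrite eq_le; have := growg p q p0 (Kc _ q0); rewrite q0 addr0 => ->.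
  by have := growg q p q0 (Kc _ p0); rewrite p0 addr0.
apply: contrapT => bn; set b := green s (f p) in cf bn.
have b0 : 0 < b by rewrite lt_neqAle green_ge0 // andbT; apply/eqP => /esym.
have [hfp fpc gfp] := hf p (Kc _ p0); have [hgp gpc fgp] := hg p (Kc _ p0).
set b' := green s (g p) in cg gpc.
have b'0 : 0 < b'.
  rewrite lt_neqAle green_ge0 // andbT; apply/eqP => /esym gp0.
  by apply: bn; rewrite -(cf (g p)) // fgp.
(* If G(f z) were 0, then G(z) = G(g (f z)) would equal b'. *)
have vpos z : green s z < b' -> 0 < green s (f z).
  move=> zb; have zc : green s z < c by lra.
  rewrite lt_neqAle green_ge0 // andbT; apply/eqP => /esym fz0.
  have [_ _ gfz] := hf z zc; have := cg _ fz0; rewrite gfz; lra.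
(* The line through S_n p and S_n z contains a disc of radius comparable to exp(D_n b' / 2) whose
   pull-back lies in {G < b'}, whereas the two points are only exp(D_n G(z) + O(1)) apart. As G(z) <
   b' / 2, Harnack's inequality gives equality in the limit. *)
have vconst z : green s z < b' / 3 -> green s (f z) = b.
  move=> zb; apply/eqP; rewrite -subr_eq0 -normr_le0; apply/ler_addgt0Pr => e e0; rewrite add0r.
  have [M M1 hM] := green_bounded_orbit K1 hs p0; have M0 : 0 <= M by lra.
  pose kap := err + ln (n2 z + M + 1).
  have r0 := rad_gt0 K1; have r100 := rad_ge100 K1.
  pose A := 64 * c / e; have A0 : 0 < A by rewrite divr_gt0 // mulr_gt0.
  have b2 : 0 < b' / 2 by rewrite divr_gt0.
  have b3 : 0 < b' / 2 - green s z by lra.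
  have [N1 hN1] := @Deg_lim R K s (err + 1) 0 _ hs (lexx _) b2.
  have [N2 hN2] := @Deg_lim R K s (ln (2 * rad) + ln (2 * (M + 1))) 0 _ hs (lexx _) b2.
  have [N3 hN3] := @Deg_lim R K s (kap + ln 4) 0 _ hs (lexx _) b3.
  have [N4 hN4] := @Deg_lim R K s (kap + ln A) 0 _ hs (lexx _) b3.
  have [n [/hN1 h1 /hN2 h2 /hN3 h3 /hN4 h4]] := large4 N1 N2 N3 N4.
  clear hN1 hN2 hN3 hN4; rewrite !mulr0 !addr0 in h1 h2 h3 h4.
  have D0 := Deg_gt0 n hs; set D := Deg s n in D0 h1 h2 h3 h4.
  pose rho1 := expR (D * (b' / 2)); have rho10 : 0 < rho1 := expR_gt0 _.
  have hrho : rad + M <= rho1 / 2.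
    have : 2 * rad * (2 * (M + 1)) <= rho1.
      rewrite /rho1 -[leLHS]lnK ?posrE; last by rewrite !mulr_gt0 //; lra.
      rewrite ler_expR lnM ?posrE ?[D * _]mulrC //; [by move: r0; clear; lra|by move: M1; clear; lra].
    have : 0 <= (rad - 1) * M by rewrite mulr_ge0 //; lra.
    by clear -r100 M0; lra.
  have hr : rad <= rho1 by clear -hrho M0 r100 rho10; lra.
  have polyd w : n2 w <= rho1 -> green s (orbV s n w) < b'.
    apply: (polydisc_lt K1 hs hr); apply: le_trans h1 _; rewrite -/D.
    by rewrite (_ : b' - b' / 2 = b' / 2) //; field.
  pose pn := orb s n p; pose zn := orb s n z; pose tau := dist2 zn pn.
  have jacs k : (s k).2 != 0 by exact: (tame_jac K1 (hs k)).
  have znE : orbV s n zn = z by rewrite /zn orbitK.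
  have pnE : orbV s n pn = p by rewrite /pn orbitK.
  have [tau0|tau0] := leP tau 0.
    have := dist2_eq0 tau0 => E; have -> : z = p by rewrite -znE -pnE E.
    by rewrite /b subrr normr0 ltW.
  have htau : tau <= expR (D * green s z + kap) by exact: dist_orb_le.
  have tauA (a : R) : 0 < a -> kap + ln a <= (b' / 2 - green s z) * D -> tau * a <= rho1.
    move=> a0 ha; apply: le_trans (_ : expR (D * green s z + kap) * a <= _); first by rewrite ler_pM2r.
    rewrite -[X in _ * X]lnK ?posrE // -expRD ler_expR.
    by move: ha; rewrite mulrBl [b' / 2 * _]mulrC [green s z * _]mulrC; clear; lra.
  have tau4 : tau * 4 <= rho1 by exact: tauA.
  have tauAA : tau * A <= rho1 by exact: tauA.
  have [u u1 hu] := line_through tau0.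
  pose cv t := f (orbV s n (line pn u t)).
  have cn t : nm t <= rho1 / 2 -> n2 (line pn u t) <= rho1.
    move=> ht; apply: le_trans (n2_dist2 _ pn) _; have := line_dist pn t u1.
    by have := hM n; rewrite -/pn; move: ht hrho r100; clear; lra.
  have rho20 : 0 < rho1 / 2 by rewrite divr_gt0.
  have hcv t : nm t <= rho1 / 2 ->
      [/\ hcurve cv t, 0 < green s (cv t) & green s (cv t) <= c].
    move=> ht; have hp := polyd _ (cn t ht).
    have [|hfl flc _] := hf (orbV s n (line pn u t)); first by lra.
    split; [|exact: vpos|exact: ltW].
    apply: (@hcurve_comp _ (fun w => f (orbV s n w))); first exact: hcurve_line.
    by apply: holo_comp; first exact: holo_orbV.
  have nmt : nm (tau%:C%C : C) = tau by rewrite nm_real gtr0_norm.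
  have := harnack_green K1 hs rho20 hcv (t := tau%:C%C); rewrite nmt /cv hu line0 znE pnE -/b.
  have tl : tau <= rho1 / 2 / 2 by clear -tau4; lra.
  move=> /(_ tl) h; apply: le_trans h _.
  rewrite ler_pdivrMr //; move: tauAA; rewrite /A mulrA ler_pdivrMr //.
  by clear; lra.
have b30 : 0 < b' / 3 by rewrite divr_gt0.
have [d1 d10 hd1] := green_cont K1 p hs b30.
have [hgf _ _] := hg (f p) fpc.
have [d2 d20 hd2] := holo_cont hgf d10.
have cb : 0 < c - b by rewrite subr_gt0.
have [d3 d30 hd3] := green_cont K1 (f p) hs cb.
(* A point w close to f p is f (g w) with g w close to p, so G(w) = b there. *)
apply: (@green_not_const R K K1 s (f p) (Num.min d2 d3) hs) => //; first by rewrite lt_min d20.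
move=> w; rewrite lt_min => /andP[/hd2 w2 /hd3 w3]; rewrite gfp in w2.
have wc : green s w < c by move: w3; rewrite -/b ltr_norml; lra.
have [_ _ fgw] := hg w wc; rewrite -{1}fgw; apply: vconst.
by have := hd1 _ w2; rewrite p0 subr0 ltr_norml => /andP[_].
Qed.

Lemma green_aut s c f g z : adm K s -> aut2 (fun w => green s w < c) f g -> 0 < c ->
  (exists p, green s p = 0) -> green s z < c -> green s (f z) = green s z.
Proof.
move=> hs hfg c0 [p p0] zc; have [hf hg] := hfg; have [_ fzc gfz] := hf z zc.
apply/eqP; rewrite eq_le; apply/andP; split.
  by have := green_aut_growth K1 hs hfg p0 zc; rewrite (green_aut_zero hs hfg p0 c0) add0r.
have hgf := aut2_sym hfg; have := green_aut_growth K1 hs hgf p0 fzc.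
by rewrite (green_aut_zero hs hgf p0 c0) add0r gfz.
Qed.

End GreenInvariance.

(** * Existence of a point with bounded forward orbit *)

Section GreenZeros.
Variable R : realType.
Local Notation C := R[i].
Variable K : R.
Hypothesis K1 : 1 <= K.
Local Notation rad := (esc_rad K).
Local Notation err := (esc_err K).
Local Notation Wset := (Wset K).
Local Notation Vplus := (Vplus K).
Local Notation green := (green K).
Implicit Types (s : nat -> henon_data R) (z w p : C2 R) (h : henon_data R).

(** The n-th image of the line x = 0, parametrised by polynomials in the second coordinate. *)
Fixpoint ypoly s n : {poly C} * {poly C} :=
  if n is m.+1 then
    let q := ypoly s m in (q.2, (s m).1 \Po q.2 - (s m).2 *: q.1)
  else (0, 'X).

Lemma ypolyE s n t : orb s n (0, t) = ((ypoly s n).1.[t], (ypoly s n).2.[t]).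
Proof.
elim: n => [|n IH] /=; first by rewrite horner0 hornerX.
by rewrite IH /henon /= !hornerE horner_comp.
Qed.

Lemma size_ypoly s n : adm K s ->
  (size (ypoly s n).1 < size (ypoly s n).2)%N /\ (1 < size (ypoly s n).2)%N.
Proof.
move=> hs; elim: n => [|n [IH1 IH2]] /=; first by rewrite size_poly0 size_polyX.
have d2 := tame_deg2 (hs n); rewrite /hdeg /henon_degree in d2.
set q := ypoly s n in IH1 IH2 *.
have sc := size_comp_poly (s n).1 q.2.
have lt : (size q.2 < size ((s n).1 \Po q.2)%R)%N.
  have : (2 * (size q.2).-1 <= (size (s n).1).-1 * (size q.2).-1)%N by rewrite leq_mul2r d2 orbT.
  rewrite -sc; move: IH2; set a := size q.2; set b := size (_ \Po _).
  by clear; lia.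
have lt2 : (size (- ((s n).2 *: q.1))%R < size ((s n).1 \Po q.2)%R)%N.
  by rewrite size_polyN; apply: leq_ltn_trans (size_scale_leq _ _) _; exact: ltn_trans lt.
by rewrite size_polyDl // lt (ltn_trans IH2 lt).
Qed.

(** For each n some point of the line x = 0 has second coordinate 0 at time n. Its orbit has not
    entered [Vplus] before, so the point and its n-th image are bounded by [rad] and G is at most
    O(1 / D_n) there; a cluster point has G = 0. *)
Lemma exists_green0 s : adm K s -> exists p, green s p = 0.
Proof.
move=> hs; have r0 := rad_gt0 K1.
have root n : exists t, (orb s n (0, t)).2 = 0.
  have [_ s1] := size_ypoly n hs.
  have /closed_rootP [t /rootP ht] : size (ypoly s n).2 != 1%N by rewrite gtn_eqF.
  by exists t; rewrite ypolyE.
pose eta n := xget 0 [set t | (orb s n (0, t)).2 = 0].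
have hY n : (orb s n (0, eta n)).2 = 0.
  by apply: (@xgetPex _ 0 [set t | (orb s n (0, t)).2 = 0]); exact: root.
have W0 n : Wset (orb s 0 (0, eta n)).
  by rewrite WsetE /= nm0 mulr_ge0 // le_max nm_ge0.
have yb n k : (k <= n)%N -> nm (orb s k (0, eta n)).2 < rad.
  move=> kn; rewrite ltNge; apply/negP => h.
  have hV : Vplus (orb s k (0, eta n)).
    by apply: W_Vplus h; exact: (orb_W_le K1 hs (leq0n k) (W0 n)).
  have := orb_Vplus K1 (n - k)%N hs hV; rewrite subnKC // => -[+ _].
  by rewrite hY nm0 leNgt r0.
have nb n : n2 ((0, eta n) : C2 R) <= rad.
  by rewrite n2_le /= nm0 !ltW //; exact: (yb n 0%N).
have [p hp] := cluster_seq2 nb; exists p.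
apply/eqP; rewrite eq_le green_ge0 // andbT; apply/ler_addgt0Pr => e e0; rewrite add0r.
have e2 : 0 < e / 2 by rewrite divr_gt0.
have [d d0 hd] := green_cont K1 p hs e2.
have [N hN] := @Deg_lim R K s (ln rad + err) 0 _ hs (lexx _) e2.
have [n Nn hn] := hp d N.+1 d0.
have := hd _ hn; rewrite ltr_norml => /andP[h1 _].
have D0 := Deg_gt0 n hs.
have : green s (0, eta n) <= e / 2.
  rewrite -(ler_pM2l D0); apply: le_trans (green_ub K1 n _ hs) _.
  have := hN n (ltnW Nn); rewrite mulr0 addr0 [Deg s n * _]mulrC; apply: le_trans.
  rewrite lerD2r; apply: L_exp => //; rewrite n2_le hY nm0 (ltW r0) andbT.
  by case: n Nn {hn h1 D0} => [|n] // _; rewrite orb1 ltW //; exact: yb.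
by move: h1; set a := green s p; set b := green s _; clear; lra.
Qed.

End GreenZeros.

(** * Stable leaves *)

Section Vitali.
Variable R : realType.
Local Notation C := R[i].

Lemma bounded_lip (g : C -> C) p (rho M : R) : 0 < rho ->
  (forall t, nm (t - p) <= rho -> cdif g t) ->
  (forall t, nm (t - p) <= rho -> nm (g t) <= M) ->
  forall u v, nm (u - p) <= rho / 4 -> nm (v - p) <= rho / 4 ->
    nm (g u - g v) <= 4 * M / rho * nm (u - v).
Proof.
move=> rho0 hg hM u v hu hv.
have sub t : nm (t - v) <= rho / 2 -> nm (t - p) <= rho.
  move=> ht; have -> : t - p = (t - v) + (v - p) by ring.
  by apply: le_trans (nmD _ _) _; lra.
have rho2 : 0 < rho / 2 by rewrite divr_gt0.
have vp : nm (v - p) <= rho by lra.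
have M0 : 0 <= M by apply: le_trans (hM v vp); exact: nm_ge0.
have := @schwarz R [::] g v (rho / 2) (2 * M) rho2 (hg v vp).
move=> H; have {H} := H (fun w hw => cdif_ccont (hg w (sub w hw))) (fun w hw _ => hg w (sub w hw)).
have bd w : nm (w - v) = rho / 2 -> nm (g w - g v) <= 2 * M.
  move=> hw; apply: le_trans (nmB _ _) _.
  have := hM w (sub w _); rewrite hw => /(_ (lexx _)) h1; have := hM v vp; lra.
move=> /(_ bd u) H; apply: le_trans (H _) _.
  have -> : u - v = (u - p) - (v - p) by ring.
  by apply: le_trans (nmB _ _) _; lra.
by rewrite le_eqVlt; apply/orP; left; apply/eqP; field; rewrite gt_eqF.
Qed.

(** Uniform boundedness gives equal Lipschitz constants on a smaller disc, which upgrade pointwise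
    convergence to uniform convergence. *)
Lemma vitali (f : nat -> C -> C) (g : C -> C) p (rho M : R) : 0 < rho ->
  (forall n t, nm (t - p) <= rho -> cdif (f n) t) ->
  (forall n t, nm (t - p) <= rho -> nm (f n t) <= M) ->
  (forall t, nm (t - p) <= rho -> forall e : R, 0 < e ->
     exists N, forall n, (N <= n)%N -> nm (f n t - g t) <= e) ->
  cdif g p.
Proof.
move=> rho0 hf hM hlim; have rho4 : 0 < rho / 4 by rewrite divr_gt0.
have small t : nm (t - p) <= rho / 4 -> nm (t - p) <= rho by lra.
have pp : nm (p - p) <= rho by rewrite subrr nm0 ltW.
have M0 : 0 <= M by apply: le_trans (hM 0%N p pp); exact: nm_ge0.
pose L := 4 * M / rho + 1; have L0 : 0 < L.
  by rewrite ltr_wpDl // divr_ge0 ?mulr_ge0 // ltW.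
have lipf n u v : nm (u - p) <= rho / 4 -> nm (v - p) <= rho / 4 ->
    nm (f n u - f n v) <= L * nm (u - v).
  move=> hu hv; apply: le_trans (bounded_lip rho0 (hf n) (hM n) hu hv) _.
  by apply: ler_wpM2r; [exact: nm_ge0|rewrite /L lerDl].
have lipg u v : nm (u - p) <= rho / 4 -> nm (v - p) <= rho / 4 ->
    nm (g u - g v) <= L * nm (u - v).
  move=> hu hv; apply/ler_addgt0Pr => e e0; have e2 : 0 < e / 2 by rewrite divr_gt0.
  have [N1 h1] := hlim u (small u hu) _ e2; have [N2 h2] := hlim v (small v hv) _ e2.
  set n := maxn N1 N2.
  have -> : g u - g v = (f n u - f n v) - (f n u - g u) + (f n v - g v) by ring.
  apply: le_trans (nmD _ _) _; apply: le_trans (lerD (nmB _ _) (lexx _)) _.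
  have := h1 n (leq_maxl _ _); have := h2 n (leq_maxr _ _); have := lipf n u v hu hv; lra.
apply: (@weierstrass R f g p (rho / 4) rho4); first by move=> n w /small; exact: hf.
move=> e e0; apply: contrapT => hno.
have bad N : exists nt : nat * C, [/\ (N <= nt.1)%N, nm (nt.2 - p) <= rho / 4 & e < nm (f nt.1 nt.2 - g nt.2)].
  apply: contrapT => h; apply: hno; exists N => n w Nn hw; rewrite leNgt; apply/negP => hlt.
  by apply: h; exists (n, w).
have [u hu] := choice bad.
have [|z0 hz0] := @cluster_seq R (fun N => (u N).2 - p) (rho / 4).
  by move=> N; have [] := hu N.
pose z := z0 + p.
have hz (d : R) N : 0 < d -> exists2 n, (N <= n)%N & nm ((u n).2 - z) < d.
  by move=> d0; have [n Nn hn] := hz0 d N d0; exists n => //; rewrite /z opprD addrA addrAC.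
have zin : nm (z - p) <= rho / 4.
  apply/ler_addgt0Pr => d d0; have [n _ hn] := hz d 0%N d0; have [_ h _] := hu n.
  have -> : z - p = ((u n).2 - p) - ((u n).2 - z) by ring.
  by apply: le_trans (nmB _ _) _; rewrite lerD // ltW.
have e4 : 0 < e / 4 by rewrite divr_gt0.
have [N hN] := hlim z (small z zin) _ e4.
have d0 : 0 < e / 4 / L by rewrite divr_gt0.
have [n Nn hn] := hz _ N d0; have [nn hin] := hu n.
have LL : L * nm ((u n).2 - z) <= e / 4 by rewrite -ler_pdivlMl // mulrC ltW.
set m := (u n).1; set w := (u n).2 in hn hin LL *.
have -> : f m w - g w = (f m w - f m z) + (f m z - g z) - (g w - g z) by ring.
apply/negP; rewrite -leNgt; apply: le_trans (nmB _ _) _; apply: le_trans (lerD (nmD _ _) (lexx _)) _.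
have := lipf m w z hin zin; have := lipg w z hin zin; have := hN m (leq_trans Nn nn); lra.
Qed.

(** The errors are measured relative to the later term. The limit then controls the sequence
    relative to its own modulus; in particular a zero limit forces a zero sequence. *)
Lemma chain (t : nat -> C) (q : R) (N : nat) : 0 <= q <= 1 / 4 ->
  (forall n, (n < N)%N -> nm (t n - t n.+1) <= q / 4 ^+ n * nm (t n.+1)) ->
  forall n, (n <= N)%N -> nm (t n - t N) <= 2 * q / 4 ^+ n * nm (t N).
Proof.
move=> /andP[q0 q1] ht n nN; rewrite -(subKn nN).
elim: (N - n)%N (leq_subr n N) => [|k IH] kN.
  rewrite subn0 subrr nm0 mulr_ge0 ?nm_ge0 // divr_ge0 ?mulr_ge0 // exprn_ge0 //.
have {IH} := IH (ltnW kN); set m := (N - k.+1)%N.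
have -> : (N - k)%N = m.+1 by rewrite /m; lia.
have mN : (m < N)%N by rewrite /m; lia.
move=> IH; have st := ht m mN.
have -> : t m - t N = (t m - t m.+1) + (t m.+1 - t N) by ring.
have h1 : nm (t m.+1) <= nm (t N) + nm (t m.+1 - t N).
  by have := nm_sub_ge (t m.+1) (t N); lra.
apply: le_trans (nmD _ _) _; set T := nm (t N) in IH h1 *; set a := nm (t m.+1 - _) in IH h1 *.
have T0 : 0 <= T := nm_ge0 _.
have P0 : (0 : R) < 4 ^+ m by rewrite exprn_gt0.
have P1 : (1 : R) <= 4 ^+ m by apply: exprn_ege1; lra.
have E : 2 * q / 4 ^+ m.+1 * T = 1 / 2 * (q / 4 ^+ m * T).
  by rewrite exprS; field; rewrite gt_eqF.
have F : 2 * q / 4 ^+ m * T = 2 * (q / 4 ^+ m * T) by ring.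
rewrite E in IH; rewrite F; set r := q / 4 ^+ m in st IH *.
have r0 : 0 <= r by rewrite divr_ge0 // ltW.
have r4 : r <= 1 / 4 by apply: le_trans q1; rewrite ler_pdivrMr // ler_peMr.
have h2 : r * nm (t m.+1) <= r * (T + 1 / 2 * (r * T)).
  by rewrite ler_wpM2l //; move: h1 IH; clear; lra.
have h3 : r * (r * T) <= 1 / 4 * (r * T) by rewrite ler_wpM2r // mulr_ge0.
have h4 : r * (T + 1 / 2 * (r * T)) = r * T + 1 / 2 * (r * (r * T)) by ring.
rewrite h4 in h2; move: st IH h2 h3 (mulr_ge0 r0 T0).
by set u := r * (r * T); set v := r * T; clear; lra.
Qed.

Lemma chain_lim (t : nat -> C) (q : R) : 0 <= q <= 1 / 4 ->
  (forall n, nm (t n - t n.+1) <= q / 4 ^+ n * nm (t n.+1)) ->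
  exists T, forall n, nm (t n - T) <= 2 * q / 4 ^+ n * nm T.
Proof.
move=> q01 ht; have ch N n (nN : (n <= N)%N) := @chain t q N q01 (fun n _ => ht n) n nN.
have [q0 q1] := andP q01.
have tb n : nm (t n) <= 2 * nm (t 0%N).
  have := ch n 0%N (leq0n n); rewrite divr1.
  have : nm (t n) - nm (t 0%N) <= nm (t 0%N - t n) by rewrite nm_distC nm_sub_ge.
  have : 2 * q * nm (t n) <= 1 / 2 * nm (t n) by rewrite ler_wpM2r ?nm_ge0 //; lra.
  by clear; lra.
have [T hT] := cluster_seq tb; exists T => n.
set c := 2 * q / 4 ^+ n.
have c0 : 0 <= c by rewrite divr_ge0 ?mulr_ge0 // exprn_ge0.
have c2 : c <= 1.
  rewrite ler_pdivrMr ?exprn_gt0 // mul1r; have : (1 : R) <= 4 ^+ n by apply: exprn_ege1; lra.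
  by clear -q1; lra.
apply/ler_addgt0Pr => e e0; have e2 : 0 < e / 2 by rewrite divr_gt0.
have [N nN hN] := hT _ n e2.
have -> : t n - T = (t n - t N) + (t N - T) by ring.
apply: le_trans (nmD _ _) _; have := ch N n nN; rewrite -/c => h.
have : c * nm (t N) <= c * nm T + e / 2.
  have -> : t N = T + (t N - T) by ring.
  apply: le_trans (_ : c * (nm T + nm (t N - T)) <= _); first by rewrite ler_wpM2l // nmD.
  rewrite mulrDr lerD2l; apply: le_trans (ltW hN); rewrite ler_piMl ?nm_ge0 //.
by move: h hN; clear; lra.
Qed.

End Vitali.

(** * Normalised displacement along a leaf *)

Section LeafInvariant.
Variable R : realType.
Local Notation C := R[i].
Variable K : R.
Hypothesis K1 : 1 <= K.
Local Notation Vplus := (Vplus K).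
Implicit Types (s : nat -> henon_data R) (z w p : C2 R) (h : henon_data R).

(* The displacement of w from z after n steps, normalised so as to converge. *)
Fixpoint Afac s n : C :=
  if n is m.+1 then Afac s m * ((hdeg (s m))%:R / (s m).2) else 1.

Definition tau s z w n : C :=
  Afac s n * ((orb s n w).1 - (orb s n z).1) * (orb s n z).2.

Definition tau_lim s z w T :=
  forall e : R, 0 < e -> exists N, forall n, (N <= n)%N -> nm (tau s z w n - T) <= e.

(* The stable leaf of an escaping point z. *)
Definition leaf s z w := exists N, exists B, forall n, (N <= n)%N ->
  Vplus (orb s n z) /\ nm ((orb s n w).2 - (orb s n z).2) <= B.

(** Depth from which the relative error [deepq] of the first step is at most 1/4. *)
Definition deepc (B : R) : R := 24 * K ^+ 3 * (1 + B).

Lemma Afac_shift s k n : Afac s (k + n) = Afac s k * Afac (sshift s k) n.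
Proof. by elim: n => [|n IH]; rewrite ?addn0 ?mulr1 // addnS /= IH mulrA. Qed.

Lemma tau_shift s k z w n :
  tau s z w (k + n) = Afac s k * tau (sshift s k) (orb s k z) (orb s k w) n.
Proof. by rewrite /tau Afac_shift !orb_shift -!mulrA. Qed.

Lemma fac_lb h : tame K h -> K^-1 <= nm ((hdeg h)%:R / h.2).
Proof.
move=> th; have k0 := K_gt0 K1; rewrite nmf_div nm_nat ler_pdivlMr; last first.
  by rewrite nm_gt0; exact: tame_jac th.
apply: le_trans (_ : 1 <= _); last by rewrite ler1n; apply: leq_trans (tame_deg2 th).
by rewrite mulrC ler_pdivrMr // mul1r (tame_jac_ub th).
Qed.

Lemma Afac_neq0 s n : adm K s -> Afac s n != 0.
Proof.
move=> hs; elim: n => [|n IH] /=; first exact: oner_neq0.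
rewrite mulf_neq0 // -nm_gt0; apply: lt_le_trans (fac_lb (hs n)).
by rewrite invr_gt0 K_gt0.
Qed.

(** Let x, e be the displacements, y the second coordinate of z and y_1 the next one. As the next
    second displacement is tiny, a x = p'(y) e nearly, where p'(y) is about d lead y^(d-1), and y_1
    is about lead y^d. Hence x y and (d / a) e y_1 agree up to a relative error O(1 / |y|); and e is
    the next first displacement. *)
Lemma tau_step h z w B : tame K h -> Vplus z -> 0 <= B -> nm (w.2 - z.2) <= B ->
  2 * K ^+ 2 * (1 + B) <= nm z.2 ->
  nm ((henon h w).2 - (henon h z).2) <= 2 * K ^+ 2 / nm (henon h z).2 * nm (w.2 - z.2) ->
  nm ((w.1 - z.1) * z.2 - (hdeg h)%:R / h.2 * (w.2 - z.2) * (henon h z).2) <=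
    6 * K ^+ 3 * (1 + B) / nm z.2 * nm ((hdeg h)%:R / h.2 * (w.2 - z.2) * (henon h z).2).
Proof.
move=> th hV B0 he hy hf; have k1 := K1; have k0 := K_gt0 K1.
have k2 : 1 <= K ^+ 2 by apply: exprn_ege1.
have [hd1 hd2 _ hd4] := Vplus_step K1 th hV.
set y := z.2 in he hy hd1 hd2 hd4 *; set e := w.2 - y in he hf *; set y1 := (henon h z).2 in hf hd1 hd2 hd4 *.
set f := (henon h w).2 - y1 in hf; have d2 := tame_deg2 th; set d := hdeg h in d2 hd1 hd2 *.
have a0 : 0 < nm h.2 by rewrite nm_gt0; exact: tame_jac th.
have B10 : 0 <= 1 + B by clear -B0; lra.
have hy1 : 2 * (1 + B) <= nm y.
  by apply: le_trans hy; apply: ler_wpM2r => //; clear -k2; lra.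
have y1' : 1 <= nm y by clear -hy1 B0; lra.
have y0 : 0 < nm y by clear -y1'; lra.
have yy1 : nm y <= nm y1 by clear -hd4 y0; lra.
have y10 : 0 < nm y1 := lt_le_trans y0 yy1.
have ey : nm e <= nm y by clear -he hy1 B0; lra.
have e0 := nm_ge0 e.
have T := tame_taylor th y1' ey; rewrite /e (addrC y) subrK -/e in T.
set dp := h.1.[w.2] - h.1.[y] in T; set q := _ * e in T.
set P := nm y ^+ d.-1.
have P1 : 1 <= P by apply: exprn_ege1.
have PE : P = nm y * nm y ^+ d.-2 by rewrite -exprS; congr (_ ^+ _); move: d2; clear; lia.
have ydE : y ^+ d = y * y ^+ d.-1 by rewrite -exprS; congr (_ ^+ _); move: d2; clear; lia.
set Q := nm (d%:R * e * y1).
have QE : nm (d%:R / h.2 * e * y1) = Q / nm h.2.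
  by rewrite /Q -nmf_div; congr nm; ring.
have LE : nm ((w.1 - z.1) * y - d%:R / h.2 * e * y1) =
    nm (y * (dp - q) - y * f - d%:R * e * (y1 - hlead h * y ^+ d)) / nm h.2.
  rewrite -nmf_div; congr nm; apply: (canRL (mulfK _)); first exact: tame_jac th.
  rewrite mulrBl (_ : d%:R / h.2 * e * y1 * h.2 = d%:R * e * y1); last first.
    by field; exact: tame_jac th.
  rewrite /f /q -/d /y1 /= -/y ydE /dp; ring.
rewrite LE QE mulrA ler_pM2r ?invr_gt0 //.
have hePQ : nm e * P <= K * Q / nm y.
  rewrite ler_pdivlMr // /Q !nmM nm_nat.
  apply: le_trans (_ : K * (2 * nm e * (nm y ^+ d / (2 * K))) <= _).
    rewrite (_ : nm y ^+ d = nm y * P); last first.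
      by rewrite /P -exprS; congr (_ ^+ _); move: d2; clear; lia.
    by rewrite le_eqVlt; apply/orP; left; apply/eqP; field; rewrite gt_eqF.
  rewrite ler_pM2l //; apply: ler_pM => //; first by rewrite mulr_ge0.
    by rewrite divr_ge0 ?exprn_ge0 ?mulr_ge0 // ltW.
  by rewrite ler_wpM2r // (ler_nat _ 2).
have b1 : nm (y * (dp - q)) <= K * (1 + B) * (nm e * P).
  rewrite nmM PE; apply: le_trans (_ : nm y * (K * nm y ^+ d.-2 * (1 + B) * nm e) <= _).
    rewrite ler_wpM2l ?nm_ge0 //; apply: le_trans T _; rewrite -/d ler_wpM2r //.
    by rewrite ler_wpM2l ?lerD2l // mulr_ge0 ?exprn_ge0 // ltW.
  by set p2 := nm y ^+ d.-2; clear; rewrite le_eqVlt; apply/orP; left; apply/eqP; ring.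
have b2 : nm (y * f) <= 2 * K ^+ 2 * (nm e * P).
  rewrite nmM; apply: le_trans (_ : nm y * (2 * K ^+ 2 / nm y1 * nm e) <= _).
    by rewrite ler_wpM2l ?nm_ge0.
  have -> : nm y * (2 * K ^+ 2 / nm y1 * nm e) = (nm y / nm y1) * (2 * K ^+ 2 * nm e) by ring.
  have h1 : nm y / nm y1 <= 1 by rewrite ler_pdivrMr // mul1r.
  have h2 : 0 <= 2 * K ^+ 2 * nm e by rewrite mulr_ge0 // mulr_ge0 // sqr_ge0.
  apply: le_trans (_ : 2 * K ^+ 2 * nm e <= _); first by rewrite ler_piMl.
  by rewrite mulrA ler_peMr.
have b3 : nm (d%:R * e * (y1 - hlead h * y ^+ d)) <= 3 * K ^+ 2 * (nm e * P).
  rewrite !nmM nm_nat; have -> : 3 * K ^+ 2 * (nm e * P) = K * nm e * (3 * K * P) by ring.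
  apply: ler_pM => //; [by rewrite mulr_ge0|exact: nm_ge0|].
  by rewrite ler_wpM2r // (tame_degK th).
apply: le_trans (nmB _ _) _; apply: le_trans (lerD (nmB _ _) (lexx _)) _.
apply: le_trans (_ : 6 * K ^+ 2 * (1 + B) * (nm e * P) <= _).
  have eP : 0 <= nm e * P := mulr_ge0 e0 (le_trans ler01 P1).
  have c1 : K * (1 + B) * (nm e * P) <= K ^+ 2 * (1 + B) * (nm e * P).
    rewrite ler_wpM2r // ler_wpM2r //.
    by rewrite expr2 ler_peMl // ltW.
  have c2 : 5 * K ^+ 2 * (nm e * P) <= 5 * K ^+ 2 * (1 + B) * (nm e * P).
    rewrite ler_wpM2r // ler_peMr //; last by clear -B0; lra.
    by rewrite mulr_ge0 // sqr_ge0.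
  have -> : 6 * K ^+ 2 * (1 + B) * (nm e * P) = K ^+ 2 * (1 + B) * (nm e * P) + 5 * K ^+ 2 * (1 + B) * (nm e * P) by ring.
  have E : 5 * K ^+ 2 * (nm e * P) = 2 * K ^+ 2 * (nm e * P) + 3 * K ^+ 2 * (nm e * P) by ring.
  rewrite E in c2; clear -b1 b2 b3 c1 c2.
  by move: b1 b2 b3 c1 c2; set u1 := K * _ * _; set u2 := 2 * _ * _; set u3 := 3 * _ * _; set u4 := K ^+ 2 * _ * _; set u5 := 5 * _ * _ * _; lra.
have -> : 6 * K ^+ 3 * (1 + B) / nm y * Q = 6 * K ^+ 2 * (1 + B) * (K * Q / nm y) by ring.
by rewrite ler_wpM2l // mulr_ge0 // mulr_ge0 // sqr_ge0.
Qed.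

Lemma deepc_ge B : 0 <= B -> 4 * K ^+ 2 * (1 + B) <= deepc B /\ 2 * K ^+ 2 * (1 + B) <= deepc B.
Proof.
move=> B0; have k1 := K1; rewrite /deepc.
have k3 : K ^+ 2 <= K ^+ 3 by rewrite exprS [leRHS]exprS ler_peMl // ?mulr_ge0 //; lra.
have k2 := sqr_ge0 K.
by split; rewrite ler_wpM2r //; lra.
Qed.

Definition deepq (B : R) z : R := 6 * K ^+ 3 * (1 + B) / nm z.2.

Lemma deepq01 B z : 0 <= B -> deepc B <= nm z.2 -> 0 <= deepq B z <= 1 / 4.
Proof.
move=> B0; have k0 := K_gt0 K1; have k3 : 0 < K ^+ 3 by rewrite exprn_gt0.
have p0 : 0 < K ^+ 3 * (1 + B) by rewrite mulr_gt0 //; lra.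
rewrite /deepc /deepq -[24 * _ * _]mulrA -[6 * _ * (1 + B)]mulrA; set A := _ * (1 + B) in p0 *.
move=> h; have y0 : 0 < nm z.2 by clear -h p0; lra.
apply/andP; split; first by rewrite divr_ge0 ?(ltW y0) // mulr_ge0 // ltW.
by rewrite ler_pdivrMr //; clear -h; lra.
Qed.

(** The relative error at time n is of order 1 / |y_n|, and |y_n| grows at least like 4^n: this is
    the hypothesis of [chain_lim]. *)
Lemma leaf_deep s z w B : adm K s -> 1 <= B -> Vplus z -> deepc B <= nm z.2 ->
  (forall n, nm ((orb s n w).2 - (orb s n z).2) <= B) ->
  forall n, nm (tau s z w n - tau s z w n.+1) <= deepq B z / 4 ^+ n * nm (tau s z w n.+1).
Proof.
move=> hs B1 hV hd hB n; have B0 : 0 <= B by lra.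
have [c1 c2] := deepc_ge B0.
have growth k : nm z.2 * 4 ^+ k <= nm (orb s k z).2 by rewrite mulrC; exact: (Vplus_growth K1 k hs hV).
have yk k : nm z.2 <= nm (orb s k z).2.
  by apply: le_trans (growth k); rewrite ler_peMr ?nm_ge0 // exprn_ege1 //; lra.
have hVk k : Vplus (orb s k z) by have := @orb_Vplus R K K1 s 0 k z hs hV.
have con := @leaf_contract R K K1 (sshift s n.+1) (orb s n.+1 z) (orb s n.+1 w) B (adm_shift _ hs) B1 (hVk _).
have {con} con : nm ((orb s n.+1 w).2 - (orb s n.+1 z).2) <=
    2 * K ^+ 2 / nm (orb s n.+1 z).2 * nm ((orb s n w).2 - (orb s n z).2).
  apply: con; first by move=> k; rewrite -!orb_shift.
  by apply: le_trans c1 _; apply: le_trans hd _; exact: yk.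
have := tau_step (hs n) (hVk n) B0 (hB n) (le_trans c2 (le_trans hd (yk n))) con.
rewrite /tau /=.
set a := Afac s n; set r := (hdeg (s n))%:R / _; set e := _ - (orb s n z).2; set y1 := _ - (s n).2 * _.
set x := (orb s n w).1 - _; set y := (orb s n z).2 => h.
have -> : a * x * y - a * r * e * y1 = a * (x * y - r * e * y1) by ring.
have -> : a * r * e * y1 = a * (r * e * y1) by ring.
rewrite !nmM [leRHS]mulrCA ler_wpM2l ?nm_ge0 //; apply: le_trans h _.
rewrite -!nmM; apply: ler_wpM2r; first exact: nm_ge0.
rewrite /deepq -[leRHS]mulrA -invfM; apply: ler_wpM2l.
  by rewrite mulr_ge0 ?mulr_ge0 ?exprn_ge0 ?(ltW (K_gt0 K1)) //; lra.
have z0 : 0 < nm z.2 by apply: lt_le_trans (rad_gt0 K1) hV.1.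
by rewrite lef_pV2 ?posrE // ?(lt_le_trans z0 (yk n)) ?mulr_gt0 ?exprn_gt0 //; exact: growth.
Qed.

End LeafInvariant.

(** * The limit of the displacement as a coordinate on the leaf *)

Section DeepLeaves.
Variable R : realType.
Variable K : R.
Hypothesis K1 : 1 <= K.
Local Notation rad := (esc_rad K).
Local Notation err := (esc_err K).
Local Notation Vplus := (Vplus K).
Local Notation green := (green K).
Local Notation leaf := (leaf K).
Local Notation deepc := (deepc K).
Local Notation deepq := (deepq K).
Implicit Types (s : nat -> henon_data R) (z w p : C2 R) (h : henon_data R).

Lemma leaf_deepen s z w : adm K s -> leaf s z w -> exists2 B, 1 <= B &
  exists N, forall k, (N <= k)%N -> [/\ Vplus (orb s k z), deepc B <= nm (orb s k z).2 &
    forall n, nm ((orb s (k + n) w).2 - (orb s (k + n) z).2) <= B].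
Proof.
move=> hs [N [B hB]]; exists (Num.max 1 B); first by rewrite le_max lexx.
set B' := Num.max 1 B; have r0 := rad_gt0 K1.
have [k0 hk0] := half_pow_small (deepc B') r0.
exists (N + k0)%N => k hk; have kN : (N <= k)%N by apply: leq_trans hk; exact: leq_addr.
have [hV _] := hB k kN; split=> //.
  have [hVN _] := hB N (leqnn N).
  have := Vplus_growth K1 (k - N) (adm_shift N hs) hVN; rewrite -orb_shift subnKC //; apply: le_trans.
  move: hk0; rewrite ltr_pdivrMr ?exprn_gt0 // => /ltW h; apply: le_trans h _; rewrite mulrC.
  apply: ler_pM; rewrite ?exprn_ge0 ?(ltW r0) //; last exact: hVN.1.
  apply: le_trans (_ : 4 ^+ k0 <= _); first by apply: lerXn2r; rewrite ?nnegrE; lra.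
  by apply: ler_weXn2l; [lra|rewrite leq_subRL // addnC].
by move=> n; have [_ h] := hB (k + n)%N (leq_trans kN (leq_addr _ _)); rewrite le_max h orbT.
Qed.

Lemma tau_lim_shift s k z w T : adm K s ->
  tau_lim (sshift s k) (orb s k z) (orb s k w) T -> tau_lim s z w (Afac s k * T).
Proof.
move=> hs hT e e0; have a0 : 0 < nm (Afac s k) by rewrite nm_gt0; exact: Afac_neq0 hs.
have [N hN] := hT _ (divr_gt0 e0 a0); exists (k + N)%N => n hn.
have kn : (k <= n)%N by apply: leq_trans hn; exact: leq_addr.
rewrite -(subnKC kn) tau_shift -mulrBr nmM mulrC -ler_pdivlMr //.
by apply: hN; rewrite leq_subRL.
Qed.

Lemma tau_lim_uniq s z w T T' : tau_lim s z w T -> tau_lim s z w T' -> T = T'.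
Proof.
move=> h h'; apply/eqP; rewrite -subr_eq0; apply/eqP/nm_le0/ler_addgt0Pr => e e0; rewrite add0r.
have e2 : 0 < e / 2 by rewrite divr_gt0.
have [N hN] := h _ e2; have [N' hN'] := h' _ e2.
set n := maxn N N'; have -> : T - T' = (tau s z w n - T') - (tau s z w n - T) by ring.
apply: le_trans (nmB _ _) _; have := hN n (leq_maxl _ _); have := hN' n (leq_maxr _ _); lra.
Qed.

Lemma chain_tau_lim s z w T (q : R) : 0 <= q ->
  (forall n, nm (tau s z w n - T) <= 2 * q / 4 ^+ n * nm T) -> tau_lim s z w T.
Proof.
move=> q0 h e e0; have T0 := nm_ge0 T.
have [k hk] := half_pow_small (2 * q * nm T) e0; exists k => n kn.
apply: le_trans (h n) _; rewrite mulrAC ler_pdivrMr ?exprn_gt0 //.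
move: hk; rewrite ltr_pdivrMr ?exprn_gt0 // => /ltW hk; apply: le_trans hk _.
rewrite ler_pM2l //; apply: le_trans (_ : 4 ^+ k <= _); first by apply: lerXn2r; rewrite ?nnegrE; lra.
by apply: ler_weXn2l => //; lra.
Qed.

Lemma leaf_deep_lim s z w B : adm K s -> 1 <= B -> Vplus z -> deepc B <= nm z.2 ->
  (forall n, nm ((orb s n w).2 - (orb s n z).2) <= B) ->
  exists2 T, tau_lim s z w T &
    forall n, nm (tau s z w n - T) <= 2 * deepq B z / 4 ^+ n * nm T.
Proof.
move=> hs B1 hV hd hB; have B0 : 0 <= B by lra.
have q01 := deepq01 K1 B0 hd.
have [T hT] := chain_lim q01 (leaf_deep K1 hs B1 hV hd hB).
by exists T => //; apply: chain_tau_lim hT; case/andP: q01.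
Qed.

Lemma leaf_unshift s k z w : leaf (sshift s k) (orb s k z) (orb s k w) -> leaf s z w.
Proof.
move=> [N [B hB]]; exists (k + N)%N, B => n hn.
have kn : (k <= n)%N by apply: leq_trans hn; exact: leq_addr.
by have := hB (n - k)%N; rewrite -!orb_shift subnKC //; apply; rewrite leq_subRL.
Qed.

Lemma leaf_tau_lim s z w : adm K s -> leaf s z w -> exists T, tau_lim s z w T.
Proof.
move=> hs hl; have [B B1 [N hN]] := leaf_deepen hs hl.
have [hV hd hB] := hN N (leqnn N).
have [|T hT _] := @leaf_deep_lim (sshift s N) (orb s N z) (orb s N w) B (adm_shift _ hs) B1 hV hd.
  by move=> n; rewrite -!orb_shift.
by exists (Afac s N * T); exact: tau_lim_shift.
Qed.

(** With limit 0 the relative estimate makes the displacement of a deep iterate vanish exactly, so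
    the first coordinates agree; [leaf_contract] then identifies the second ones. *)
Lemma leaf_T0 s z w : adm K s -> leaf s z w -> tau_lim s z w 0 -> z = w.
Proof.
move=> hs hl hT; have [B B1 [N hN]] := leaf_deepen hs hl.
have [hV hd hB] := hN N (leqnn N).
have hB' n : nm ((orb (sshift s N) n (orb s N w)).2 - (orb (sshift s N) n (orb s N z)).2) <= B.
  by rewrite -!orb_shift.
have hs' : adm K (sshift s N) by exact: adm_shift.
have [T hT' est] := leaf_deep_lim hs' B1 hV hd hB'.
have T0 : T = 0.
  have /eqP := tau_lim_uniq (tau_lim_shift hs hT') hT; rewrite mulf_eq0 (negbTE (Afac_neq0 K1 N hs)) => /= /eqP //.
have := est 0%N; rewrite T0 subr0 nm0 mulr0 /tau /= mul1r => h0.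
have z0 : 0 < nm (orb s N z).2 by apply: lt_le_trans (rad_gt0 K1) hV.1.
have x0 : (orb s N w).1 = (orb s N z).1.
  move/nm_le0/eqP: h0; rewrite mulf_eq0 subr_eq0 => /orP[/eqP //|/eqP E].
  by move: z0; rewrite E nm0 ltxx.
have B0 : 0 <= B by lra.
have := leaf_contract K1 hs' B1 hV hB' (le_trans (deepc_ge K1 B0).1 hd).
rewrite x0 subrr nm0 mulr0 => /nm_le0/eqP; rewrite subr_eq0 => /eqP y0.
have jacs k : (s k).2 != 0 by exact: (tame_jac K1 (hs k)).
rewrite -(orbitK N jacs z) -(orbitK N jacs w); congr orbV.
by move: x0 y0; case: (orb s N z) (orb s N w) => a b [a' b'] /= -> ->.
Qed.

Lemma leaf_y s z w (e : R) : adm K s -> leaf s z w -> 0 < e ->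
  exists N, forall n, (N <= n)%N -> Vplus (orb s n w) /\
    nm ((orb s n w).2 / (orb s n z).2 - 1) <= e.
Proof.
move=> hs [N [B hB]] e0; have r0 := rad_gt0 K1; have r100 := rad_ge100 K1.
have [k0 hk0] := half_pow_small ((`|B| + 1) * (4 + e^-1)) r0.
have big n : (N + k0 <= n)%N -> (`|B| + 1) * (4 + e^-1) + rad <= nm (orb s n.+1 z).2 /\
   nm (orb s n.+1 z).1 <= nm (orb s n.+1 z).2 / 4.
  move=> hn; have Nn : (N <= n)%N by apply: leq_trans hn; exact: leq_addr.
  have [hV _] := hB n Nn; have [hVN _] := hB N (leqnn N).
  have [_ _ _ h4] := Vplus_step K1 (hs n) hV.
  have yn : (`|B| + 1) * (4 + e^-1) <= nm (orb s n z).2.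
    have := Vplus_growth K1 (n - N) (adm_shift N hs) hVN; rewrite -orb_shift subnKC //; apply: le_trans.
    move: hk0; rewrite ltr_pdivrMr ?exprn_gt0 // => /ltW h; apply: le_trans h _; rewrite mulrC.
    apply: ler_pM; rewrite ?exprn_ge0 ?(ltW r0) //; last exact: hVN.1.
    apply: le_trans (_ : 4 ^+ k0 <= _); first by apply: lerXn2r; rewrite ?nnegrE; lra.
    by apply: ler_weXn2l; [lra|rewrite leq_subRL // addnC].
  split; last by rewrite ler_pdivlMr // mulrC.
  apply: le_trans h4; have := hV.1; set y := nm (orb s n z).2 in yn *.
  by clear -yn r0; lra.
exists (N + k0).+1 => -[//|n] hn; have [b1 b2] := big n hn.
have [_ hd] : Vplus (orb s n.+1 z) /\ nm ((orb s n.+1 w).2 - (orb s n.+1 z).2) <= B.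
  by apply: hB; rewrite ltnS in hn; apply: leqW; apply: leq_trans hn; exact: leq_addr.
have [|_ hd'] := hB n; first by rewrite ltnS in hn; apply: leq_trans hn; exact: leq_addr.
have ei : 0 < e^-1 by rewrite invr_gt0.
have Bn := normr_ge0 B; have BB := ler_norm B.
have p1 : (`|B| + 1) * (4 + e^-1) = 4 * `|B| + 4 + (`|B| + 1) * e^-1 by ring.
have p2 : 0 < (`|B| + 1) * e^-1 by rewrite mulr_gt0 //; lra.
set Y := (orb s n.+1 z).2 in b1 b2 hd *; set Y' := (orb s n.+1 w).2 in hd *.
have Y0 : 0 < nm Y by rewrite p1 in b1; clear -b1 p2 Bn r0; lra.
split.
  have t1 := nm_sub_ge Y Y'; rewrite nm_distC in t1.
  split; rewrite -/Y'; first by rewrite p1 in b1; clear -b1 p2 Bn BB hd t1; lra.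
  have t2 := nm_sub_ge (orb s n.+1 w).1 (orb s n.+1 z).1.
  rewrite !orb1 in t2 b2 *; rewrite p1 in b1.
  move: b1 p2 Bn BB hd t1 t2 b2 hd' r100; clear.
  set a := nm (_ - _); set b := nm (_ - _); set u := _ * e^-1; lra.
have -> : Y' / Y - 1 = (Y' - Y) / Y by field; rewrite -nm_gt0.
rewrite nmf_div ler_pdivrMr //; apply: le_trans hd _.
apply: le_trans (_ : e * ((`|B| + 1) * e^-1) <= _); first by rewrite mulrCA mulfV ?gt_eqF // mulr1; lra.
by rewrite ler_pM2l //; rewrite p1 in b1; clear -b1 Bn r0; lra.
Qed.

(** A change of base point multiplies the difference of the displacements by the ratio of the second
    coordinates, which tends to 1. So the coordinate only undergoes a translation, and each leaf
    carries an affine structure. *)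
Lemma leaf_sub s z w w' T T' : adm K s -> leaf s z w -> leaf s z w' ->
  tau_lim s z w T -> tau_lim s z w' T' -> leaf s w w' /\ tau_lim s w w' (T' - T).
Proof.
move=> hs hl hl' hT hT'; split.
  have [N [B hB]] := hl; have [N' [B' hB']] := hl'; have [M hM] := leaf_y hs hl (@ltr01 R).
  have [k [k1 k2 k3 _]] := large4 N N' M 0.
  exists k, (B' + B) => n kn; split; first by have [] := hM n (leq_trans k3 kn).
  have -> : (orb s n w').2 - (orb s n w).2 = ((orb s n w').2 - (orb s n z).2) - ((orb s n w).2 - (orb s n z).2) by ring.
  apply: le_trans (nmB _ _) _; apply: lerD.
    by have [] := hB' n (leq_trans k2 kn).
  by have [] := hB n (leq_trans k1 kn).
move=> e e0; set m := nm (T' - T) + 1.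
have m0 : 0 < m by rewrite /m; have := nm_ge0 (T' - T); lra.
pose e1 := Num.min 1 (e / 8); have e10 : 0 < e1 by rewrite lt_min ltr01 divr_gt0.
pose e2 := Num.min 1 (e / (2 * m)); have e20 : 0 < e2.
  by rewrite lt_min ltr01 divr_gt0 // mulr_gt0.
have [M hM] := leaf_y hs hl e20.
have [N1 hN1] := hT _ e10; have [N2 hN2] := hT' _ e10.
have [Nz [Bz hBz]] := hl.
have [k [k1 k2 k3 k4]] := large4 M N1 N2 Nz; exists k => n kn.
have [_ hr] := hM n (leq_trans k1 kn).
have {hN1} h1 := hN1 n (leq_trans k2 kn); have {hN2} h2 := hN2 n (leq_trans k3 kn).
have [[hz _] _] := hBz n (leq_trans k4 kn).
have y0 : (orb s n z).2 != 0 by rewrite -nm_gt0; apply: lt_le_trans (rad_gt0 K1) hz.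
set r := (orb s n w).2 / (orb s n z).2 in hr.
have -> : tau s w w' n = (tau s z w' n - tau s z w n) * r.
  by rewrite /tau /r; field.
set t := tau s z w n in h1 *; set t' := tau s z w' n in h2 *.
have -> : (t' - t) * r - (T' - T) = ((t' - T') - (t - T)) * r + (T' - T) * (r - 1) by ring.
apply: le_trans (nmD _ _) _; rewrite (nmM _ r) (nmM _ (r - 1)).
have r2 : nm r <= 2.
  have -> : r = (r - 1) + 1 by ring.
  apply: le_trans (nmD _ _) _; rewrite nm1; have : e2 <= 1 by rewrite ge_min lexx.
  by move: hr; clear; lra.
have s1 : nm ((t' - T') - (t - T)) <= e / 4.
  apply: le_trans (nmB _ _) _; have : e1 <= e / 8 by rewrite ge_min lexx orbT.
  by move: h1 h2; clear; lra.
have s2 : nm ((t' - T') - (t - T)) * nm r <= e / 4 * 2.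
  by apply: ler_pM => //; exact: nm_ge0.
have s3 : nm (T' - T) * nm (r - 1) <= m * (e / (2 * m)).
  apply: ler_pM; rewrite ?nm_ge0 //; first by rewrite /m lerDl.
  by apply: le_trans hr _; rewrite ge_min lexx orbT.
have E : m * (e / (2 * m)) = e / 2 by field; rewrite gt_eqF.
by rewrite E in s3; move: s2 s3; clear; lra.
Qed.

Lemma leaf_uniq s z w w' T : adm K s -> leaf s z w -> leaf s z w' ->
  tau_lim s z w T -> tau_lim s z w' T -> w = w'.
Proof.
move=> hs hl hl' hT hT'; have [h1 h2] := leaf_sub hs hl hl' hT hT'.
by apply: (leaf_T0 hs h1); rewrite subrr in h2.
Qed.

(** The second coordinates have ratio tending to 1, so their logarithms differ by O(1), which
    division by D_n removes. *)
Lemma leaf_green s z w : adm K s -> leaf s z w -> green s w = green s z.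
Proof.
move=> hs hl; have half : (0 : R) < 1 / 2 by rewrite divr_gt0.
have [M hM] := leaf_y hs hl half.
have [N [B hB]] := hl.
have est n : (maxn M N <= n)%N ->
    `|Deg s n * green s w - Deg s n * green s z| <= 2 * (err + ln 2) + 1.
  rewrite geq_max => /andP[Mn Nn]; have [hw hr] := hM n Mn; have [hz _] := hB n Nn.
  have q1 := green_V_ln K1 hs hw; have q2 := green_V_ln K1 hs hz.
  have r0 := rad_gt0 K1.
  have y0 : 0 < nm (orb s n z).2 by apply: lt_le_trans r0 hz.1.
  have y0' : 0 < nm (orb s n w).2 by apply: lt_le_trans r0 hw.1.
  have q3 : ln (nm (orb s n w).2) - ln (nm (orb s n z).2) <= 1.
    rewrite -ln_div ?posrE // -nmf_div; set r := (orb s n w).2 / _ in hr *.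
    have rr : nm r <= 1 + 1 / 2.
      have -> : r = 1 + (r - 1) by ring.
      by apply: le_trans (nmD _ _) _; rewrite nm1 lerD2l.
    apply: le_trans (_ : ln (1 + 1 / 2) <= _).
      by rewrite ler_ln ?posrE // /r nmf_div divr_gt0.
    by apply: le_trans (le_ln1Dx _) _; lra.
  have q4 : ln (nm (orb s n z).2) - ln (nm (orb s n w).2) <= 1.
    rewrite -ln_div ?posrE // -nmf_div.
    have -> : (orb s n z).2 / (orb s n w).2 = ((orb s n w).2 / (orb s n z).2)^-1 by rewrite invf_div.
    set r := (orb s n w).2 / _ in hr *.
    have rr : 1 / 2 <= nm r.
      by have := nm_sub_ge 1 r; rewrite nm1 nm_distC; move: hr; clear; lra.
    rewrite nmV; apply: le_trans (_ : ln (1 + 1) <= _); last by apply: le_ln1Dx; lra.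
    rewrite ler_ln ?posrE ?invr_gt0 ?(lt_le_trans half rr) //.
    by rewrite -div1r ler_pdivrMr ?(lt_le_trans half rr) //; clear -rr; lra.
  move: q1 q2 q3 q4; rewrite !ler_norml; set a := ln (nm (orb s n w).2); set b := ln (nm _).
  set u := Deg s n * _; set v := Deg s n * _; set E := err + ln 2.
  by clear; move=> /andP[? ?] /andP[? ?] ? ?; apply/andP; split; lra.
apply/eqP; rewrite eq_le; apply/andP; split; apply: (@le_of_Deg R K s _ _ (2 * (err + ln 2) + 1) hs);
  exists (maxn M N) => n /est; rewrite ler_norml; clear; lra.
Qed.

End DeepLeaves.

(** * Approximate points with prescribed coordinate *)

Section LeafParam.
Variable R : realType.
Variable K : R.
Hypothesis K1 : 1 <= K.
Local Notation Vplus := (Vplus K).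
Local Notation deepc := (deepc K).
Local Notation deepq := (deepq K).
Implicit Types (s : nat -> henon_data R) (z w p : C2 R) (h : henon_data R).

(** Finite-time counterpart of [leaf_contract]: if the next second displacement is small, expansion
    forces p'(y) e to be balanced by a x. The conclusion has the shape of the hypothesis, one step
    earlier. *)
Lemma step_back h z w B : tame K h -> 0 <= B -> nm (w.2 - z.2) <= B ->
  deepc B <= nm z.2 -> 4 * nm z.2 <= nm (henon h z).2 ->
  nm ((henon h w).2 - (henon h z).2) <= 2 * K ^+ 2 / nm (henon h z).2 * nm (w.2 - z.2) ->
  nm (w.2 - z.2) <= 2 * K ^+ 2 / nm z.2 * nm (w.1 - z.1).
Proof.
move=> th B0 he hd h4 hf; have k1 := K1; have k0 := K_gt0 K1.
have [c1 c2] := deepc_ge K1 B0.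
have st := leaf_step K1 th B0 he (le_trans c2 hd).
set e := nm (w.2 - z.2) in he hf st *; set y := nm z.2 in hd h4 st *; set y1 := nm (henon h z).2 in h4 hf *.
have k2 : 1 <= K ^+ 2 by apply: exprn_ege1.
have e0 : 0 <= e := nm_ge0 _.
have yK : 4 * K ^+ 2 <= y.
  apply: le_trans hd; apply: le_trans c1; rewrite ler_peMr //; last by lra.
  by rewrite mulr_ge0 // sqr_ge0.
have y0 : 0 < y by clear -yK k2; lra.
have y10 : 0 < y1 by clear -h4 y0; lra.
have f1 : 2 * K ^+ 2 / y1 * e <= e.
  by rewrite ler_piMl // ler_pdivrMr // mul1r; clear -h4 yK y0 k2; lra.
have ax : nm h.2 * nm (w.1 - z.1) <= K * nm (w.1 - z.1).
  by rewrite ler_wpM2r ?nm_ge0 // (tame_jac_ub th).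
have t1 := nm_sub_ge (h.1.[w.2] - h.1.[z.2]) ((henon h w).2 - (henon h z).2).
have E : (h.1.[w.2] - h.1.[z.2]) - ((henon h w).2 - (henon h z).2) = h.2 * (w.1 - z.1).
  by rewrite /=; ring.
rewrite E nmM in t1.
have h1 : y * e / K - e <= K * nm (w.1 - z.1).
  by move: st hf f1 ax t1; clear; lra.
have h2 : e <= y * e / (2 * K).
  rewrite ler_pdivlMr ?mulr_gt0 // mulrC ler_wpM2r //.
  have : K <= K ^+ 2 by rewrite expr2 ler_peMl // ltW.
  by clear -yK k2 k0; lra.
have E2 : y * e / K = y * e / (2 * K) + y * e / (2 * K) by field; rewrite gt_eqF.
have h3 : y * e / (2 * K) <= K * nm (w.1 - z.1).
  by rewrite E2 in h1; move: h1 h2; clear; lra.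
rewrite mulrAC ler_pdivlMr //.
move: h3; rewrite ler_pdivrMr ?mulr_gt0 // mulrC => h3; apply: le_trans h3 _.
by rewrite le_eqVlt; apply/orP; left; apply/eqP; ring.
Qed.

(** Converts a bound for [tau] at time n + 1 into one for the second displacement at time n, whose
    coefficient in it has this modulus. *)
Lemma Afac_growth s z n : adm K s -> Vplus z -> K ^+ 2 <= nm z.2 ->
  nm z.2 ^+ 2 / K ^+ 2 <= 2 * nm (Afac s n.+1) * nm (orb s n.+1 z).2.
Proof.
move=> hs hV hy; have k1 := K1; have k0 := K_gt0 K1.
have hVk k : Vplus (orb s k z) by have := @orb_Vplus R K K1 s 0 k z hs hV.
have step k : nm (Afac s k.+1) * nm (orb s k.+1 z).2 >= nm (Afac s k) * nm (orb s k z).2 * (nm (orb s k z).2 / (2 * K ^+ 2)).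
  have [_ h2 _ _] := Vplus_step K1 (hs k) (hVk k).
  have fl := fac_lb K1 (hs k); rewrite [Afac _ _]/= nmM -/(orb s k.+1 z).
  have h3 : nm (orb s k z).2 ^+ 2 / (2 * K) <= nm (orb s k.+1 z).2.
    apply: le_trans h2; rewrite ler_wpM2r ?invr_ge0 ?mulr_ge0 ?(ltW k0) //.
    apply: ler_weXn2l; last exact: tame_deg2 (hs k).
    by have := (hVk k).1; have := rad_ge100 K1; lra.
  have -> : nm (Afac s k) * nm (orb s k z).2 * (nm (orb s k z).2 / (2 * K ^+ 2)) =
      nm (Afac s k) * (K^-1 * (nm (orb s k z).2 ^+ 2 / (2 * K))) by field; rewrite gt_eqF.
  rewrite -mulrA ler_wpM2l ?nm_ge0 //; apply: ler_pM => //; first by rewrite invr_ge0 ltW.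
  by rewrite divr_ge0 ?sqr_ge0 // mulr_ge0 // ltW.
elim: n => [|n IH].
  have := step 0%N; rewrite /= nm1 mul1r => h.
  rewrite -mulrA; apply: le_trans (_ : 2 * (nm z.2 * (nm z.2 / (2 * K ^+ 2))) <= _).
    by rewrite le_eqVlt; apply/orP; left; apply/eqP; field; rewrite gt_eqF.
  by rewrite ler_pM2l.
apply: le_trans IH _; rewrite -!mulrA ler_pM2l //.
apply: le_trans (step n.+1); rewrite ler_peMr //; first by rewrite mulr_ge0 ?nm_ge0.
rewrite ler_pdivlMr ?mul1r; last by rewrite mulr_gt0 // exprn_gt0.
have := Vplus_growth K1 n.+1 hs hV; apply: le_trans.
apply: ler_pM => //; first exact: sqr_ge0.
apply: le_trans (_ : 4 ^+ 1 <= _); first by rewrite expr1; lra.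
by apply: ler_weXn2l => //; lra.
Qed.

(* The point whose n-th iterate has the same second coordinate as that of z
   and whose normalised displacement is exactly sig. *)
Definition leaf_approx s z sig n : C2 R :=
  orbV s n ((orb s n z).1 + sig / (Afac s n * (orb s n z).2), (orb s n z).2).

(** Displacement allowed for coordinates up to kap |y|^2: 2 kap |y|^2 divided by the lower bound of
    [Afac_growth]. *)
Definition leafB (kap : R) : R := 4 * K ^+ 2 * kap.

(** Downward induction from time N, where the coordinate is exact and the second displacement is 0.
    The three bounds must be carried together, since [tau_step] and [step_back] both presuppose the
    displacement bound. *)
Lemma leaf_approxP s z sig kap N : adm K s -> 1 <= kap -> Vplus z ->
  deepc (leafB kap) <= nm z.2 -> nm sig <= kap * nm z.2 ^+ 2 ->
  forall n, (n <= N)%N ->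
  [/\ nm (tau s z (leaf_approx s z sig N) n - sig) <= 2 * deepq (leafB kap) z / 4 ^+ n * nm sig,
      nm ((orb s n (leaf_approx s z sig N)).2 - (orb s n z).2) <= leafB kap &
      nm ((orb s n (leaf_approx s z sig N)).2 - (orb s n z).2) <=
        2 * K ^+ 2 / nm (orb s n z).2 * nm ((orb s n (leaf_approx s z sig N)).1 - (orb s n z).1)].
Proof.
move=> hs kap1 hV hd hsig; have k1 := K1; have k0 := K_gt0 K1.
have k2 : 1 <= K ^+ 2 by apply: exprn_ege1.
set B := leafB kap in hd *; set w := leaf_approx s z sig N.
have B1 : 1 <= B.
  rewrite /B /leafB -[leLHS]mulr1; apply: ler_pM => //; lra.
have B0 : 0 <= B by lra.
have [q0 q1] := andP (deepq01 K1 B0 hd).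
have jacs k : (s k).2 != 0 by exact: (tame_jac K1 (hs k)).
have wN : orb s N w = ((orb s N z).1 + sig / (Afac s N * (orb s N z).2), (orb s N z).2).
  by rewrite /w /leaf_approx orbitVK.
have hVk k : Vplus (orb s k z) by have := @orb_Vplus R K K1 s 0 k z hs hV.
have r0 := rad_gt0 K1.
have y0 k : 0 < nm (orb s k z).2 by apply: lt_le_trans r0 (hVk k).1.
have yn k : (orb s k z).2 != 0 by rewrite -nm_gt0.
have An k : Afac s k != 0 := Afac_neq0 K1 k hs.
have yk k : nm z.2 <= nm (orb s k z).2.
  by apply: le_trans (Vplus_growth K1 k hs hV); rewrite ler_peMl ?nm_ge0 // exprn_ege1 //; lra.
have yd k : deepc B <= nm (orb s k z).2 := le_trans hd (yk k).
have yK : K ^+ 2 <= nm z.2.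
  apply: le_trans hd; apply: le_trans (deepc_ge K1 B0).1; apply: le_trans (_ : K ^+ 2 * 4 <= _).
    by rewrite ler_peMr ?sqr_ge0 //; lra.
  by rewrite [K ^+ 2 * 4]mulrC ler_peMr //; [rewrite mulr_ge0 // sqr_ge0|lra].
move=> n nN; rewrite -(subKn nN).
elim: (N - n)%N (leq_subr n N) => [|k IH] kN.
  rewrite subn0 wN /tau wN /= subrr nm0; split => //.
  - rewrite (addrC (orb s N z).1) addrK.
    have -> : Afac s N * (sig / (Afac s N * (orb s N z).2)) * (orb s N z).2 = sig.
      by field; rewrite An yn.
    rewrite subrr nm0; apply: mulr_ge0 (nm_ge0 _); apply: divr_ge0; last exact: exprn_ge0.
    exact: mulr_ge0.
  - by rewrite mulr_ge0 ?nm_ge0 // divr_ge0 ?nm_ge0 // mulr_ge0 // sqr_ge0.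
have {IH} := IH (ltnW kN); set m := (N - k.+1)%N.
have -> : (N - k)%N = m.+1 by rewrite /m -subSn // subSS.
move=> [IH1 _ IH3].
set T := nm sig in hsig IH1 *; have T0 : 0 <= T := nm_ge0 _.
have P0 : (0 : R) < 4 ^+ m by rewrite exprn_gt0.
have P1 : (1 : R) <= 4 ^+ m by apply: exprn_ege1; lra.
have E : 2 * deepq B z / 4 ^+ m.+1 * T = 1 / 2 * (deepq B z / 4 ^+ m * T).
  by rewrite exprS; field; rewrite gt_eqF.
have F : 2 * deepq B z / 4 ^+ m * T = 2 * (deepq B z / 4 ^+ m * T) by ring.
rewrite E in IH1; rewrite F; set r := deepq B z / 4 ^+ m in IH1 *.
have rr0 : 0 <= r by rewrite divr_ge0 // ltW.
have r4 : r <= 1 / 4 by apply: le_trans q1; rewrite ler_pdivrMr // ler_peMr.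
have rT : r * T <= 1 / 4 * T by rewrite ler_wpM2r.
have t1 : nm (tau s z w m.+1) <= T + 1 / 2 * (r * T).
  by have := nm_sub_ge (tau s z w m.+1) sig; rewrite -/T; move: IH1; clear; lra.
have t2 : nm (tau s z w m.+1) <= 2 * T by move: t1 rT T0; clear; lra.
have dyB : nm ((orb s m w).2 - (orb s m z).2) <= B.
  have tE : nm (tau s z w m.+1) = nm (Afac s m.+1) * nm (orb s m.+1 z).2 * nm ((orb s m w).2 - (orb s m z).2).
    by rewrite /tau !nmM !orb1 mulrAC.
  have ag := Afac_growth m hs hV yK.
  have yy0 : 0 < nm z.2 := y0 0%N.
  have ag0 : 0 < nm (Afac s m.+1) * nm (orb s m.+1 z).2 by rewrite mulr_gt0 // nm_gt0.
  move: t2; rewrite tE mulrC -ler_pdivlMr // => t2; apply: le_trans t2 _.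
  rewrite ler_pdivrMr //; apply: le_trans (_ : 2 * (kap * nm z.2 ^+ 2) <= _); first by rewrite ler_pM2l.
  have -> : B * (nm (Afac s m.+1) * nm (orb s m.+1 z).2) =
     2 * (kap * (K ^+ 2 * (2 * nm (Afac s m.+1) * nm (orb s m.+1 z).2))) by rewrite /B /leafB; ring.
  rewrite ler_pM2l // ler_pM2l; last by lra.
  by rewrite mulrC -ler_pdivrMr // exprn_gt0.
have [_ _ _ h4] := Vplus_step K1 (hs m) (hVk m).
split=> //; last by apply: step_back (hs m) B0 dyB (yd m) h4 _; exact: IH3.
have [_ c2] := deepc_ge K1 B0.
have ts := tau_step K1 (hs m) (hVk m) B0 dyB (le_trans c2 (yd m)) IH3.
have st : nm (tau s z w m - tau s z w m.+1) <= r * nm (tau s z w m.+1).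
  move: ts; rewrite /tau /=.
  set a := Afac s m; set rf := (hdeg (s m))%:R / _; set e := _ - (orb s m z).2; set y1 := _ - (s m).2 * _.
  set x := (orb s m w).1 - _; set y := (orb s m z).2 => h.
  have -> : a * x * y - a * rf * e * y1 = a * (x * y - rf * e * y1) by ring.
  have -> : a * rf * e * y1 = a * (rf * e * y1) by ring.
  rewrite (nmM a) (nmM a) [leRHS]mulrCA ler_wpM2l ?nm_ge0 //; apply: le_trans h _.
  apply: ler_wpM2r; first exact: nm_ge0.
  rewrite /r /deepq -[leRHS]mulrA -invfM; apply: ler_wpM2l.
    by rewrite mulr_ge0 ?mulr_ge0 ?exprn_ge0 ?(ltW k0) //; apply: addr_ge0.
  rewrite lef_pV2 ?posrE //; [|exact: y0|by rewrite mulr_gt0 //; exact: (y0 0%N)].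
  by rewrite mulrC; exact: (Vplus_growth K1 m hs hV).
have -> : tau s z w m - sig = (tau s z w m - tau s z w m.+1) + (tau s z w m.+1 - sig) by ring.
apply: le_trans (nmD _ _) _.
have h2 : r * nm (tau s z w m.+1) <= r * (T + 1 / 2 * (r * T)) by rewrite ler_wpM2l.
have h3 : r * (r * T) <= 1 / 4 * (r * T) by rewrite ler_wpM2r // mulr_ge0.
have h5 : r * (T + 1 / 2 * (r * T)) = r * T + 1 / 2 * (r * (r * T)) by ring.
rewrite h5 in h2; move: st IH1 h2 h3 (mulr_ge0 rr0 T0).
by set u := r * (r * T); set v := r * T; clear; lra.
Qed.

End LeafParam.

(** * Leaves as entire curves *)

Section LeafFamilies.
Variable R : realType.
Local Notation C := R[i].
Variable K : R.
Hypothesis K1 : 1 <= K.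
Local Notation Vplus := (Vplus K).
Local Notation green := (green K).
Local Notation leaf := (leaf K).
Local Notation deepc := (deepc K).
Local Notation deepq := (deepq K).
Local Notation leafB := (leafB K).
Implicit Types (s : nat -> henon_data R) (z w p : C2 R) (h : henon_data R).

Lemma cluster_le (F : C2 R -> C) (u : nat -> C2 R) p a (b : R) N0 : cont2 F p ->
  (forall e N, 0 < e -> exists2 n, (N <= n)%N & dist2 (u n) p < e) ->
  (forall n, (N0 <= n)%N -> nm (F (u n) - a) <= b) -> nm (F p - a) <= b.
Proof.
move=> Fc hu hb; apply/ler_addgt0Pr => e e0; have [d d0 hd] := Fc e e0.
have [n nN hn] := hu d N0 d0.
have -> : F p - a = (F (u n) - a) - (F (u n) - F p) by ring.
by apply: le_trans (nmB _ _) _; apply: lerD; [exact: hb|apply: ltW; exact: hd].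
Qed.

Lemma dif2_orb1 s n z : dif2 (fun w => (orb s n w).1) z.
Proof. by have [] := holo_orb s n z. Qed.

Lemma dif2_orb2 s n z : dif2 (fun w => (orb s n w).2) z.
Proof. by have [] := holo_orb s n z. Qed.

Lemma dif2_tau s z n w : dif2 (fun w => tau s z w n) w.
Proof.
apply: dif2M; last exact: dif2_cst.
apply: dif2M; first exact: dif2_cst.
by apply: dif2B; [exact: dif2_orb1|exact: dif2_cst].
Qed.

(** A closed form of membership in the leaf with coordinate [sig]: bounds with explicit constants at
    all times, stable under limits of approximate points. *)
Definition leaf_at s z sig (kap : R) w :=
  (forall n, nm ((orb s n w).2 - (orb s n z).2) <= leafB kap) /\
  (forall n, nm (tau s z w n - sig) <= 2 * deepq (leafB kap) z / 4 ^+ n * nm sig).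

Section DeepLeaf.
Variables (s : nat -> henon_data R) (z : C2 R) (kap : R).
Hypotheses (hs : adm K s) (kap1 : 1 <= kap) (hV : Vplus z).
Hypothesis hd : deepc (leafB kap) <= nm z.2.

Lemma leafB_ge1 : 1 <= leafB kap.
Proof.
have k1 := K1; have kk := kap1; have k2 : 1 <= K ^+ 2 by apply: exprn_ege1.
rewrite /leafB -[leLHS]mulr1; apply: ler_pM => //; lra.
Qed.

Lemma leaf_atP sig w : leaf_at s z sig kap w -> leaf s z w /\ tau_lim s z w sig.
Proof.
move=> [h1 h2]; have B1 := leafB_ge1; have B0 : 0 <= leafB kap by lra.
have [q0 _] := andP (deepq01 K1 B0 hd); split; last exact: (chain_tau_lim q0 h2).
exists 0%N, (leafB kap) => n _; split=> //.
by have := @orb_Vplus R K K1 s 0 n z hs hV.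
Qed.

Lemma leaf_at_uniq sig w w' : leaf_at s z sig kap w -> leaf_at s z sig kap w' -> w = w'.
Proof.
move=> /leaf_atP[h1 h2] /leaf_atP[h3 h4]; exact: (leaf_uniq K1 hs h1 h3 h2 h4).
Qed.

Lemma leaf_approx_bound sig N : nm sig <= kap * nm z.2 ^+ 2 ->
  n2 (leaf_approx s z sig N) <= n2 z + leafB kap + 2 * kap * nm z.2.
Proof.
move=> hsig; have [h1 h2 _] := leaf_approxP K1 hs kap1 hV hd hsig (leq0n N).
have B0 : 0 <= leafB kap by have := leafB_ge1; lra.
have [q0 q1] := andP (deepq01 K1 B0 hd); have kk := kap1.
have y0 : 0 < nm z.2 := lt_le_trans (rad_gt0 K1) hV.1.
have yn : z.2 != 0 by rewrite -nm_gt0.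
have hx : nm ((leaf_approx s z sig N).1 - z.1) <= 2 * kap * nm z.2.
  have t2 : nm (tau s z (leaf_approx s z sig N) 0) <= 2 * nm sig.
    have := nm_sub_ge (tau s z (leaf_approx s z sig N) 0) sig.
    have : 2 * deepq (leafB kap) z / 4 ^+ 0 * nm sig <= 1 * nm sig.
      by rewrite ler_wpM2r ?nm_ge0 // divr1; move: q1; lra.
    by move: h1; lra.
  move: t2; rewrite /tau /= mul1r nmM -ler_pdivlMr // => t2; apply: le_trans t2 _.
  rewrite ler_pdivrMr //; have -> : 2 * kap * nm z.2 * nm z.2 = 2 * (kap * nm z.2 ^+ 2) by ring.
  by rewrite ler_pM2l.
have kz : 0 <= 2 * kap * nm z.2 by rewrite mulr_ge0 ?nm_ge0 //; lra.
apply: le_trans (n2_dist2 _ z) _; rewrite -addrA lerD2l dist2_le; apply/andP; split.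
  by move: hx B0; lra.
by move: h2 kz; rewrite /=; lra.
Qed.

Lemma leaf_cluster sig (phi : nat -> nat) w : nm sig <= kap * nm z.2 ^+ 2 ->
  (forall k, (k <= phi k)%N) ->
  (forall e N, 0 < e -> exists2 n, (N <= n)%N & dist2 (leaf_approx s z sig (phi n)) w < e) ->
  leaf_at s z sig kap w.
Proof.
move=> hsig hphi hw; split => n.
- apply: (@cluster_le (fun v => (orb s n v).2) _ w (orb s n z).2 _ n _ hw).
    exact: dif2_cont (dif2_orb2 _ _ _).
  move=> k nk; have [] := leaf_approxP K1 hs kap1 hV hd hsig (leq_trans nk (hphi k)) => //.
- apply: (@cluster_le (fun v => tau s z v n) _ w sig _ n _ hw).
    exact: dif2_cont (dif2_tau _ _ _ _).
  by move=> k nk; have [] := leaf_approxP K1 hs kap1 hV hd hsig (leq_trans nk (hphi k)).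
Qed.

Lemma leaf_at_exists sig : nm sig <= kap * nm z.2 ^+ 2 -> exists w, leaf_at s z sig kap w.
Proof.
move=> hsig; have [w hw] := cluster_seq2 (fun n => leaf_approx_bound n hsig).
by exists w; apply: (@leaf_cluster sig id).
Qed.

(** Every cluster point satisfies [leaf_at], which determines it, so the whole bounded sequence
    converges; [vitali] then makes the limit holomorphic in [sig]. *)
Lemma leaf_approx_cvg sig w (e : R) : nm sig <= kap * nm z.2 ^+ 2 -> leaf_at s z sig kap w ->
  0 < e -> exists N, forall n, (N <= n)%N -> dist2 (leaf_approx s z sig n) w <= e.
Proof.
move=> hsig hw e0; apply: contrapT => hno.
have bad N : exists n, (N <= n)%N /\ e < dist2 (leaf_approx s z sig n) w.
  apply: contrapT => h; apply: hno; exists N => n Nn; rewrite leNgt; apply/negP => hlt.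
  by apply: h; exists n.
have [phi hphi] := choice bad.
have [w' hw'] := cluster_seq2 (fun n => leaf_approx_bound (phi n) hsig).
have hphi' k : (k <= phi k)%N by have [] := hphi k.
have := leaf_at_uniq (leaf_cluster hsig hphi' hw') hw => E.
by have [n _] := hw' e 0%N e0; rewrite E; have [_] := hphi n; lra.
Qed.

Lemma leaf_param : exists Phi : C -> C2 R,
  forall sig, (nm sig <= kap * nm z.2 ^+ 2 -> leaf_at s z sig kap (Phi sig)) /\
    (nm sig < kap * nm z.2 ^+ 2 -> hcurve Phi sig).
Proof.
pose Phi sig := xget z [set w | leaf_at s z sig kap w].
have hPhi sig : nm sig <= kap * nm z.2 ^+ 2 -> leaf_at s z sig kap (Phi sig).
  by move=> h; apply: (@xgetPex _ z [set w | leaf_at s z sig kap w]); exact: leaf_at_exists.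
exists Phi => sig; split; first exact: hPhi.
move=> hlt; set M := n2 z + leafB kap + 2 * kap * nm z.2.
set rho := kap * nm z.2 ^+ 2 - nm sig; have rho0 : 0 < rho by rewrite subr_gt0.
have inn t : nm (t - sig) <= rho -> nm t <= kap * nm z.2 ^+ 2.
  move=> h; have -> : t = (t - sig) + sig by ring.
  by apply: le_trans (nmD _ _) _; rewrite -lerBrDr.
have hc n t : hcurve (fun v => leaf_approx s z v n) t.
  apply: (@hcurve_comp R (orbV s n) (fun v => ((orb s n z).1 + v / (Afac s n * (orb s n z).2), (orb s n z).2))).
    split; last exact: cdif_cst.
    apply: cdifD; first exact: cdif_cst.
    by apply: cdifM; [exact: cdif_id|exact: cdif_cst].
  exact: holo_orbV.
have hlim t (e : R) : nm (t - sig) <= rho -> 0 < e ->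
    exists N, forall n, (N <= n)%N -> dist2 (leaf_approx s z t n) (Phi t) <= e.
  by move=> /inn ht e0; apply: leaf_approx_cvg => //; exact: hPhi.
split.
- apply: (@vitali R (fun n t => (leaf_approx s z t n).1) _ sig rho M rho0).
  + by move=> n t _; have [] := hc n t.
  + move=> n t /inn ht; apply: le_trans (n2_1 _) _; exact: leaf_approx_bound.
  + move=> t ht e e0; have [N hN] := hlim t e ht e0; exists N => n /hN.
    by apply: le_trans; exact: dist2_1.
- apply: (@vitali R (fun n t => (leaf_approx s z t n).2) _ sig rho M rho0).
  + by move=> n t _; have [] := hc n t.
  + move=> n t /inn ht; apply: le_trans (n2_2 _) _; exact: leaf_approx_bound.
  + move=> t ht e e0; have [N hN] := hlim t e ht e0; exists N => n /hN.
    by apply: le_trans; exact: dist2_2.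
Qed.

End DeepLeaf.

(** At time k the parametrisation covers coordinates up to |y_k|^2, that is up to |A_k| |y_k|^2 in
    the coordinate of time 0; this radius exceeds any given one. *)
Lemma deep_level s z (B rho : R) : adm K s -> 0 < green s z -> exists k,
  [/\ Vplus (orb s k z), B <= nm (orb s k z).2 & rho <= nm (Afac s k) * nm (orb s k z).2 ^+ 2].
Proof.
move=> hs g0; have [k0 hk0] := green_pos_V K1 hs g0.
have k1 := K1; have k00 := K_gt0 K1.
set z0 := orb s k0 z in hk0; set s0 := sshift s k0; have hs0 : adm K s0 by exact: adm_shift.
have K2 : K ^+ 2 <= nm z0.2.
  apply: le_trans hk0.1; have := rad_ge K1 (n := 2) isT; have := sqr_ge0 K; lra.
have r0 := rad_gt0 K1; have y0 : 0 < nm z0.2 := lt_le_trans r0 hk0.1.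
pose m := nm (Afac s k0) * (nm z0.2 ^+ 2 / K ^+ 2).
have a0 : 0 < nm (Afac s k0) by rewrite nm_gt0; exact: (Afac_neq0 K1 _ hs).
have m0 : 0 < m by rewrite mulr_gt0 // divr_gt0 // exprn_gt0.
have [j hj] := half_pow_small (`|B| + 2 * `|rho| / m) y0.
have big : `|B| + 2 * `|rho| / m <= nm (orb s (k0 + j.+1) z).2.
  have := Vplus_growth K1 j.+1 hs0 hk0; rewrite -orb_shift -/z0; apply: le_trans.
  move: hj; rewrite ltr_pdivrMr ?exprn_gt0 // => /ltW h; apply: le_trans h _; rewrite mulrC.
  rewrite ler_pM2r //; apply: le_trans (_ : 4 ^+ j <= _); first by apply: lerXn2r; rewrite ?nnegrE; lra.
  by apply: ler_weXn2l => //; lra.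
have p1 : 0 <= 2 * `|rho| / m by apply: divr_ge0; [exact: mulr_ge0|exact: ltW].
exists (k0 + j.+1)%N; split.
- rewrite orb_shift; have := @orb_Vplus R K K1 s0 0 j.+1 z0 hs0 hk0; exact.
- by apply: le_trans big; have := ler_norm B; lra.
have := Afac_growth K1 j hs0 hk0 K2; rewrite -orb_shift => ag.
rewrite Afac_shift nmM.
set Y := nm (orb s (k0 + j.+1) z).2 in big ag *; set a := nm (Afac s0 j.+1) in ag *.
have Y0 : 0 <= Y by exact: nm_ge0.
have mY : m <= 2 * (nm (Afac s k0) * a * Y).
  have -> : 2 * (nm (Afac s k0) * a * Y) = nm (Afac s k0) * (2 * a * Y) by ring.
  by rewrite /m ler_pM2l.
have bY : 2 * `|rho| / m <= Y by apply: le_trans big; have := normr_ge0 B; lra.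
apply: le_trans (ler_norm rho) _.
have -> : nm (Afac s k0) * a * Y ^+ 2 = (nm (Afac s k0) * a * Y) * Y by ring.
have -> : `|rho| = m / 2 * (2 * `|rho| / m) by field; rewrite gt_eqF.
apply: ler_pM => //; first by rewrite divr_ge0 // ltW.
by move: mY; clear; lra.
Qed.

(** The parametrisations of larger and larger discs agree by [leaf_uniq], so a pointwise choice is
    already holomorphic. *)
Lemma leaf_family s z : adm K s -> 0 < green s z -> exists Phi : C -> C2 R,
  forall sig, [/\ leaf s z (Phi sig), tau_lim s z (Phi sig) sig & hcurve Phi sig].
Proof.
move=> hs g0.
have loc (rho : R) : exists Phi : C -> C2 R, forall sig, nm sig < rho ->
    [/\ leaf s z (Phi sig), tau_lim s z (Phi sig) sig & hcurve Phi sig].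
  have [k [hV hd hr]] := deep_level (deepc (leafB 1)) rho hs g0.
  have hs' : adm K (sshift s k) by exact: adm_shift.
  have a0 := Afac_neq0 K1 k hs; have a0' : 0 < nm (Afac s k) by rewrite nm_gt0.
  have jacs i : (s i).2 != 0 by exact: (tame_jac K1 (hs i)).
  have [Phi hPhi] := leaf_param hs' (lexx 1) hV hd.
  exists (fun sig => orbV s k (Phi (sig / Afac s k))) => sig hsig.
  have lt : nm (sig / Afac s k) < 1 * nm (orb s k z).2 ^+ 2.
    by rewrite nmf_div ltr_pdivrMr // mul1r mulrC; apply: lt_le_trans hr.
  have [hP hc] := hPhi (sig / Afac s k).
  have [hl ht] := leaf_atP hs' (lexx 1) hV hd (hP (ltW lt)).
  split.
  - by apply: (@leaf_unshift R K s k); rewrite orbitVK.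
  - have := @tau_lim_shift R K K1 s k z (orbV s k (Phi (sig / Afac s k))) (sig / Afac s k) hs.
    by rewrite orbitVK // [Afac s k * _]mulrC divfK //; apply.
  - apply: (@hcurve_comp R (orbV s k) (fun t => Phi (t / Afac s k))); last exact: holo_orbV.
    have [h1 h2] := hc lt.
    have hid : cdif (fun t : C => t / Afac s k) sig by apply: cdifM; [exact: cdif_id|exact: cdif_cst].
    by split; [exact: (cdif_comp hid h1)|exact: (cdif_comp hid h2)].
have ex sig : exists w, leaf s z w /\ tau_lim s z w sig.
  have [Phi hPhi] := loc (nm sig + 1); have [|h1 h2 _] := hPhi sig; last by exists (Phi sig).
  by rewrite ltrDl.
have [Phi hPhi] := choice ex; exists Phi => sig; have [h1 h2] := hPhi sig; split=> //.
have [Psi hPsi] := loc (nm sig + 1).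
have E (t : C) : nm (t - sig) < 1 -> Psi t = Phi t.
  move=> ht; have [|h3 h4 _] := hPsi t.
    have -> : t = sig + (t - sig) by ring.
    by apply: le_lt_trans (nmD _ _) _; rewrite ltrD2l.
  by have [h5 h6] := hPhi t; exact: (leaf_uniq K1 hs h3 h5 h4 h6).
have [|_ _ [c1 c2]] := hPsi sig; first by rewrite ltrDl.
split; [apply: (cdif_near (@ltr01 R) _ c1)|apply: (cdif_near (@ltr01 R) _ c2)] => w /E -> //.
Qed.

End LeafFamilies.

(** * Automorphisms act linearly on leaf coordinates *)

Section LeafImages.
Variable R : realType.
Local Notation C := R[i].
Variable K : R.
Hypothesis K1 : 1 <= K.
Local Notation Vplus := (Vplus K).
Local Notation green := (green K).
Local Notation leaf := (leaf K).
Local Notation deepc := (deepc K).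
Local Notation deepq := (deepq K).
Implicit Types (s : nat -> henon_data R) (z w p : C2 R) (h : henon_data R).

Lemma level_curve_from s (c : C -> C2 R) (rho : R) N : adm K s -> 0 < rho ->
  (forall t, nm t <= rho -> [/\ hcurve c t, green s (c t) = green s (c 0) & Vplus (orb s N (c t))]) ->
  forall n t, (N <= n)%N -> nm t <= rho / 2 ->
    nm ((orb s n (c t)).2 - (orb s n (c 0)).2) <= 288 * K ^+ 2 * (2 * nm t / rho).
Proof.
move=> hs rho0 hc n t Nn ht; rewrite -(subnKC Nn) !orb_shift.
apply: (@level_curve R K K1 (sshift s N) (fun t => orb s N (c t)) rho (adm_shift _ hs) rho0 _ _ t ht).
move=> u /hc [h1 h2 h3]; split=> //; first by apply: hcurve_comp h1 _; exact: holo_orb.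
by rewrite !(green_shift K1) // h2.
Qed.

Lemma leaf_tau_bound s z w B N T : adm K s -> 1 <= B -> Vplus (orb s N z) ->
  deepc B <= nm (orb s N z).2 ->
  (forall n, nm ((orb s (N + n) w).2 - (orb s (N + n) z).2) <= B) -> tau_lim s z w T ->
  forall n, (N <= n)%N -> nm (tau s z w n) <= 2 * nm T /\ nm T <= 2 * nm (tau s z w n).
Proof.
move=> hs B1 hV hd hB hT n Nn; have hs' := adm_shift N hs.
have [|T' hT' est] := leaf_deep_lim K1 hs' B1 hV hd (w := orb s N w).
  by move=> k; rewrite -!orb_shift.
have B0 : 0 <= B by lra.
have [q0 q1] := andP (deepq01 K1 B0 hd).
have TE := tau_lim_uniq (tau_lim_shift K1 hs hT') hT.
rewrite -(subnKC Nn) tau_shift -TE; set k := (n - N)%N.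
have := est k; set t := tau _ _ _ k; rewrite !(nmM (Afac s N)); set q := deepq B _ in q0 q1 *; set a := nm (Afac s N) => h.
have a0 : 0 <= a := nm_ge0 _.
have h2 : nm (t - T') <= 1 / 2 * nm T'.
  apply: le_trans h _; rewrite ler_wpM2r ?nm_ge0 // ler_pdivrMr ?exprn_gt0 //.
  have : (1 : R) <= 4 ^+ k by apply: exprn_ege1; lra.
  by move: q1; clear; lra.
have t1 := nm_sub_ge t T'; have t2 := nm_sub_ge T' t; rewrite nm_distC in t2.
have s1 : a * nm t <= a * (2 * nm T') by rewrite ler_wpM2l //; have := nm_ge0 T'; lra.
have s2 : a * nm T' <= a * (2 * nm t) by rewrite ler_wpM2l //; lra.
by rewrite !(mulrCA 2); split.
Qed.

Lemma tau_le s z w n (B : R) : nm ((orb s n w).2 - (orb s n z).2) <= B ->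
  nm (tau s z w n.+1) <= nm (Afac s n.+1) * nm (orb s n.+1 z).2 * B.
Proof.
move=> hB; rewrite /tau; set a := Afac s n.+1; set y := (orb s n.+1 z).2.
rewrite (nmM _ y) (nmM a) mulrAC; apply: ler_wpM2l; last by rewrite !orb1.
by apply: mulr_ge0; exact: nm_ge0.
Qed.

Definition preserves s (c : R) (f : C2 R -> C2 R) := forall z, green s z < c -> green s (f z) = green s z.

Section LeafAut.
Variables (s : nat -> henon_data R) (c : R) (f g : C2 R -> C2 R).
Hypotheses (hs : adm K s) (hfg : aut2 (fun w => green s w < c) f g) (pf : preserves s c f).

(** G is constant on the leaf and f preserves it, so the image of a disc of the leaf is a level
    curve, in [Vplus] from a common time on; [level_curve_from] bounds the displacement. The disc of
    twice the radius serves because that estimate concerns the half disc. *)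
Lemma leaf_image z (Phi : C -> C2 R) (rho : R) : 0 < green s z -> green s z < c -> 0 < rho ->
  (forall sig, leaf s z (Phi sig) /\ hcurve Phi sig) -> Phi 0 = z ->
  exists N, forall n t, (N <= n)%N -> nm t <= rho ->
    Vplus (orb s n (f (Phi t))) /\
    nm ((orb s n (f (Phi t))).2 - (orb s n (f z)).2) <= 288 * K ^+ 2.
Proof.
move=> g0 gc rho0 hPhi P0; have [hf _] := hfg.
have gP t : green s (Phi t) = green s z by exact: (leaf_green K1 hs (hPhi t).1).
have hc t : hcurve (fun u => f (Phi u)) t.
  by apply: hcurve_comp; [exact: (hPhi t).2|have [] := hf (Phi t); rewrite ?gP].
have rho2 : 0 < 2 * rho by rewrite mulr_gt0.
have [||N hN] := @V_uniform R K K1 s (fun w => n2 w <= 2 * rho) (fun w => f (Phi w.1)) (2 * rho) hs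
   (@closed2_ball R (2 * rho)) (fun _ => id).
- by move=> w _; apply: (@holo_fst R (fun u => f (Phi u))); exact: hc.
- by move=> w _; rewrite pf gP.
have hV n t : (N <= n)%N -> nm t <= 2 * rho -> Vplus (orb s n (f (Phi t))).
  by move=> Nn ht; apply: (hN n (t, 0)) => //; rewrite n2_le /= ht nm0 ltW.
exists N => n t Nn ht; split; first by apply: hV => //; lra.
have ht2 : nm t <= 2 * rho / 2 by lra.
have := @level_curve_from s (fun u => f (Phi u)) (2 * rho) N hs rho2 _ n t Nn ht2.
rewrite P0 => H; apply: le_trans (H _) _.
  by move=> u hu; split; [exact: hc|rewrite !pf ?gP|exact: hV].
apply: ler_piMr; first by apply: mulr_ge0; [exact: ler0n|exact: sqr_ge0].
by rewrite ler_pdivrMr // mul1r ler_pM2l.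
Qed.

Lemma leaf_aut z w : 0 < green s z -> green s z < c -> leaf s z w -> leaf s (f z) (f w).
Proof.
move=> g0 gc hl; have [Phi hPhi] := leaf_family K1 hs g0.
have [T hT] := leaf_tau_lim K1 hs hl.
have P0 : Phi 0 = z.
  have [h1 h2 _] := hPhi 0; have := leaf_T0 K1 hs h1 h2; by move=> ->.
have PT : Phi T = w by have [h1 h2 _] := hPhi T; exact: (leaf_uniq K1 hs h1 hl h2 hT).
have T1 : 0 < nm T + 1 by have := nm_ge0 T; lra.
have [|N hN] := leaf_image g0 gc T1 _ P0; first by move=> sig; have [] := hPhi sig.
exists N, (288 * K ^+ 2) => n Nn; rewrite -PT.
have [_ h2] := hN n T Nn (ltac:(lra)).
have [h1 _] := hN n 0 Nn (ltac:(rewrite nm0; lra)).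
by rewrite P0 in h1.
Qed.

(** The coordinates at finite times are holomorphic in the parameter; by [leaf_tau_bound] they are
    controlled by their value at one fixed time, so [vitali] applies. *)
Lemma leaf_coord_entire z (Phi : C -> C2 R) (h : C -> C) : 0 < green s z -> green s z < c ->
  (forall sig, leaf s z (Phi sig) /\ hcurve Phi sig) -> Phi 0 = z ->
  (forall sig, tau_lim s (f z) (f (Phi sig)) (h sig)) -> forall sig, cdif h sig.
Proof.
move=> g0 gc hPhi P0 hh sig; have [hf _] := hfg.
have k1 := K1; have k2 : 1 <= K ^+ 2 by apply: exprn_ege1.
have rho0 : 0 < nm sig + 1 by have := nm_ge0 sig; lra.
have [N hN] := leaf_image g0 gc rho0 hPhi P0.
set B := 288 * K ^+ 2 in hN; have B1 : 1 <= B by rewrite /B; lra.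
have gP t : green s (Phi t) = green s z by exact: (leaf_green K1 hs (hPhi t).1).
have hV0 n : (N <= n)%N -> Vplus (orb s n (f z)).
  by move=> Nn; have [] := hN n 0 Nn (ltac:(rewrite nm0; lra)); rewrite P0.
have r0 := rad_gt0 K1.
have [k hk] := half_pow_small (deepc B) r0.
set M := (N + k).+1; have NM : (N <= M)%N by rewrite /M -addnS leq_addr.
have hd : deepc B <= nm (orb s M (f z)).2.
  have NM' : (N + k <= M)%N by rewrite /M.
  have := Vplus_growth K1 (M - N) (adm_shift N hs) (hV0 N (leqnn N)); rewrite -orb_shift subnKC //; apply: le_trans.
  move: hk; rewrite ltr_pdivrMr ?exprn_gt0 // => /ltW h0; apply: le_trans h0 _; rewrite mulrC.
  apply: ler_pM; rewrite ?exprn_ge0 ?(ltW r0) //; last exact: (hV0 N (leqnn N)).1.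
  apply: le_trans (_ : 4 ^+ k <= _); first by apply: lerXn2r; rewrite ?nnegrE; lra.
  by apply: ler_weXn2l; [lra|rewrite leq_subRL].
have inn t : nm (t - sig) <= 1 -> nm t <= nm sig + 1.
  move=> ht; have -> : t = sig + (t - sig) by ring.
  by apply: le_trans (nmD _ _) _; rewrite lerD2l.
pose Q := 4 * (nm (Afac s M) * nm (orb s M (f z)).2 * B).
apply: (@vitali R (fun n t => tau s (f z) (f (Phi t)) (M + n)) h sig 1 Q (@ltr01 R)).
- move=> n t _.
  have hc : hcurve (fun u => f (Phi u)) t.
    by apply: hcurve_comp; [exact: (hPhi t).2|have [] := hf (Phi t); rewrite ?gP].
  exact: (dif2_curve (F := fun w => tau s (f z) w (M + n)) hc (dif2_tau _ _ _ _)).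
- move=> n t /inn ht.
  have dB m : (N <= m)%N -> nm ((orb s m (f (Phi t))).2 - (orb s m (f z)).2) <= B.
    by move=> Nm; have [] := hN m t Nm ht.
  have bd := @leaf_tau_bound s (f z) (f (Phi t)) B M (h t) hs B1 (hV0 M NM) hd
    (fun i => dB (M + i)%N (leq_trans NM (leq_addr _ _))) (hh t).
  have [b1 _] := bd (M + n)%N (leq_addr _ _); have [_ b2] := bd M (leqnn M).
  have : nm (tau s (f z) (f (Phi t)) M) <= nm (Afac s M) * nm (orb s M (f z)).2 * B.
    by apply: tau_le; apply: dB; exact: leq_addr.
  by rewrite /Q; move: b1 b2; clear; lra.
- move=> t _ e e0; have [N' hN'] := hh t e e0; exists N' => n hn.
  by apply: hN'; apply: leq_trans hn _; exact: leq_addl.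
Qed.

End LeafAut.

Lemma leaf_aut_linear s c f g z : adm K s -> aut2 (fun w => green s w < c) f g ->
  preserves s c f -> preserves s c g -> 0 < green s z -> green s z < c ->
  exists b, forall w T, leaf s z w -> tau_lim s z w T -> tau_lim s (f z) (f w) (b * T).
Proof.
move=> hs hfg pf pg g0 gc; have hgf := aut2_sym hfg; have [hf hg] := hfg.
have [_ fzc gfz] := hf z gc; have fz := pf z gc.
have f0 : 0 < green s (f z) by rewrite fz.
have [Phi hPhi] := leaf_family K1 hs g0; have [Psi hPsi] := leaf_family K1 hs f0.
have P0 : Phi 0 = z by have [h1 h2 _] := hPhi 0; have := leaf_T0 K1 hs h1 h2; by move=> ->.
have Q0 : Psi 0 = f z by have [h1 h2 _] := hPsi 0; have := leaf_T0 K1 hs h1 h2; by move=> ->.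
have lf t : leaf s (f z) (f (Phi t)) by apply: (leaf_aut hs hfg pf) => //; have [] := hPhi t.
have lg t : leaf s z (g (Psi t)).
  by rewrite -gfz; apply: (leaf_aut hs hgf pg) => //; have [] := hPsi t.
have [h hh] := choice (fun t => leaf_tau_lim K1 hs (lf t)).
have [k hk] := choice (fun t => leaf_tau_lim K1 hs (lg t)).
have gP t : green s (Phi t) < c by have [h1 _ _] := hPhi t; rewrite (leaf_green K1 hs h1).
have gQ t : green s (Psi t) < c by have [h1 _ _] := hPsi t; rewrite (leaf_green K1 hs h1) fz.
have hE w T : leaf s z w -> tau_lim s z w T -> Phi T = w.
  by move=> h1 h2; have [h3 h4 _] := hPhi T; exact: (leaf_uniq K1 hs h3 h1 h4 h2).
have kE w T : leaf s (f z) w -> tau_lim s (f z) w T -> Psi T = w.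
  by move=> h1 h2; have [h3 h4 _] := hPsi T; exact: (leaf_uniq K1 hs h3 h1 h4 h2).
have hk1 : cancel h k.
  move=> t; have E := kE _ _ (lf t) (hh t).
  have [_ _ E2] := hf _ (gP t); have := hk (h t); rewrite E E2.
  by have [_ h2 _] := hPhi t => h3; exact: tau_lim_uniq h3 h2.
have kh1 : cancel k h.
  move=> t; have E := hE _ _ (lg t) (hk t).
  have [_ _ E2] := hg _ (gQ t); have := hh (k t); rewrite E E2.
  by have [_ h2 _] := hPsi t => h3; exact: tau_lim_uniq h3 h2.
have hent t : cdif h t.
  apply: (leaf_coord_entire hs hfg pf g0 gc _ P0 hh) => sig; by have [] := hPhi sig.
have kent t : cdif k t.
  have hP' sig : leaf s (f z) (Psi sig) /\ hcurve Psi sig by have [] := hPsi sig.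
  apply: (leaf_coord_entire hs hgf pg f0 fzc hP' Q0 (h := k)) => sig.
  by rewrite gfz.
have h00 : h 0 = 0.
  have := hh 0; rewrite P0 => h1; apply: (tau_lim_uniq h1) => e e0; exists 0%N => n _.
  by rewrite /tau subrr mulr0 mul0r subrr nm0 ltW.
(* In leaf coordinates f and g are mutually inverse entire functions fixing 0. *)
have lin := entire_bijection_linear hent kent hk1 kh1 h00.
exists (h 1) => w T hl hT; rewrite -lin -(hE w T hl hT); exact: hh.
Qed.

End LeafImages.

(** * Uniform bounds and motion along a leaf *)

Section LeafUniform.
Variable R : realType.
Local Notation C := R[i].
Variable K : R.
Hypothesis K1 : 1 <= K.
Local Notation err := (esc_err K).
Local Notation Vplus := (Vplus K).
Local Notation green := (green K).
Local Notation leaf := (leaf K).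
Local Notation deepc := (deepc K).
Local Notation deepq := (deepq K).
Local Notation leafB := (leafB K).
Implicit Types (s : nat -> henon_data R) (z w p : C2 R) (h : henon_data R).

Lemma closed2_green s (r a b : R) : adm K s ->
  closed2 (fun z => [/\ n2 z <= r, a <= green s z & green s z <= b]).
Proof.
move=> hs z hz; split.
- by apply: (@closed2_ball R r) => e e0; have [w [hw _ _] hd] := hz e e0; exists w.
- apply/ler_addgt0Pr => e e0; have [d d0 hd] := green_cont K1 z hs e0.
  have [w [_ hw _] /hd] := hz d d0; rewrite ltr_norml; lra.
- apply/ler_addgt0Pr => e e0; have [d d0 hd] := green_cont K1 z hs e0.
  have [w [_ _ hw] /hd] := hz d d0; rewrite ltr_norml; lra.
Qed.

Lemma leaf_at_bound s z sig kap w : adm K s -> 1 <= kap -> Vplus z -> deepc (leafB kap) <= nm z.2 ->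
  leaf_at K s z sig kap w -> nm (w.1 - z.1) <= 2 * nm sig / nm z.2 /\ nm (w.2 - z.2) <= leafB kap.
Proof.
move=> hs kap1 hV hd [h1 h2]; split; last exact: (h1 0%N).
have B1 := leafB_ge1 K1 kap1; have B0 : 0 <= leafB kap by lra.
have [q0 q1] := andP (deepq01 K1 B0 hd).
have y0 : 0 < nm z.2 := lt_le_trans (rad_gt0 K1) hV.1.
have := h2 0%N; rewrite divr1 /tau /= mul1r; set v := (w.1 - z.1) => h.
rewrite ler_pdivlMr // -nmM; have := nm_sub_ge (v * z.2) sig.
have : 2 * deepq (leafB kap) z * nm sig <= 1 * nm sig.
  by rewrite ler_wpM2r ?nm_ge0 //; move: q1; set q := deepq _ _; clear; lra.
by move: h; clear; lra.
Qed.

Lemma deep_uniform s (P : C2 R -> Prop) (F : C2 R -> C2 R) N (B : R) : adm K s ->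
  (forall n z, (N <= n)%N -> P z -> Vplus (orb s n (F z))) ->
  exists M, (N < M)%N /\ forall n z, (M <= n)%N -> P z -> B <= nm (orb s n (F z)).2.
Proof.
move=> hs hV; have r0 := rad_gt0 K1; have [k hk] := half_pow_small B r0.
exists (N + k).+1; split; first by rewrite ltnS leq_addr.
move=> n z hn Pz; have nN : (N <= n)%N by apply: leq_trans hn; rewrite -addnS leq_addr.
have := Vplus_growth K1 (n - N) (adm_shift N hs) (hV N z (leqnn N) Pz).
rewrite -orb_shift subnKC //; apply: le_trans.
move: hk; rewrite ltr_pdivrMr ?exprn_gt0 // => /ltW h; apply: le_trans h _; rewrite mulrC.
apply: ler_pM; rewrite ?exprn_ge0 ?(ltW r0) //; last exact: (hV N z (leqnn N) Pz).1.
apply: le_trans (_ : 4 ^+ k <= _); first by apply: lerXn2r; rewrite ?nnegrE; lra.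
by apply: ler_weXn2l; [lra|rewrite leq_subRL // ltnW].
Qed.

(* Compactness bounds the slope of the affine map that f induces between leaves. *)
Lemma leaf_aut_uniform s c f g (r a b : R) : adm K s -> aut2 (fun w => green s w < c) f g ->
  preserves K s c f -> preserves K s c g -> 0 < a -> b < c ->
  exists2 Bd, 0 <= Bd & forall z, Vplus z -> deepc (leafB 1) <= nm z.2 -> n2 z <= r ->
    a <= green s z -> green s z <= b -> forall w T, leaf s z w -> tau_lim s z w T ->
    exists2 T', tau_lim s (f z) (f w) T' & nm T' <= Bd * nm T.
Proof.
move=> hs hfg pf pg a0 bc; have [hf _] := hfg.
have k1 := K1; have k2 : 1 <= K ^+ 2 by apply: exprn_ege1.
(* Radius containing the part |sig| <= 2 of every leaf involved, by [leaf_at_bound]. *)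
pose r' := r + 4 + leafB 1.
pose A z := [/\ n2 z <= r', a <= green s z & green s z <= b].
have [|||N hN] := @V_uniform R K K1 s A f r' hs (closed2_green hs).
- by move=> z [].
- by move=> z [_ _ h]; have [] := hf z (le_lt_trans h bc).
- by move=> z [_ h h']; rewrite pf ?(le_lt_trans h' bc) //; lra.
set B := 288 * K ^+ 2; have B1 : 1 <= B by rewrite /B; lra.
have [M [NM hM]] := deep_uniform (deepc B) hs hN.
exists (2 * (nm (Afac s M) * expR (Deg s M * c + err) * B)).
  have B0 : 0 <= B := le_trans ler01 B1.
  apply: mulr_ge0 => //; apply: mulr_ge0 B0; apply: mulr_ge0; [exact: nm_ge0|exact: expR_ge0].
move=> z hV hd hr ga gb w T hl hT.
have gz0 : 0 < green s z by lra.
have gzc : green s z < c by lra.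
have [bb hb] := leaf_aut_linear K1 hs hfg pf pg gz0 gzc.
exists (bb * T); first exact: hb.
rewrite nmM; apply: ler_wpM2r; first exact: nm_ge0.
have [Phi hPhi] := leaf_param K1 hs (lexx 1) hV hd.
have y100 : 100 <= nm z.2 by apply: le_trans hV.1; exact: rad_ge100.
have ysq : 2 < 1 * nm z.2 ^+ 2.
  by rewrite mul1r expr2; apply: lt_le_trans (_ : 100 * 100 <= _); [lra|apply: ler_pM; lra].
have hat t : nm t <= 2 -> leaf_at K s z t 1 (Phi t).
  by move=> ht; have [h _] := hPhi t; apply: h; apply: ltW; exact: le_lt_trans ysq.
have hlf t : nm t <= 2 -> leaf s z (Phi t) /\ tau_lim s z (Phi t) t.
  by move=> ht; apply: (leaf_atP K1 hs (lexx 1) hV hd); exact: hat.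
have gP t : nm t <= 2 -> green s (Phi t) = green s z.
  by move=> /hlf[h _]; exact: (leaf_green K1 hs h).
have PA t : nm t <= 2 -> A (Phi t).
  move=> ht; rewrite /A gP //; split=> //.
  have [h1 h2] := leaf_at_bound hs (lexx 1) hV hd (hat t ht).
  apply: le_trans (n2_dist2 _ z) _; rewrite /r' -addrA lerD //.
  have B10 : 0 <= leafB 1 by have := leafB_ge1 K1 (lexx 1); lra.
  rewrite dist2_le; apply/andP; split; last by apply: le_trans h2 _; lra.
  apply: le_trans h1 _; apply: le_trans (_ : 4 <= _); last by lra.
  by rewrite ler_pdivrMr; lra.
have n02 : nm (0 : C) <= 2 by rewrite nm0.
have n12 : nm (1 : C) <= 2 by rewrite nm1; lra.
have P0 : Phi 0 = z by have [h1 h2] := hlf 0 n02; have := leaf_T0 K1 hs h1 h2; by move=> ->.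
have hc t : nm t <= 2 -> [/\ hcurve (fun u => f (Phi u)) t,
    green s (f (Phi t)) = green s (f (Phi 0)) & Vplus (orb s N (f (Phi t)))].
  move=> ht; split; last exact: hN (leqnn N) (PA t ht).
    apply: hcurve_comp; last by have [] := hf (Phi t); rewrite ?gP.
    by have [_ h] := hPhi t; apply: h; exact: le_lt_trans ysq.
  by rewrite !pf ?gP.
have two0 : (0 : R) < 2 by [].
have dB n : (N <= n)%N -> nm ((orb s n (f (Phi 1))).2 - (orb s n (f z)).2) <= B.
  move=> Nn; have n1 : nm (1 : C) <= 2 / 2 by rewrite nm1 divff.
  have := level_curve_from K1 hs two0 hc Nn n1.
  by rewrite P0 nm1 mulr1 divff // mulr1.
have [h1 h2] := hlf 1 n12.
have t1 := hb _ _ h1 h2; rewrite mulr1 in t1.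
have Az : A z by rewrite -P0; exact: PA.
have hVM : Vplus (orb s M (f z)) by exact: hN (ltnW NM) Az.
have [_ b2] := leaf_tau_bound K1 hs B1 hVM (hM M z (leqnn M) Az)
  (fun i => dB (M + i)%N (leq_trans (ltnW NM) (leq_addr _ _))) t1 (leqnn M).
apply: le_trans b2 _; rewrite ler_pM2l //.
have [M' ME] : exists M', M = M'.+1 by case: (M) NM => // M' _; exists M'.
have MN' : (N <= M')%N by rewrite -ltnS -ME.
have := tau_le (dB M' MN'); rewrite -ME => h; apply: le_trans h _.
apply: ler_wpM2r; first by lra.
rewrite ler_wpM2l ?nm_ge0 //; apply: le_trans (n2_2 _) _; apply: le_trans (n2_le_exp K1 _) _.
rewrite ler_expR; have := green_lb K1 hs (Vplus_W hVM).
have : Deg s M * green s (f z) <= Deg s M * c.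
  by rewrite ler_pM2l ?(Deg_gt0 M hs) // pf // ltW.
by clear; lra.
Qed.

Lemma leaf_refl s z w : leaf s z w -> leaf s z z.
Proof.
move=> [N [B hB]]; exists N, 0 => n Nn; have [h _] := hB n Nn.
by split=> //; rewrite subrr nm0.
Qed.

Lemma tau_lim_refl s z : tau_lim s z z 0.
Proof. by move=> e e0; exists 0%N => n _; rewrite /tau subrr mulr0 mul0r subrr nm0 ltW. Qed.

Lemma leaf_sym s z w T : adm K s -> leaf s z w -> tau_lim s z w T ->
  leaf s w z /\ tau_lim s w z (- T).
Proof.
move=> hs hl hT; rewrite -[- T]add0r.
exact: (leaf_sub K1 hs hl (leaf_refl hl) hT (@tau_lim_refl s z)).
Qed.

Lemma leaf_trans s z u w T T' : adm K s -> leaf s z u -> tau_lim s z u T ->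
  leaf s u w -> tau_lim s u w T' -> leaf s z w /\ tau_lim s z w (T + T').
Proof.
move=> hs h1 t1 h2 t2; have [h3 t3] := leaf_sym hs h1 t1.
by have := leaf_sub K1 hs h3 h2 t3 t2; rewrite opprK [T' + _]addrC.
Qed.

(* Solves for the first coordinate along the leaf: a point of minimal modulus
   would otherwise be improved by one Newton step. *)
Lemma leaf_move s z x' : adm K s -> Vplus z -> 4 * deepc (leafB 65) <= nm z.2 ->
  nm (x' - z.1) <= 2 * nm z.2 -> exists w, exists sig,
  [/\ w.1 = x', leaf s z w, tau_lim s z w sig, nm sig <= 4 * nm z.2 ^+ 2 &
      nm (w.2 - z.2) <= leafB 65].
Proof.
move=> hs hV hd4 hx.
have k65 : (1 : R) <= 65 by lra.
have B1 := leafB_ge1 K1 k65; have B0 : 0 <= leafB 65 by lra.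
have dc0 : 0 <= deepc (leafB 65).
  by apply: le_trans (deepc_ge K1 B0).1; rewrite !mulr_ge0 ?sqr_ge0 ?(ltW (K_gt0 K1)) //; lra.
have hd : deepc (leafB 65) <= nm z.2 by lra.
have y0 : 0 < nm z.2 := lt_le_trans (rad_gt0 K1) hV.1.
have yn : z.2 != 0 by rewrite -nm_gt0.
have [q0 _] := andP (deepq01 K1 B0 hd); set q := deepq (leafB 65) z in q0.
have q16 : q <= 1 / 16.
  rewrite /q /deepq ler_pdivrMr //; move: hd4; rewrite /deepc; clear; lra.
have [Phi hPhi] := leaf_param K1 hs k65 hV hd.
set Y := nm z.2 ^+ 2 in hPhi *; have Y0 : 0 < Y by rewrite exprn_gt0.
pose g (t : C) := ((Phi t).1 - z.1) * z.2 - t.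
have gb t : nm t <= 65 * Y -> nm (g t) <= 2 * q * nm t.
  move=> ht; have [_ h2] := (hPhi t).1 ht.
  by have := h2 0%N; rewrite divr1 /tau /= mul1r.
have gd t : nm t <= 64 * Y -> cdif g t.
  move=> ht; have [|c1 _] := (hPhi t).2; first by lra.
  apply: cdifB; last exact: cdif_id.
  by apply: cdifM; [apply: cdifB; [exact: c1|exact: cdif_cst]|exact: cdif_cst].
have Y64 : 0 < 64 * Y by rewrite mulr_gt0.
(* [g] is the deviation of the normalised first displacement from its limit. The radii leave room
   for each step: coordinates up to 65 Y, differentiability up to 64 Y, contraction on 16 Y, a
   minimum inside 8 Y. *)
have glip u v : nm u <= 16 * Y -> nm v <= 16 * Y -> nm (g u - g v) <= 1 / 2 * nm (u - v).
  move=> hu hv; have := @bounded_lip R g 0 (64 * Y) (8 * Y) Y64.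
  move=> H; have {H} := H _ _ u v; rewrite !subr0 => H; apply: le_trans (H _ _ _ _) _.
  - by move=> t; rewrite subr0; exact: gd.
  - move=> t; rewrite subr0 => ht; apply: le_trans (gb t _) _; first by lra.
    apply: le_trans (_ : 2 * q * (64 * Y) <= _); first by rewrite ler_wpM2l // mulr_ge0.
    have : q * Y <= 1 / 16 * Y by rewrite ler_wpM2r // ltW.
    by clear; lra.
  - by lra.
  - by lra.
  by rewrite (_ : 4 * (8 * Y) / (64 * Y) = 1 / 2) //; field; rewrite gt_eqF.
pose v t := (Phi t).1 - x'.
have vE t : v t * z.2 = g t + t - (x' - z.1) * z.2 by rewrite /v /g; ring.
have Y16 : 0 <= 16 * Y by rewrite mulr_ge0 // ltW.
have [|t0] := @disc_max R (fun t => - nm (v t)) 0 (16 * Y) Y16.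
  move=> t e; rewrite subr0 => ht e0; have [|c1 _] := (hPhi t).2; first by lra.
  have [d d0 hdd] := cdif_ccont c1 e0; exists d => // u /hdd h.
  have := nm_sub_ge (v t) (v u); have : v t - v u = - ((Phi u).1 - (Phi t).1) by rewrite /v; ring.
  by move=> ->; rewrite nmN; move: h; clear; lra.
rewrite subr0 => ht0 hmin.
have v00 : nm (v t0) <= 2 * nm z.2.
  have := hmin 0; rewrite subrr nm0 => /(_ Y16) h; apply: le_trans hx.
  have -> : x' - z.1 = - v 0.
    have := gb 0; rewrite nm0 mulr0 => /(_ (ltac:(lra))) h0; have /eqP := nm_le0 h0.
    rewrite /g subr0 mulf_eq0 (negbTE yn) orbF subr_eq0 => /eqP E; rewrite /v E; ring.
  by rewrite nmN; move: h; clear; lra.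
have t0b : nm t0 <= 8 * Y.
  have E : t0 = (v t0 + (x' - z.1)) * z.2 - g t0 by rewrite mulrDl vE; ring.
  have h1 : nm ((v t0 + (x' - z.1)) * z.2) <= 4 * Y.
    rewrite nmM /Y expr2 mulrA ler_wpM2r ?nm_ge0 //; apply: le_trans (nmD _ _) _; lra.
  have h2 := nmB ((v t0 + (x' - z.1)) * z.2) (g t0); rewrite -E in h2.
  have h3 := gb t0 (ltac:(lra)).
  have h4 : 2 * q * nm t0 <= 2 * (1 / 16) * nm t0 by rewrite ler_wpM2r ?nm_ge0 //; lra.
  by move: h1 h2 h3 h4 Y0; clear; lra.
have vz : v t0 = 0.
  apply: contrapT => /eqP; rewrite -nm_gt0 => vpos.
  (* Newton step with derivative 1 / z.2: the new value is (g t1 - g t0) / z.2, at most half of the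
     old one by [glip]. *)
  pose t1 := t0 - v t0 * z.2.
  have vy : nm (v t0 * z.2) <= 2 * Y.
    by rewrite nmM /Y expr2 mulrA ler_wpM2r ?nm_ge0.
  have t1b : nm t1 <= 16 * Y by apply: le_trans (nmB _ _) _; lra.
  have := hmin t1; rewrite subr0 => /(_ t1b); rewrite lerN2 leNgt => /negP; apply.
  have E : v t1 * z.2 = g t1 - g t0 by rewrite vE /t1 (vE t0); ring.
  have h5 := glip t1 t0 t1b (ltac:(lra)).
  have E2 : t1 - t0 = - (v t0 * z.2) by rewrite /t1; ring.
  rewrite E2 -E nmN !nmM mulrA ler_pM2r // in h5.
  by move: h5 vpos; clear; lra.
exists (Phi t0), t0; have h65 : nm t0 <= 65 * Y by lra.
have hat := (hPhi t0).1 h65; have [l1 l2] := leaf_atP K1 hs k65 hV hd hat.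
split=> //; first by move/eqP: vz; rewrite subr_eq0 => /eqP.
- have := vE t0; rewrite vz mul0r => /esym E.
  have E2 : t0 = (x' - z.1) * z.2 - g t0 by move/eqP: E; rewrite subr_eq0 => /eqP <-; ring.
  have h1 : nm ((x' - z.1) * z.2) <= 2 * Y by rewrite nmM /Y expr2 mulrA ler_wpM2r ?nm_ge0.
  have h2 := nmB ((x' - z.1) * z.2) (g t0); rewrite -E2 in h2.
  have h3 := gb t0 h65.
  have h4 : 2 * q * nm t0 <= 2 * (1 / 16) * nm t0 by rewrite ler_wpM2r ?nm_ge0 //; lra.
  by move: h1 h2 h3 h4; clear -Y0; lra.
- by have [] := leaf_at_bound hs k65 hV hd hat.
Qed.

End LeafUniform.

(** * Growth of the conjugates on polydiscs *)

Section AutGrowth.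
Variable R : realType.
Variable K : R.
Hypothesis K1 : 1 <= K.
Local Notation rad := (esc_rad K).
Local Notation err := (esc_err K).
Local Notation Lrad := (Lrad K).
Local Notation Wset := (Wset K).
Local Notation Vplus := (Vplus K).
Local Notation green := (green K).
Local Notation leaf := (leaf K).
Local Notation deepc := (deepc K).
Local Notation leafB := (leafB K).
Implicit Types (s : nat -> henon_data R) (z w p : C2 R) (h : henon_data R).

(** Exceeds the depth needed by [leaf_move], the first coordinate that may arise from an inverse
    step in [leaf_descend], and the escape radius. *)
Definition leafD : R := 4 * deepc (leafB 65) + K * leafB 65 + rad.

Lemma leafD_gt : [/\ rad < leafD, 4 * deepc (leafB 65) < leafD & K * leafB 65 < leafD].
Proof.
have k65 : (1 : R) <= 65 by lra.
have B1 := leafB_ge1 K1 k65; have k0 := K_gt0 K1; have r0 := rad_gt0 K1.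
have h1 : 0 < K * leafB 65 by rewrite mulr_gt0 //; lra.
have h2 : 0 < deepc (leafB 65) by rewrite !mulr_gt0 ?exprn_gt0 //; lra.
by rewrite /leafD; move: h1 h2 r0; clear; split; lra.
Qed.

Lemma henon_root h y : tame K h -> exists x, h.1.[x] = y.
Proof.
move=> th; have d2 := tame_deg2 th; rewrite /hdeg /henon_degree in d2.
have : size (h.1 - y%:P) != 1%N.
  rewrite size_polyDl; first by move: d2; set n := size _; case: n => [|[|[|n]]].
  by rewrite size_polyN; apply: leq_ltn_trans (size_polyC_leq1 _) _; move: d2; clear; lia.
case/closed_rootP => x /rootP; rewrite hornerD hornerN hornerC => /eqP.
by rewrite subr_eq0 => /eqP; exists x.
Qed.

(** A point with |x| <= |y| need not have a preimage of this kind, but some point on its leaf has: w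
    is moved along its leaf to first coordinate x' with p(x') = w.2. The preimage is then ((w.2 -
    w'.2) / a, x'), with bounded first coordinate, while its Green value forces x' to be large.
    Iterating down to time 0 adds up leaf coordinates dominated by the last one, whence the factor
    8. *)
Lemma leaf_descend s n w : adm K s -> nm w.1 <= nm w.2 ->
  ln leafD + err <= green s (orbV s n w) ->
  exists z, exists T, [/\ nm z.1 <= nm z.2, leafD <= nm z.2, leaf s z (orbV s n w),
    tau_lim s z (orbV s n w) T & nm T <= nm (Afac s n) * (8 * nm w.2 ^+ 2)].
Proof.
move=> hs; have [D1 D2 D3] := leafD_gt; have r0 := rad_gt0 K1; have r100 := rad_ge100 K1.
have k1 := K1; have k0 := K_gt0 K1.
have D0 : 0 < leafD by lra.
have jacs i : (s i).2 != 0 by exact: (tame_jac K1 (hs i)).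
have k65 : (1 : R) <= 65 by lra.
have B1 := leafB_ge1 K1 k65.
have deg1 m : 1 <= Deg s m.
  by apply: le_trans (Deg_ge m hs); apply: exprn_ege1; lra.
have lnD0 : 0 <= ln leafD + err.
  by apply: addr_ge0; [apply: ln_ge0; lra|exact: ltW (err_gt0 K1)].
have deep m u : ln leafD + err <= green s (orbV s m u) -> leafD <= n2 u.
  move=> hg; have := green_ub K1 m (orbV s m u) hs; rewrite orbitVK // => h.
  have h2 : ln leafD <= Lrad u.
    have : ln leafD + err <= Deg s m * green s (orbV s m u).
      by apply: le_trans hg _; rewrite ler_peMl // green_ge0.
    by move: h; clear; lra.
  have : leafD <= expR (Lrad u) by rewrite -[leLHS]lnK ?posrE // ler_expR.
  by rewrite LradE lnK ?posrE ?maxrad_gt0 // le_max => /orP[h3|//]; move: D1; rewrite ltNge h3.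
elim: n w => [|n IH] w hw hg.
  have := deep 0%N w hg => hd; have wy : leafD <= nm w.2.
    by move: hd; rewrite /n2 max_r.
  have hV : Vplus w by split; [lra|have := nm_ge0 w.2; lra].
  exists w, 0; split=> //; last by rewrite nm0 !mulr_ge0 ?nm_ge0 ?sqr_ge0.
    exists 0%N, 0 => m _; split; last by rewrite subrr nm0.
    by have := @orb_Vplus R K K1 s 0 m w hs hV.
  exact: tau_lim_refl.
have wy : leafD <= nm w.2 by have := deep n.+1 w hg; rewrite /n2 max_r.
have hV : Vplus w by split; [lra|have := nm_ge0 w.2; lra].
have [x' hx'] := henon_root w.2 (hs n).
have V0 : rad <= nm x' -> Vplus (0, x') by move=> h; split=> //=; rewrite nm0 mulr_ge0 ?nm_ge0.
have henx : (henon (s n) (0, x')).2 = w.2 by rewrite /= mulr0 subr0.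
have xw : nm x' <= nm w.2.
  have [h|h] := leP rad (nm x'); last by lra.
  by have [_ _ _] := Vplus_step K1 (hs n) (V0 h); rewrite henx /=; have := nm_ge0 x'; lra.
have hs1 : adm K (sshift s n.+1) by exact: adm_shift.
have [|w' [sig [w1 wl wt wsig we]]] := @leaf_move R K K1 (sshift s n.+1) w x' hs1 hV (ltW (lt_le_trans D2 wy)).
  by apply: le_trans (nmB _ _) _; lra.
set u := henon_inv (s n) w'.
have uE : u = (((w.2 - w'.2) / (s n).2), x') by rewrite /u /henon_inv w1 hx'.
have orbVE : orbV s n u = orbV s n.+1 w' by [].
have lww : leaf s (orbV s n.+1 w) (orbV s n.+1 w').
  by apply: (@leaf_unshift R K s n.+1); rewrite !orbitVK.
have tww : tau_lim s (orbV s n.+1 w) (orbV s n.+1 w') (Afac s n.+1 * sig).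
  by apply: (tau_lim_shift K1 hs); rewrite !orbitVK.
have gu : ln leafD + err <= green s (orbV s n u) by rewrite orbVE (leaf_green K1 hs lww).
have u1 : nm u.1 < leafD.
  apply: le_lt_trans D3; rewrite uE /= nmf_div ler_pdivrMr ?nm_gt0 // mulrAC.
  apply: le_trans (_ : leafB 65 * 1 <= _); first by rewrite mulr1 nm_distC.
  rewrite mulr1; apply: ler_peMl; first exact: le_trans ler01 B1.
  by rewrite -ler_pdivrMl // mulr1; exact: tame_jac_lb (hs n).
have u2 : leafD <= nm x'.
  have := deep n u gu; rewrite /n2 le_max uE => /orP[|//].
  by rewrite uE in u1; rewrite leNgt u1.
have u12 : nm u.1 <= nm u.2 by rewrite [u.2](_ : _ = x') ?uE //= in u1 *; lra.
have [z [T [z1 z2 zl zt zT]]] := IH u u12 gu.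
rewrite orbVE in zl zt.
have [l1 t1] := leaf_sym K1 hs lww tww.
have [l2 t2] := leaf_trans K1 hs zl zt l1 t1.
exists z; eexists; split; [exact: z1|exact: z2|exact: l2|exact: t2|].
apply: le_trans (nmB _ _) _; rewrite nmM.
have h1 : nm (Afac s n.+1) * nm sig <= nm (Afac s n.+1) * (4 * nm w.2 ^+ 2) by rewrite ler_wpM2l ?nm_ge0.
(* The accumulated coordinate of the earlier steps is at most the allowance for the present one,
   because |x'|^2 is at most 2 K |w.2|. *)
have h2 : nm (Afac s n) * (8 * nm u.2 ^+ 2) <= nm (Afac s n.+1) * (4 * nm w.2 ^+ 2).
  rewrite [Afac s n.+1]/= nmM -mulrA ler_wpM2l ?nm_ge0 // [u.2](_ : _ = x') ?uE //.
  have rx : rad <= nm x' by lra.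
  have [_ hlb _ _] := Vplus_step K1 (hs n) (V0 rx); rewrite henx [(0, x').2]/= in hlb.
  have xsq : nm x' ^+ 2 / (2 * K) <= nm w.2.
    apply: le_trans hlb; rewrite ler_wpM2r ?invr_ge0 ?mulr_ge0 ?(ltW k0) //.
    by apply: ler_weXn2l; [lra|exact: tame_deg2 (hs n)].
  rewrite ler_pdivrMr ?mulr_gt0 // in xsq.
  apply: le_trans (_ : K^-1 * (4 * nm w.2 ^+ 2) <= _); last first.
    by rewrite ler_wpM2r ?(fac_lb K1 (hs n)) // mulr_ge0 // sqr_ge0.
  rewrite ler_pdivlMl //; apply: le_trans (_ : K * (8 * (nm w.2 * (2 * K))) <= _).
    by rewrite ler_pM2l // ler_pM2l.
  have rK := rad_ge K1 (n := 2) isT.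
  have yr : 100 * K ^+ 2 <= nm w.2 := le_trans rK (le_trans (ltW D1) wy).
  rewrite (_ : K * (8 * (nm w.2 * (2 * K))) = nm w.2 * (16 * K ^+ 2)); last by ring.
  rewrite (_ : 4 * nm w.2 ^+ 2 = nm w.2 * (4 * nm w.2)); last by ring.
  by rewrite ler_wpM2l ?nm_ge0 //; have := sqr_ge0 K; move: yr; clear; lra.
rewrite (_ : 8 * nm w.2 ^+ 2 = 4 * nm w.2 ^+ 2 + 4 * nm w.2 ^+ 2); last by ring.
rewrite [nm (Afac s n.+1) * (_ + _)]mulrDr.
by move: zT h1 h2; clear; lra.
Qed.

(** One [err] is lost between the radius at time n and the Green value at time 0; the other one is
    required by [leaf_descend]. *)
Definition level_exp : R := ln leafD + 2 * err.
Local Notation c1 := level_exp.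
Definition rho s n : R := expR (Deg s n * c1).

(* Such a w lies on the stable leaf of a point z of a fixed compact set, and f is
   affine along leaves with a slope bounded on that set. *)
Lemma aut_growth s c f g : adm K s -> aut2 (fun w => green s w < c) f g ->
  preserves K s c f -> preserves K s c g -> c1 + err < c ->
  exists C0, exists N, forall n w, (N <= n)%N -> nm w.1 <= rho s n -> nm w.2 = rho s n ->
    n2 (orb s n (f (orbV s n w))) <= C0 * rho s n.
Proof.
move=> hs hfg pf pg cc; have [hf _] := hfg.
have [D1 D2 D3] := leafD_gt; have r0 := rad_gt0 K1; have r100 := rad_ge100 K1.
have k1 := K1; have k0 := K_gt0 K1; have er0 := err_gt0 K1.
have D0 : 0 < leafD by lra.
have lnD0 : 0 < ln leafD by apply: ln_gt0; lra.
have jacs i : (s i).2 != 0 by exact: (tame_jac K1 (hs i)).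
have k65 : (1 : R) <= 65 by lra.
have c10 : 0 < c1 by rewrite /c1; lra.
pose a := ln leafD + err; pose b := c1 + err; pose r := expR (b + err).
have a0 : 0 < a by rewrite /a; lra.
pose P z := [/\ n2 z <= r, a <= green s z & green s z <= b].
have [Bd Bd0 hB] := leaf_aut_uniform K1 r hs hfg pf pg a0 cc.
have [|||N hN] := @V_uniform R K K1 s P f r hs (closed2_green K1 hs).
- by move=> z [].
- by move=> z [_ _ h]; have [] := hf z (le_lt_trans h cc).
- by move=> z [_ h h']; rewrite pf ?(le_lt_trans h' cc) //; lra.
pose C3 := expR (2 * err + ln 2); have C30 : 0 < C3 := expR_gt0 _.
(* The slope [Bd] times the coordinate 8 rho^2 of [leaf_descend], expressed through |u.2|, which
   agrees with rho up to the factor [C3]. *)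
pose kap := 1 + Bd * (8 * C3 ^+ 2).
have kap1 : 1 <= kap by rewrite /kap lerDl mulr_ge0 // mulr_ge0 // sqr_ge0.
have [M [NM hM]] := deep_uniform K1 (deepc (leafB kap)) hs hN.
exists ((2 + 2 * kap + leafB kap) * C3), M => n w Mn wx wy.
have D1n := Deg_gt0 n hs; set rh := rho s n in wx wy *.
have deg1 : 1 <= Deg s n.
  by apply: le_trans (Deg_ge n hs); apply: exprn_ege1; lra.
have lnrh : ln rh = Deg s n * c1 by rewrite /rh /rho expRK.
have rh0 : 0 < rh := expR_gt0 _.
have rhrad : rad <= rh.
  rewrite /rh /rho -[leLHS]lnK ?posrE // ler_expR; apply: le_trans (_ : 1 * c1 <= _).
    rewrite mul1r /c1; have : ln rad <= ln leafD by rewrite ler_ln ?posrE // ltW.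
    by lra.
  by rewrite ler_pM2r.
have wn2 : n2 w = rh by rewrite /n2 max_r wy.
have wW : Wset w by rewrite WsetE wy; apply: le_trans wx _; rewrite max_l // ler_peMl ?ler1n // ltW.
have LE : Lrad w = Deg s n * c1 by rewrite LradE wn2 max_r.
set zw := orbV s n w; have zwE : orb s n zw = w by rewrite /zw orbitVK.
have gub : Deg s n * green s zw <= Deg s n * c1 + err.
  by have := green_ub K1 n zw hs; rewrite zwE LE.
have glb : Deg s n * c1 - err <= Deg s n * green s zw.
  by have := green_lb (n := n) (z := zw) K1 hs; rewrite zwE LE; apply.
have errD : err <= Deg s n * err by rewrite ler_peMl // ltW.
have ga : a <= green s zw.
  rewrite -(ler_pM2l D1n); apply: le_trans glb.
  by rewrite /a (_ : ln leafD + err = c1 - err) ?mulrBr; [lra|rewrite /c1; ring].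
have gb : green s zw <= b.
  by rewrite -(ler_pM2l D1n) /b mulrDr; apply: le_trans gub _; lra.
have [z [T [z1 z2 zl zt zT]]] := leaf_descend hs (le_trans wx (eq_ind_r (fun v => rh <= v) (lexx _) wy)) ga.
have gz : green s z = green s zw by rewrite -(leaf_green K1 hs zl).
have zV : Vplus z.
  split; first exact: le_trans (ltW D1) z2.
  by apply: le_trans z1 _; rewrite ler_peMl ?nm_ge0 // ler1n.
have zP : P z.
  split; rewrite ?gz //; apply: le_trans (n2_le_exp K1 _) _; rewrite ler_expR.
  have := green_lb (n := 0) (z := z) K1 hs (Vplus_W zV); by rewrite /= mul1r gz; move: gb; rewrite /b; clear; lra.
have B65 := leafB_ge1 K1 k65.
have dz : deepc (leafB 1) <= nm z.2.
  have : leafB 1 <= leafB 65 by rewrite /leafB ler_wpM2l // mulr_ge0 // sqr_ge0.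
  have k3 : 0 <= 24 * K ^+ 3 by rewrite mulr_ge0 // exprn_ge0 // ltW.
  move=> h; have : deepc (leafB 1) <= deepc (leafB 65) by rewrite /deepc ler_wpM2l // lerD2l.
  have : 0 <= deepc (leafB 65) by rewrite /deepc mulr_ge0 // addr_ge0 // (le_trans ler01 B65).
  by move: D2 z2; clear; lra.
have zw0 : 0 < green s z by rewrite gz; exact: lt_le_trans a0 ga.
have zwc : green s z < c by rewrite gz; exact: le_lt_trans gb cc.
have [T' tT' T'b] := hB z zV dz (let: And3 h _ _ := zP in h)
  (let: And3 _ h _ := zP in h) (let: And3 _ _ h := zP in h) zw T zl zt.
set u := orb s n (f z).
have uV : Vplus u by exact: hN (leq_trans (ltnW NM) Mn) zP.
have ud : deepc (leafB kap) <= nm u.2 by exact: hM.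
have fl : leaf s (f z) (f zw) by exact: (leaf_aut K1 hs hfg pf zw0 zwc zl).
have u0 : 0 < nm u.2 by apply: lt_le_trans r0 uV.1.
have gu : `|Deg s n * green s zw - ln (nm u.2)| <= err + ln 2.
  by have := green_V_ln K1 hs uV; rewrite pf // gz.
have lnu : `|ln (nm u.2) - ln rh| <= 2 * err + ln 2.
  rewrite lnrh; move: gu gub glb; rewrite !ler_norml; set x := Deg s n * green s zw; set y := Deg s n * c1.
  by clear; move=> /andP[? ?] ? ?; apply/andP; split; lra.
have uC : nm u.2 <= rh * C3.
  rewrite -[leLHS]lnK ?posrE // -[rh]lnK ?posrE // -expRD ler_expR.
  by move: lnu; rewrite ler_norml => /andP[_]; clear; lra.
have uC' : rh <= nm u.2 * C3.
  rewrite -[leLHS]lnK ?posrE // -[nm u.2]lnK ?posrE // -expRD ler_expR.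
  by move: lnu; rewrite ler_norml => /andP[+ _]; clear; lra.
have An0 : 0 < nm (Afac s n) by rewrite nm_gt0; exact: (Afac_neq0 K1 n hs).
set sig := T' / Afac s n.
have sigb : nm sig <= kap * nm u.2 ^+ 2.
  rewrite /sig nmf_div ler_pdivrMr //; apply: le_trans T'b _.
  apply: le_trans (_ : Bd * (nm (Afac s n) * (8 * rh ^+ 2)) <= _).
    by rewrite ler_wpM2l // -wy.
  rewrite (_ : Bd * _ = Bd * 8 * rh ^+ 2 * nm (Afac s n)); last by ring.
  rewrite ler_pM2r //; apply: le_trans (_ : Bd * 8 * (nm u.2 * C3) ^+ 2 <= _).
    by rewrite ler_wpM2l ?mulr_ge0 //; apply: lerXn2r; rewrite ?nnegrE ?mulr_ge0 ?nm_ge0 ?(ltW rh0) ?(ltW C30).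
  rewrite (_ : Bd * 8 * (nm u.2 * C3) ^+ 2 = Bd * (8 * C3 ^+ 2) * nm u.2 ^+ 2); last by ring.
  by rewrite ler_wpM2r ?sqr_ge0 // /kap lerDr ler01.
have hs' : adm K (sshift s n) by exact: adm_shift.
have [Phi hPhi] := leaf_param K1 hs' kap1 uV ud.
have hat := (hPhi sig).1 sigb; have [pl pt] := leaf_atP K1 hs' kap1 uV ud hat.
have PE : Phi sig = orb s n (f zw).
  have l2 : leaf s (f z) (orbV s n (Phi sig)) by apply: (@leaf_unshift R K s n); rewrite orbitVK.
  have t2 : tau_lim s (f z) (orbV s n (Phi sig)) T'.
    rewrite (_ : T' = Afac s n * sig); last by rewrite /sig mulrC divfK // -nm_gt0.
    by apply: (tau_lim_shift K1 hs); rewrite orbitVK.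
  by rewrite -(leaf_uniq K1 hs l2 fl t2 tT') orbitVK.
have [e1 e2] := leaf_at_bound K1 hs' kap1 uV ud hat.
rewrite -PE; apply: le_trans (n2_dist2 _ u) _.
have u1 : n2 u <= 2 * nm u.2.
  by rewrite n2_le uV.2 ler_peMl ?nm_ge0 // ler1n.
have Bk := leafB_ge1 K1 kap1.
have dd : dist2 (Phi sig) u <= (2 * kap + leafB kap) * nm u.2.
  have p1 : 0 <= leafB kap * nm u.2 by rewrite mulr_ge0 ?nm_ge0 ?(le_trans ler01 Bk).
  have p2 : 0 <= kap * nm u.2 by rewrite mulr_ge0 ?nm_ge0 ?(le_trans ler01 kap1).
  rewrite mulrDl dist2_le; apply/andP; split.
    apply: le_trans e1 _; apply: le_trans (_ : 2 * kap * nm u.2 <= _); last by rewrite lerDl.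
    rewrite ler_pdivrMr // (_ : 2 * kap * nm u.2 * nm u.2 = 2 * (kap * nm u.2 ^+ 2)); last by ring.
    by rewrite ler_pM2l.
  apply: le_trans e2 _; apply: le_trans (_ : leafB kap * nm u.2 <= _); last by move: p2; clear; lra.
  apply: ler_peMr; first exact: le_trans ler01 Bk.
  exact: le_trans (le_trans (ler1n _ 100) (rad_ge100 K1)) uV.1.
apply: le_trans (lerD u1 dd) _; rewrite -mulrDl addrA -[leRHS]mulrA [C3 * _]mulrC.
by rewrite ler_wpM2l //; move: kap1 Bk; clear; lra.
Qed.

End AutGrowth.

(** * Conjugates by the iterates are almost affine *)

Section AffineApprox.
Variable R : realType.
Local Notation C := R[i].
Variable K : R.
Hypothesis K1 : 1 <= K.
Local Notation rad := (esc_rad K).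
Local Notation err := (esc_err K).
Local Notation green := (green K).
Implicit Types (s : nat -> henon_data R) (z w p : C2 R) (h : henon_data R).

Definition conjn s (f : C2 R -> C2 R) n w := orb s n (f (orbV s n w)).

(** Affine interpolation at the three nodes (0,0), (1,0), (0,1): its coefficients are values of F,
    so identities between maps pass to them without derivatives. *)
Definition aff (F : C2 R -> C2 R) w : C2 R :=
  ((F (0, 0)).1 + ((F (1, 0)).1 - (F (0, 0)).1) * w.1 + ((F (0, 1)).1 - (F (0, 0)).1) * w.2,
   (F (0, 0)).2 + ((F (1, 0)).2 - (F (0, 0)).2) * w.1 + ((F (0, 1)).2 - (F (0, 0)).2) * w.2).

Lemma dif2_slice1 (F : C2 R -> C) x y : dif2 F (x, y) -> cdif (fun t => F (t, y)) x.
Proof.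
move=> dF; apply: (@dif2_curve R F (fun t => (t, y)) x) => //.
by split; [exact: cdif_id|exact: cdif_cst].
Qed.

Lemma dif2_slice2 (F : C2 R -> C) x y : dif2 F (x, y) -> cdif (fun t => F (x, t)) y.
Proof.
move=> dF; apply: (@dif2_curve R F (fun t => (x, t)) y) => //.
by split; [exact: cdif_cst|exact: cdif_id].
Qed.

(** Interpolation in x for fixed y, then in y for x = 0. The slope in x still depends on y; by the
    Schwarz lemma it varies by O(|y| / r). *)
Lemma bidisc_affine (F : C2 R -> C) (r M : R) : 2 <= r -> 0 <= M ->
  (forall w, n2 w <= r -> dif2 F w) -> (forall w, n2 w <= r -> nm (F w) <= M * r) ->
  [/\ nm (F (1, 0) - F (0, 0)) <= 4 * M, nm (F (0, 1) - F (0, 0)) <= 4 * M &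
   forall w, n2 w <= r -> nm (F w - (F (0, 0) + (F (1, 0) - F (0, 0)) * w.1 + (F (0, 1) - F (0, 0)) * w.2))
     <= 88 * M * (1 + n2 w) ^+ 2 / r].
Proof.
move=> r2 M0 dF bF; have r0 : 0 < r by lra.
have n0 : nm (0 : C) <= r / 2 by rewrite nm0; lra.
have n1 : nm (1 : C) <= r / 2 by rewrite nm1; lra.
have n01 : (0 : C) != 1 by rewrite eq_sym oner_neq0.
have inn x y : nm x <= r -> nm y <= r -> n2 ((x, y) : C2 R) <= r by move=> h1 h2; rewrite n2_le h1.
have I1 y : nm y <= r -> nm (F (1, y) - F (0, y)) <= 4 * M /\
    forall x, nm x <= r -> nm (F (x, y) - (F (0, y) + (F (1, y) - F (0, y)) * x)) <= 40 * M * nm x * nm (x - 1) / r.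
  move=> hy; have := @interpolation R [::] (fun t => F (t, y)) r (M * r) 0 1 r0 n01 n0 n1 isT isT.
  have cd t : nm t <= r -> cdif (fun t => F (t, y)) t.
    by move=> ht; apply: dif2_slice1; apply: dF; exact: inn.
  move=> /(_ (fun t ht => cdif_ccont (cd t ht)) (fun t ht _ => cd t ht) (fun t ht => bF _ (inn t y ht hy))).
  rewrite subr0 divr1 => -[h1 h2]; split.
    by apply: le_trans h1 _; rewrite mulrA mulfK // gt_eqF.
  move=> x hx; have := h2 x hx; rewrite !subr0 => h; apply: le_trans h _.
  by rewrite le_eqVlt; apply/orP; left; apply/eqP; field; rewrite gt_eqF.
have I2 : nm (F (0, 1) - F (0, 0)) <= 4 * M /\
    forall y, nm y <= r -> nm (F (0, y) - (F (0, 0) + (F (0, 1) - F (0, 0)) * y)) <= 40 * M * nm y * nm (y - 1) / r.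
  have n0r : nm (0 : C) <= r by lra.
  have := @interpolation R [::] (fun t => F (0, t)) r (M * r) 0 1 r0 n01 n0 n1 isT isT.
  have cd t : nm t <= r -> cdif (fun t => F (0, t)) t.
    by move=> ht; apply: dif2_slice2; apply: dF; exact: inn.
  move=> /(_ (fun t ht => cdif_ccont (cd t ht)) (fun t ht _ => cd t ht) (fun t ht => bF _ (inn 0 t n0r ht))).
  rewrite subr0 divr1 => -[h1 h2]; split.
    by apply: le_trans h1 _; rewrite mulrA mulfK // gt_eqF.
  move=> x hx; have := h2 x hx; rewrite !subr0 => h; apply: le_trans h _.
  by rewrite le_eqVlt; apply/orP; left; apply/eqP; field; rewrite gt_eqF.
have n0r : nm (0 : C) <= r by lra.
have n1r : nm (1 : C) <= r by lra.
split; [exact: (I1 0 n0r).1|exact: I2.1|].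
move=> [x y]; rewrite n2_le => /andP[/= hx hy].
pose D t := F (1, t) - F (0, t).
have Dd t : nm t <= r -> cdif D t.
  by move=> ht; apply: cdifB; apply: dif2_slice2; apply: dF; exact: inn.
have Ds : nm (D y - D 0) <= 8 * M * nm y / r.
  have := @schwarz R [::] D 0 r (8 * M) r0 (Dd 0 n0r).
  move=> H; have {H} := H _ _ _ y; rewrite !subr0; apply => //.
  - by move=> t; rewrite subr0 => /Dd /cdif_ccont.
  - by move=> t; rewrite subr0 => /Dd.
  - move=> t; rewrite subr0 => ht; apply: le_trans (nmB _ _) _.
    by have [h1 _] := I1 t (ltac:(lra)); have [h2 _] := I1 0 n0r; rewrite /D; lra.
set m := n2 ((x, y) : C2 R).
have mx : nm x <= m by exact: (n2_1 (x, y)).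
have my : nm y <= m by exact: (n2_2 (x, y)).
have m0 : 0 <= m := n2_ge0 _.
have J1 := (I1 y hy).2 x hx; have J2 := I2.2 y hy.
set a := F (0, 0) in J2 *; set b := F (1, 0) - a; set d := F (0, 1) - a in J2 *.
have -> : F (x, y) - (a + b * x + d * y) =
   (F (x, y) - (F (0, y) + (F (1, y) - F (0, y)) * x)) + (F (0, y) - (a + d * y)) + (D y - D 0) * x.
  by rewrite /D /b /a; ring.
apply: le_trans (nmD _ _) _; apply: le_trans (lerD (nmD _ _) (lexx _)) _; rewrite nmM.
have xx : nm x * nm (x - 1) <= m * (m + 1).
  by apply: ler_pM; rewrite ?nm_ge0 //; apply: le_trans (nmB _ _) _; rewrite nm1 lerD2r.
have yy : nm y * nm (y - 1) <= m * (m + 1).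
  by apply: ler_pM; rewrite ?nm_ge0 //; apply: le_trans (nmB _ _) _; rewrite nm1 lerD2r.
have M40 : 0 <= 40 * M / r by rewrite divr_ge0 ?mulr_ge0 // ltW.
have K1' : nm (F (x, y) - (F (0, y) + (F (1, y) - F (0, y)) * x)) <= 40 * M / r * (m * (m + 1)).
  apply: le_trans J1 _; rewrite (_ : 40 * M * nm x * nm (x - 1) / r = 40 * M / r * (nm x * nm (x - 1))); last by ring.
  by rewrite ler_wpM2l.
have K2' : nm (F (0, y) - (a + d * y)) <= 40 * M / r * (m * (m + 1)).
  apply: le_trans J2 _; rewrite (_ : 40 * M * nm y * nm (y - 1) / r = 40 * M / r * (nm y * nm (y - 1))); last by ring.
  by rewrite ler_wpM2l.
have K3' : nm (D y - D 0) * nm x <= 8 * M / r * (m * m).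
  rewrite (_ : 8 * M / r * (m * m) = (8 * M * m / r) * m); last by ring.
  apply: ler_pM; rewrite ?nm_ge0 //; apply: le_trans Ds _.
  by rewrite ler_wpM2r ?invr_ge0 ?(ltW r0) // ler_wpM2l // mulr_ge0.
have Mr : 0 <= M / r by rewrite divr_ge0 // ltW.
have -> : 88 * M * (1 + m) ^+ 2 / r = 40 * M / r * (m * (m + 1)) + 40 * M / r * (m * (m + 1)) + 8 * M / r * (m * m)
   + M / r * (96 * m + 88) by ring.
have : 0 <= M / r * (96 * m + 88) by rewrite mulr_ge0 //; move: m0; clear; lra.
by move: K1' K2' K3'; clear; lra.
Qed.

Lemma rho_ge s n : adm K s -> [/\ rad <= rho K s n, 2 <= rho K s n & 0 < rho K s n].
Proof.
move=> hs; have [D1 D2 D3] := leafD_gt K1; have r0 := rad_gt0 K1; have r100 := rad_ge100 K1.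
have h : rad <= rho K s n.
  rewrite /rho -[leLHS]lnK ?posrE // ler_expR.
  have l1 : ln rad <= ln (leafD K) by rewrite ler_ln ?posrE //; [exact: ltW|exact: (lt_trans r0 D1)].
  have l0 : 0 <= ln rad by apply: ln_ge0; lra.
  have e0 := err_gt0 K1; apply: le_trans (_ : 1 * level_exp K <= _); first by rewrite mul1r /level_exp; lra.
  rewrite ler_wpM2r //; first by rewrite /level_exp; lra.
  by apply: le_trans (Deg_ge n hs); apply: exprn_ege1; lra.
by split => //; lra.
Qed.

Lemma rho_polydisc s n w c : adm K s -> level_exp K + err < c -> n2 w <= rho K s n ->
  green s (orbV s n w) < c.
Proof.
move=> hs hc hw; have [h1 _ _] := rho_ge n hs.
have := polydisc_green K1 n hs h1 hw; rewrite /rho expRK => h.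
have D0 := Deg_gt0 n hs; rewrite -(ltr_pM2l D0); apply: le_lt_trans h _.
have D1 : 1 <= Deg s n by apply: le_trans (Deg_ge n hs); apply: exprn_ege1; lra.
have : err <= Deg s n * err by rewrite ler_peMl // ltW // (err_gt0 K1).
have : Deg s n * (level_exp K + err) < Deg s n * c by rewrite ltr_pM2l.
by rewrite mulrDr; clear; lra.
Qed.

Lemma holo_conjn s c f g n w : adm K s -> aut2 (fun w => green s w < c) f g ->
  level_exp K + err < c -> n2 w <= rho K s n -> holo (conjn s f n) w.
Proof.
move=> hs [hf _] hc hw; have [h _ _] := hf _ (rho_polydisc hs hc hw).
apply: (@holo_comp R (fun v => f (orbV s n v)) (orb s n)); last exact: holo_orb.
by apply: holo_comp; first exact: holo_orbV.
Qed.

(** [aut_growth] covers |x| <= rho_n with |y| = rho_n; the maximum principle in y fills the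
    polydisc. *)
Lemma aut_bounded s c f g : adm K s -> aut2 (fun w => green s w < c) f g ->
  preserves K s c f -> preserves K s c g -> level_exp K + err < c ->
  exists2 M, 0 <= M & exists N, forall n w, (N <= n)%N -> n2 w <= rho K s n ->
    n2 (conjn s f n w) <= M * rho K s n.
Proof.
move=> hs hfg pf pg hc; have [C0 [N hN]] := aut_growth K1 hs hfg pf pg hc.
exists `|C0| => //; exists N => n [x y] Nn hw; have [rr r2 r0] := rho_ge n hs.
set r := rho K s n in hw rr r2 r0 *.
have hn t : nm t <= r -> n2 ((x, t) : C2 R) <= r.
  by move=> ht; move: hw; rewrite !n2_le => /andP[/= -> _].
have hd t : nm t <= r -> holo (conjn s f n) (x, t) by move=> /hn; exact: (holo_conjn hs hfg hc).
have xr : nm x <= r by move: hw; rewrite n2_le => /andP[].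
have yr : nm y <= r by move: hw; rewrite n2_le => /andP[].
have circ t : nm t = r -> n2 (conjn s f n (x, t)) <= `|C0| * r.
  move=> ht; apply: le_trans (hN n (x, t) Nn xr ht) _.
  by rewrite ler_pM2r // ler_norm.
rewrite n2_le; apply/andP; split.
- have := @max_disc R [::] (fun t => (conjn s f n (x, t)).1) 0 r (`|C0| * r).
  move=> H; have {H} := H _ _ _ y; rewrite subr0; apply => //.
  + by move=> t; rewrite subr0 => /hd[h _]; apply: cdif_ccont; exact: (dif2_slice2 h).
  + by move=> t; rewrite subr0 => /hd[h _] _; exact: (dif2_slice2 h).
  + by move=> t; rewrite subr0 => /circ h; apply: le_trans h; exact: n2_1.
- have := @max_disc R [::] (fun t => (conjn s f n (x, t)).2) 0 r (`|C0| * r).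
  move=> H; have {H} := H _ _ _ y; rewrite subr0; apply => //.
  + by move=> t; rewrite subr0 => /hd[_ h]; apply: cdif_ccont; exact: (dif2_slice2 h).
  + by move=> t; rewrite subr0 => /hd[_ h] _; exact: (dif2_slice2 h).
  + by move=> t; rewrite subr0 => /circ h; apply: le_trans h; exact: n2_2.
Qed.

Definition affine_approx s (F : nat -> C2 R -> C2 R) M N := forall n, (N <= n)%N ->
  [/\ n2 (F n (0, 0)) <= M,
    dist2 (F n (1, 0)) (F n (0, 0)) <= M,
    dist2 (F n (0, 1)) (F n (0, 0)) <= M &
    forall w, n2 w <= rho K s n ->
      dist2 (F n w) (aff (F n) w) <= M * (1 + n2 w) ^+ 2 / rho K s n].

(** Interpolation bounds the slopes, but the constant term a priori only by O(rho_n). It is bounded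
    because F_n sends S_n p to S_n (f p), and both orbits are bounded if G(p) = 0. *)
Lemma aut_affine s c f g : adm K s -> aut2 (fun w => green s w < c) f g ->
  preserves K s c f -> preserves K s c g -> level_exp K + err < c ->
  exists2 M, 1 <= M & exists N, affine_approx s (conjn s f) M N.
Proof.
move=> hs hfg pf pg hc; have [M M0 [N hN]] := aut_bounded hs hfg pf pg hc.
have [p p0] := exists_green0 K1 hs; have [Mp Mp1 hMp] := green_bounded_orbit K1 hs p0.
have cpos : 0 < c.
  have [D1 D2 D3] := leafD_gt K1; have r0 := rad_gt0 K1; have r100 := rad_ge100 K1.
  have e0 := err_gt0 K1; have : 0 <= ln (leafD K) by apply: ln_ge0; lra.
  by move: hc; rewrite /level_exp; lra.
have fp0 : green s (f p) = 0 by rewrite pf // p0.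
have [Mq Mq1 hMq] := green_bounded_orbit K1 hs fp0.
have lev0 : 0 < level_exp K.
  have [D1 D2 D3] := leafD_gt K1; have r0 := rad_gt0 K1.
  have r100 := rad_ge100 K1; have e1 := err_gt0 K1.
  have : 0 <= ln (leafD K) by apply: ln_ge0; lra.
  by rewrite /level_exp; lra.
have [N2 hN2] := @Deg_lim R K s (ln Mp) 0 (level_exp K) hs (lexx _) lev0.
pose M' := 1 + Mq + 8 * M * Mp + 88 * M * (1 + Mp) ^+ 2 + 4 * M + 88 * M.
have P1 : 0 <= 88 * M * (1 + Mp) ^+ 2 by rewrite mulr_ge0 ?sqr_ge0 // mulr_ge0.
have P2 : 0 <= M * Mp by rewrite mulr_ge0 //; lra.
have M4 : 4 * M <= M' by rewrite /M'; lra.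
exists M'; first by rewrite /M'; lra.
exists (maxn N N2) => n; rewrite geq_max => /andP[Nn N2n].
have [rr r2 r0] := rho_ge n hs.
have dF1 w : n2 w <= rho K s n -> dif2 (fun v => (conjn s f n v).1) w.
  by move=> hw; have [] := holo_conjn hs hfg hc hw.
have dF2 w : n2 w <= rho K s n -> dif2 (fun v => (conjn s f n v).2) w.
  by move=> hw; have [] := holo_conjn hs hfg hc hw.
have [a1 a2 a3] := bidisc_affine r2 M0 dF1 (fun w hw => le_trans (n2_1 _) (hN n w Nn hw)).
have [b1 b2 b3] := bidisc_affine r2 M0 dF2 (fun w hw => le_trans (n2_2 _) (hN n w Nn hw)).
have est w : n2 w <= rho K s n ->
    dist2 (conjn s f n w) (aff (conjn s f n) w) <= 88 * M * (1 + n2 w) ^+ 2 / rho K s n.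
  by move=> hw; rewrite dist2_le /= a3 // b3.
have pn : n2 (orb s n p) <= rho K s n.
  apply: le_trans (hMp n) _; rewrite /rho -[leLHS]lnK ?posrE; last by lra.
  by rewrite ler_expR; have := hN2 n N2n; rewrite mulr0 addr0 mulrC.
split.
- have E : conjn s f n (orb s n p) = orb s n (f p).
    by rewrite /conjn orbitK // => k; exact: (tame_jac K1 (hs k)).
  have := est _ pn; rewrite E; set q := orb s n p in pn *.
  have qM : n2 q <= Mp := hMp n.
  have h88 : 88 * M * (1 + n2 q) ^+ 2 / rho K s n <= 88 * M * (1 + Mp) ^+ 2.
    rewrite ler_pdivrMr //; apply: le_trans (_ : 88 * M * (1 + Mp) ^+ 2 * 1 <= _).
      rewrite mulr1 ler_wpM2l ?mulr_ge0 //; apply: lerXn2r; rewrite ?nnegrE; have := n2_ge0 q; move: qM; clear; lra.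
    by rewrite ler_wpM2l //; move: r2; clear; lra.
  have tri x y (a b d u : C) : nm b <= 4 * M -> nm d <= 4 * M -> nm x <= Mp -> nm y <= Mp ->
      nm u <= Mq -> nm (u - (a + b * x + d * y)) <= 88 * M * (1 + Mp) ^+ 2 -> nm a <= M'.
    move=> hb hd hx hy hu h; have -> : a = u - (u - (a + b * x + d * y)) - b * x - d * y by ring.
    apply: le_trans (nmB _ _) _; apply: le_trans (lerD (nmB _ _) (lexx _)) _.
    apply: le_trans (lerD (lerD (nmB _ _) (lexx _)) (lexx _)) _; rewrite !nmM.
    have : nm b * nm x <= 4 * M * Mp by apply: ler_pM; rewrite ?nm_ge0.
    have : nm d * nm y <= 4 * M * Mp by apply: ler_pM; rewrite ?nm_ge0.
    by rewrite /M'; move: hu h P2; clear -M0; lra.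
  rewrite dist2_le => /andP[/= t1 t2]; rewrite n2_le; apply/andP; split.
  + apply: (tri q.1 q.2 _ _ _ _ a1 a2 (le_trans (n2_1 _) qM) (le_trans (n2_2 _) qM) _ (le_trans t1 h88)).
    by apply: le_trans (hMq n); exact: n2_1.
  + apply: (tri q.1 q.2 _ _ _ _ b1 b2 (le_trans (n2_1 _) qM) (le_trans (n2_2 _) qM) _ (le_trans t2 h88)).
    by apply: le_trans (hMq n); exact: n2_2.
- by rewrite dist2_le; apply/andP; split; [apply: le_trans a1 _|apply: le_trans b1 _]; exact: M4.
- by rewrite dist2_le; apply/andP; split; [apply: le_trans a2 _|apply: le_trans b2 _]; exact: M4.
move=> w hw; apply: le_trans (est w hw) _.
rewrite ler_wpM2r ?invr_ge0 ?(ltW r0) // ler_wpM2r ?sqr_ge0 //.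
by rewrite /M'; lra.
Qed.

End AffineApprox.

(** * Comparison of coefficients across one step *)

Section AffineRows.
Variable R : realType.
Local Notation C := R[i].
Variable K : R.
Hypothesis K1 : 1 <= K.
Local Notation lipc := (lipc K).
Implicit Types (s : nat -> henon_data R) (z w p : C2 R) (h : henon_data R).

Local Notation affine_approx := (affine_approx K).

Lemma poly_lipc h y y' M : tame K h -> 1 <= M -> nm y <= M -> nm y' <= M ->
  nm (h.1.[y'] - h.1.[y]) <= lipc M * nm (y' - y).
Proof.
move=> th M1 hy hy'; apply: le_trans (tame_lip th M1 hy hy') _; rewrite ler_wpM2r ?nm_ge0 //.
have k1 := K1; rewrite /lipc; apply: ler_pM; rewrite ?exprn_ge0 //; try by clear -k1 M1; lra.
  by apply: le_trans (_ : K * K <= _); [rewrite ler_peMl //; lra|rewrite -expr2; have := sqr_ge0 K; lra].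
apply: le_trans (_ : (M + 1) ^+ (hdeg h).-1 <= _); first by apply: lerXn2r; rewrite ?nnegrE; lra.
by apply: ler_weXn2l; [lra|apply: leq_trans (leq_pred _) _; exact: hdeg_cap].
Qed.

Lemma poly_le_lipc h y M : tame K h -> 1 <= M -> nm y <= M -> nm h.1.[y] <= lipc M.
Proof.
move=> th M1 hy; apply: le_trans (tame_bound th M1 hy) _.
have k1 := K1; rewrite /lipc; apply: ler_pM; rewrite ?exprn_ge0 //; try by clear -k1 M1; lra.
  by apply: le_trans (_ : K * K <= _); [rewrite ler_peMl //; lra|rewrite -expr2; have := sqr_ge0 K; lra].
apply: le_trans (_ : (M + 1) ^+ (hdeg h) <= _); first by apply: lerXn2r; rewrite ?nnegrE; lra.
by apply: ler_weXn2l; [lra|exact: hdeg_cap].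
Qed.

Lemma henon_le h w M : tame K h -> 1 <= M -> n2 w <= M -> n2 (henon h w) <= lipc M + K * M.
Proof.
move=> th M1; rewrite n2_le => /andP[h1 h2]; have k1 := K1.
have l1 := lipc_ge1 K1 (ltac:(lra) : 0 <= M).
rewrite n2_le; apply/andP; split; [rewrite [(henon h w).1]/=|rewrite [(henon h w).2]/=].
  apply: le_trans h2 _; have : 1 * M <= K * M by rewrite ler_wpM2r //; lra.
  by clear -l1; lra.
apply: le_trans (nmB _ _) _; apply: lerD; first exact: poly_le_lipc.
by rewrite nmM; apply: ler_pM; rewrite ?nm_ge0 // (tame_jac_ub th).
Qed.

Lemma henon_lip h w z M : tame K h -> 1 <= M -> n2 w <= M -> n2 z <= M ->
  dist2 (henon h w) (henon h z) <= (lipc M + K) * dist2 w z.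
Proof.
move=> th M1; rewrite !n2_le => /andP[w1 w2] /andP[z1 z2]; have k1 := K1.
have l1 := lipc_ge1 K1 (ltac:(lra) : 0 <= M); have d0 := dist2_ge0 w z.
rewrite dist2_le; apply/andP; split;
  [rewrite [(henon h w).1]/= [(henon h z).1]/=|rewrite [(henon h w).2]/= [(henon h z).2]/=].
  by apply: le_trans (dist2_2 w z) _; rewrite ler_peMl //; lra.
have -> : h.1.[w.2] - h.2 * w.1 - (h.1.[z.2] - h.2 * z.1) =
  (h.1.[w.2] - h.1.[z.2]) - h.2 * (w.1 - z.1) by ring.
apply: le_trans (nmB _ _) _; rewrite mulrDl; apply: lerD.
  apply: le_trans (poly_lipc th M1 z2 w2) _; rewrite ler_wpM2l ?dist2_2 //; lra.
by rewrite nmM; apply: ler_pM; rewrite ?nm_ge0 ?(tame_jac_ub th) ?dist2_1.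
Qed.

(* All terms but [ka' * h.1.[y]] are affine in y, while h.1 grows faster than
   linearly. *)
Lemma first_row h (mu' ka' s' la nu t : C) e : tame K h -> 0 <= e ->
  (forall x y, nm x <= 5 * K ^+ 2 -> nm y <= 5 * K ^+ 2 ->
    nm (s' + mu' * y + ka' * (h.1.[y] - h.2 * x) - (t + la * x + nu * y)) <= e) ->
  [/\ nm ka' <= 2 * e, nm la <= 4 * K * e, nm (mu' - nu) <= 4 * K * e & nm (s' - t) <= 4 * K * e].
Proof.
move=> th e0 H; have k1 := K1; have k2 : K <= K ^+ 2 by rewrite expr2 ler_peMl //; lra.
set p := h.1 in H; set a := h.2 in H; have ha : nm a <= K := tame_jac_ub th.
have n0 : nm (0 : C) <= 1 by rewrite nm0.
have n1 : nm (1 : C) <= 1 by rewrite nm1.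
have le1 : 1 <= 5 * K ^+ 2 by lra.
pose q y := s' + mu' * y + ka' * p.[y] - (t + nu * y).
have Hq y : nm y <= 5 * K ^+ 2 -> nm (q y) <= e.
  move=> hy; have := H 0 y (le_trans n0 le1) hy; rewrite !mulr0 addr0 subr0; exact.
have Dq y : nm y <= 4 * K ^+ 2 -> nm (ka' * (p.[y + 1] - p.[y]) + (mu' - nu)) <= 2 * e.
  move=> hy; have -> : ka' * (p.[y + 1] - p.[y]) + (mu' - nu) = q (y + 1) - q y by rewrite /q; ring.
  apply: le_trans (nmB _ _) _; have h1 := Hq y (ltac:(lra)).
  have h2 : nm (q (y + 1)) <= e by apply: Hq; apply: le_trans (nmD _ _) _; rewrite nm1; lra.
  by move: h1 h2; clear; lra.
have mk : nm (mu' - nu) <= nm ka' * K + 2 * e.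
  have := Dq 0; rewrite nm0 add0r => /(_ (ltac:(lra))) h1.
  have -> : mu' - nu = (ka' * (p.[1] - p.[0]) + (mu' - nu)) - ka' * (p.[1] - p.[0]) by ring.
  apply: le_trans (nmB _ _) _; rewrite nmM addrC; apply: lerD => //.
  rewrite ler_wpM2l ?nm_ge0 //; apply: le_trans (tame_lip th (lexx 1) n0 n1) _.
  by rewrite expr1n subr0 nm1 !mulr1.
have kb : nm ka' * (4 * K) <= nm (mu' - nu) + 2 * e.
  pose y : C := (4 * K ^+ 2)%:C%C.
  have ny : nm y = 4 * K ^+ 2 by rewrite /y nm_real ger0_norm //; lra.
  have h1 := Dq y (ltac:(lra)).
  have := @leaf_step R K K1 h y (y + 1) 1 th ler01; rewrite addrAC subrr add0r nm1.
  move=> /(_ (lexx _)); rewrite ny => /(_ (ltac:(lra))) h2.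
  have h3 : 4 * K <= nm (p.[y + 1] - p.[y]).
    apply: le_trans h2; rewrite le_eqVlt; apply/orP; left; apply/eqP; field; lra.
  apply: le_trans (_ : nm ka' * nm (p.[y + 1] - p.[y]) <= _); first by rewrite ler_wpM2l ?nm_ge0.
  rewrite -nmM; have -> : ka' * (p.[y + 1] - p.[y]) =
    (ka' * (p.[y + 1] - p.[y]) + (mu' - nu)) - (mu' - nu) by ring.
  by apply: le_trans (nmB _ _) _; lra.
have ka0 := nm_ge0 ka'.
have kk : nm ka' * 1 <= nm ka' * K by rewrite ler_wpM2l.
have kae : nm ka' <= 2 * e by lra.
have kKe : nm ka' * K <= 2 * e * K by rewrite ler_wpM2r //; lra.
have eK : e * 1 <= e * K by rewrite ler_wpM2l.
split=> //; last 2 first.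
- by apply: le_trans mk _; lra.
- have -> : s' - t = q 0 - ka' * p.[0] by rewrite /q; ring.
  have h1 := Hq 0 (le_trans n0 le1); have h2 := tame_bound th (lexx 1) n0; rewrite expr1n mulr1 in h2.
  apply: le_trans (nmB _ _) _; rewrite nmM.
  have : nm ka' * nm p.[0] <= nm ka' * K by rewrite ler_wpM2l.
  by lra.
have h1 := H 1 0 (le_trans n1 le1) (le_trans n0 le1); have h2 := H 0 0 (le_trans n0 le1) (le_trans n0 le1).
have -> : la = (s' + mu' * 0 + ka' * (p.[0] - a * 0) - (t + la * 0 + nu * 0)) -
  (s' + mu' * 0 + ka' * (p.[0] - a * 1) - (t + la * 1 + nu * 0)) - ka' * a by ring.
apply: le_trans (nmB _ _) _; apply: le_trans (lerD (nmB _ _) (lexx _)) _; rewrite nmM.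
have : nm ka' * nm a <= nm ka' * K by rewrite ler_wpM2l.
by lra.
Qed.

(** The coefficient of x in this expression is a (mu - nu'). *)
Lemma second_row h (mu s nu' t' nu t : C) e : tame K h ->
  (forall x y, nm x <= 1 -> nm y <= 1 ->
    nm (nu' * (h.1.[y] - h.2 * x) + t' - h.1.[nu * y + t] + h.2 * (mu * x + s)) <= e) ->
  nm (nu' - mu) <= 2 * K * e.
Proof.
move=> th H; have k1 := K1; set p := h.1 in H; set a := h.2 in H.
have n0 : nm (0 : C) <= 1 by rewrite nm0.
have n1 : nm (1 : C) <= 1 by rewrite nm1.
have h1 := H 1 0 n1 n0; have h2 := H 0 0 n0 n0.
have h3 : nm a * nm (nu' - mu) <= 2 * e.
  rewrite -nmM; have -> : a * (nu' - mu) = (nu' * (p.[0] - a * 0) + t' - p.[nu * 0 + t] + a * (mu * 0 + s)) -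
     (nu' * (p.[0] - a * 1) + t' - p.[nu * 0 + t] + a * (mu * 1 + s)) by ring.
  by apply: le_trans (nmB _ _) _; lra.
have k0 : 0 < K by lra.
have : K^-1 * nm (nu' - mu) <= 2 * e.
  by apply: le_trans h3; rewrite ler_wpM2r ?nm_ge0 // (tame_jac_lb th).
by rewrite mulrC ler_pdivrMr // => hh; rewrite mulrAC.
Qed.

(* Where [nu * y + t = B] the difference of the values of h.1 is at least
   [B / K * nm (t1 - t)]; where [nu * y + t = 0] it is at most a constant times
   [nm (t1 - t)]. *)
Lemma translation_drift h (nu t t1 c : C) e M B : tame K h -> 1 <= M -> 0 < B ->
  2 * K ^+ 2 * (1 + 2 * M) <= B -> K * (lipc (2 * M) + 1) <= B ->
  M^-1 <= nm nu -> nm t <= M -> nm t1 <= M ->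
  (forall y, nm y <= M * (B + M) -> nm (h.1.[nu * y + t1] - h.1.[nu * y + t] - c) <= e) ->
  nm (t1 - t) <= 2 * e.
Proof.
move=> th M1 B0 B1 B2 hnu ht ht1 H; have k1 := K1; have M0 : 0 < M by lra.
have nu0 : 0 < nm nu by apply: lt_le_trans hnu; rewrite invr_gt0.
have nun := nm_neq0 nu0; set p := h.1 in H; set d := t1 - t.
have dM : nm d <= 2 * M by apply: le_trans (nmB _ _) _; lra.
have at_ u : nm u <= B -> nm (p.[u + d] - p.[u] - c) <= e.
  move=> hu; have := H ((u - t) / nu).
  have -> : nu * ((u - t) / nu) + t1 = u + d by rewrite /d; field.
  have -> : nu * ((u - t) / nu) + t = u by field.
  apply; rewrite nmf_div ler_pdivrMr //; apply: le_trans (nmB _ _) _.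
  apply: le_trans (_ : B + M <= _); first by lra.
  rewrite mulrAC -{1}[B + M]mul1r ler_wpM2r //; first by lra.
  by move: hnu; rewrite -div1r ler_pdivrMr // mulrC.
pose u : C := B%:C%C.
have nu_ : nm u = B by rewrite /u nm_real ger0_norm // ltW.
have h1 := at_ u (ltac:(lra)); have h0 := at_ 0; rewrite nm0 add0r in h0; have {}h0 := h0 (ltW B0).
have hd0 : nm (p.[d] - p.[0]) <= lipc (2 * M) * nm d.
  have := @poly_lipc h 0 d (2 * M) th; rewrite nm0 subr0; apply; lra.
have st : nm u * nm d / K <= nm (p.[u + d] - p.[u]).
  have := @leaf_step R K K1 h u (u + d) (2 * M) th; rewrite addrAC subrr add0r; apply; rewrite ?nu_ //; lra.
have up : nm (p.[u + d] - p.[u]) <= lipc (2 * M) * nm d + 2 * e.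
  have -> : p.[u + d] - p.[u] = (p.[u + d] - p.[u] - c) - (p.[d] - p.[0] - c) + (p.[d] - p.[0]) by ring.
  apply: le_trans (nmD _ _) _; apply: le_trans (lerD (nmB _ _) (lexx _)) _.
  by move: h1 h0 hd0; clear; lra.
have lo : (lipc (2 * M) + 1) * nm d <= nm u * nm d / K.
  rewrite mulrAC ler_wpM2r ?nm_ge0 // ler_pdivlMr ?nu_; last by lra.
  by rewrite mulrC.
have := le_trans lo (le_trans st up); rewrite mulrDl mul1r.
by clear; lra.
Qed.

Lemma rho_mono s n m : adm K s -> (n <= m)%N -> rho K s n <= rho K s m.
Proof.
move=> hs nm_; rewrite /rho ler_expR; have [D1 D2 D3] := leafD_gt K1; have r100 := rad_ge100 K1.
have e1 := err_gt0 K1; have r0 := rad_gt0 K1.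
have l0 : 0 <= ln (leafD K) by apply: ln_ge0; lra.
rewrite ler_wpM2r //; first by rewrite /level_exp; lra.
have k1 := K1; rewrite -(subnKC nm_) Deg_shift; apply: ler_peMr; first exact: (ltW (Deg_gt0 n hs)).
by apply: le_trans (Deg_ge _ (fun k => hs (n + k)%N)); apply: exprn_ege1; lra.
Qed.

Lemma level_exp_gt0 : 0 < level_exp K.
Proof.
have [D1 D2 D3] := leafD_gt K1; have r0 := rad_gt0 K1.
have r100 := rad_ge100 K1; have e1 := err_gt0 K1.
have : 0 <= ln (leafD K) by apply: ln_ge0; lra.
by rewrite /level_exp; lra.
Qed.

Lemma rho_big s (x : R) : adm K s -> exists N, forall n, (N <= n)%N -> x <= rho K s n.
Proof.
move=> hs; have [N hN] := @Deg_lim R K s (ln (Num.max 1 x)) 0 (level_exp K) hs (lexx _) level_exp_gt0.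
exists N => n /hN; rewrite mulr0 addr0 mulrC => h.
have m0 : 0 < Num.max 1 x by rewrite lt_max ltr01.
rewrite /rho; apply: le_trans (_ : Num.max 1 x <= _); first by rewrite le_max lexx orbT.
by rewrite -[leLHS]lnK ?posrE // ler_expR.
Qed.

Lemma conjn_henon s f n w : adm K s ->
  conjn s f n.+1 (henon (s n) w) = henon (s n) (conjn s f n w).
Proof. by move=> hs; rewrite /conjn /= henonK // (tame_jac K1 (hs n)). Qed.

Lemma aff_le F M w : n2 (F (0, 0)) <= M -> dist2 (F (1, 0)) (F (0, 0)) <= M ->
  dist2 (F (0, 1)) (F (0, 0)) <= M -> n2 (aff F w) <= M * (1 + 2 * n2 w).
Proof.
rewrite n2_le !dist2_le => /andP[a1 a2] /andP[b1 b2] /andP[c1 c2].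
have M0 : 0 <= M := le_trans (nm_ge0 _) a1.
have tri (a b c : C) : nm a <= M -> nm b <= M -> nm c <= M ->
    nm (a + b * w.1 + c * w.2) <= M * (1 + 2 * n2 w).
  move=> ha hb hc; apply: le_trans (nmD _ _) _; apply: le_trans (lerD (nmD _ _) (lexx _)) _; rewrite !nmM.
  have : nm b * nm w.1 <= M * n2 w by apply: ler_pM; rewrite ?nm_ge0 ?n2_1.
  have : nm c * nm w.2 <= M * n2 w by apply: ler_pM; rewrite ?nm_ge0 ?n2_2.
  by lra.
by rewrite n2_le; apply/andP; split; apply: tri.
Qed.

(** The exact relation F_{n+1} o h_n = h_n o F_n persists for the affine parts up to O(1 / rho_n),
    because h_n is Lipschitz on bounded sets uniformly in n. *)
Lemma affine_step s f M N (r : R) : adm K s -> 1 <= M -> affine_approx s (conjn s f) M N -> 1 <= r ->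
  exists2 c0, 0 <= c0 & exists N', forall n w, (N' <= n)%N -> n2 w <= r ->
    dist2 (aff (conjn s f n.+1) (henon (s n) w)) (henon (s n) (aff (conjn s f n) w)) <= c0 / rho K s n.
Proof.
move=> hs M1 H r1; have k1 := K1; have l1 := lipc_ge1 K1 (ltac:(lra) : 0 <= r).
pose r2 := lipc r + K * r.
have kr : 1 <= K * r by apply: mulr_ege1.
pose B := M * (1 + 2 * r) + M * (1 + r) ^+ 2.
have [N' hN'] := rho_big r2 hs.
have Mr : 0 <= M * r by rewrite mulr_ge0 //; lra.
have Mq : 0 <= M * (1 + r) ^+ 2 by rewrite mulr_ge0 ?sqr_ge0 //; lra.
have B1 : 1 <= B by rewrite /B; lra.
have BB : M * (1 + 2 * r) <= B by rewrite /B lerDl.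
have M0 : 0 <= M by lra.
have lB := lipc_ge1 K1 (ltac:(lra) : 0 <= B).
have Mq2 : 0 <= M * (1 + r2) ^+ 2 by rewrite mulr_ge0 ?sqr_ge0 //; lra.
have lKM : 0 <= (lipc B + K) * (M * (1 + r) ^+ 2) by rewrite mulr_ge0 //; lra.
exists (M * (1 + r2) ^+ 2 + (lipc B + K) * (M * (1 + r) ^+ 2)); first by lra.
exists (maxn N N') => n w; rewrite geq_max => /andP[Nn N'n] hw.
have [_ q2 q0] := rho_ge K1 n hs; have [a1 a2 a3 a4] := H n Nn.
have [_ _ _ b4] := H n.+1 (leqW Nn).
have rr : rho K s n <= rho K s n.+1 := rho_mono hs (leqnSn n).
have hr2 := hN' n N'n.
have rr2 : r <= r2.
  have : 1 * r <= K * r by rewrite ler_wpM2r //; lra.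
  by rewrite /r2; lra.
have hhw : n2 (henon (s n) w) <= r2 by exact: henon_le.
have w0 := n2_ge0 w; have hw0 := n2_ge0 (henon (s n) w).
have i0 : 0 <= (rho K s n)^-1 by rewrite invr_ge0 ltW.
have E1 : dist2 (conjn s f n.+1 (henon (s n) w)) (aff (conjn s f n.+1) (henon (s n) w)) <=
    M * (1 + r2) ^+ 2 / rho K s n.
  apply: le_trans (b4 _ (le_trans hhw (le_trans hr2 rr))) _; apply: ler_pM.
  - by rewrite mulr_ge0 ?sqr_ge0.
  - by rewrite invr_ge0; exact: ltW (lt_le_trans q0 rr).
  - by rewrite ler_wpM2l //; apply: lerXn2r; rewrite ?nnegrE; move: w0 hw0 hhw hw r1 rr2; clear; lra.
  - by rewrite lef_pV2 ?posrE //; exact: lt_le_trans q0 rr.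
have sq : M * (1 + n2 w) ^+ 2 <= M * (1 + r) ^+ 2.
  by rewrite ler_wpM2l //; apply: lerXn2r; rewrite ?nnegrE; move: w0 hw0 hhw hw r1 rr2; clear; lra.
have E2 : dist2 (conjn s f n w) (aff (conjn s f n) w) <= M * (1 + r) ^+ 2 / rho K s n.
  by apply: le_trans (a4 w (le_trans hw (le_trans rr2 hr2))) _; rewrite ler_wpM2r.
have A1 : n2 (aff (conjn s f n) w) <= M * (1 + 2 * r).
  by apply: le_trans (aff_le w a1 a2 a3) _; rewrite ler_wpM2l // lerD2l ler_pM2l.
have A2 : n2 (conjn s f n w) <= B.
  apply: le_trans (n2_dist2 _ (aff (conjn s f n) w)) _; apply: lerD => //.
  apply: le_trans E2 _; rewrite ler_pdivrMr // ler_peMr //; exact: le_trans (ler1n _ 2) q2.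
have L1 := henon_lip (hs n) B1 A2 (le_trans A1 BB).
apply: le_trans (dist2_tri (conjn s f n.+1 (henon (s n) w)) _ _) _.
rewrite mulrDl; apply: lerD; first by rewrite dist2_sym.
rewrite conjn_henon //; apply: le_trans L1 _; rewrite -mulrA ler_wpM2l //; move: lB k1; clear; lra.
Qed.

End AffineRows.

(** * Drift of the affine parts over an even period *)

Section AffineDrift.
Variable R : realType.
Local Notation C := R[i].
Variable K : R.
Hypothesis K1 : 1 <= K.
Local Notation err := (esc_err K).
Local Notation green := (green K).
Local Notation lipc := (lipc K).
Implicit Types (s : nat -> henon_data R) (z w p : C2 R) (h : henon_data R).

Local Notation affine_approx := (affine_approx K).

Lemma div_rho_le s (a : R) n m : adm K s -> 0 <= a -> (n <= m)%N -> a / rho K s m <= a / rho K s n.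
Proof.
move=> hs a0 nm_; have [_ _ h1] := rho_ge K1 n hs; have [_ _ h2] := rho_ge K1 m hs.
by rewrite ler_wpM2l // lef_pV2 ?posrE // rho_mono.
Qed.

Definition aff11 (F : C2 R -> C2 R) : C := (F (1, 0)).1 - (F (0, 0)).1.
Definition aff12 (F : C2 R -> C2 R) : C := (F (0, 1)).1 - (F (0, 0)).1.
Definition aff21 (F : C2 R -> C2 R) : C := (F (1, 0)).2 - (F (0, 0)).2.
Definition aff22 (F : C2 R -> C2 R) : C := (F (0, 1)).2 - (F (0, 0)).2.

Lemma affE1 F w : (aff F w).1 = (F (0, 0)).1 + aff11 F * w.1 + aff12 F * w.2.
Proof. by []. Qed.

Lemma affE2 F w : (aff F w).2 = (F (0, 0)).2 + aff21 F * w.1 + aff22 F * w.2.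
Proof. by []. Qed.

Section Drift.
Variables (s : nat -> henon_data R) (f : C2 R -> C2 R) (M : R) (N : nat).
Hypothesis hs : adm K s.
Hypothesis M1 : 1 <= M.
Hypothesis Fa : affine_approx s (conjn s f) M N.
Local Notation F := (conjn s f).
Local Notation rh := (rho K s).

Lemma aff_coef_le n : (N <= n)%N ->
  [/\ nm (F n (0, 0)).1 <= M, nm (F n (0, 0)).2 <= M, nm (aff21 (F n)) <= M & nm (aff22 (F n)) <= M].
Proof.
move=> /Fa[]; rewrite n2_le !dist2_le => /andP[a1 a2] /andP[b1 b2] /andP[c1 c2] _.
by split.
Qed.

(** Up to O(1 / rho_n) the affine parts are diagonal, and the first component of the one at time n +
    1 is the second component of the one at time n. *)
Lemma affine_first_row : exists2 c, 0 <= c & exists N', forall n, (N' <= n)%N ->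
  [/\ nm (aff12 (F n.+1)) <= c / rh n, nm (aff21 (F n)) <= c / rh n,
   nm (aff11 (F n.+1) - aff22 (F n)) <= c / rh n & nm ((F n.+1 (0, 0)).1 - (F n (0, 0)).2) <= c / rh n].
Proof.
have k1 := K1; have k2 : 1 <= K ^+ 2 by apply: exprn_ege1.
have [c c0 [N' hN']] := affine_step K1 hs M1 Fa (ltac:(lra) : 1 <= 5 * K ^+ 2).
exists (4 * K * c); first by rewrite mulr_ge0 //; lra.
exists N' => n Nn; have [_ _ r0] := rho_ge K1 n hs.
have e0 : 0 <= c / rh n by rewrite divr_ge0 // ltW.
have := @first_row R K K1 (s n) (aff11 (F n.+1)) (aff12 (F n.+1)) (F n.+1 (0, 0)).1
  (aff21 (F n)) (aff22 (F n)) (F n (0, 0)).2 _ (hs n) e0.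
case=> [x y hx hy|h1 h2 h3 h4].
  have := hN' n (x, y) Nn; rewrite n2_le hx hy => /(_ isT).
  by rewrite dist2_le => /andP[].
rewrite -[4 * K * c / _]mulrA; split=> //; apply: le_trans h1 _.
by rewrite ler_wpM2r //; lra.
Qed.

Lemma affine_second_row (r : R) : 1 <= r -> exists2 c, 0 <= c & exists N', forall n x y, (N' <= n)%N ->
  nm x <= r -> nm y <= r ->
  nm (aff22 (F n.+2) * ((s n.+1).1.[y] - (s n.+1).2 * x) + (F n.+2 (0, 0)).2 -
    (s n.+1).1.[aff22 (F n.+1) * y + (F n.+1 (0, 0)).2] +
    (s n.+1).2 * (aff11 (F n.+1) * x + (F n.+1 (0, 0)).1)) <= c / rh n.
Proof.
move=> r1; have k1 := K1; have [c c0 [N1 h1]] := affine_first_row.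
have [d d0 [N2 h2]] := affine_step K1 hs M1 Fa r1.
pose B := M * (1 + 2 * r).
have m1 := M1; have Mr : 0 <= M * r by rewrite mulr_ge0 //; lra.
have B1 : 1 <= B by rewrite /B; lra.
have lB := lipc_ge1 K1 (ltac:(lra) : 0 <= B).
have cr : 0 <= c * r by rewrite mulr_ge0 //; lra.
have p1 : 0 <= lipc B * (c * r) by rewrite mulr_ge0 //; lra.
have p2 : 0 <= K * (c * r) by rewrite mulr_ge0 //; lra.
exists (d + c * r + lipc B * (c * r) + K * (c * r)); first by lra.
exists (maxn N (maxn N1 N2)) => n x y; rewrite !geq_max => /andP[Nn /andP[N1n N2n]] hx hy.
have [a1 a2 a3 a4] := aff_coef_le (leqW Nn).
have [b12 _ _ _] := h1 n N1n; have [_ b21 _ _] := h1 n.+1 (leqW N1n).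
have [_ c21 _ _] := h1 n.+2 (leqW (leqW N1n)).
have hw : n2 ((x, y) : C2 R) <= r by rewrite n2_le hx.
have := h2 n.+1 (x, y) (leqW N2n) hw; rewrite dist2_le => /andP[_].
set q := s n.+1; have tq : tame K q := hs _.
set A := F n.+2; set A' := F n.+1 in a1 a2 a3 a4 b12 b21 *.
set t := (A' (0, 0)).2 in a2 *; set la := aff21 A' in a3 b21; set nu := aff22 A' in a4 *.
rewrite [X in nm X <= _ -> _](_ : _ = (A (0, 0)).2 + aff21 A * y + aff22 A * (q.1.[y] - q.2 * x)
  - (q.1.[t + la * x + nu * y] - q.2 * ((A' (0, 0)).1 + aff11 A' * x + aff12 A' * y))) // => H.
have rn2 : d / rh n.+1 <= d / rh n := div_rho_le hs d0 (leqnSn n).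
have rn3 : c / rh n.+1 <= c / rh n := div_rho_le hs c0 (leqnSn n).
have rn4 : c / rh n.+2 <= c / rh n := div_rho_le hs c0 (leqW (leqnSn n)).
have -> : aff22 A * (q.1.[y] - q.2 * x) + (A (0, 0)).2 - q.1.[nu * y + t] + q.2 * (aff11 A' * x + (A' (0, 0)).1) =
  ((A (0, 0)).2 + aff21 A * y + aff22 A * (q.1.[y] - q.2 * x)
  - (q.1.[t + la * x + nu * y] - q.2 * ((A' (0, 0)).1 + aff11 A' * x + aff12 A' * y)))
  - aff21 A * y + (q.1.[t + la * x + nu * y] - q.1.[nu * y + t]) - q.2 * (aff12 A' * y) by ring.
have -> : (d + c * r + lipc B * (c * r) + K * (c * r)) / rh n =
  d / rh n + c * r / rh n + lipc B * (c * r) / rh n + K * (c * r) / rh n by ring.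
apply: le_trans (nmB _ _) _; apply: lerD; last first.
  rewrite !nmM -!mulrA; apply: ler_pM; rewrite ?mulr_ge0 ?nm_ge0 ?(tame_jac_ub tq) //.
  by rewrite [r / _]mulrC mulrA; apply: ler_pM; rewrite ?nm_ge0.
apply: le_trans (nmD _ _) _; apply: lerD; last first.
  have s1 : nm (la * x) <= M * r by rewrite nmM; apply: ler_pM; rewrite ?nm_ge0.
  have s2 : nm (nu * y) <= M * r by rewrite nmM; apply: ler_pM; rewrite ?nm_ge0.
  apply: le_trans (poly_lipc K1 tq B1 _ _) _.
  - by apply: le_trans (nmD _ _) _; rewrite /B; lra.
  - by apply: le_trans (nmD _ _) _; apply: le_trans (lerD (nmD _ _) (lexx _)) _; rewrite /B; lra.
  rewrite -mulrA ler_wpM2l //; first by lra.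
  have -> : t + la * x + nu * y - (nu * y + t) = la * x by ring.
  rewrite nmM -mulrA [r / _]mulrC mulrA; apply: ler_pM; rewrite ?nm_ge0 //.
  exact: le_trans b21 _.
apply: le_trans (nmB _ _) _; apply: lerD; first exact: le_trans H _.
rewrite nmM -mulrA [r / _]mulrC mulrA; apply: ler_pM; rewrite ?nm_ge0 //.
exact: le_trans c21 _.
Qed.

Lemma aff22_drift2 : exists2 c, 0 <= c & exists N', forall n, (N' <= n)%N ->
  nm (aff22 (F n.+2) - aff22 (F n)) <= c / rh n.
Proof.
have k1 := K1; have [c c0 [N1 h1]] := affine_first_row.
have [d d0 [N2 h2]] := affine_second_row (lexx 1).
have Kd : 0 <= K * d by rewrite mulr_ge0 //; lra.
exists (2 * K * d + c); first by lra.
exists (maxn N1 N2) => n; rewrite geq_max => /andP[N1n N2n].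
have [_ _ b _] := h1 n N1n.
have := second_row K1 (hs n.+1) (fun x y hx hy => h2 n x y N2n hx hy) => b'.
rewrite mulrDl -[2 * K * d / _]mulrA; apply: le_trans (nm_tri _ (aff11 (F n.+1)) _) _.
exact: lerD.
Qed.

Lemma aff22_drift j : exists2 c, 0 <= c & exists N', forall n, (N' <= n)%N ->
  nm (aff22 (F (n + j.*2)) - aff22 (F n)) <= c / rh n.
Proof.
have [c c0 [N' hN]] := aff22_drift2; elim: j => [|j [d d0 [N2 hN2]]].
  by exists 0 => //; exists 0%N => n _; rewrite addn0 subrr nm0 mul0r.
exists (c + d); first by lra.
exists (maxn N' N2) => n; rewrite geq_max => /andP[N1n N2n].
rewrite doubleS !addnS mulrDl; apply: le_trans (nm_tri _ (aff22 (F (n + j.*2))) _) _.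
apply: lerD; last exact: hN2.
apply: le_trans (hN _ _) _; first by apply: leq_trans N1n _; exact: leq_addr.
by apply: div_rho_le => //; exact: leq_addr.
Qed.

End Drift.

(** The conjugates of f and g are inverse to each other and nearly diagonal, so the product of their
    lower right entries is close to 1. *)
Lemma aff22_lb s c f g M M' N N' : adm K s -> aut2 (fun w => green s w < c) f g -> level_exp K + err < c ->
  1 <= M -> affine_approx s (conjn s f) M N -> 1 <= M' -> affine_approx s (conjn s g) M' N' ->
  exists2 B, 1 <= B & exists N2, forall n, (N2 <= n)%N -> B^-1 <= nm (aff22 (conjn s f n)).
Proof.
move=> hs [_ hgf] hc M1 Fa M1' Ga; have k1 := K1.
have [d d0 [N1 h1]] := affine_first_row hs M1 Fa.
pose B0 := 3 * M' + 4 * M'.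
pose E0 := M * (1 + B0) ^+ 2 + 2 * M * (4 * M').
have M'0 : 0 <= M' by lra.
have M0 : 0 <= M by lra.
have B00 : 0 <= B0 by rewrite /B0; lra.
have E00 : 0 <= E0 by rewrite /E0 addr_ge0 // !mulr_ge0 ?sqr_ge0 //; lra.
have [N3 h3] := rho_big K1 (2 * (2 * E0 + d * M') + 1 + B0) hs.
exists (2 * M'); first by lra.
exists (maxn (maxn N N') (maxn N1 N3)) => n; rewrite !geq_max => /andP[/andP[Nn N'n] /andP[N1n N3n]].
have [_ r2 r0] := rho_ge K1 n hs; have r3 := h3 n N3n.
have [a1 a2 a3 a4] := Fa n Nn; have [b1 b2 b3 b4] := Ga n N'n.
have dM' : 0 <= d * M' by rewrite mulr_ge0.
set F := conjn s f n in a1 a2 a3 a4 *; set G := conjn s g n in b1 b2 b3 b4.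
have inv w : n2 w <= 1 -> F (G w) = w.
  move=> hw; rewrite /F /G /conjn orbitK; last by move=> k; exact: (tame_jac K1 (hs k)).
  have [_ _ ->] := hgf (orbV s n w) (rho_polydisc K1 hs hc (ltac:(lra) : n2 w <= rho K s n)).
  by rewrite orbitVK // => k; exact: (tame_jac K1 (hs k)).
have G1 w : n2 w <= 1 -> [/\ dist2 (G w) (aff G w) <= 4 * M' / rho K s n, n2 (aff G w) <= 3 * M' & n2 (G w) <= B0].
  move=> hw; have w0 := n2_ge0 w.
  have e1 : dist2 (G w) (aff G w) <= 4 * M' / rho K s n.
    apply: le_trans (b4 w _) _; first by lra.
    rewrite ler_wpM2r ?invr_ge0 ?(ltW r0) // mulrC ler_wpM2r //.
    apply: le_trans (_ : 2 ^+ 2 <= _); first by apply: lerXn2r; rewrite ?nnegrE; move: w0 hw; clear; lra.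
    by rewrite -natrX.
  have e2 : n2 (aff G w) <= 3 * M'.
    by apply: le_trans (aff_le w b1 b2 b3) _; rewrite mulrC ler_wpM2r //; lra.
  split=> //; apply: le_trans (n2_dist2 _ (aff G w)) _; apply: lerD => //.
  by apply: le_trans e1 _; rewrite ler_pdivrMr // ler_peMr ?mulr_ge0 //; move: r2; clear; lra.
have FG w : n2 w <= 1 -> nm (w.2 - (aff F (aff G w)).2) <= E0 / rho K s n.
  move=> hw; have [e1 e2 e3] := G1 w hw; rewrite -{1}(inv w hw).
  apply: le_trans (nm_tri _ (aff F (G w)).2 _) _; rewrite /E0 mulrDl; apply: lerD.
    apply: le_trans (dist2_2 _ _) (le_trans (a4 _ _) _); first by lra.
    rewrite ler_wpM2r ?invr_ge0 ?(ltW r0) // ler_wpM2l //; apply: lerXn2r; rewrite ?nnegrE //; have := n2_ge0 (G w); move: e3 B00; clear; lra.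
  have -> : (aff F (G w)).2 - (aff F (aff G w)).2 =
    aff21 F * ((G w).1 - (aff G w).1) + aff22 F * ((G w).2 - (aff G w).2).
    by rewrite !affE2; ring.
  apply: le_trans (nmD _ _) _; rewrite !nmM.
  have [_ _ c1 c2] := aff_coef_le Fa Nn.
  have t1 : nm (aff21 F) * nm ((G w).1 - (aff G w).1) <= M * (4 * M' / rho K s n).
    by apply: ler_pM; rewrite ?nm_ge0 //; exact: le_trans (dist2_1 _ _) e1.
  have t2 : nm (aff22 F) * nm ((G w).2 - (aff G w).2) <= M * (4 * M' / rho K s n).
    by apply: ler_pM; rewrite ?nm_ge0 //; exact: le_trans (dist2_2 _ _) e1.
  by rewrite -[2 * M * _ / _]mulrA -[2 * M * _]mulrA [2 * (M * _)]mulrDl !mul1r -[4 * M' / _]mulrA mulrA; move: t1 t2; rewrite !mulrA; clear; lra.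
have [_ c1 _ _] := h1 n N1n.
have w0 : n2 ((0, 0) : C2 R) <= 1 by rewrite n2_le !nm0 ler01.
have w1 : n2 ((0, 1) : C2 R) <= 1 by rewrite n2_le nm0 nm1 ler01 lexx.
have := FG _ w1; have := FG _ w0.
have -> : (aff F (aff G (0, 1))).2 = (aff F (aff G (0, 0))).2 + aff21 F * aff12 G + aff22 F * aff22 G.
  by rewrite !affE2 !affE1 /=; ring.
set q := (aff F (aff G (0, 0))).2 => f0 f1; rewrite [X in nm X <= _]/= in f0 f1.
have [g12 g22] : nm (aff12 G) <= M' /\ nm (aff22 G) <= M'.
  by move: b3; rewrite dist2_le => /andP[].
have small : nm (1 - aff22 F * aff22 G) <= (2 * E0 + d * M') / rho K s n.
  have -> : 1 - aff22 F * aff22 G = (1 - (q + aff21 F * aff12 G + aff22 F * aff22 G)) - (0 - q) + aff21 F * aff12 G by ring.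
  apply: le_trans (nmD _ _) _; apply: le_trans (lerD (nmB _ _) (lexx _)) _; rewrite nmM.
  have : nm (aff21 F) * nm (aff12 G) <= d / rho K s n * M' by apply: ler_pM; rewrite ?nm_ge0.
  have -> : (2 * E0 + d * M') / rho K s n = 2 * (E0 / rho K s n) + d / rho K s n * M' by ring.
  rewrite [X in nm (X - _)]/= in f1.
  by move: f0 f1; clear; lra.
have half : nm (1 - aff22 F * aff22 G) <= 1 / 2.
  by apply: le_trans small _; rewrite ler_pdivrMr //; move: r3 B00; clear; lra.
have := nm_sub_ge 1 (1 - aff22 F * aff22 G); rewrite subKr nm1 nmM => lo.
have up : nm (aff22 F) * nm (aff22 G) <= nm (aff22 F) * M' by rewrite ler_wpM2l ?nm_ge0.
rewrite -div1r ler_pdivrMr; last by move: M1'; clear; lra.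
by move: half lo up; clear; lra.
Qed.

Lemma aff_drift s c f g j : adm K s -> aut2 (fun w => green s w < c) f g ->
  preserves K s c f -> preserves K s c g -> level_exp K + err < c ->
  (forall n, s (n + j.*2)%N = s n) ->
  exists2 d, 0 <= d & exists N, forall n w, (N <= n)%N ->
    dist2 (aff (conjn s f (n.+2 + j.*2)) w) (aff (conjn s f n.+2) w) <= d / rho K s n * (1 + n2 w).
Proof.
move=> hs hfg pf pg hc per; have k1 := K1.
have [M M1 [N Fa]] := aut_affine K1 hs hfg pf pg hc.
have [M' M1' [N' Ga]] := aut_affine K1 hs (aut2_sym hfg) pg pf hc.
have [B B1 [N0 h0]] := aff22_lb hs hfg hc M1 Fa M1' Ga.
have [d d0 [N1 h1]] := affine_first_row hs M1 Fa.
have [d2 d20 [N2 h2]] := aff22_drift hs M1 Fa j.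
pose m := Num.max M B; have mM : M <= m by rewrite le_max lexx.
have mB : B <= m by rewrite le_max lexx orbT.
have m1 : 1 <= m by lra.
pose b := Num.max (2 * K ^+ 2 * (1 + 2 * m)) (K * (lipc (2 * m) + 1)).
have b1 : 2 * K ^+ 2 * (1 + 2 * m) <= b by rewrite le_max lexx.
have b2 : K * (lipc (2 * m) + 1) <= b by rewrite le_max lexx orbT.
have K2 : 1 <= K ^+ 2 by apply: exprn_ege1.
have b0 : 1 <= b.
  by apply: le_trans b1; apply: le_trans (_ : 1 * 1 <= _); [rewrite mulr1|apply: ler_pM; lra].
pose r := m * (b + m).
have r1 : 1 <= r by apply: mulr_ege1 => //; lra.
have lr := lipc_ge1 K1 (ltac:(lra) : 0 <= r).
have [d3 d30 [N3 h3]] := affine_second_row hs M1 Fa r1.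
have tB : 1 <= 2 * M * r by apply: mulr_ege1 => //; lra.
pose T := 2 * M * r; have lT := lipc_ge1 K1 (ltac:(rewrite /T; lra) : 0 <= T).
pose e1 := 2 * d3 + d2 * lipc r + lipc T * (d2 * r).
have p1 : 0 <= d2 * lipc r by rewrite mulr_ge0 //; lra.
have p2 : 0 <= lipc T * (d2 * r) by apply: mulr_ge0; [exact: le_trans ler01 lT|apply: mulr_ge0 => //; exact: le_trans ler01 r1].
have e10 : 0 <= e1 by rewrite /e1; lra.
exists (6 * d + d2 + 2 * e1); first by lra.
exists (maxn (maxn N N0) (maxn (maxn N1 N2) N3)) => n w; rewrite !geq_max.
move=> /andP[/andP[Nn N0n] /andP[/andP[N1n N2n] N3n]].
set q := j.*2 in h2 per *; pose R0 := (rho K s n)^-1.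
have [_ r2 r0] := rho_ge K1 n hs.
have i0 : 0 <= R0 by rewrite invr_ge0 ltW.
have dr a k l : 0 <= a -> (n <= k)%N -> l <= a / rho K s k -> l <= a * R0.
  by move=> a0 nk h; apply: le_trans h _; exact: div_rho_le.
(* The second-row relations at times k and k + q involve the same map h by periodicity. Subtracting
   them, with the slopes already known to agree, leaves the situation of [translation_drift]. *)
have tdrift k : (n <= k)%N ->
    nm ((conjn s f (k.+1 + q) (0, 0)).2 - (conjn s f k.+1 (0, 0)).2) <= 2 * e1 * R0.
  move=> nk; have Nk l : (N <= k + l)%N by apply: leq_trans (leq_trans Nn nk) (leq_addr _ _).
  have N1k l : (N1 <= k + l)%N by apply: leq_trans (leq_trans N1n nk) (leq_addr _ _).
  have N3k l : (N3 <= k + l)%N by apply: leq_trans (leq_trans N3n nk) (leq_addr _ _).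
  have N2k : (N2 <= k)%N := leq_trans N2n nk.
  have N0k : (N0 <= k)%N := leq_trans N0n nk.
  rewrite -mulrA; set h := s k.+1.
  have hh : s (k + q).+1 = h by rewrite /h -addSn per.
  have th : tame K h := hs _.
  have [_ t0 _ n0] := aff_coef_le Fa (leqW (leq_trans Nn nk)).
  have Nkq : (N <= k.+1 + q)%N by rewrite addSn; apply: leqW.
  have [_ t1 _ n1] := aff_coef_le Fa Nkq.
  have u1 : nm (aff22 (conjn s f (k.+1 + q)) - aff22 (conjn s f k.+1)) <= d2 * R0.
    by apply: (dr _ k.+1) => //; [exact: leqW|apply: h2; exact: leqW].
  have u2 : nm (aff22 (conjn s f (k.+2 + q)) - aff22 (conjn s f k.+2)) <= d2 * R0.
    by apply: (dr _ k.+2) => //; [do 2 apply: leqW|apply: h2; do 2 apply: leqW].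
  have lb : m^-1 <= nm (aff22 (conjn s f k.+1)).
    by apply: le_trans (h0 _ (leqW N0k)); rewrite lef_pV2 ?posrE //; move: m1 B1 mB; clear; lra.
  set x0 := conjn s f k.+1 in t0 n0 u1 lb *; set x1 := conjn s f (k.+1 + q) in t1 n1 u1 *.
  apply: (@translation_drift R K K1 h (aff22 x0) (x0 (0, 0)).2 (x1 (0, 0)).2
    (((conjn s f (k.+2 + q) (0, 0)).2 + h.2 * (x1 (0, 0)).1) - ((conjn s f k.+2 (0, 0)).2 + h.2 * (x0 (0, 0)).1))
    (e1 * R0) m b) => //.
  - exact: lt_le_trans ltr01 b0.
  - exact: le_trans t0 mM.
  - exact: le_trans t1 mM.
  move=> y hy; have nr : nm (0 : C) <= r by rewrite nm0 (le_trans ler01 r1).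
  have v1 : nm (aff22 (conjn s f k.+2) * h.1.[y] + (conjn s f k.+2 (0, 0)).2 -
      h.1.[aff22 x0 * y + (x0 (0, 0)).2] + h.2 * (x0 (0, 0)).1) <= d3 * R0.
    have := h3 k 0 y (leq_trans N3n nk) nr hy; rewrite !mulr0 subr0 add0r => v.
    exact: (dr d3 k).
  have v2 : nm (aff22 (conjn s f (k.+2 + q)) * h.1.[y] + (conjn s f (k.+2 + q) (0, 0)).2 -
      h.1.[aff22 x1 * y + (x1 (0, 0)).2] + h.2 * (x1 (0, 0)).1) <= d3 * R0.
    have := h3 (k + q)%N 0 y (N3k q) nr hy; rewrite !mulr0 subr0 add0r hh => v.
    by apply: (dr d3 (k + q)%N) => //; exact: leq_trans nk (leq_addr _ _).
  have v3 : nm (h.1.[aff22 x0 * y + (x1 (0, 0)).2] - h.1.[aff22 x1 * y + (x1 (0, 0)).2]) <= lipc T * (d2 * r) * R0.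
    have Mr : M * 1 <= M * r by rewrite ler_wpM2l // (le_trans ler01 M1).
    have in_ x x' : nm x <= M -> nm x' <= M -> nm (x * y + x') <= T.
      move=> hx hx'; apply: le_trans (nmD _ _) _; rewrite nmM.
      have : nm x * nm y <= M * r by apply: ler_pM; rewrite ?nm_ge0.
      by rewrite /T -mulrA; move: hx' Mr; clear; lra.
    apply: le_trans (poly_lipc K1 th tB (in_ _ _ n1 t1) (in_ _ _ n0 t1)) _.
    rewrite -[_ * _ * R0]mulrA -/T; apply: ler_wpM2l; first exact: le_trans ler01 lT.
    have -> : aff22 x0 * y + (x1 (0, 0)).2 - (aff22 x1 * y + (x1 (0, 0)).2) = (aff22 x0 - aff22 x1) * y by ring.
    by rewrite nmM mulrAC; apply: ler_pM; rewrite ?nm_ge0 // nm_distC.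
  have v4 : nm ((aff22 (conjn s f (k.+2 + q)) - aff22 (conjn s f k.+2)) * h.1.[y]) <= d2 * lipc r * R0.
    by rewrite nmM mulrAC; apply: ler_pM; rewrite ?nm_ge0 // (poly_le_lipc K1).
  set n2_ := aff22 (conjn s f k.+2) in v1 v4; set n3_ := aff22 (conjn s f (k.+2 + q)) in v2 v4.
  set a := h.1.[aff22 x0 * y + (x0 (0, 0)).2] in v1 *; set a1 := h.1.[aff22 x1 * y + (x1 (0, 0)).2] in v2 v3.
  set a2 := h.1.[aff22 x0 * y + (x1 (0, 0)).2] in v3 *.
  set cc := (X in nm (_ - X)).
  have -> : a2 - a - cc = (n2_ * h.1.[y] + (conjn s f k.+2 (0, 0)).2 - a + h.2 * (x0 (0, 0)).1)
     - (n3_ * h.1.[y] + (conjn s f (k.+2 + q) (0, 0)).2 - a1 + h.2 * (x1 (0, 0)).1)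
     + (a2 - a1) + (n3_ - n2_) * h.1.[y] by rewrite /cc; ring.
  apply: le_trans (nmD _ _) _; apply: le_trans (lerD (nmD _ _) (lexx _)) _.
  apply: le_trans (lerD (lerD (nmB _ _) (lexx _)) (lexx _)) _.
  have -> : e1 * R0 = 2 * (d3 * R0) + d2 * lipc r * R0 + lipc T * (d2 * r) * R0 by rewrite /e1; ring.
  by move: v1 v2 v3 v4; clear; lra.
have A12 l : (n.+2 <= l)%N -> nm (aff12 (conjn s f l)) <= d * R0.
  case: l => [//|l] hl; have nl : (n <= l)%N by move: hl; rewrite ltnS; exact: ltnW.
  by apply: (dr d l) => //; have [] := h1 l (leq_trans N1n nl).
have A21 l : (n.+2 <= l)%N -> nm (aff21 (conjn s f l)) <= d * R0.
  move=> hl; have nl : (n <= l)%N by apply: leq_trans hl; do 2 apply: leqW.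
  by apply: (dr d l) => //; have [] := h1 l (leq_trans N1n nl).
have nq k : (n <= k + q)%N -> (N1 <= k + q)%N by exact: leq_trans.
have nl1 : (n <= n.+1 + q)%N by apply: leq_trans (leq_addr _ _); exact: leqnSn.
have [_ _ x11 x1] := h1 (n.+1 + q)%N (nq _ nl1).
have [_ _ y11 y1] := h1 n.+1 (leqW N1n).
move: x11 x1 => /(dr d _ _ d0 nl1) x11 /(dr d _ _ d0 nl1) x1.
move: y11 y1 => /(dr d _ _ d0 (leqnSn n)) y11 /(dr d _ _ d0 (leqnSn n)) y1.
have z11 := dr d2 _ _ d20 (leqnSn n) (h2 n.+1 (leqW N2n)).
have z22 := dr d2 _ _ d20 (leqW (leqnSn n)) (h2 n.+2 (leqW (leqW N2n))).
have t1 := tdrift n (leqnn n); have t2 := tdrift n.+1 (leqnSn n).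
have lq : (n.+2 <= n.+2 + q)%N by exact: leq_addr.
have := A12 _ lq; have := A12 _ (leqnn _); have := A21 _ lq; have := A21 _ (leqnn _).
rewrite -[(n.+1 + q).+1]addSn in x11 x1.
set F := conjn s f (n.+2 + q) in x11 x1 z22 t2 *; set F' := conjn s f n.+2 in y11 y1 z22 t2 *.
move=> a1 a2 a3 a4; have w0 := n2_ge0 w; have w1 := n2_1 w; have w2 := n2_2 w.
set G := conjn s f (n.+1 + q) in x11 x1 z11 t1; set G' := conjn s f n.+1 in y11 y1 z11 t1.
have dR : 0 <= d * R0 by rewrite mulr_ge0.
have dR2 : 0 <= d2 * R0 by rewrite mulr_ge0.
have eR : 0 <= 2 * e1 * R0 by rewrite !mulr_ge0.
have b1' : nm (aff11 F - aff11 F') <= 2 * (d * R0) + d2 * R0.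
  apply: le_trans (nm_tri _ (aff22 G) _) _; apply: le_trans (lerD x11 (nm_tri _ (aff22 G') _)) _.
  by rewrite [nm (aff22 G' - _)]nm_distC; move: y11 z11; clear; lra.
have b2' : nm ((F (0, 0)).1 - (F' (0, 0)).1) <= 2 * (d * R0) + 2 * e1 * R0.
  apply: le_trans (nm_tri _ (G (0, 0)).2 _) _; apply: le_trans (lerD x1 (nm_tri _ (G' (0, 0)).2 _)) _.
  by rewrite [nm ((G' (0, 0)).2 - _)]nm_distC; move: y1 t1; clear; lra.
have b3' : nm (aff12 F - aff12 F') <= 2 * (d * R0) by apply: le_trans (nmB _ _) _; move: a3 a4; clear; lra.
have b4' : nm (aff21 F - aff21 F') <= 2 * (d * R0) by apply: le_trans (nmB _ _) _; move: a1 a2; clear; lra.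
have tri (x y z : C) X Y Z : nm x <= X -> nm y <= Y -> nm z <= Z -> 0 <= X -> 
    nm (x + y * w.1 + z * w.2) <= (X + Y + Z) * (1 + n2 w).
  move=> hx hy hz X0; apply: le_trans (nmD _ _) _; apply: le_trans (lerD (nmD _ _) (lexx _)) _; rewrite !nmM.
  have Y0 := le_trans (nm_ge0 _) hy; have Z0 := le_trans (nm_ge0 _) hz.
  have : nm y * nm w.1 <= Y * n2 w by apply: ler_pM; rewrite ?nm_ge0.
  have : nm z * nm w.2 <= Z * n2 w by apply: ler_pM; rewrite ?nm_ge0.
  have : 0 <= X * n2 w by rewrite mulr_ge0.
  by rewrite mulrDr mulr1 !mulrDl; move: hx Y0 Z0; clear; lra.
have -> : (6 * d + d2 + 2 * e1) / rho K s n = 6 * (d * R0) + d2 * R0 + 2 * e1 * R0 by rewrite /R0; ring.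
have w1' : 0 <= 1 + n2 w by move: w0; clear; lra.
rewrite dist2_le; apply/andP; split.
- have -> : (aff F w).1 - (aff F' w).1 = ((F (0, 0)).1 - (F' (0, 0)).1) + (aff11 F - aff11 F') * w.1
      + (aff12 F - aff12 F') * w.2.
    by rewrite !affE1; ring.
  apply: le_trans (tri _ _ _ _ _ _ b2' b1' b3' _) _; first by move: dR eR; clear; lra.
  by rewrite ler_wpM2r //; clear; lra.
- have -> : (aff F w).2 - (aff F' w).2 = ((F (0, 0)).2 - (F' (0, 0)).2) + (aff21 F - aff21 F') * w.1
      + (aff22 F - aff22 F') * w.2.
    by rewrite !affE2; ring.
  apply: le_trans (tri _ _ _ _ _ _ t2 b4' z22 eR) _.
  by rewrite ler_wpM2r //; move: dR; clear; lra.
Qed.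

End AffineDrift.

(** * Rigidity *)

Section AffineRigidity.
Variable R : realType.
Local Notation C := R[i].
Variable K : R.
Hypothesis K1 : 1 <= K.
Local Notation rad := (esc_rad K).
Local Notation err := (esc_err K).
Local Notation green := (green K).
Local Notation lipc := (lipc K).
Implicit Types (s : nat -> henon_data R) (z w p : C2 R) (h : henon_data R).

(** Identity theorem without connectedness: for large n the complex line through S_n p and S_n z has
    a disc around S_n p that contains S_n z and pulls back into {G < c}. *)
Lemma identity_sublevel s (c eta : R) (F G : C2 R -> C) : adm K s -> 0 < eta ->
  (forall z, green s z < c -> dif2 F z /\ dif2 G z) ->
  (forall z, green s z < eta -> F z = G z) ->
  forall z, green s z < c -> F z = G z.
Proof.
move=> hs e0 dFG eqFG z zc; have [p p0] := exists_green0 K1 hs.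
have [M M1 hM] := green_bounded_orbit K1 hs p0; have M0 : 0 <= M by lra.
have g0 := green_ge0 K1 z hs.
pose c' := (green s z + c) / 2.
have zc' : 0 < c' - green s z by rewrite /c'; lra.
have c'c : 0 < c - c' by rewrite /c'; lra.
have c'0 : 0 < c' by lra.
have r0 := rad_gt0 K1; have r100 := rad_ge100 K1.
pose kap := err + ln (n2 z + M + 1).
have [N1 hN1] := @Deg_lim R K s (err + 1) 0 (c - c') hs (lexx _) c'c.
have [N2 hN2] := @Deg_lim R K s (ln (rad + 4 * M)) 0 c' hs (lexx _) c'0.
have [N3 hN3] := @Deg_lim R K s (kap + ln 4) 0 _ hs (lexx _) zc'.
have [n [/hN1 h1 /hN2 h2 /hN3 h3 _]] := large4 N1 N2 N3 0.
rewrite !mulr0 !addr0 in h1 h2 h3.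
set D := Deg s n in h1 h2 h3; pose rho1 := expR (D * c').
have jacs k : (s k).2 != 0 by exact: (tame_jac K1 (hs k)).
pose pn := orb s n p; pose zn := orb s n z; pose tau := dist2 zn pn.
have znE : orbV s n zn = z by rewrite /zn orbitK.
have pnE : orbV s n pn = p by rewrite /pn orbitK.
have hrho : rad + 4 * M <= rho1.
  rewrite /rho1 -[leLHS]lnK ?posrE; last by lra.
  by rewrite ler_expR [D * _]mulrC.
have [tau0|tau0] := leP tau 0.
  have zp : z = p by rewrite -znE (dist2_eq0 tau0) pnE.
  by apply: eqFG; rewrite zp p0.
have tau4 : tau * 4 <= rho1.
  apply: le_trans (_ : expR (D * green s z + kap) * 4 <= _).
    by rewrite ler_pM2r //; exact: dist_orb_le.
  rewrite -[X in _ * X]lnK ?posrE // -expRD ler_expR.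
  by move: h3; rewrite mulrBl [c' * _]mulrC [green s z * _]mulrC; clear; lra.
have [u u1 hu] := line_through tau0.
pose cv t := orbV s n (line pn u t).
have cvd t : hcurve cv t by apply: hcurve_comp (hcurve_line _ _ _) _; exact: holo_orbV.
have cn t : nm t <= rho1 / 2 -> green s (cv t) < c.
  move=> ht; apply: (polydisc_lt K1 hs _ h1); first by rewrite -/D -/rho1; lra.
  apply: le_trans (n2_dist2 _ pn) _; have := line_dist pn t u1.
  by have := hM n; rewrite -/pn -/D -/rho1; move: ht hrho r0 M0; clear; lra.
have [d1 d10 hd1] := green_cont K1 p hs e0.
have [d2 d20 hd2] := hcurve_cont (cvd 0) d10.
have cv0 : cv 0 = p by rewrite /cv line0 pnE.
have := @identity_disc R (fun t => F (cv t) - G (cv t)) 0 (d2 / 2) (rho1 / 2) _ _ _ tau%:C%C.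
have cvt : cv tau%:C%C = z by rewrite /cv hu znE.
rewrite subr0 nm_real (gtr0_norm tau0) cvt => H.
apply/eqP; rewrite -subr_eq0; apply/eqP; apply: H.
- by lra.
- move=> t; rewrite subr0 => /cn /dFG[dF dG].
  by apply: cdifB; apply: dif2_curve.
- move=> t; rewrite subr0 => ht; apply/eqP; rewrite subr_eq0; apply/eqP; apply: eqFG.
  have /hd2 : nm (t - 0) < d2 by rewrite subr0; lra.
  by rewrite cv0 => /hd1; rewrite p0 subr0 ltr_norml => /andP[].
- by lra.
Qed.

(** Degrees at least double, so D_1 + ... + D_n <= 2 D_n: the Lipschitz constant of the inverse
    iterate is exp(O(eta D_n)) up to A^n. *)
Lemma prod_lipc s (Q eta : R) n : adm K s -> 1 <= Q -> 0 <= eta ->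
  \prod_(k < n) lipc (Q * expR (Deg s k.+1 * eta)) <=
  (2 * K ^+ 2 * (2 * Q) ^+ deg_cap K) ^+ n * expR (2 * (deg_cap K)%:R * eta * Deg s n).
Proof.
move=> hs Q1 e0; have k1 := K1; set A := 2 * K ^+ 2 * _; set m := deg_cap K.
have A0 : 0 <= A by rewrite /A !mulr_ge0 ?exprn_ge0 ?mulr_ge0 //; lra.
elim: n => [|n IH]; first by rewrite big_ord0 expr0 mul1r -[leLHS]expR0 ler_expR !mulr_ge0.
have Dn := Deg_gt0 n hs; have Dn1 := Deg_gt0 n.+1 hs.
have DD : 2 * Deg s n <= Deg s n.+1.
  rewrite /= [2 * _]mulrC ler_pM2l // (ler_nat _ 2); exact: tame_deg2 (hs n).
set x := expR (Deg s n.+1 * eta).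
have x1 : 1 <= x by rewrite /x -[leLHS]expR0 ler_expR mulr_ge0 // ltW.
have Qx : 1 <= Q * x by apply: mulr_ege1.
have st : lipc (Q * x) <= A * expR (m%:R * eta * Deg s n.+1).
  have -> : m%:R * eta * Deg s n.+1 = (Deg s n.+1 * eta) * m%:R by ring.
  rewrite expRM_natr -/x /lipc /A -/m -[_ * _ * x ^+ m]mulrA -exprMn ler_wpM2l //; first by rewrite mulr_ge0 ?exprn_ge0 //; lra.
  by apply: lerXn2r; rewrite ?nnegrE; lra.
rewrite big_ord_recr; apply: le_trans (_ : (A ^+ n * expR (2 * m%:R * eta * Deg s n)) * (A * expR (m%:R * eta * Deg s n.+1)) <= _).
  apply: ler_pM => //; last exact: le_trans ler01 (lipc_ge1 K1 (le_trans ler01 Qx)).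
  by apply: prodr_ge0 => k _; apply: le_trans ler01 (lipc_ge1 K1 _); rewrite mulr_ge0 ?expR_ge0 //; lra.
rewrite exprSr mulrACA -expRD ler_wpM2l //; first by rewrite mulr_ge0 // exprn_ge0.
have me : 0 <= m%:R * eta by rewrite mulr_ge0.
rewrite ler_expR; have : m%:R * eta * (2 * Deg s n) <= m%:R * eta * Deg s n.+1 by rewrite ler_wpM2l.
by clear; lra.
Qed.

Lemma Deg_le_cap s n : adm K s -> Deg s n.+1 <= (deg_cap K)%:R * Deg s n.
Proof.
by move=> hs; rewrite /= mulrC ler_wpM2r ?(ltW (Deg_gt0 n hs)) // ler_nat (hdeg_cap K1 (hs n)).
Qed.

Section Period.
Variables (s : nat -> henon_data R) (j : nat).
Hypothesis hs : adm K s.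
Hypothesis per : forall n, s (n + j.*2)%N = s n.
Local Notation q := (j.*2).

Lemma sshift_per k : sshift s (q * k) = s.
Proof.
elim: k => [|k IH]; first by rewrite muln0; apply: funext.
apply: funext => i; rewrite /sshift mulnS -addnA addnC per.
exact: (congr1 (fun t => t i) IH).
Qed.

Lemma orb_per k n z : orb s (q * k + n) z = orb s n (orb s (q * k) z).
Proof. by rewrite orb_shift sshift_per. Qed.

Lemma orbV_per k n z : orbV s (q * k + n) z = orbV s (q * k) (orbV s n z).
Proof. by rewrite orbV_shift sshift_per. Qed.

Lemma green_per k z : green s (orb s (q * k) z) = Deg s (q * k) * green s z.
Proof. by have := green_shift K1 (q * k) z hs; rewrite sshift_per. Qed.

Lemma conjn_per f k n w : conjn s f (q * k + n) w = conjn s (conjn s f (q * k)) n w.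
Proof. by rewrite /conjn orb_per orbV_per. Qed.

(* The n-th iterates of both sides are close to order 1 / rho n; the inverse of
   the n-th iterate near the orbit of f z has a Lipschitz constant exp(O(eta D_n)),
   which is negligible against rho n. *)
Lemma conjn_fix f g c : aut2 (fun w => green s w < c) f g ->
  preserves K s c f -> preserves K s c g -> level_exp K + err < c ->
  exists2 eta, 0 < eta & forall z, green s z < eta -> conjn s f q z = f z.
Proof.
move=> hfg pf pg hc; have k1 := K1; have lev0 := level_exp_gt0 K1.
have [M M1 [N Fa]] := aut_affine K1 hs hfg pf pg hc.
have [d d0 [N1 hd]] := aff_drift K1 hs hfg pf pg hc per.
set m := deg_cap K; have m1 : 1 <= m%:R :> R by rewrite (ler_nat R 1).
pose E : R := m%:R ^+ 2; have E1 : 1 <= E by apply: exprn_ege1.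
pose a : R := 2 + 2 * m%:R; have a0 : 4 <= a by rewrite /a; lra.
(* In [a] the 2 comes from the factor (1 + |w|)^2 and 2 m from [prod_lipc]; [E] converts D_{n+2}
   into D_n. The pull-back thus loses at most the square root of rho_n, and the remaining square
   root absorbs A^n and the constants. *)
pose eta := level_exp K / (2 * (E * a)).
have Ea : 1 <= E * a by apply: mulr_ege1 => //; lra.
have eta0 : 0 < eta by apply: divr_gt0 => //; lra.
have etaE : eta * (E * a) = level_exp K / 2 by rewrite /eta; field; lra.
have eta2 : eta <= level_exp K / 2 by rewrite -etaE ler_peMr // ltW.
exists eta => // z zeta; have zc : green s z < c by have := err_gt0 K1; lra.
have jacs k : (s k).2 != 0 by exact: (tame_jac K1 (hs k)).
have [_ fzc _] := hfg.1 z zc.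
pose Q := n2 z + n2 (f z) + expR err.
have er0 := err_gt0 K1.
have ee : 1 <= expR err by rewrite -[leLHS]expR0 ler_expR ltW.
have z0 := n2_ge0 z; have fz0 := n2_ge0 (f z).
have Q1 : 1 <= Q by rewrite /Q; lra.
pose P k := Q * expR (Deg s k * eta).
have bnd x k : n2 x <= n2 z + n2 (f z) -> green s x < eta -> n2 (orb s k x) <= P k.
  move=> hx hg; apply: le_trans (n2_orb_le K1 k x hs) _; have D0 := Deg_gt0 k hs.
  have e1 : 1 <= expR (Deg s k * eta) by rewrite -[leLHS]expR0 ler_expR mulr_ge0 // ltW.
  rewrite ge_max; apply/andP; split.
    by apply: le_trans (_ : Q * 1 <= _); [rewrite mulr1 /Q; lra|rewrite ler_wpM2l //; lra].
  apply: le_trans (_ : expR err * expR (Deg s k * eta) <= _).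
    by rewrite -expRD ler_expR addrC lerD2l ler_wpM2l // ltW.
  by rewrite ler_wpM2r ?expR_ge0 // /Q; lra.
suff key r : 0 < r -> r <= 1 -> dist2 (conjn s f q z) (f z) <= r.
  apply: dist2_eq0; apply/ler_addgt0Pr => e e0; rewrite add0r.
  apply: le_trans (key (Num.min e 1) _ _) _; rewrite ?ge_min ?lexx ?orbT //.
  by rewrite lt_min e0 ltr01.
move=> r0 r1; pose A := 2 * K ^+ 2 * (2 * Q) ^+ m.
have A1 : 1 <= A.
  have K2 : 1 <= K ^+ 2 by apply: exprn_ege1.
  by apply: mulr_ege1; [lra|apply: exprn_ege1; lra].
pose c1 := (2 * M + d) * (2 * Q) ^+ 2.
have c10 : 0 < c1 by rewrite /c1; apply: mulr_gt0; [lra|apply: exprn_gt0; lra].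
have lA : 0 <= ln A by apply: ln_ge0.
have lev2 : 0 < level_exp K / 2 by lra.
have [N2 hN2] := @Deg_lim R K s (ln (c1 * A ^+ 2 / r)) (ln A) _ hs lA lev2.
have [N3 hN3] := @Deg_lim R K s (ln Q) 0 _ hs (lexx _) lev2.
pose n := maxn (maxn N N1) (maxn N2 N3).
have [[Nn N1n] [N2n N3n]] : ((N <= n)%N /\ (N1 <= n)%N) /\ ((N2 <= n)%N /\ (N3 <= n)%N).
  by rewrite /n !leq_max !leqnn !orbT.
pose w := orb s n.+2 z; have hw : n2 w <= P n.+2 by apply: bnd => //; lra.
have Fw : conjn s f n.+2 w = orb s n.+2 (f z) by rewrite /conjn /w orbitK.
have Fqw : conjn s f (n.+2 + q) w = orb s n.+2 (conjn s f q z).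
  by rewrite addnC -{1}[q]muln1 conjn_per muln1 /conjn /w orbitK.
have rho2 : rho K s n.+2 <= rho K s (n.+2 + q) := rho_mono K1 hs (leq_addr _ _).
have D2 := Deg_gt0 n.+2 hs; have D0 := Deg_gt0 n hs.
have Prho : P n.+2 <= rho K s n.+2.
  have -> : rho K s n.+2 = expR (Deg s n.+2 * (level_exp K / 2)) * expR (Deg s n.+2 * (level_exp K / 2)).
    by rewrite -expRD -mulrDr /rho; congr (expR (_ * _)); lra.
  apply: ler_pM; rewrite ?expR_ge0 //; first by lra.
    have h3 := hN3 n.+2 (leqW (leqW N3n)); rewrite -[leLHS]lnK ?posrE; last by lra.
    by rewrite ler_expR mulrC; move: h3; rewrite mulr0 addr0.
  by rewrite ler_expR ler_wpM2l // ltW.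
have [_ q2 q0] := rho_ge K1 n hs.
have w0 := n2_ge0 w.
have rr2 : rho K s n <= rho K s n.+2 := rho_mono K1 hs (leqW (leqnSn n)).
have H1 k : (n <= k)%N -> n2 w <= rho K s k ->
    dist2 (conjn s f k w) (aff (conjn s f k) w) <= M * (1 + n2 w) ^+ 2 / rho K s n.
  move=> nk hk; have [_ _ _ H] := Fa k (leq_trans Nn nk).
  apply: le_trans (H _ hk) _; apply: div_rho_le => //.
  by rewrite mulr_ge0 ?sqr_ge0 //; lra.
have close : dist2 (conjn s f (n.+2 + q) w) (conjn s f n.+2 w) <= (2 * M + d) * (1 + n2 w) ^+ 2 / rho K s n.
  apply: le_trans (dist2_tri (aff (conjn s f (n.+2 + q)) w) _ _) _.
  have h1 : n2 w <= rho K s n.+2 := le_trans hw Prho.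
  have nq : (n <= n.+2 + q)%N by apply: leq_trans (leq_addr _ _); do 2 apply: leqW.
  have e1 := H1 _ nq (le_trans h1 rho2).
  have e2 := H1 n.+2 (leqW (leqnSn n)) h1.
  have e3 := hd n w N1n.
  apply: le_trans (lerD e1 (dist2_tri (aff (conjn s f n.+2) w) _ _)) _.
  rewrite [dist2 _ (conjn s f n.+2 w)]dist2_sym.
  have : d / rho K s n * (1 + n2 w) <= d / rho K s n * (1 + n2 w) ^+ 2.
    rewrite ler_wpM2l ?divr_ge0 ?(ltW q0) //.
    by rewrite expr2 ler_peMr ?addr_ge0 // lerDl.
  have -> : (2 * M + d) * (1 + n2 w) ^+ 2 / rho K s n =
    2 * (M * (1 + n2 w) ^+ 2 / rho K s n) + d / rho K s n * (1 + n2 w) ^+ 2 by ring.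
  by move: e1 e2 e3; clear; lra.
have -> : conjn s f q z = orbV s n.+2 (orb s n.+2 (conjn s f q z)) by rewrite orbitK.
apply: (@orbV_lip R K K1 s P n.+2) => //.
  by move=> k _; apply: bnd; [lra|rewrite pf].
rewrite -Fqw -Fw; apply: le_trans close _.
have P0 : 0 < \prod_(k < n.+2) lipc (P k.+1).
  apply: prodr_gt0 => k _; apply: lt_le_trans ltr01 (lipc_ge1 K1 _).
  by rewrite /P mulr_ge0 ?expR_ge0 //; lra.
have PL := prod_lipc n.+2 hs Q1 (ltW eta0); rewrite -/m -/A in PL.
rewrite ler_pdivlMr //; set Y := _ * expR _ in PL; set X := _ / rho K s n.
apply: le_trans (_ : X * Y <= _).
  apply: ler_wpM2l; last exact: PL.
  by rewrite divr_ge0 ?(ltW q0) // mulr_ge0 ?sqr_ge0 //; apply: addr_ge0 => //; apply: mulr_ge0 => //; exact: le_trans ler01 M1.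
rewrite /X /Y mulrAC ler_pdivrMr //.
set x := expR (Deg s n.+2 * eta) in hw.
have x1 : 1 <= x by rewrite /x -[leLHS]expR0 ler_expR mulr_ge0 // ltW.
have Qx : 1 <= Q * x by apply: mulr_ege1.
have sq : (2 * M + d) * (1 + n2 w) ^+ 2 <= c1 * x ^+ 2.
  rewrite /c1 -mulrA -exprMn ler_wpM2l //; first by apply: addr_ge0 => //; apply: mulr_ge0 => //; exact: le_trans ler01 M1.
  by apply: lerXn2r; rewrite ?nnegrE; move: hw w0 Qx; rewrite /P -/x; clear; lra.
apply: le_trans (ler_wpM2r _ sq) _.
  by rewrite mulr_ge0 ?expR_ge0 // exprn_ge0 // (le_trans ler01 A1).
have -> : c1 * x ^+ 2 * (A ^+ n.+2 * expR (2 * m%:R * eta * Deg s n.+2)) =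
   (c1 * A ^+ 2 * A ^+ n) * (expR (a * eta * Deg s n.+2)).
  have -> : a * eta * Deg s n.+2 = (Deg s n.+2 * eta) * 2%:R + 2 * m%:R * eta * Deg s n.+2 by rewrite /a; ring.
  rewrite expRD expRM_natr -/x (exprS A n.+1) (exprS A n).
  by move: (expR _) (A ^+ n) => u v; ring.
have DE : a * eta * Deg s n.+2 <= level_exp K / 2 * Deg s n.
  have d1 := Deg_le_cap n hs; have d2 := Deg_le_cap n.+1 hs.
  have : Deg s n.+2 <= E * Deg s n.
    apply: le_trans d2 _; rewrite /E expr2 -mulrA ler_wpM2l //.
  move=> h; apply: le_trans (_ : a * eta * (E * Deg s n) <= _).
    by rewrite ler_wpM2l // mulr_ge0 ?(ltW eta0) //; exact: le_trans (ler0n _ 4) a0.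
  by rewrite -etaE le_eqVlt; apply/orP; left; apply/eqP; ring.
have -> : r * rho K s n = (r * expR (level_exp K / 2 * Deg s n)) * expR (level_exp K / 2 * Deg s n).
  by rewrite -mulrA -expRD /rho; congr (_ * expR _); field.
have c1A : 0 < c1 * A ^+ 2 by rewrite mulr_gt0 // exprn_gt0 // (lt_le_trans ltr01 A1).
apply: ler_pM; rewrite ?expR_ge0 ?ler_expR //.
  by rewrite mulr_ge0 ?exprn_ge0 ?(le_trans ler01 A1) ?(ltW c1A) //; apply: mulr_ge0; rewrite ?exprn_ge0 ?(le_trans ler01 A1) // ltW.
have := hN2 n N2n; rewrite -ler_expR expRD lnK ?posrE ?divr_gt0 // mulrC expRM_natl lnK ?posrE; last exact: lt_le_trans ltr01 A1.
rewrite mulrA ler_pdivrMr // => hh; rewrite [_ * A ^+ n]mulrC [r * _]mulrC; exact: hh.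
Qed.

Lemma Deg_per k : Deg s (q * k) = Deg s q ^+ k.
Proof.
elim: k => [|k IH]; first by rewrite muln0.
by rewrite mulnSr Deg_shift sshift_per IH exprSr.
Qed.

Lemma green_perV k z : green s (orbV s (q * k) z) = green s z / Deg s (q * k).
Proof.
have D0 := Deg_gt0 (q * k) hs; have := green_per k (orbV s (q * k) z).
rewrite orbitVK; last by move=> i; exact: (tame_jac K1 (hs i)).
by move=> ->; rewrite mulrAC divff ?mul1r // gt_eqF.
Qed.

Lemma aut2_conjn f g c k : aut2 (fun w => green s w < c) f g ->
  aut2 (fun w => green s w < Deg s (q * k) * c) (conjn s f (q * k)) (conjn s g (q * k)).
Proof.
have D0 := Deg_gt0 (q * k) hs; have jacs i : (s i).2 != 0 by exact: (tame_jac K1 (hs i)).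
have main F G : (forall z, green s z < c -> [/\ holo F z, green s (F z) < c & G (F z) = z]) ->
    forall z, green s z < Deg s (q * k) * c ->
    [/\ holo (conjn s F (q * k)) z, green s (conjn s F (q * k) z) < Deg s (q * k) * c
      & conjn s G (q * k) (conjn s F (q * k) z) = z].
  move=> H z hz; have /H[h1 h2 h3] : green s (orbV s (q * k) z) < c by rewrite green_perV ltr_pdivrMr // mulrC.
  split; last by rewrite /conjn orbitK // h3 orbitVK.
    apply: (@holo_comp R (fun v => F (orbV s (q * k) v)) (orb s (q * k))); last exact: holo_orb.
    by apply: holo_comp; first exact: holo_orbV.
  by rewrite green_per ltr_pM2l.
by case=> [h1 h2]; split; exact: main.
Qed.

Lemma holo_ext_sublevel f g c : aut2 (fun w => green s w < c) f g ->
  preserves K s c f -> preserves K s c g -> level_exp K + err < c ->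
  forall z, green s z < c -> conjn s f q z = f z.
Proof.
move=> hfg pf pg hc z zc; have [eta eta0 he] := conjn_fix hfg pf pg hc.
have [h2 _] := aut2_conjn 1 hfg; rewrite muln1 in h2.
have D1 : 1 <= Deg s q by apply: le_trans (Deg_ge q hs); apply: exprn_ege1; lra.
have dd w : green s w < c -> holo (conjn s f q) w /\ holo f w.
  move=> wc; have [hf _ _] := hfg.1 w wc; split=> //; have [] := h2 w => //.
  have g0 := green_ge0 K1 w hs; have c0 : 0 <= c by lra.
  by apply: lt_le_trans wc _; rewrite ler_peMl.
have E1 := @identity_sublevel s c eta (fun w => (conjn s f q w).1) (fun w => (f w).1) hs eta0
  (fun w wc => conj (proj1 (dd w wc).1) (proj1 (dd w wc).2)) (fun w hw => congr1 fst (he w hw)) z zc.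
have E2 := @identity_sublevel s c eta (fun w => (conjn s f q w).2) (fun w => (f w).2) hs eta0
  (fun w wc => conj (proj2 (dd w wc).1) (proj2 (dd w wc).2)) (fun w hw => congr1 snd (he w hw)) z zc.
by rewrite [LHS]surjective_pairing E1 E2 -surjective_pairing.
Qed.

(** The conjugates F_{ql} extend f to the growing sublevel sets {G < D_{ql} c}, which exhaust the
    plane, so at each point they are eventually constant. Since they differ from their affine parts
    by O(1 / rho), the common value is affine. *)
Lemma aut_is_affine f g c : (0 < j)%N -> aut2 (fun w => green s w < c) f g ->
  preserves K s c f -> preserves K s c g -> level_exp K + err < c ->
  exists F : C2 R -> C2 R, [/\ forall z, green s z < c -> aff F z = f z,
    forall z, aff F (orb s q z) = orb s q (aff F z) &
    forall z, exists l0, forall l, (l0 <= l)%N -> aff F z = conjn s f (q * l) z].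
Proof.
move=> j0 hfg pf pg hc; have k1 := K1; have lev0 := level_exp_gt0 K1; have er0 := err_gt0 K1.
have jacs k : (s k).2 != 0 by exact: (tame_jac K1 (hs k)).
have q0 : (0 < q)%N by rewrite double_gt0.
have c0 : 0 < c by lra.
have D2 : 2 <= Deg s q.
  apply: le_trans (Deg_ge q hs); rewrite -{1}[2]expr1; apply: ler_weXn2l => //; lra.
have fixf := holo_ext_sublevel hfg pf pg hc.
pose F l := conjn s f (q * l).
have stable k l z : (k <= l)%N -> green s z < Deg s (q * k) * c -> F l z = F k z.
  move=> kl hz; rewrite -(subnK kl); elim: (l - k)%N => [|i IH] //.
  rewrite addSn -IH; set m := (i + k)%N.
  have -> : F m.+1 z = conjn s (conjn s f q) (q * m) z.
    by rewrite /F mulnS -{1}[q]muln1 conjn_per muln1.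
  rewrite /conjn -/(conjn s f q _) fixf // green_perV ltr_pdivrMr ?(Deg_gt0 _ hs) //.
  apply: lt_le_trans hz _; rewrite mulrC ler_pM2l // !Deg_per.
  by apply: ler_weXn2l; [lra|exact: leq_addl].
have big z : exists l0, forall l, (l0 <= l)%N -> green s z < Deg s (q * l) * c.
  have [N hN] := Deg_big (green s z / c + 1) hs; exists N => l Nl.
  rewrite -ltr_pdivrMr //; apply: lt_le_trans (hN (q * l)%N _); first by lra.
  by apply: leq_trans Nl _; exact: leq_pmull.
have [a0 h0] := big (0, 0); have [a1 h1] := big (1, 0); have [a2 h2] := big (0, 1).
(* From [k0] on the values at the three interpolation nodes, hence the affine parts, no longer
   change. *)
have [k0 [b0 b1 b2 _]] := large4 a0 a1 a2 0.
have affE l z : (k0 <= l)%N -> aff (F l) z = aff (F k0) z.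
  by move=> kl; rewrite /aff !(stable k0 l) ?h0 ?h1 ?h2.
have [M M1 [N Fa]] := aut_affine K1 hs hfg pf pg hc.
have main z k : (k0 <= k)%N -> green s z < Deg s (q * k) * c -> aff (F k0) z = F k z.
  move=> kk hz; apply/esym/dist2_eq0/ler_addgt0Pr => e e0; rewrite add0r.
  have w0 := n2_ge0 z; pose A := M * (1 + n2 z) ^+ 2.
  have A0 : 0 <= A by rewrite mulr_ge0 ?sqr_ge0 //; lra.
  have [N1 hN1] := rho_big K1 (n2 z + A / e) hs.
  have [l [Nl N1l kl _]] := large4 N N1 k 0.
  have ql : (l <= q * l)%N by exact: leq_pmull.
  have Ae : 0 <= A / e by rewrite divr_ge0 // ltW.
  have r1 := hN1 (q * l)%N (leq_trans N1l ql).
  have [_ _ _ H] := Fa (q * l)%N (leq_trans Nl ql).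
  rewrite -(stable k l) // -(affE l) ?(leq_trans kk) //.
  apply: le_trans (H z _) _; first by lra.
  have [_ _ r0] := rho_ge K1 (q * l) hs.
  rewrite -/A ler_pdivrMr //; rewrite -ler_pdivrMl // mulrC; lra.
have conv z : exists l0, forall l, (l0 <= l)%N -> aff (F k0) z = F l z.
  have [l0 hl] := big z; exists (maxn k0 l0) => l; rewrite geq_max => /andP[kl ll].
  by apply: main => //; exact: hl.
exists (F k0); split.
- move=> z zc; have [l0 hl] := conv z; rewrite (hl l0) // (stable 0%N) //.
    by rewrite /F muln0.
  by rewrite muln0 mul1r.
(* Conjugation by one more period sends the value at S_q z to S_q of the previous value at z, and
   both are the stable ones. *)
- move=> z; have [l0 hl] := conv z; have [l1 hl1] := conv (orb s q z).
  rewrite (hl (maxn l0 l1)) ?leq_maxl // (hl1 (maxn l0 l1).+1); last by apply: leqW; exact: leq_maxr.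
  set l := maxn l0 l1; rewrite /F /conjn.
  have -> : orbV s (q * l.+1) (orb s q z) = orbV s (q * l) z.
    by rewrite mulnSr orbV_per orbitK.
  by rewrite mulnSr orb_per.
- by [].
Qed.

End Period.

Definition affine2 (L : C2 R -> C2 R) := exists F, L = aff F.

(** Conjugation by S_{qN} enlarges the level to D_{qN} c, above the threshold of the affine
    estimates. The affine map obtained there commutes with S_q, so it restricts to f itself and not
    only to the conjugate of f. *)
Theorem aut_sublevel_affine s j f g c : adm K s -> (0 < j)%N -> (forall n, s (n + j.*2)%N = s n) ->
  0 < c -> aut2 (fun w => green s w < c) f g ->
  exists L L' : C2 R -> C2 R, [/\ affine2 L, affine2 L', cancel L L' & cancel L' L] /\
   [/\ forall z, green s z < c -> L z = f z,
     forall z, L (orb s j.*2 z) = orb s j.*2 (L z) & forall z, L' (orb s j.*2 z) = orb s j.*2 (L' z)].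
Proof.
move=> hs j0 per c0 hfg; set q := j.*2 in per *.
have jacs k : (s k).2 != 0 by exact: (tame_jac K1 (hs k)).
have [N hN] := Deg_big ((level_exp K + err) / c + 1) hs.
have q0 : (0 < q)%N by rewrite double_gt0.
pose n := (q * N)%N; pose C := Deg s n * c.
have D0 : 0 < Deg s n := Deg_gt0 n hs.
have C0 : 0 < C by rewrite mulr_gt0.
have hC : level_exp K + err < C.
  rewrite /C -ltr_pdivrMr //; apply: lt_le_trans (hN n _); first by lra.
  exact: leq_pmull.
pose f1 := conjn s f n; pose g1 := conjn s g n.
have hfg1 : aut2 (fun w => green s w < C) f1 g1 by exact: aut2_conjn.
have z0 : exists p, green s p = 0 by exact: exists_green0.
have pf : preserves K s C f1 by move=> z hz; exact: (green_aut K1 hs hfg1 C0 z0 hz).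
have pg : preserves K s C g1 by move=> z hz; exact: (green_aut K1 hs (aut2_sym hfg1) C0 z0 hz).
have [F [F1 F2 F3]] := aut_is_affine hs per j0 hfg1 pf pg hC.
have [G [G1 G2 G3]] := aut_is_affine hs per j0 (aut2_sym hfg1) pg pf hC.
have inv F' G' f' g' : aut2 (fun w => green s w < C) f' g' ->
    (forall z, exists l0, forall l, (l0 <= l)%N -> aff F' z = conjn s f' (q * l) z) ->
    (forall z, exists l0, forall l, (l0 <= l)%N -> aff G' z = conjn s g' (q * l) z) ->
    cancel (aff F') (aff G').
  move=> hfg' HF HG z; have [l0 h0] := HF z; have [l1 h1] := HG (aff F' z).
  have [N2 hN2] := Deg_big (green s z / C + 1) hs.
  have [l [/h0 e0 /h1 e1 hl _]] := large4 l0 l1 N2 0.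
  rewrite e1 e0; have [h _] := aut2_conjn hs per l hfg'; have [] := h z => //.
  rewrite -ltr_pdivrMr //; apply: lt_le_trans (hN2 (q * l)%N _); first by lra.
  by apply: leq_trans hl _; exact: leq_pmull.
exists (aff F), (aff G); split.
  split; [by exists F|by exists G|exact: inv hfg1 F3 G3|].
  exact: inv (aut2_sym hfg1) G3 F3.
split=> // z zc; have iterq k w : aff F (orb s (q * k) w) = orb s (q * k) (aff F w).
  elim: k => [|k IH]; first by rewrite muln0.
  by rewrite mulnSr !(orb_per per) F2 IH.
have : orb s n (aff F z) = orb s n (f z).
  rewrite /n -iterq F1; first by rewrite /f1 /conjn orbitK.
  by rewrite (green_per hs per) /C ltr_pM2l.
by move/(congr1 (orbV s n)); rewrite !orbitK.
Qed.

End AffineRigidity.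

(** * The theorem *)

Section Periodic.
Variable R : realType.
Local Notation C := R[i].
Implicit Types (z w : C2 R) (h : henon_data R).
Variables (K : R) (hs : seq (henon_data R)).
Hypothesis K1 : 1 <= K.
Hypothesis hsK : forall h, h \in hs -> tame K h.
Hypothesis hs0 : (0 < size hs)%N.
Local Notation m := (size hs).

Definition cyc : nat -> henon_data R := fun n => nth (0, 0) hs (n %% size hs).

Lemma cyc_adm : adm K cyc.
Proof. by move=> k; apply: hsK; rewrite mem_nth // ltn_mod. Qed.

Lemma cyc_per n : cyc (n + m.*2)%N = cyc n.
Proof. by rewrite /cyc -mul2n addnC modnMDl. Qed.

Lemma cyc_shift k : sshift cyc (m * k) = cyc.
Proof. by apply: funext => i; rewrite /sshift /cyc [(m * k)%N]mulnC modnMDl. Qed.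

Lemma cyc_take k z : (k <= m)%N ->
  [/\ orb cyc k z = gen_henon (take k hs) z, orbV cyc k z = gen_henon_inv (take k hs) z
    & Deg cyc k = (gen_degree (take k hs))%:R].
Proof.
elim: k z => [|k IH] z hk; first by rewrite take0 /gen_degree big_nil.
have [_ _ IH3] := IH z (ltnW hk).
have ck : cyc k = nth (0, 0) hs k by rewrite /cyc modn_small.
rewrite (take_nth (0, 0) hk) /gen_henon /gen_henon_inv /gen_degree foldl_rcons foldr_rcons big_rcons /=.
have [IH1 _ _] := IH z (ltnW hk); have [_ IH2 _] := IH (henon_inv (cyc k) z) (ltnW hk).
rewrite IH1 IH2 IH3 ck; split=> //.
by rewrite /hdeg /gen_degree natrM mulrC.
Qed.

Lemma cyc_orb k z : orb cyc (m * k) z = iter k (gen_henon hs) z.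
Proof.
elim: k => [|k IH]; first by rewrite muln0.
rewrite mulnSr orb_shift cyc_shift IH /=.
by have [-> _ _] := cyc_take (iter k (gen_henon hs) z) (leqnn m); rewrite take_size.
Qed.

Lemma cyc_orbV k z : orbV cyc (m * k) z = iter k (gen_henon_inv hs) z.
Proof.
elim: k z => [|k IH] z; first by rewrite muln0.
rewrite mulnSr orbV_shift cyc_shift IH iterSr.
by have [_ -> _] := cyc_take z (leqnn m); rewrite take_size.
Qed.

Lemma cyc_Deg k : Deg cyc (m * k) = (gen_degree hs)%:R ^+ k.
Proof.
elim: k => [|k IH]; first by rewrite muln0.
rewrite mulnSr Deg_shift cyc_shift IH exprSr.
by have [_ _ ->] := cyc_take (0, 0) (leqnn m); rewrite take_size.
Qed.

Lemma n2_norm2 z : n2 z <= norm2 z <= 2 * n2 z.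
Proof.
rewrite /norm2 -/(nm z.1) -/(nm z.2); have a0 := nm_ge0 z.1; have b0 := nm_ge0 z.2.
have h1 := n2_1 z; have h2 := n2_2 z; have n0 := n2_ge0 z; apply/andP; split.
  rewrite n2_le; apply/andP; split; rewrite -[leLHS]ger0_norm // -sqrtr_sqr ler_wsqrtr //.
    by rewrite lerDl sqr_ge0.
  by rewrite lerDr sqr_ge0.
have -> : 2 * n2 z = Num.sqrt ((2 * n2 z) ^+ 2) by rewrite sqrtr_sqr ger0_norm // mulr_ge0.
rewrite ler_wsqrtr //; apply: le_trans (_ : n2 z ^+ 2 + n2 z ^+ 2 <= _).
  by apply: lerD; apply: lerXn2r; rewrite ?nnegrE.
by rewrite exprMn; have := sqr_ge0 (n2 z); lra.
Qed.

Lemma logp_Lrad w : `|logp (norm2 w) - Lrad K w| <= ln (esc_rad K) + ln 2.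
Proof.
have /andP[h1 h2] := n2_norm2 w; have r0 := rad_gt0 K1; have r100 := rad_ge100 K1.
have n0 := n2_ge0 w; have l2 : 0 <= ln (2 : R) by apply: ln_ge0; lra.
have lr : 0 <= ln (esc_rad K) by apply: ln_ge0; lra.
have L0 := L_ge0 K1 w; rewrite /logp; set x := norm2 w in h1 h2 *.
have up : Num.max 0 (ln x) <= Lrad K w + ln 2.
  rewrite ge_max addr_ge0 //=; have [x1|x1] := leP x 1.
    by apply: le_trans (_ : 0 <= _); [exact: ln_le0|rewrite addr_ge0].
  apply: le_trans (_ : ln (2 * n2 w) <= _); first by rewrite ler_ln ?posrE; lra.
  rewrite lnM ?posrE; [|by lra|by lra].
  by rewrite addrC lerD2r; apply: L_ge_n2 => //; lra.
have lo : Lrad K w <= ln (esc_rad K) + Num.max 0 (ln x).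
  have m0 : 0 <= Num.max 0 (ln x) by rewrite le_max lexx.
  rewrite LradE; have [h|h] := leP (n2 w) (esc_rad K); first by lra.
  apply: le_trans (_ : ln x <= _); first by rewrite ler_ln ?posrE; lra.
  by apply: le_trans (_ : Num.max 0 (ln x) <= _); [rewrite le_max lexx orbT|lra].
by rewrite ler_norml; apply/andP; split; lra.
Qed.

(** The norms and the truncations of the logarithm differ by bounded amounts, which division by the
    degree removes; iterates of the composite map are the times divisible by [size hs]. *)
Lemma green_plusE z : green_plus hs z = green K cyc z.
Proof.
have cs := cyc_adm; apply: cvg_lim => //; apply/cvgrPdist_le => /= e e0.
have [n0 hn0] := orb_enter_W K1 z cs.
have r100 := rad_ge100 K1; have er0 := err_gt0 K1.
pose B := ln (esc_rad K) + ln 2 + esc_err K.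
have B0 : 0 < B.
  have l2 : 0 <= ln (2 : R) by apply: ln_ge0; lra.
  have lr : 0 <= ln (esc_rad K) by apply: ln_ge0; lra.
  by rewrite /B; lra.
have [N hN] := Deg_big (B / e) cs.
exists (maxn n0 N) => // n; rewrite /= geq_max => /andP[n0n Nn].
have mn : (n <= m * n)%N by rewrite leq_pmull.
rewrite -cyc_Deg -cyc_orb; set D := Deg cyc (m * n); set w := orb cyc (m * n) z.
have D0 : 0 < D := Deg_gt0 _ cs.
have u1 := green_ub K1 (m * n) z cs.
have W := orb_W_le K1 cs (leq_trans n0n mn) hn0.
have u2 := green_lb K1 cs W.
have u3 := logp_Lrad w.
have dE : B / e <= D := hN _ (leq_trans Nn mn).
have -> : green K cyc z - D^-1 * logp (norm2 w) = (D * green K cyc z - logp (norm2 w)) / D.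
  by rewrite mulrBl [D * _]mulrC mulfK ?gt_eqF // mulrC.
rewrite normrM normfV (gtr0_norm D0) ler_pdivrMr //.
apply: le_trans (_ : B <= _); last by rewrite mulrC -ler_pdivrMr.
move: u3; rewrite ler_norml => /andP[v1 v2]; rewrite ler_norml; apply/andP; split; rewrite /B.
  by move: u1 u2 v1 v2; rewrite -/D -/w; have := ln2_ge0 R; have := ln_rad0 K1; lra.
by move: u1 u2 v1 v2; rewrite -/D -/w; have := ln2_ge0 R; have := ln_rad0 K1; lra.
Qed.

End Periodic.

(** * Passage to the notions of the statement *)

Section Bridge.
Variable R : realType.
Local Notation C := R[i].
Implicit Types (z w : C2 R) (h : henon_data R) (F : C2 R -> C2 R).

Lemma norm_C2 z : `|z| = (n2 z)%:C%C :> C.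
Proof.
rewrite prod_normE /= /n2 -[`|z.1|]/((nm z.1)%:C%C) -[`|z.2|]/((nm z.2)%:C%C) /Order.max ltcR.
by case: ifP.
Qed.

(** The remainder is divided by whichever coordinate increment is larger, so both factors stay
    continuous at z. *)
Lemma dif2_eps (F : C2 R -> C) z (a b : C) :
  (forall e : R, 0 < e -> exists2 d : R, 0 < d & forall w, dist2 w z < d ->
    nm (F w - F z - (a * (w.1 - z.1) + b * (w.2 - z.2))) <= e * dist2 w z) -> dif2 F z.
Proof.
move=> H; pose E w := F w - F z - (a * (w.1 - z.1) + b * (w.2 - z.2)).
pose big w := nm (w.2 - z.2) <= nm (w.1 - z.1).
pose q1 w : C := a + if big w then E w / (w.1 - z.1) else 0.
pose q2 w : C := b + if big w then 0 else E w / (w.2 - z.2).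
have E0 : E z = 0 by rewrite /E !subrr !mulr0 addr0 subrr.
have Ez w : dist2 w z = 0 -> E w = 0 by move=> /eqP; rewrite eq_le => /andP[/dist2_eq0 -> _].
have q1z : q1 z = a by rewrite /q1 /big !subrr lexx E0 mul0r addr0.
have q2z : q2 z = b by rewrite /q2 /big !subrr lexx addr0.
have quot w e (x : C) : dist2 w z <= nm x -> nm (E w) <= e * dist2 w z -> 0 <= e -> nm (E w / x) <= e.
  move=> hx hE e0; rewrite nmf_div; have [x0|x0] := leP (nm x) 0.
    by rewrite (nm_le0 x0) nm0 invr0 mulr0.
  by rewrite ler_pdivrMr //; apply: le_trans hE _; rewrite ler_wpM2l.
exists q1, q2; split.
- move=> e e0; have [d d0 hd] := H (e / 2) (divr_gt0 e0 (ltr0Sn R 1)); exists d => // w /hd hw.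
  rewrite q1z /q1 addrAC subrr add0r; case: ifP => hb; last by rewrite nm0.
  apply: le_lt_trans (quot w (e / 2) _ _ hw _) _; try lra.
  by rewrite dist2_le lexx.
- move=> e e0; have [d d0 hd] := H (e / 2) (divr_gt0 e0 (ltr0Sn R 1)); exists d => // w /hd hw.
  rewrite q2z /q2 addrAC subrr add0r; case: ifP => hb; first by rewrite nm0.
  apply: le_lt_trans (quot w (e / 2) _ _ hw _) _; try lra.
  rewrite dist2_le lexx andbT ltW // ltNge; exact: negbT hb.
move=> w; have -> : F w - F z = E w + (a * (w.1 - z.1) + b * (w.2 - z.2)) by rewrite /E subrK.
rewrite /q1 /q2; case: ifP => hb.
  have [x0|x0] := eqVneq (w.1 - z.1) 0; last by rewrite addr0 mulrDl divfK //; ring.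
  have d0 : dist2 w z <= 0 by rewrite dist2_le; move: hb; rewrite /big x0 nm0 lexx.
  have -> : E w = 0 by apply: Ez; apply/eqP; rewrite eq_le d0 dist2_ge0.
  by rewrite mul0r !addr0 add0r.
have [x0|x0] := eqVneq (w.2 - z.2) 0; last by rewrite addr0 mulrDl divfK //; ring.
by move: hb; rewrite /big x0 nm0 nm_ge0.
Qed.

Lemma dist2E w z : (dist2 w z)%:C%C = `|w - z| :> C.
Proof. by rewrite norm_C2. Qed.

Lemma differentiable_holo (f : C2 R -> C2 R) z : differentiable f z -> holo f z.
Proof.
move=> df; have /eqaddoP H := diff_locally df.
have lin w : 'd f z w = w.1 *: 'd f z (1, 0) + w.2 *: 'd f z (0, 1).
  rewrite -!linearZ -linearD; congr ('d f z _); case: w => x y.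
  by congr pair => /=; rewrite ?scaler0 ?addr0 ?add0r // -[LHS]mulr1.
have key e : 0 < e -> exists2 d : R, 0 < d & forall w, dist2 w z < d ->
    dist2 (f w) (f z + 'd f z (w - z)) <= e * dist2 w z.
  move=> e0; have e0C : 0 < e%:C%C :> C by rewrite ltcR.
  have /nbhs_normP[d /= d0 hd] := H _ e0C.
  (* The radius is a positive element of [R[i]], hence real. *)
  have dE : d = (complex.Re d)%:C%C by rewrite RRe_real // gtr0_real.
  exists (complex.Re d); first by rewrite -ltcR -dE.
  move=> w hw; have := hd (w - z); rewrite /ball_ /= add0r normrN => hd'.
  have : `|w - z| < d by rewrite dE -dist2E ltcR.
  move=> /hd'; have -> : (f \o +%R^~ z - (cst (f z) + 'd f z)) (w - z) = f w - (f z + 'd f z (w - z)).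
    by rewrite -[LHS]/(f (w - z + z) - (f z + 'd f z (w - z))) subrK.
  by rewrite -!dist2E -rmorphM lecR.
split.
- apply: (@dif2_eps _ z ('d f z (1, 0)).1 ('d f z (0, 1)).1) => e /key[d d0 hd].
  exists d => // w /hd; rewrite dist2_le => /andP[h _]; apply: le_trans h.
  have -> : (f z + 'd f z (w - z)).1 = (f z).1 +
      ((w.1 - z.1) * ('d f z (1, 0)).1 + (w.2 - z.2) * ('d f z (0, 1)).1) by rewrite lin.
  by rewrite (mulrC (w.1 - z.1)) (mulrC (w.2 - z.2)) -addrA -opprD.
- apply: (@dif2_eps _ z ('d f z (1, 0)).2 ('d f z (0, 1)).2) => e /key[d d0 hd].
  exists d => // w /hd; rewrite dist2_le => /andP[_ h]; apply: le_trans h.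
  have -> : (f z + 'd f z (w - z)).2 = (f z).2 +
      ((w.1 - z.1) * ('d f z (1, 0)).2 + (w.2 - z.2) * ('d f z (0, 1)).2) by rewrite lin.
  by rewrite (mulrC (w.1 - z.1)) (mulrC (w.2 - z.2)) -addrA -opprD.
Qed.

Lemma bounded_iter (H : C2 R -> C2 R) z :
  bounded_fun (fun n : nat => iter n H z) <-> exists B : R, forall n, n2 (iter n H z) <= B.
Proof.
split.
  move=> [M [Mr hM]]; exists (complex.Re (M + 1)) => n.
  have M1 : M < M + 1 by rewrite ltrDl.
  by have /= := hM _ M1 n I; rewrite norm_C2 lecE => /andP[].
move=> [B hB]; exists B%:C%C; split; first by rewrite complex_real.
by move=> M BM n _ /=; rewrite norm_C2; apply: le_trans (ltW BM); rewrite lecR.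
Qed.

Definition aff_lin (F : C2 R -> C2 R) z : C2 R :=
  (aff11 F * z.1 + aff12 F * z.2, aff21 F * z.1 + aff22 F * z.2).

Lemma aff_lin_linear F : linear (aff_lin F).
Proof.
by move=> a [u1 u2] [v1 v2]; congr pair; rewrite [LHS]/= [RHS]/= -![a *: _]/(a * _) /=; ring.
Qed.

HB.instance Definition _ F := GRing.isLinear.Build _ _ _ _ (aff_lin F) (aff_lin_linear F).

Lemma aff_linE F : aff F = cst (F (0, 0)) + aff_lin F.
Proof.
apply: funext => z; rewrite [LHS]surjective_pairing [RHS]surjective_pairing affE1 affE2.
by congr pair; rewrite -addrA.
Qed.

Lemma aff_affine F : affine_map (aff F).
Proof. by exists (aff_lin F), (F (0, 0)) => z; rewrite aff_linE addrC. Qed.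

Lemma aff_lin_continuous F : continuous (aff_lin F).
Proof.
pose B := 2 * Num.max (Num.max (nm (aff11 F)) (nm (aff12 F))) (Num.max (nm (aff21 F)) (nm (aff22 F))).
have hB z : n2 (aff_lin F z) <= B * n2 z.
  have tri (x y : C) M : nm x <= M -> nm y <= M -> nm (x * z.1 + y * z.2) <= 2 * M * n2 z.
    move=> hx hy; apply: le_trans (nmD _ _) _; rewrite !nmM -mulrA mulr2n mulrDl mul1r.
    by apply: lerD; apply: ler_pM; rewrite ?nm_ge0 ?n2_1 ?n2_2.
  by rewrite n2_le; apply/andP; split; apply: tri; rewrite !le_max lexx ?orbT.
apply: bounded_linear_continuous; apply/linear_boundedP; exists B%:C%C; split.
  by rewrite complex_real.
move=> r Br z; rewrite !norm_C2; apply: le_trans (_ : B%:C%C * (n2 z)%:C%C <= _).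
  by rewrite -[B%:C%C * _]rmorphM lecR; exact: hB.
by apply: ler_wpM2r; [rewrite lecR n2_ge0|exact: ltW].
Qed.

Lemma aff_differentiable F z : differentiable (aff F) z.
Proof.
rewrite aff_linE; apply: differentiableD; first exact: differentiable_cst.
apply: linear_differentiable; exact: aff_lin_continuous.
Qed.

Lemma orbV_bounded (K : R) (s : nat -> henon_data R) n B : 1 <= K -> adm K s ->
  exists B' : R, forall w, n2 w <= B -> n2 (orbV s n w) <= B'.
Proof.
move=> K1 hs; elim: n B => [|n IH] B; first by exists B.
pose M := Num.max 1 B; pose P := K * (lipc K M + M) + M.
have [B' hB'] := IH P; exists B' => w hw; apply: hB'.
have M1 : 1 <= M by rewrite le_max lexx.
have wM : n2 w <= M by apply: le_trans hw _; rewrite le_max lexx orbT.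
move: wM; rewrite n2_le => /andP[w1 w2]; have th := hs n.
have l1 := lipc_ge1 K1 (ltac:(lra) : 0 <= M).
have P0 : 0 <= K * (lipc K M + M) by rewrite mulr_ge0 //; lra.
rewrite n2_le; apply/andP; split; last by rewrite /P /=; lra.
rewrite [(henon_inv _ _).1]/= nmf_div ler_pdivrMr ?nm_gt0 ?(tame_jac K1 th) //.
apply: le_trans (nmB _ _) _; apply: le_trans (_ : lipc K M + M <= _).
  by apply: lerD => //; exact: (poly_le_lipc K1 th).
have a0 := tame_jac_lb th; have k0 : 0 < K by lra.
apply: le_trans (_ : (K * (lipc K M + M)) * K^-1 <= _).
  by rewrite mulrAC divff ?mul1r // gt_eqF.
apply: ler_pM => //; first by rewrite invr_ge0 ltW.
by rewrite /P; lra.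
Qed.

(** Commutation with S_q passes to its inverse, so the backward orbit of the image is bounded along
    multiples of q. As q is two periods of [hs], the odd backward iterates need one more inverse
    map, which is bounded on bounded sets. *)
Lemma Kminus_aff (K : R) (hs : seq (henon_data R)) F z : 1 <= K ->
  (forall h, h \in hs -> tame K h) -> (0 < size hs)%N ->
  (forall w, aff F (orb (cyc hs) (size hs).*2 w) = orb (cyc hs) (size hs).*2 (aff F w)) ->
  Kminus hs z -> Kminus hs (aff F z).
Proof.
move=> K1 hsK hs0 comm /bounded_iter[B hB]; apply/bounded_iter.
have cs := cyc_adm hsK hs0; set s := cyc hs in comm cs; set q := (size hs).*2 in comm.
have jacs k : (s k).2 != 0 by exact: (tame_jac K1 (cs k)).
have per : forall n, s (n + (size hs).*2)%N = s n := @cyc_per R hs.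
have commV w : aff F (orbV s q w) = orbV s q (aff F w).
  by rewrite -{2}(@orbitVK _ s q jacs w) comm orbitK.
have commVk k w : aff F (orbV s (q * k) w) = orbV s (q * k) (aff F w).
  elim: k w => [|k IH] w; first by rewrite muln0.
  have E v : orbV s (q * k.+1) v = orbV s q (orbV s (q * k) v).
    by rewrite mulnS -[X in (X + _)%N]muln1 (orbV_per per) muln1.
  by rewrite !E commV IH.
pose M := Num.max (n2 (F (0, 0))) (Num.max (dist2 (F (1, 0)) (F (0, 0))) (dist2 (F (0, 1)) (F (0, 0)))).
have M0 : 0 <= M by rewrite le_max n2_ge0.
have mx (a b d : R) : [/\ a <= Num.max a (Num.max b d), b <= Num.max a (Num.max b d) &
    d <= Num.max a (Num.max b d)] by rewrite !le_max !lexx !orbT.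
have [m1 m2 m3] := mx (n2 (F (0, 0))) (dist2 (F (1, 0)) (F (0, 0))) (dist2 (F (0, 1)) (F (0, 0))).
have hL w : n2 (aff F w) <= M * (1 + 2 * n2 w) by exact: aff_le.
have [B' hB'] := @orbV_bounded K s (size hs) (M * (1 + 2 * B)) K1 cs.
have ev k : n2 (iter k.*2 (gen_henon_inv hs) (aff F z)) <= M * (1 + 2 * B).
  have E w : iter k.*2 (gen_henon_inv hs) w = orbV s (q * k) w.
    by rewrite -cyc_orbV // -/s; congr (orbV s _ w); rewrite /q; lia.
  rewrite E -commVk -E; apply: le_trans (hL _) _; rewrite ler_wpM2l //.
  by have := hB k.*2; lra.
exists (Num.max B' (M * (1 + 2 * B))) => n; rewrite -(odd_double_half n).
case: (odd n) => /=; rewrite le_max; last by rewrite ev orbT.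
have -> w : gen_henon_inv hs w = orbV s (size hs) w by rewrite -{1}[size hs]muln1 cyc_orbV.
by rewrite hB' // ev.
Qed.

Lemma KplusE (K : R) (hs : seq (henon_data R)) z : 1 <= K ->
  (forall h, h \in hs -> tame K h) -> (0 < size hs)%N ->
  Kplus hs z <-> green K (cyc hs) z = 0.
Proof.
move=> K1 hsK hs0; have cs := cyc_adm hsK hs0; split.
  move=> /bounded_iter[B hB]; apply: (@bounded_green_0 R K K1 _ _ (ln (Num.max (esc_rad K) B)) cs) => N.
  exists (size hs * N)%N; first exact: leq_pmull.
  apply: L_exp => //; first by rewrite le_max lexx.
  by rewrite cyc_orb // le_max hB orbT.
move=> /(green_bounded_orbit K1 cs)[M M1 hM]; apply/bounded_iter; exists M => n.
by rewrite -cyc_orb.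
Qed.

End Bridge.

Local Open Scope classical_set_scope.

Theorem corollary1p3 (R : realType) (hs : seq (henon_data R)) (c : R)
    (f : C2 R -> C2 R) :
  is_gen_henon hs -> 0 < c -> holomorphic_aut (Omega hs c) f ->
  exists L : C2 R -> C2 R,
    [/\ affine_map L, holomorphic_aut [set: C2 R] L,
        L @` Kplus hs = Kplus hs, L @` Kminus hs = Kminus hs
      & forall z, Omega hs c z -> L z = f z].
Proof.
move=> /andP[hs0 hsh] c0 [df Uf [g [dg Ug fg gf]]].
have [K K1 hsK] := exists_tame hsh.
have cs := cyc_adm hsK hs0.
have OmegaP z : Omega hs c z <-> green K (cyc hs) z < c by rewrite /Omega /= (green_plusE K1 hsK hs0).
have hfg : aut2 (fun w => green K (cyc hs) w < c) f g.
  split=> z /OmegaP zc; split.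
  - exact: differentiable_holo (df _ zc).
  - by apply/OmegaP; exact: Uf.
  - by apply: fg; rewrite inE.
  - exact: differentiable_holo (dg _ zc).
  - by apply/OmegaP; exact: Ug.
  - by apply: gf; rewrite inE.
have [L [L' [[[F ->] [G ->] FK GK] [Ff FS GS]]]] :=
  aut_sublevel_affine K1 cs hs0 (@cyc_per R hs) c0 hfg.
have zero : exists p, green K (cyc hs) p = 0 by exact: exists_green0.
have Gg z : green K (cyc hs) z < c -> aff G z = g z.
  by move=> zc; have [_ gzc fgz] := hfg.2 z zc; rewrite -[in LHS]fgz -Ff // FK.
exists (aff F); split.
- exact: aff_affine.
- split; [by move=> z _; exact: aff_differentiable|by move=> z _|].
  exists (aff G); split; [by move=> z _; exact: aff_differentiable|by move=> z _| |] => z _.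
    exact: FK.
  exact: GK.
(* K+ is the zero set of G, inside the domain of f, so invariance of G suffices for it; K- leaves
   this domain and is handled through commutation. *)
- have kp H h z : (forall z, green K (cyc hs) z < c -> aff H z = h z) ->
      (forall z, green K (cyc hs) z < c -> green K (cyc hs) (h z) = green K (cyc hs) z) ->
      Kplus hs z -> Kplus hs (aff H z).
    move=> Hh hg /(KplusE _ K1 hsK hs0) z0; apply/(KplusE _ K1 hsK hs0).
    by rewrite Hh ?hg // z0.
  apply/seteqP; split.
    by move=> _ [z zK <-]; apply: kp Ff _ zK => w wc; exact: (green_aut K1 cs hfg c0 zero wc).
  move=> z zK; exists (aff G z); last exact: GK.
  by apply: kp Gg _ zK => w wc; exact: (green_aut K1 cs (aut2_sym hfg) c0 zero wc).
- apply/seteqP; split.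
    by move=> _ [z zK <-]; exact: (Kminus_aff K1 hsK hs0 FS).
  move=> z zK; exists (aff G z); last exact: GK.
  exact: (Kminus_aff K1 hsK hs0 GS).
- by move=> z /OmegaP; exact: Ff.
Qed.
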